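(* Let $k\ge1$, $h=k/(k+1)$, and let $F$ be a CDF on $[0,\infty)$ with $F(0)=0$ and finite mean satisfying the local condition with index $k$; set $\beta=F^{(k)}(0)/k!$. Consider a family of $GI/GI/1{+}GI$ queues indexed by $\alpha\downarrow0$ with patience CDF $F_\alpha(x)=F(\alpha x)$, arrival rate $\lambda^\alpha$, service rate $\mu^\alpha$, $\rho^\alpha=\lambda^\alpha/\mu^\alpha$, such that $\mu^\alpha\to\mu>0$ and $\alpha^{-h}(\rho^\alpha-1)\to c\in\mathbb R$. With the processes and scalings defined in the context, assume the functional CLT \[ (\tilde A^\alpha,\tilde S^\alpha,\tilde Z^\alpha(0))\Rightarrow\bigl(c_aB_a\circ(\mu e),\,c_sB_s\circ(\mu e),\,Z^*(0)\bigr),\qquad\alpha\downarrow0, \] where $B_a,B_s$ are independent standard Brownian motions and $e(t)=t$. Then $(\tilde Z^\alpha,\tilde L^\alpha,\tilde Y^\alpha,\tilde A_0^\alpha)\Rightarrow(Z^*,L^*,Y^*,A_0^* )$ as $\alpha\downarrow0$, where $(Z^*,L^* )$ is the unique solution of \[ Z^*(t)=Z^*(0)+\mu^{-1}c_aB_a(\mu t)+\mu^{-1}c_sB_s(\mu t)-\frac{F^{(k)}(0)}{k!}\int_0^t(Z^*(s))^kds+ct+L^*(t), \] with $Z^*\ge0$, $L^*$ nondecreasing, $L^*(0)=0$, $\int_0^\infty\mathbf 1\{Z^*(t)>0\}dL^*(t)=0$, and \[ A_0^*(t)=c_aB_a(\mu t)-\mu\frac{F^{(k)}(0)}{k!}\int_0^t(Z^*(s))^kds,\qquad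 Y^*(t)=\frac1\mu A_0^*(t)+\frac1\mu c_sB_s(\mu t). \]
   Context: Local condition with index $k$: $F$ is $k$ times continuously differentiable on $[0,\infty)$, $F^{(j)}(0)=0$ for $j=0,\dots,k-1$, $F^{(k)}(0)\ne0$. In the $\alpha$th system (a single FCFS server with unit processing rate, customers arriving one at a time, i.i.d. service times $V_i^\alpha$, i.i.d. patience times $D_i^\alpha$ with CDF $F_\alpha$, renewal arrivals, all independent), $A^\alpha$ is the arrival counting process with epochs $T_i^\alpha$, $S^\alpha$ is the renewal counting process of the service-time sequence $\{V_i^\alpha\}$, $Z^\alpha$ is the virtual (offered) waiting time process, $W_i^\alpha=Z^\alpha(T_i^\alpha-)$, $A_0^\alpha(t)=\sum_{i=1}^{A^\alpha(t)}\mathbf 1\{D_i^\alpha>W_i^\alpha\}$, $Y^\alpha(t)=\sum_{i=1}^{A^\alpha(t)}V_i^\alpha\mathbf 1\{D_i^\alpha>W_i^\alpha\}$, and $L^\alpha$ is the cumulative idle time, so $Z^\alpha(t)=Z^\alpha(0)+Y^\alpha(t)-t+L^\alpha(t)$. Scalings: $\tilde A^\alpha(t)=\alpha^h[A^\alpha(\alpha^{-2h}t)-\alpha^{-2h}\lambda^\alpha t]$, $\tilde S^\alpha(t)=\alpha^h[S^\alpha(\alpha^{-2h}t)-\alpha^{-2h}\mu^\alpha t]$, $\tilde A_0^\alpha(t)=\alpha^h[A_0^\alpha(\alpha^{-2h}t)-\alpha^{-2h}\lambda^\alpha t]$, $\tilde Y^\alpha(t)=\alpha^h[Y^\alpha(\alpha^{-2h}t)-\alpha^{-2h}\rho^\alpha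 t]$, $\tilde Z^\alpha(t)=\alpha^hZ^\alpha(\alpha^{-2h}t)$, $\tilde L^\alpha(t)=\alpha^hL^\alpha(\alpha^{-2h}t)$. The constants $c_a^2,c_s^2$ are the asymptotic variability parameters of arrivals and services. Weak convergence is in the Skorokhod $J_1$ space of càdlàg paths.
   Formalization: The initial workload Z^α(0) is assumed independent of the interarrival, service and patience times; if it may depend on the service times, the limit with +c_s B_s can have the wrong law. *)

(* Defs.v *)
From HB Require Import structures.
From mathcomp Require Import all_boot all_order all_algebra.
From mathcomp Require Import all_classical all_reals all_analysis.
Set Implicit Arguments. Unset Strict Implicit. Unset Printing Implicit Defensive.
Import Order.TTheory GRing.Theory Num.Def Num.Theory.
Import numFieldNormedType.Exports.
Local Open Scope classical_set_scope.
Local Open Scope ring_scope.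

Definition cadlag {R : realType} (x : R -> R) : Prop :=
  (forall t, 0 <= t -> x s @[s --> at_right t] --> x t) /\
  (forall t, 0 < t -> cvg (x s @[s --> at_left t])).

Definition time_change {R : realType} (l : R -> R) : Prop :=
  l 0 = 0 /\ {within `[0, +oo[, continuous l} /\
  {in `[0, +oo[ &, forall a b, a < b -> l a < l b} /\
  (forall y, 0 <= y -> exists2 x, 0 <= x & l x = y).

(* Sequential J1 convergence in D([0,oo)) (Billingsley 1999, Thm 16.1):
   there are time changes l_m with sup_{t>=0} |l_m t - t| -> 0 and,
   for every T, sup_{t in [0,T]} |x_m (l_m t) - x t| -> 0. *)
Definition J1_cvg {R : realType} (xs : nat -> R -> R) (x : R -> R) : Prop :=
  exists ls : nat -> R -> R,
    (forall m, time_change (ls m)) /\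
    (forall e : R, 0 < e -> \forall m \near \oo,
        forall t, 0 <= t -> `|ls m t - t| <= e) /\
    (forall T e : R, 0 < e -> \forall m \near \oo,
        forall t, 0 <= t <= T -> `|xs m (ls m t) - x t| <= e).

Definition J1n_cvg {R : realType} n (xs : nat -> 'I_n -> R -> R)
  (x : 'I_n -> R -> R) : Prop :=
  forall i, J1_cvg (fun m => xs m i) (x i).

(* continuity of a functional on D^n (D^n is metrizable, so sequential
   continuity is continuity) *)
Definition J1_continuous {R : realType} n (f : ('I_n -> R -> R) -> R) : Prop :=
  forall (xs : nat -> 'I_n -> R -> R) (x : 'I_n -> R -> R),
    (forall m i, cadlag (xs m i)) -> (forall i, cadlag (x i)) ->
    J1n_cvg xs x -> (fun m => f (xs m)) @ \oo --> f x.

Definition bounded_functional {R : realType} n (f : ('I_n -> R -> R) -> R) :=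
  exists M : R, forall y, `|f y| <= M.

Definition weak_cvg {R : realType} {d : measure_display}
  (Om : R -> measurableType d) (P : forall a, probability (Om a) R) n
  (X : forall a, Om a -> 'I_n -> R -> R) (Fl : set_system R)
  {d0 : measure_display} (Om0 : measurableType d0) (P0 : probability Om0 R)
  (X0 : Om0 -> 'I_n -> R -> R) : Prop :=
  forall f : ('I_n -> R -> R) -> R,
    bounded_functional f -> J1_continuous f ->
    (fun a => (\int[P a]_w (f (X a w))%:E)%E) @ Fl -->
      (\int[P0]_w (f (X0 w))%:E)%E.

Definition pvec {R : realType} n (s : seq (R -> R)) : 'I_n -> R -> R :=
  fun i => nth (fun _ => 0) s i.
Arguments pvec {R} n s.

Definition mutual_indep {R : realType} {d} {Om : measurableType d}
  (P : probability Om R) (I : Type) (X : I -> Om -> R) : Prop :=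
  forall n (j : 'I_n -> I), injective j ->
  forall A : 'I_n -> set R, (forall m, measurable (A m)) ->
    P (\bigcap_(m in [set: 'I_n]) (X (j m) @^-1` A m)) =
    (\prod_(m < n) P (X (j m) @^-1` A m))%E.

Definition same_law {R : realType} {d} {Om : measurableType d}
  (P : probability Om R) (X Y : Om -> R) : Prop :=
  forall A : set R, measurable A -> P (X @^-1` A) = P (Y @^-1` A).

(* independence of a finite family of real processes (rectangles over
   finitely many times generate the product sigma-algebras) *)
Definition indep_processes {R : realType} {d} {Om : measurableType d}
  (P : probability Om R) (J : finType) (X : J -> R -> Om -> R) : Prop :=
  forall n (t : 'I_n -> R) (A : J -> 'I_n -> set R),
    (forall j m, measurable (A j m)) ->
    P (\bigcap_(j in [set: J]) \bigcap_(m in [set: 'I_n])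
          (X j (t m) @^-1` A j m)) =
    (\prod_(j : J) P (\bigcap_(m in [set: 'I_n]) (X j (t m) @^-1` A j m)))%E.

Definition std_BM {R : realType} {d} {Om : measurableType d}
  (P : probability Om R) (B : R -> Om -> R) : Prop :=
  (forall t, measurable_fun setT (B t)) /\
  (forall w, B 0 w = 0) /\
  (forall w, {within `[0, +oo[, continuous (fun t => B t w)}) /\
  (forall s t, 0 <= s -> s < t -> forall A, measurable A ->
     P ((fun w => B t w - B s w) @^-1` A) = normal_prob 0 (Num.sqrt (t - s)) A) /\
  (forall n (t : nat -> R), 0 <= t 0%N -> (forall m, t m < t m.+1) ->
     mutual_indep P (fun m : 'I_n => fun w => B (t m.+1) w - B (t m) w)).

Definition cdf0 {R : realType} (F : R -> R) : Prop :=
  {homo F : x y / x <= y} /\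
  (forall x, F s @[s --> at_right x] --> F x) /\
  (forall x, x <= 0 -> F x = 0) /\
  F x @[x --> +oo] --> (1 : R).

Definition nonneg_reals {R : realType} : set R := `[0, +oo[.

Definition finite_mean {R : realType} (F : R -> R) : Prop :=
  (\int[@lebesgue_measure R]_(x in nonneg_reals) (1 - F x)%:E < +oo)%E.

(* Local condition with index k: G j is the j-th derivative of F on [0,oo)
   (one-sided at 0), G k is continuous on [0,oo), G j 0 = 0 for j < k and
   G k 0 <> 0.  Thus G k 0 = F^(k)(0). *)
Definition local_cond {R : realType} (F : R -> R) (k : nat) (G : nat -> R -> R)
  : Prop :=
  (forall x, 0 <= x -> G 0%N x = F x) /\
  (forall j, (j < k)%N -> forall x : R, 0 < x -> is_derive x (1 : R) (G j) (G j.+1 x)) /\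
  (forall j, (j < k)%N ->
     (fun h => h^-1 * (G j h - G j 0)) @ at_right 0 --> G j.+1 0) /\
  {within `[0, +oo[, continuous (G k)} /\
  (forall j, (j < k)%N -> G j 0 = 0) /\
  G k 0 != 0.

(* limit of partial sums (a.s. finite counts) *)
Definition nsum {R : realType} (g : nat -> R) : R :=
  lim ((fun N => \sum_(i < N) g i) @ \oo).

(* arrival epoch of customer i (0-based): T_{i+1} = u_1 + ... + u_{i+1} *)
Definition Tarr {R : realType} (u : nat -> R) (i : nat) : R := \sum_(j < i.+1) u j.

Definition Acount {R : realType} (u : nat -> R) (t : R) : R :=
  nsum (fun i => (nat_of_bool (Tarr u i <= t)%R)%:R).

Definition Scount {R : realType} (V : nat -> R) (t : R) : R :=
  nsum (fun i => (nat_of_bool (\sum_(j < i.+1) V j <= t)%R)%:R).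

Definition Woff {R : realType} (u : nat -> R) (Z : R -> R) (i : nat) : R :=
  lim (Z s @[s --> at_left (Tarr u i)]).

Definition A0count {R : realType} (u D : nat -> R) (Z : R -> R) (t : R) : R :=
  nsum (fun i => (nat_of_bool ((Tarr u i <= t) && (Woff u Z i < D i))%R)%:R).

Definition Ywork {R : realType} (u V D : nat -> R) (Z : R -> R) (t : R) : R :=
  nsum (fun i => (nat_of_bool ((Tarr u i <= t) && (Woff u Z i < D i))%R)%:R * V i).

Definition vwt_dyn {R : realType} (u V D : nat -> R) (z0 : R) (Z L : R -> R)
  : Prop :=
  forall t, 0 <= t ->
    0 <= Z t /\
    L t = (\int[@lebesgue_measure R]_(s in `[0, t]) (nat_of_bool (Z s == 0))%:R) /\
    Z t = z0 + Ywork u V D Z t - t + L t.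

Inductive prim_idx := PU of nat | PV of nat | PD of nat | PZ0.

Definition prim {R : realType} {T : Type} (u V D : nat -> T -> R) (z0 : T -> R)
  (i : prim_idx) : T -> R :=
  match i with PU n => u n | PV n => V n | PD n => D n | PZ0 => z0 end.

(* the alpha-th system: interarrival times u_i, service times V_i, patience
   times D_i (CDF Fa), initial virtual waiting time z0, arrival rate lam,
   service rate mu, virtual waiting time Z and idle time L *)
Definition queue_system {R : realType} {d} {Om : measurableType d}
  (P : probability Om R) (Fa : R -> R) (u V D : nat -> Om -> R) (z0 : Om -> R)
  (lam mu : R) (Z L : Om -> R -> R) : Prop :=
  (forall i, measurable_fun setT (u i)) /\
  (forall i, measurable_fun setT (V i)) /\
  (forall i, measurable_fun setT (D i)) /\
  measurable_fun setT z0 /\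
  (forall i, same_law P (u i) (u 0%N)) /\
  (forall i, same_law P (V i) (V 0%N)) /\
  (forall i, same_law P (D i) (D 0%N)) /\
  mutual_indep P (prim u V D z0) /\
  P [set w | 0 < u 0%N w] = 1%E /\
  P [set w | 0 <= V 0%N w] = 1%E /\
  (forall x, P (D 0%N @^-1` `]-oo, x]) = (Fa x)%:E) /\
  0 < lam /\ 0 < mu /\
  (\int[P]_w (u 0%N w)%:E = (lam^-1)%:E)%E /\
  (\int[P]_w (V 0%N w)%:E = (mu^-1)%:E)%E /\
  {ae P, forall w, vwt_dyn (fun i => u i w) (fun i => V i w) (fun i => D i w)
                           (z0 w) (Z w) (L w)}.

Definition diffscale {R : realType} (a h : R) (x : R -> R) (r : R) (t : R) : R :=
  powR a h * (x (powR a (- (2 * h)) * t) - powR a (- (2 * h)) * r * t).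

(* (Z,L) solves Z(t) = z0 + X(t) - beta int_0^t Z^k + c t + L(t), Z >= 0,
   L nondecreasing, L(0) = 0, int 1{Z>0} dL = 0 (L is constant on every
   interval on which Z > 0); solutions are continuous on [0,oo). *)
Definition refl_sol {R : realType} (z0 : R) (X : R -> R) (beta c : R) (k : nat)
  (Z L : R -> R) : Prop :=
  {within `[0, +oo[, continuous Z} /\ {within `[0, +oo[, continuous L} /\
  (forall t, 0 <= t ->
     Z t = z0 + X t - beta * (\int[@lebesgue_measure R]_(s in `[0, t]) (Z s ^+ k))
           + c * t + L t) /\
  (forall t, 0 <= t -> 0 <= Z t) /\
  {in `[0, +oo[ &, forall s t, s <= t -> L s <= L t} /\
  L 0 = 0 /\
  (forall s t, 0 <= s -> s <= t -> (forall r, s <= r <= t -> 0 < Z r) ->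
     L s = L t).

(* Main.v *)
(** The scaled arrival and service paths are, off a small event, uniformly close
    to a path of a fixed Lipschitz class; this replaces tightness. On that event
    the work brought by the arrivals is read off the inverse of the service
    counting process, the acceptance decisions are replaced by their conditional
    probabilities (a second-moment bound along a deterministic grid of customers),
    and the local condition turns the resulting sum into
    [beta * int Z^k]. Hence the scaled workload solves the reflected equation up
    to a small error, and this equation is stable: a perturbation [e] of the
    driving path moves the solution by at most [2 e].

    The functionals of the limit theorem need not be measurable along the
    prelimit, so integrals of bounded functions are handled as lower integrals
    and convergence is proved by one-sided bounds: an infimum of [f y' + N r'] over
    Lipschitz [y] near the input and outputs [y'] within [r'] of the solution
    driven by [y] is a bounded J1-continuous functional of the input, to which
    the functional CLT applies; it bounds [f] from below, and the same is done
    for [- f].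

    The service process enters the work with a minus sign whereas the statement has
    a plus sign: the two limits have the same law since, by prelimit independence,
    the service limit is independent of the other inputs, and its Gaussian
    increments are symmetric. *)
Require Import Defs.
From HB Require Import structures.
From mathcomp Require Import all_boot all_order all_algebra.
From mathcomp Require Import all_classical all_reals all_analysis measurable_realfun.
From mathcomp Require Import ring lra.
Set Implicit Arguments. Unset Strict Implicit. Unset Printing Implicit Defensive.
Import Order.TTheory GRing.Theory Num.Def Num.Theory.
Import numFieldNormedType.Exports.
Local Open Scope classical_set_scope.
Local Open Scope ring_scope.

(** * Integrals of bounded functions *)

(** Service times are only assumed to have a mean, while a second-moment bound requires truncating
    them at a level [b] of the order of [B], the inverse of alpha^h. The cost of the truncation is
    measured by [b * E phi(V / b)] with [phi x = x - 1 + exp(-x)], which controls both the truncated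
    second moment and the mean beyond [b]; it is made small by the functional CLT for the service
    counts, through the Laplace transform of a sum of [b] service times.

    The exponent h = k/(k+1) is the one for which [B * (B * alpha)^k = 1]: a customer facing a wait
    of order [B] abandons with probability of order 1/B, so that of the B^2 arrivals per unit of
    scaled time about [B] are lost, the order of the fluctuations.

    The drift z^k need not be globally Lipschitz, but it is monotone and acts downward. This yields
    stability without an exponential factor and a priori bounds, for the Picard iterates as well as
    for the scaled workload before anything is known about its losses; the waits can therefore be
    truncated at a deterministic level. *)

Section measurable_comparison.
Context {d} {T : measurableType d} {R : realType}.

Lemma measurable_set_le (f g : T -> R) :
  measurable_fun setT f -> measurable_fun setT g -> measurable [set x | f x <= g x].
Proof.
move=> mf mg; have H := measurable_fun_ler mf mg; have := H measurableT [set true] I.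
by rewrite setTI; congr (measurable _).
Qed.

Lemma measurable_set_lt (f g : T -> R) :
  measurable_fun setT f -> measurable_fun setT g -> measurable [set x | f x < g x].
Proof.
move=> mf mg; have H := measurable_fun_ltr mf mg; have := H measurableT [set true] I.
by rewrite setTI; congr (measurable _).
Qed.

End measurable_comparison.

Section lower_integral.
Context {d} {T : measurableType d} {R : realType}.
Variable mu : {measure set T -> \bar R}.
Import HBNNSimple.
Local Open Scope ereal_scope.

(** For nonnegative functions the integral is a supremum over the simple functions below, so
    monotonicity holds without measurability. *)
Lemma ge0_le_integral_nomeas (D : set T) (f g : T -> \bar R) :
  (forall x, D x -> 0 <= f x) -> (forall x, D x -> f x <= g x) ->
  \int[mu]_(x in D) f x <= \int[mu]_(x in D) g x.
Proof.
move=> f0 fg; rewrite !ge0_integralE//; last by move=> x Dx; exact: le_trans (f0 _ Dx) (fg _ Dx).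
apply: ge_ereal_sup => _ [h/= hf <-]; apply: ereal_sup_ubound; exists h => //= x.
apply: (le_trans (hf x)); rewrite /patch; case: ifPn => //.
by rewrite inE => /fg.
Qed.

(** Of the three functions only [s] is measurable. For a simple [g] below [h], the positive part of
    [g - s] is measurable, lies below [f], and loses at most the integral of [s]. *)
Lemma le_lower_integralD (h f : T -> \bar R) (s : T -> R) :
  (forall x, 0 <= f x) -> (forall x, 0 <= h x) -> (forall x, (0 <= s x)%R) ->
  measurable_fun setT s -> (forall x, h x <= f x + (s x)%:E) ->
  \int[mu]_x h x <= \int[mu]_x f x + \int[mu]_x (s x)%:E.
Proof.
move=> f0 h0 s0 ms hfs; rewrite (ge0_integralTE _ h0).
apply: ge_ereal_sup => _ [g/= gh <-].
pose q (x : T) : R := maxr (g x - s x)%R 0%R.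
have mg : measurable_fun setT (g : T -> R) by [].
have mq : measurable_fun setT q.
  by apply: measurable_maxr => //; exact: measurable_funB.
have q0 x : (0 <= q x)%R by rewrite /q le_max lexx orbT.
apply: (@le_trans _ _ (\int[mu]_x (q x)%:E + \int[mu]_x (s x)%:E)).
  have <- : \int[mu]_x ((q x)%:E + (s x)%:E) = \int[mu]_x (q x)%:E + \int[mu]_x (s x)%:E.
    by rewrite ge0_integralD//; (try by move=> x _; rewrite lee_fin); exact/measurable_EFinP.
  rewrite -integralT_nnsfun; apply: ge0_le_integral_nomeas => x _.
    by rewrite lee_fin; exact: (@fun_ge0 _ _ g).
  by rewrite -EFinD lee_fin -lerBlDr /q le_max lexx.
apply: leeD => //; apply: ge0_le_integral_nomeas => x _; first by rewrite lee_fin q0.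
have := le_trans (gh x) (hfs x); have := f0 x.
case: (f x) => [r | |]//= r0; rewrite ?leey//.
by rewrite !lee_fin /q ge_max => ?; apply/andP; split; [rewrite lerBlDr|].
Qed.

End lower_integral.

(* The integral of a bounded function, measurable or not: the library's integral
   is the lower integral of the positive part minus that of the negative part. *)
Section bounded_integral.
Context {d} {T : measurableType d} {R : realType}.
Variable P : probability T R.
Import HBNNSimple.

Lemma bounded_integral_posfin (f : T -> R) (M : R) : (forall x, `|f x| <= M) ->
  (\int[P]_x ((EFin \o f)^\+ x) \is a fin_num)%E.
Proof.
move=> fM; rewrite ge0_fin_numE; last by apply: integral_ge0.
apply: (@le_lt_trans _ _ (\int[P]_x (`|M|)%:E)%E).
  apply: ge0_le_integral_nomeas => // x _; rewrite funeposE /=.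
  rewrite -EFin_max lee_fin ge_max normr_ge0 andbT.
  by apply: (le_trans (ler_norm _)); apply: (le_trans (fM x)); exact: ler_norm.
by rewrite integral_cst//= probability_setT mule1 ltry.
Qed.

Lemma bounded_integral_negfin (f : T -> R) (M : R) : (forall x, `|f x| <= M) ->
  (\int[P]_x ((EFin \o f)^\- x) \is a fin_num)%E.
Proof.
move=> fM.
have -> : ((EFin \o f)^\-)%E = ((EFin \o (fun x => (- f x)%R)) ^\+)%E.
  by apply/funext => x; rewrite funenegE funeposE /=.
by apply: (@bounded_integral_posfin _ M) => x; rewrite normrN.
Qed.

Lemma bounded_integral_fin (f : T -> R) (M : R) : (forall x, `|f x| <= M) ->
  (\int[P]_x (f x)%:E \is a fin_num)%E.
Proof.
move=> fM; rewrite integralE fin_numB.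
by rewrite (bounded_integral_posfin fM) (bounded_integral_negfin fM).
Qed.

Lemma bounded_integralE (f : T -> R) (M : R) : (forall x, `|f x| <= M) ->
  \int[P]_x f x = fine (\int[P]_x ((EFin \o f)^\+ x))%E - fine (\int[P]_x ((EFin \o f)^\- x))%E.
Proof.
move=> fM; rewrite /Rintegral integralE fineB//.
  exact: (bounded_integral_posfin fM).
exact: (bounded_integral_negfin fM).
Qed.

Lemma bounded_integralN (f : T -> R) (M : R) : (forall x, `|f x| <= M) ->
  \int[P]_x (- f x) = - \int[P]_x f x.
Proof.
move=> fM; rewrite /Rintegral -fineN; congr fine.
under eq_integral do rewrite EFinN.
rewrite integralN//= fin_num_adde_defl// fin_numN.
exact: (bounded_integral_negfin fM).
Qed.

(** With [s = c + 2 M 1_Bd] one has [q <= F + s] everywhere. The integral is a difference of two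
    lower integrals; positive and negative parts are compared separately, each at the price of the
    integral of [s], hence [2 c] and [4 M]. *)
Lemma bounded_integral_close (F q : T -> R) (M c : R) (Bd : set T) :
  measurable Bd -> 0 <= c -> (forall x, `|F x| <= M) -> (forall x, `|q x| <= M) ->
  (forall x, ~ Bd x -> q x <= F x + c) ->
  \int[P]_x q x <= \int[P]_x F x + 2 * c + 4 * M * fine (P Bd).
Proof.
move=> mB c0 FM qM qF.
have M0 : 0 <= M by apply: le_trans (FM point).
pose s x := c + 2 * M * \1_Bd x.
have ms : measurable_fun setT s.
  by apply: measurable_funD => //; apply: measurable_funM => //; exact: measurable_indic.
have s0 x : 0 <= s x.
  by rewrite addr_ge0// !mulr_ge0// indicE.
have qFs x : q x <= F x + s x.
  rewrite /s indicE; case: (boolP (x \in Bd)) => [_|].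
    have := FM x; have := qM x; rewrite !ler_norml => /andP[? ?] /andP[? ?].
    rewrite mulr1; lra.
  by rewrite notin_setE => /qF ?; rewrite mulr0 addr0.
have Is : (\int[P]_x (s x)%:E = (c + 2 * M * fine (P Bd))%:E)%E.
  rewrite /s.
  under eq_integral do rewrite EFinD.
  rewrite ge0_integralD//=; last 2 first.
  - move=> x _; rewrite lee_fin !mulr_ge0// indicE//.
  - apply/measurable_EFinP; apply: measurable_funM => //; exact: measurable_indic.
  rewrite integral_cst// [X in (_ * X + _)%E]probability_setT mule1 EFinD; congr (_ + _)%E.
  under eq_integral do rewrite EFinM.
  rewrite ge0_integralZl//=; last 2 first.
  - by apply/measurable_EFinP; exact: measurable_indic.
  - by rewrite lee_fin mulr_ge0.
  by rewrite integral_indic// setIT (EFinM (2 * M)) fineK// fin_num_measure.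
have H (a b : T -> R) : (forall x, a x <= b x + s x) ->
    (\int[P]_x ((EFin \o a)^\+ x) <= \int[P]_x ((EFin \o b)^\+ x) + (c + 2 * M * fine (P Bd))%:E)%E.
  move=> ab; rewrite -Is; apply: le_lower_integralD => // x.
  rewrite !funeposE /= -!EFin_max -EFinD lee_fin ge_max; apply/andP; split.
    by apply: (le_trans (ab x)); rewrite lerD2r le_max lexx.
  by rewrite addr_ge0// le_max lexx orbT.
have H1 := H _ _ qFs.
have H2 : (\int[P]_x ((EFin \o F)^\- x) <= \int[P]_x ((EFin \o q)^\- x) + (c + 2 * M * fine (P Bd))%:E)%E.
  have E (g : T -> R) : ((EFin \o g)^\-)%E = ((EFin \o (fun x => (- g x)%R)) ^\+)%E.
    by apply/funext => x; rewrite funenegE funeposE /=.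
  rewrite !E; apply: H => x; have := qFs x; lra.
rewrite (bounded_integralE FM) (bounded_integralE qM).
have Fp := bounded_integral_posfin FM; have Fn := bounded_integral_negfin FM.
have qp := bounded_integral_posfin qM; have qn := bounded_integral_negfin qM.
move: H1 H2; rewrite -(fineK Fp) -(fineK Fn) -(fineK qp) -(fineK qn) -!EFinD !lee_fin.
set a1 := fine _; set a2 := fine _; set a3 := fine _; set a4 := fine _; set a5 := fine _.
rewrite /=; lra.
Qed.

Lemma bounded_integrable (f : T -> R) (M : R) : measurable_fun setT f ->
  (forall x, `|f x| <= M) -> P.-integrable setT (EFin \o f).
Proof.
move=> mf fM; apply: measurable_bounded_integrable => //.
  by rewrite [X in (X < _)%E]probability_setT ltry.
exists M; split; first exact: num_real.
by move=> y My x _ /=; rewrite (le_trans (fM x))// ltW.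
Qed.

Lemma bounded_integralD (f g : T -> R) (M N : R) :
  measurable_fun setT f -> measurable_fun setT g ->
  (forall x, `|f x| <= M) -> (forall x, `|g x| <= N) ->
  \int[P]_x (f x + g x) = \int[P]_x f x + \int[P]_x g x.
Proof.
by move=> mf mg fM gN; rewrite RintegralD//; [exact: bounded_integrable fM|exact: bounded_integrable gN].
Qed.

Lemma bounded_integralZ (f : T -> R) (M c : R) :
  measurable_fun setT f -> (forall x, `|f x| <= M) ->
  \int[P]_x (c * f x) = c * \int[P]_x f x.
Proof. by move=> mf fM; rewrite RintegralZl//; exact: bounded_integrable fM. Qed.

Lemma prob_integral_cst (c : R) : \int[P]_x c = c.
Proof. by rewrite Rintegral_cst//= [X in fine X](probability_setT P) /= mulr1. Qed.

Lemma bounded_integral_sum (I : Type) (r : seq I) (f : I -> T -> R) (M : I -> R) :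
  (forall i, measurable_fun setT (f i)) -> (forall i x, `|f i x| <= M i) ->
  \int[P]_x (\sum_(i <- r) f i x) = \sum_(i <- r) \int[P]_x f i x.
Proof.
move=> mf fM; elim: r => [|i r IH].
  by rewrite big_nil -[RHS]prob_integral_cst; apply: eq_Rintegral => x _; rewrite big_nil.
rewrite big_cons -IH -(@bounded_integralD _ _ (M i) (\sum_(j <- r) M j))//.
- by apply: eq_Rintegral => x _; rewrite big_cons.
- by apply: measurable_sum => j; exact: mf.
- by move=> x; rewrite (le_trans (ler_norm_sum _ _ _))//; apply: ler_sum => j _; exact: fM.
Qed.

Lemma Rintegral_indic (A : set T) : measurable A -> \int[P]_x \1_A x = fine (P A).
Proof. by move=> mA; rewrite /Rintegral integral_indic// setIT. Qed.

Lemma le_bounded_integral (f g : T -> R) (M : R) :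
  (forall x, `|f x| <= M) -> (forall x, `|g x| <= M) -> (forall x, f x <= g x) ->
  \int[P]_x f x <= \int[P]_x g x.
Proof.
move=> fM gM fg.
have := @bounded_integral_close g f M 0 set0 measurable0 (lexx 0) gM fM.
rewrite measure0 /= mulr0 mulr0 !addr0; apply => x _; rewrite addr0; exact: fg.
Qed.

Lemma bounded_integral_dist (f g : T -> R) (M c : R) :
  measurable_fun setT f -> measurable_fun setT g ->
  (forall x, `|f x| <= M) -> (forall x, `|g x| <= M) -> (forall x, `|f x - g x| <= c) ->
  `|\int[P]_x f x - \int[P]_x g x| <= c.
Proof.
move=> mf mg fM gM fg.
have c0 : 0 <= c by apply: le_trans (fg point).
have L (a b : T -> R) : measurable_fun setT b ->
    (forall x, `|a x| <= M) -> (forall x, `|b x| <= M) -> (forall x, a x <= b x + c) ->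
    \int[P]_x a x <= \int[P]_x b x + c.
  move=> mb aM bM ab; rewrite -[X in _ <= _ + X]prob_integral_cst.
  rewrite -(@bounded_integralD _ _ M c)//; last by move=> x; rewrite ger0_norm.
  apply: (@le_bounded_integral _ _ (M + c)) => // x; first by rewrite (le_trans (aM x))// lerDl.
  by rewrite (le_trans (ler_normD _ _))// lerD// ger0_norm.
rewrite ler_norml; apply/andP; split.
  rewrite lerBrDr addrC lerBlDr; apply: L => // x.
  by have := fg x; rewrite ler_norml => /andP[? ?]; lra.
rewrite lerBlDr addrC; apply: L => // x.
by have := fg x; rewrite ler_norml => /andP[? ?]; lra.
Qed.

Lemma bounded_integral_le (f : T -> R) (M : R) : (forall x, `|f x| <= M) -> `|\int[P]_x f x| <= M.
Proof.
move=> fM; have M0 : 0 <= M by apply: le_trans (fM point).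
have A := @le_bounded_integral f (fun=> M) M fM _ _.
have B := @le_bounded_integral (fun=> - M) f M _ fM _.
rewrite !prob_integral_cst in A B; rewrite ler_norml; apply/andP; split.
  by apply: B => x; [rewrite normrN ger0_norm|have := fM x; rewrite ler_norml => /andP[]].
by apply: A => x; [rewrite ger0_norm|have := fM x; rewrite ler_norml => /andP[]].
Qed.

Lemma norm_indic_le1 (A : set T) x : `|\1_A x : R| <= 1.
Proof. by rewrite indicE; case: (_ \in _); rewrite ?normr1 ?normr0. Qed.

(** A measurable good event extracted from a functional that need not be measurable: some simple [g]
    below [f] still has integral above [1 - eta], and Markov's inequality applies to the event
    [g >= 1 - r]. *)
Lemma inner_event (f : T -> R) (eta r : R) :
  (forall x, 0 <= f x <= 1) -> 1 - eta < \int[P]_x f x -> 0 < r ->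
  exists2 E : set T, measurable E &
    fine (P (~` E)) <= eta / r /\ forall x, E x -> 1 - r <= f x.
Proof.
move=> f01 If r0.
have f0 x : (0 <= (f x)%:E)%E by have /andP[] := f01 x; rewrite lee_fin.
have fM x : `|f x| <= 1 by have /andP[? ?] := f01 x; rewrite ger0_norm.
have : ((1 - eta)%:E < \int[P]_x (f x)%:E)%E.
  by rewrite -(fineK (bounded_integral_fin fM)) lte_fin.
rewrite (ge0_integralTE _ f0) => /ereal_sup_gt[_ [g/= gf <-]].
rewrite -integralT_nnsfun => Ig.
have mg : measurable_fun setT (g : T -> R) by [].
pose E := [set x | 1 - r <= g x].
have mE : measurable E.
  exact: measurable_set_le.
exists E => //; split; last first.
  by move=> x Ex; apply: (le_trans Ex); have := gf x; rewrite lee_fin.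
rewrite ler_pdivlMr//.
have mEC := measurableC mE.
have gfx x : g x <= f x by have := gf x; rewrite lee_fin.
have g0 x : 0 <= g x by exact: (@fun_ge0 _ _ g).
have Hle : \int[P]_x g x <= \int[P]_x (1 + (- r) * \1_(~` E) x).
  apply: (@le_bounded_integral _ _ (1 + r)) => x.
  - have /andP[_ f1] := f01 x; rewrite ger0_norm//.
    by rewrite (le_trans (gfx x))// (le_trans f1)// lerDl ltW.
  - rewrite (le_trans (ler_normD _ _))// normr1 lerD2l normrM normrN (gtr0_norm r0).
    by rewrite ler_piMr ?norm_indic_le1// ltW.
  - rewrite indicE; have /andP[_ f1] := f01 x; case: (boolP (x \in ~` E)) => [|_].
      by rewrite inE /E /= => /negP; rewrite -ltNge => /ltW; rewrite mulr1.
    by rewrite mulr0 addr0 (le_trans (gfx x)).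
move: Hle; rewrite (@bounded_integralD _ _ 1 r) ?prob_integral_cst//; last 3 first.
- by apply: measurable_funM => //; exact: measurable_indic.
- by move=> x; rewrite normr1.
- by move=> x; rewrite normrM normrN (gtr0_norm r0) ler_piMr ?norm_indic_le1// ltW.
rewrite (@bounded_integralZ _ 1) ?Rintegral_indic//; last exact: norm_indic_le1.
have Ifin : (\int[P]_x (g x)%:E \is a fin_num)%E.
  apply: (@bounded_integral_fin _ 1) => x; have /andP[_ f1] := f01 x.
  by rewrite ger0_norm// (le_trans (gfx x)).
move: Ig; rewrite -(fineK Ifin) lte_fin -/(Rintegral _ _ _) => Ig Hle; lra.
Qed.

End bounded_integral.

(* The idle time, as a lower integral, is 1-Lipschitz whatever the set b. *)
Section idle_time.
Context {R : realType}.
Variable b : R -> bool.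
Local Notation leb := (@lebesgue_measure R).
Let J (t : R) : R := \int[leb]_(s in `[0, t]) (nat_of_bool (b s))%:R.

Let Jfin (t : R) : 0 <= t -> (\int[leb]_(s in `[0%R, t]) ((nat_of_bool (b s))%:R)%:E \is a fin_num)%E.
Proof.
move=> t0; rewrite ge0_fin_numE; last by apply: integral_ge0 => x _; rewrite lee_fin.
apply: (@le_lt_trans _ _ (\int[leb]_(s in `[0%R, t]) (cst 1 s))%E).
  by apply: ge0_le_integral_nomeas => x _; rewrite lee_fin//; case: (b x).
rewrite integral_cst//= mul1e lebesgue_measure_itv /=.
by case: ifP => _; rewrite ltry.
Qed.

Lemma idle_time_lip (s t : R) : 0 <= s -> s <= t -> 0 <= J t - J s <= t - s.
Proof.
move=> s0 st; have t0 := le_trans s0 st.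
have := Jfin s0; have := Jfin t0.
set A := (\int[leb]_(x in `[0%R, t]) _)%E; set B := (\int[leb]_(x in `[0%R, s]) _)%E => fA fB.
have BA : (B <= A)%E.
  rewrite /A /B integral_mkcond [leRHS]integral_mkcond.
  apply: ge0_le_integral_nomeas => x _; rewrite /patch; case: ifPn => //.
    rewrite inE /= in_itv /= => /andP[x0 xs].
    by rewrite ifT// inE /= in_itv /= x0 (le_trans xs).
  by move=> _; case: ifP => // _; rewrite (_ : point = 0%:E)// lee_fin.
have AB : (A <= B + (t - s)%:E)%E.
  rewrite /A /B integral_mkcond [X in (_ <= X + _)%E]integral_mkcond.
  have -> : ((t - s)%:E = \int[leb]_x (\1_(`]s, t]%classic) x)%:E)%E.
    rewrite integral_indic// setIT [RHS]lebesgue_measure_itv /= lte_fin.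
    by case: ltP => // ts; rewrite (@le_anti _ _ s t) ?subrr// st.
  apply: le_lower_integralD => // x.
  - by rewrite /patch; case: ifP => // _; rewrite lee_fin.
  - by rewrite /patch; case: ifP => // _; rewrite lee_fin.
  rewrite /patch indicE !mem_setE !in_itv /=.
  case: (leP 0 x) => //= x0; case: (leP x t) => xt; case: (leP x s) => xs //=; rewrite -?EFinD ?lee_fin ?addr0 ?add0r//.
  all: try by case: (b x).
move: BA AB; rewrite /J /Rintegral -/A -/B -(fineK fA) -(fineK fB) -EFinD !lee_fin /=.
by move=> ? ?; apply/andP; split; lra.
Qed.

Lemma idle_time_flat (s t : R) : 0 <= s -> s <= t -> (forall r, s < r <= t -> b r = false) ->
  J t = J s.
Proof.
move=> s0 st bF; rewrite /J Rintegral_mkcond [RHS]Rintegral_mkcond; congr fine; apply: eq_integral => x _.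
congr EFin; rewrite /patch !mem_setE !in_itv /=.
case: (leP 0 x) => //= x0; case: (leP x s) => xs; first by rewrite (le_trans xs st).
by case: (leP x t) => // xt; rewrite bF// xs xt.
Qed.

End idle_time.

(** * The reflected equation *)

Section cont0.
Context {R : realType}.
Implicit Types f g : R -> R.

(** Continuity on the half-line in epsilon-delta form. Paths are unconstrained at negative times,
    which this notion never inspects. *)
Definition cont0 f := forall t : R, 0 <= t -> forall e : R, 0 < e ->
  exists2 dl : R, 0 < dl & forall r : R, 0 <= r -> `|r - t| < dl -> `|f r - f t| < e.

Lemma cont0P f : cont0 f <-> {within `[0, +oo[, continuous f}.
Proof.
rewrite subspace_continuousP; split=> [cf x|cf t t0 e e0].
- rewrite /= in_itv /= andbT => x0.
  apply/cvgrPdist_lt => e e0; have [dl dl0 H] := cf x x0 e e0.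
  rewrite /within /=; apply/nbhs_ballP; exists dl => //= y xy.
  rewrite in_itv /= andbT => y0; rewrite distrC; apply: H => //.
  by rewrite distrC.
- have tA : (`[0, +oo[%classic : set R) t by rewrite /= in_itv /= t0.
  have /cvgrPdist_lt/(_ e e0) := cf t tA.
  rewrite /within /= => /nbhs_ballP[dl /= dl0 H]; exists dl => // r r0 rt.
  rewrite distrC; apply: H; last by rewrite /= in_itv /= r0.
  by rewrite /ball /= distrC.
Qed.

Lemma cont0_within f (T : R) : cont0 f -> 0 <= T -> {within `[0, T], continuous f}.
Proof.
move=> /cont0P cf T0; apply: continuous_subspaceW cf => x /=.
by rewrite !in_itv /= andbT => /andP[].
Qed.

Lemma cont0_cst c : cont0 (fun _ => c).
Proof. by move=> t t0 e e0; exists 1 => // r _ _; rewrite subrr normr0. Qed.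

Lemma cont0_id : cont0 id.
Proof. by move=> t t0 e e0; exists e. Qed.

Lemma eq_cont0 f g : (forall t : R, 0 <= t -> f t = g t) -> cont0 f -> cont0 g.
Proof.
move=> fg cf t t0 e e0; have [dl dl0 H] := cf t t0 e e0; exists dl => // r r0 rt.
by rewrite -!fg// H.
Qed.

Lemma cont0D f g : cont0 f -> cont0 g -> cont0 (fun t => f t + g t).
Proof.
move=> cf cg t t0 e e0.
have e20 : 0 < e / 2 by rewrite divr_gt0.
have [d1 d10 H1] := cf t t0 _ e20; have [d2 d20 H2] := cg t t0 _ e20.
exists (minr d1 d2); first by rewrite lt_min d10.
move=> r r0; rewrite lt_min => /andP[r1 r2].
have := H1 r r0 r1; have := H2 r r0 r2.
by rewrite !ltr_norml => /andP[? ?] /andP[? ?]; apply/andP; split; lra.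
Qed.

Lemma cont0M f g : cont0 f -> cont0 g -> cont0 (fun t => f t * g t).
Proof.
move=> /cont0P cf /cont0P cg; apply/cont0P => x.
by apply: cvgM; [exact: cf|exact: cg].
Qed.

Lemma cont0Z c f : cont0 f -> cont0 (fun t => c * f t).
Proof. by move=> cf; apply: cont0M => //; exact: cont0_cst. Qed.

Lemma cont0N f : cont0 f -> cont0 (fun t => - f t).
Proof. by move=> cf; apply: eq_cont0 (cont0Z (-1) cf) => t _; rewrite mulN1r. Qed.

Lemma cont0B f g : cont0 f -> cont0 g -> cont0 (fun t => f t - g t).
Proof. by move=> cf cg; apply: cont0D => //; exact: cont0N. Qed.

Lemma lip_cont0 f (C : R) : (forall s t : R, 0 <= s -> s <= t -> `|f t - f s| <= C * (t - s)) -> cont0 f.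
Proof.
move=> fl t t0 e e0.
have C0 : 0 < `|C| + 1 by rewrite ltr_wpDl.
exists (e / (`|C| + 1)); first by rewrite divr_gt0.
move=> r r0; rewrite ltr_pdivlMr// => rt.
apply: le_lt_trans rt.
have H (a b : R) : a <= b -> C * (b - a) <= `|b - a| * (`|C| + 1).
  move=> ab; rewrite ger0_norm ?subr_ge0// mulrC ler_wpM2l ?subr_ge0//.
  by rewrite (le_trans (ler_norm C))// lerDl.
case: (leP r t) => rt.
  by rewrite distrC (distrC r); apply: (le_trans (fl _ _ r0 rt)); exact: H.
by apply: (le_trans (fl _ _ t0 (ltW rt))); apply: H; exact: ltW.
Qed.

Lemma cont0_bounded f (T : R) : cont0 f -> exists2 K : R, 0 <= K & forall t : R, 0 <= t <= T -> `|f t| <= K.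
Proof.
move=> cf; case: (leP 0 T) => [T0|T0]; last first.
  by exists 0 => // t /andP[t0 tT]; move: (lt_le_trans T0 (le_trans t0 tT)); rewrite ltxx.
have cw := cont0_within cf T0.
have [c1 _ H1] := EVT_max T0 cw; have [c2 _ H2] := EVT_min T0 cw.
exists (`|f c1| + `|f c2|); first by rewrite addr_ge0.
move=> t tT; have tT' : t \in `[0, T] by rewrite in_itv.
have := H1 _ tT'; have := H2 _ tT'.
have := ler_norm (f c1); have := ler_norm (- f c2); rewrite normrN => ? ? ? ?.
have := normr_ge0 (f c1); have := normr_ge0 (f c2) => ? ?.
by rewrite ler_norml; apply/andP; split; lra.
Qed.

(** Heine's theorem: otherwise pairs of ever closer points with values [e] apart would cluster at a
    point of [[0, T]], against continuity there. *)
Lemma cont0_unif f (T e : R) : cont0 f -> 0 <= T -> 0 < e ->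
  exists2 dl : R, 0 < dl & forall s t : R, 0 <= s <= T -> 0 <= t <= T -> `|s - t| < dl -> `|f s - f t| < e.
Proof.
move=> cf T0 e0.
apply: contrapT => H.
have {}H (n : nat) : exists st : R * R, [/\ 0 <= st.1 <= T, 0 <= st.2 <= T,
    `|st.1 - st.2| < n.+1%:R^-1 & e <= `|f st.1 - f st.2|].
  apply: contrapT => H2; apply: H; exists n.+1%:R^-1 => // s t s0 t0 st.
  by rewrite ltNge; apply/negP => est; apply: H2; exists (s, t).
pose p n := sval (cid (H n)).
have pP n : [/\ 0 <= (p n).1 <= T, 0 <= (p n).2 <= T, `|(p n).1 - (p n).2| < n.+1%:R^-1
    & e <= `|f (p n).1 - f (p n).2|] := svalP (cid (H n)).
have cpt : compact (`[0, T]%classic : set R) by exact: segment_compact.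
have := cpt ((fun n => (p n).1) @ \oo) _.
case.
  by exists 0%N => // n _ /=; have [h _ _ _] := pP n; rewrite in_itv.
move=> x [xT cl]; have x0 : 0 <= x by move: xT; rewrite /= in_itv /= => /andP[].
have e20 : 0 < e / 2 by rewrite divr_gt0.
have [dl dl0 Hd] := cf x x0 (e / 2) e20.
have dl20 : 0 < dl / 2 by rewrite divr_gt0.
have F1 : ((fun n => (p n).1) @ \oo) [set s | exists n, s = (p n).1 /\ n.+1%:R^-1 < dl / 2].
  have [N _ HN] := near_infty_natSinv_lt (PosNum dl20).
  by exists N => // n /= Nn; exists n; split => //; exact: HN.
have [s [[n [sE nd]] sx]] := cl _ _ F1 (nbhsx_ballx x (dl / 2) dl20).
have [/andP[s10 _] /andP[s20 _] p12 fe] := pP n.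
have A0 : `|(p n).1 - x| < dl / 2 by move: sx; rewrite sE /ball /= distrC.
have A1 : `|(p n).1 - x| < dl by lra.
have A2 : `|(p n).2 - x| < dl.
  rewrite (le_lt_trans (ler_distD (p n).1 _ _))// (splitr dl) ltrD//.
  by rewrite distrC (lt_trans p12).
have := Hd _ s10 A1; have := Hd _ s20 A2; move=> B2 B1.
have := ler_distD (f x) (f (p n).1) (f (p n).2).
rewrite (distrC (f x)) => ?; lra.
Qed.

End cont0.

(** * Integrals from time zero of locally bounded functions *)

Section int0.
Context {R : realType}.
Implicit Types f g : R -> R.
Local Notation leb := (@lebesgue_measure R).

(** Measurable and locally bounded: a class that contains both the continuous limit paths and the
    scaled workload, which jumps. *)
Definition locint f := measurable_fun (`[0, +oo[%classic : set R) f /\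
  forall T : R, exists M : R, forall t : R, 0 <= t <= T -> `|f t| <= M.

Definition int0 f (t : R) := \int[leb]_(s in `[0, t]) f s.

Lemma cont0_locint f : cont0 f -> locint f.
Proof.
move=> cf; split.
  by apply: subspace_continuous_measurable_fun => //; apply/cont0P.
by move=> T; have [K _ H] := cont0_bounded T cf; exists K.
Qed.

Lemma locint_integrable f (a b : itv_bound R) (T : R) : locint f ->
  [set` Interval a b] `<=` `[0, T]%classic ->
  leb.-integrable [set` Interval a b] (EFin \o f).
Proof.
move=> [mf bf] sub; have [M HM] := bf T.
apply: measurable_bounded_integrable => //.
- apply: (@le_lt_trans _ _ (leb (`[0, T]%classic : set R))).
    by apply: le_measure; rewrite ?inE.
  by rewrite lebesgue_measure_itv /=; case: ifP; rewrite ltry.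
- apply: measurable_funS mf => // x /sub /=; rewrite !in_itv /= andbT; by case/andP.
- exists M; split; first exact: num_real.
  move=> y My x /sub /=; rewrite in_itv /= => xT; apply: (le_trans (HM _ xT)); exact: ltW.
Qed.

Lemma int0B f (s t : R) : locint f -> 0 <= s -> s <= t ->
  int0 f t - int0 f s = \int[leb]_(x in `]s, t]) f x.
Proof.
move=> lf s0 st; rewrite /int0 Rintegral_itvB//.
- by apply: (@locint_integrable _ _ _ t).
Qed.

Lemma int0_0 f : int0 f 0 = 0.
Proof. by rewrite /int0 set_itv1 Rintegral_set1. Qed.

Lemma int0_le f g (s t : R) : locint f -> locint g -> 0 <= s -> s <= t ->
  (forall x : R, s < x <= t -> f x <= g x) ->
  int0 f t - int0 f s <= int0 g t - int0 g s.
Proof.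
move=> lf lg s0 st fg; rewrite !int0B//; apply: le_Rintegral => //.
1,2: apply: (@locint_integrable _ _ _ t) => // x /=; rewrite !in_itv /= => /andP[sx ->].
1,2: by rewrite (le_trans s0) ?ltW.
Qed.

Lemma locint_cst c : locint (fun _ => c).
Proof. by apply: cont0_locint; exact: cont0_cst. Qed.

Lemma int0_cst c (t : R) : 0 <= t -> int0 (fun _ => c) t = c * t.
Proof.
move=> t0; rewrite /int0 Rintegral_cst//; congr (_ * _).
rewrite /= lebesgue_measure_itv /= lte_fin; case: ltP => [_|tn]; first by rewrite -EFinB /= subr0.
by apply/eqP; rewrite eq_le t0 tn.
Qed.

Lemma int0_ge0 f (s t : R) : locint f -> 0 <= s -> s <= t ->
  (forall x : R, s < x <= t -> 0 <= f x) -> int0 f s <= int0 f t.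
Proof.
move=> lf s0 st f0; rewrite -subr_ge0.
have := int0_le (locint_cst 0) lf s0 st f0.
by rewrite !int0_cst ?(le_trans s0 st)// !mul0r subrr.
Qed.

Lemma locintD f g : locint f -> locint g -> locint (fun x => f x + g x).
Proof.
move=> [mf bf] [mg bg]; split; first exact: measurable_funD.
move=> T; have [M HM] := bf T; have [N HN] := bg T; exists (M + N) => t tT.
by rewrite (le_trans (ler_normD _ _))// lerD// ?HM// HN.
Qed.

Lemma locintZ c f : locint f -> locint (fun x => c * f x).
Proof.
move=> [mf bf]; split; first exact: measurable_funM.
move=> T; have [M HM] := bf T; exists (`|c| * M) => t tT.
by rewrite normrM ler_wpM2l// HM.
Qed.

Lemma locintX f n : locint f -> locint (fun x => f x ^+ n).
Proof.
move=> [mf bf]; split; first exact: measurable_funX.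
by move=> T; have [M HM] := bf T; exists (M ^+ n) => t tT; rewrite normrX lerXn2r ?nnegrE ?(le_trans _ (HM t tT))// HM.
Qed.

Lemma locint_norm f : locint f -> locint (fun x => `|f x|).
Proof.
move=> [mf bf]; split; first exact: measurableT_comp.
by move=> T; have [M HM] := bf T; exists M => t tT; rewrite normr_id HM.
Qed.

Lemma int0D f g (t : R) : locint f -> locint g -> 0 <= t ->
  int0 (fun x => f x + g x) t = int0 f t + int0 g t.
Proof.
by move=> lf lg t0; rewrite /int0 RintegralD//; apply: (@locint_integrable _ _ _ t).
Qed.

Lemma int0Z c f (t : R) : locint f -> 0 <= t -> int0 (fun x => c * f x) t = c * int0 f t.
Proof.
by move=> lf t0; rewrite /int0 RintegralZl//; apply: (@locint_integrable _ _ _ t).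
Qed.

Lemma int0_lip f (s t : R) M : locint f -> 0 <= s -> s <= t ->
  (forall x : R, s < x <= t -> `|f x| <= M) -> `|int0 f t - int0 f s| <= M * (t - s).
Proof.
move=> lf s0 st fM; have t0 := le_trans s0 st.
have H1 := @int0_le f (fun _ => M) s t lf (locint_cst M) s0 st.
have H2 := @int0_le (fun _ => - M) f s t (locint_cst (- M)) lf s0 st.
rewrite !int0_cst// in H1 H2.
rewrite ler_norml; apply/andP; split.
  rewrite -mulNr mulrBr; apply: H2 => x /fM; rewrite ler_norml => /andP[] //.
by rewrite mulrBr; apply: H1 => x /fM; rewrite ler_norml => /andP[].
Qed.

Lemma int0_dist f g (t e : R) : locint f -> locint g -> 0 <= t ->
  (forall x : R, 0 < x <= t -> `|f x - g x| <= e) -> `|int0 f t - int0 g t| <= e * t.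
Proof.
move=> lf lg t0 fg.
have lN := locintZ (-1) lg.
have -> : int0 f t - int0 g t = int0 (fun x => f x + -1 * g x) t - int0 (fun x => f x + -1 * g x) 0.
  by rewrite int0_0 subr0 int0D// int0Z// mulN1r.
rewrite -[e * t]/(e * t) -[in leRHS](subr0 t); apply: int0_lip => //; first exact: locintD.
by move=> x xt; rewrite mulN1r fg.
Qed.

Lemma cont0_int0 f : locint f -> cont0 (int0 f).
Proof.
move=> lf t t0 e e0; have [M HM] := lf.2 (t + 1).
have M0 : 0 <= M by apply: le_trans (HM t _) => //; rewrite t0 lerDl ler01.
have M1 : 0 < M + 1 by rewrite ltr_wpDl.
exists (minr 1 (e / (M + 1))); first by rewrite lt_min ltr01 divr_gt0.
move=> r r0; rewrite lt_min ltr_pdivlMr// => /andP[r1 re].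
have H (a b : R) : 0 <= a -> a <= b -> b <= t + 1 -> `|int0 f b - int0 f a| <= `|b - a| * (M + 1).
  move=> a0 ab bt; apply: (@le_trans _ _ (M * (b - a))).
    apply: int0_lip => // x /andP[ax xb]; apply: HM; rewrite (le_trans xb)// andbT.
    by rewrite (le_trans a0)// ltW.
  by rewrite ger0_norm ?subr_ge0// mulrC ler_wpM2l ?subr_ge0// lerDl.
apply: le_lt_trans re; case: (leP r t) => rt.
  by rewrite distrC (distrC r); apply: H => //; rewrite lerDl.
apply: H => //; first exact: ltW.
by move: r1; rewrite ltr_norml => /andP[]; lra.
Qed.

Lemma int0_exprn n (t : R) : 0 <= t -> int0 (fun s => s ^+ n) t = t ^+ n.+1 / n.+1%:R.
Proof.
rewrite le_eqVlt => /predU1P[<-|t0]; first by rewrite int0_0 expr0n mul0r.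
rewrite /int0 /Rintegral.
rewrite (@continuous_FTC2 _ _ (fun s => s ^+ n.+1 / n.+1%:R))//.
- by rewrite -EFinB /= expr0n /= mul0r subr0.
- by apply: continuous_subspaceT => x; exact: exprn_continuous.
- split.
  + by move=> x _; apply: derivableM => //; exact: exprn_derivable.
  + by apply: cvg_at_right_filter; apply: cvgMl; exact: exprn_continuous.
  + by apply: cvg_at_left_filter; apply: cvgMl; exact: exprn_continuous.
- move=> x _; rewrite (_ : (fun s : R => _) = (n.+1%:R^-1 \*: (fun s : R => s ^+ n.+1))); last first.
    by apply/funext => s; rewrite /= mulrC.
  rewrite derive1E deriveZ//=; last exact: exprn_derivable.
  by rewrite exp_derive /= /GRing.scale /= mulr1 mulrA mulVf ?mul1r// pnatr_eq0.
Qed.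

End int0.

(** * Reflection at zero and its stability *)

Section reflection.
Context {R : realType}.
Implicit Types y Z L p : R -> R.

(** Complementarity of [Z] and [L] up to time [T], stated through constancy of [L] instead of a
    Stieltjes integral. *)
Definition flat_off Z L (T : R) := forall s t : R, 0 <= s -> s <= t -> t <= T ->
  (forall r, s <= r <= t -> 0 < Z r) -> L s = L t.

Definition nd0 L := forall s t : R, 0 <= s -> s <= t -> L s <= L t.

(* At the last time at which f <= g before t, a reflected path cannot have been
   pushed since; only continuity of the push L is used, not of the paths. *)
Lemma last_crossing Z L (f : R -> R) (a t e : R) :
  0 <= a -> a <= t -> cont0 L -> nd0 L -> flat_off Z L t -> 0 < e ->
  (forall r, a <= r <= t -> 0 < f r -> 0 < Z r) ->
  f a <= 0 -> 0 < f t ->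
  exists r s, [/\ a <= r, r <= s, s <= t, f r <= 0 &
    [/\ (forall q, s < q <= t -> 0 < f q), L t - L r <= e & s - r < e]].
Proof.
move=> a0 at_ cL nL fL e0 fZ fa ft.
pose S := [set r | a <= r <= t /\ f r <= 0].
have Sa : S a by split; rewrite ?lexx.
have hS : has_sup S by split; [exists a|exists t => r [/andP[]]].
set s := sup S.
have as_ : a <= s by apply: sup_upper_bound.
have st : s <= t by apply: ge_sup; [exists a|move=> r [/andP[]]].
have s0 : 0 <= s by exact: le_trans as_.
have e20 : 0 < e / 2 by rewrite divr_gt0.
have [dl dl0 H] := cL s s0 _ e20.
have m0 : 0 < minr dl e by rewrite lt_min dl0.
(* [f] may jump, so the supremum [s] need not satisfy [f s <= 0]; some [r] just before it, or equal
   to it, does. *)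
have [r [[/andP[ar rt] fr] sr]] := sup_adherent m0 hS.
have rs : r <= s by apply: sup_upper_bound => //; split => //; rewrite ar.
have rdl : `|r - s| < dl.
  rewrite distrC ger0_norm ?subr_ge0//; move: sr; rewrite ltrBlDl -ltrBlDr.
  by rewrite lt_min => /andP[].
have Lr := H r (le_trans a0 ar) rdl.
have fq q : s < q <= t -> 0 < f q.
  move=> /andP[sq qt]; rewrite ltNge; apply/negP => fq.
  have : q <= s by apply: sup_upper_bound => //; split => //; rewrite qt (le_trans as_)// ltW.
  by rewrite leNgt sq.
exists r, s; split => //; split => //; last first.
  by move: sr; rewrite ltrBlDl -ltrBlDr lt_min => /andP[].
have [ts|ts] := leP t (s + dl / 2).
  have tdl : `|t - s| < dl.
    by rewrite ger0_norm ?subr_ge0//; lra.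
  have := H t (le_trans s0 st) tdl.
  by move: Lr; rewrite !ltr_norml => /andP[? ?] /andP[? ?]; lra.
(* Just after [s] the push is controlled by continuity; from [s + dl / 2] on it is frozen, since
   [f > 0] there forces [Z > 0]. *)
have -> : L t = L (s + dl / 2).
  apply/esym; apply: fL => //; rewrite ?addr_ge0//; try lra.
  move=> q /andP[q1 q2]; apply: fZ; first by rewrite q2 andbT; lra.
  by apply: fq; rewrite q2 andbT; lra.
have tdl : `|s + dl / 2 - s| < dl.
  by rewrite addrAC subrr add0r ger0_norm; lra.
have := H (s + dl / 2) _ tdl.
move=> /(_ ltac:(rewrite addr_ge0//; lra)).
by move: Lr; rewrite !ltr_norml => /andP[? ?] /andP[? ?]; lra.
Qed.

(** Look back from [t] to the last time at which [Z1 <= Z2]. Since then [Z1 > Z2 >= 0], so [L1] has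
    not grown, [L2] can only have lowered the difference, and the larger path has had the stronger
    downward drift. What remains is the variation of [y1 - y2], at most [2 e]: monotonicity of the
    drift stands in for a Gronwall argument. *)
Lemma refl_stability Z1 Z2 y1 y2 p1 p2 L1 L2 (T e : R) :
  (forall t, 0 <= t <= T -> Z1 t = y1 t - p1 t + L1 t) ->
  (forall t, 0 <= t <= T -> Z2 t = y2 t - p2 t + L2 t) ->
  (forall t, 0 <= t <= T -> 0 <= Z2 t) ->
  cont0 p2 -> nd0 p1 -> p1 0 = p2 0 ->
  (forall s t, 0 <= s -> s <= t -> t <= T -> (forall r, s < r <= t -> Z2 r <= Z1 r) ->
     p2 t - p2 s <= p1 t - p1 s) ->
  cont0 L1 -> nd0 L1 -> flat_off Z1 L1 T -> nd0 L2 -> L1 0 = L2 0 ->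
  (forall t, 0 <= t <= T -> `|y1 t - y2 t| <= e) ->
  forall t, 0 <= t <= T -> Z1 t - Z2 t <= 2 * e.
Proof.
move=> E1 E2 Z20 cp2 np1 p00 cmp cL1 nL1 fL1 nL2 L00 ye t /andP[t0 tT].
have T0 : 0 <= T by exact: le_trans tT.
have e0 : 0 <= e by apply: le_trans (ye 0 _); rewrite ?lexx.
rewrite leNgt; apply/negP => H.
(* The excess over [2 e] is [4 eta]. The growth of [L1] since [r] and that of [p2] between [r] and
   [s] will cost one [eta] each, which leaves a contradiction. *)
pose eta := (Z1 t - Z2 t - 2 * e) / 4.
have eta0 : 0 < eta by rewrite /eta divr_gt0// subr_gt0.
have fLt : flat_off Z1 L1 t by move=> s q s0 sq qt; apply: fL1 => //; exact: le_trans tT.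
have yt := ye t; move: yt; rewrite t0 tT => /(_ isT); rewrite ler_norml => /andP[yt1 yt2].
have y00 := ye 0; move: y00; rewrite lexx T0 => /(_ isT); rewrite ler_norml => /andP[y01 y02].
have tT' : 0 <= t <= T by rewrite t0.
have fZ r : 0 <= r <= t -> 0 < Z1 r - Z2 r -> 0 < Z1 r.
  by move=> /andP[r0 rt] D; have := Z20 r; rewrite r0 (le_trans rt tT) => /(_ isT); lra.
(* If [Z1] stays above [Z2] from the start, the comparison is made from time 0, where drifts and
   pushes agree. *)
have [AP|/existsNP[q /not_implyP[/andP[q0 qt] /negP]]] :=
    pselect (forall q, 0 <= q <= t -> 0 < Z1 q - Z2 q).
  have C : p2 t - p2 0 <= p1 t - p1 0.
    apply: cmp => // r /andP[r0 rt]; rewrite -subr_ge0 ltW// AP// rt andbT; exact: ltW.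
  have L1t : L1 0 = L1 t by apply: fL1 => // r r0t; apply: fZ => //; exact: AP.
  have L2t : L2 0 <= L2 t by exact: nL2.
  move: H; rewrite E1// E2//; lra.
rewrite -leNgt => qD.
have [dl dl0 Hp] := cont0_unif cp2 T0 eta0.
have m0 : 0 < minr eta dl by rewrite lt_min eta0.
have Dt : 0 < Z1 t - Z2 t by apply: le_lt_trans H; rewrite mulr_ge0.
have fZ' r : q <= r <= t -> 0 < Z1 r - Z2 r -> 0 < Z1 r.
  by move=> /andP[qr rt]; apply: fZ; rewrite rt (le_trans q0).
have [r [s [qr rs st fr [fs Lr sr]]]] := last_crossing q0 qt cL1 nL1 fLt m0 fZ' qD Dt.
have r0 := le_trans q0 qr; have s0 := le_trans r0 rs.
have sT := le_trans st tT; have rT := le_trans rs sT.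
have rT' : 0 <= r <= T by rewrite r0.
have sT' : 0 <= s <= T by rewrite s0.
have C : p2 t - p2 s <= p1 t - p1 s.
  by apply: cmp => // z zt; rewrite -subr_ge0 ltW// fs.
have p1rs : p1 r <= p1 s by exact: np1.
have p2rs : p2 s - p2 r <= eta.
  have : `|s - r| < dl by rewrite ger0_norm ?subr_ge0//; move: sr; rewrite lt_min => /andP[].
  by move=> /(Hp _ _ sT' rT'); rewrite ltr_norml => /andP[_ /ltW].
have L2rt : L2 r <= L2 t by apply: nL2 => //; exact: le_trans st.
have Le : L1 t - L1 r <= eta by move: Lr; rewrite le_min => /andP[].
have := ye r rT'; rewrite ler_norml => /andP[yr1 yr2].
have Et : Z1 t - Z2 t = 2 * e + 4 * eta by rewrite /eta; lra.
move: fr Et; rewrite E1// E2// E1// E2//; lra.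
Qed.

(** The same look-back at the level [Z s]: after the last time at or below this level the push is
    idle and [a] only lowers [Z], so that an upward move is due to [y]. *)
Lemma refl_upward Z y a L (s t w : R) :
  0 <= s -> s <= t ->
  (forall r, s <= r <= t -> Z r = y r - a r + L r) ->
  (forall r, s <= r <= t -> 0 <= Z r) -> nd0 a ->
  cont0 L -> nd0 L -> flat_off Z L t ->
  (forall r, s <= r <= t -> y t - y r <= w) -> 0 <= w ->
  Z t - Z s <= w.
Proof.
move=> s0 st E Z0 na cL nL fL yw w0.
rewrite leNgt; apply/negP => H.
have Zs0 : 0 <= Z s by apply: Z0; rewrite lexx.
have fZ r : s <= r <= t -> 0 < Z r - Z s -> 0 < Z r by move=> _ ?; lra.
pose eta := (Z t - Z s - w) / 2.
have eta0 : 0 < eta by rewrite /eta; lra.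
have Dt : 0 < Z t - Z s by lra.
have Ds : Z s - Z s <= 0 by rewrite subrr.
have [r [q [sr rq qt fr [_ Lr _]]]] :=
  @last_crossing Z L (fun r => Z r - Z s) s t eta s0 st cL nL fL eta0 fZ Ds Dt.
have rt := le_trans rq qt.
have ar : a r <= a t by apply: na => //; exact: le_trans sr.
have yr : y t - y r <= w by apply: yw; rewrite sr.
have Er : Z r = y r - a r + L r by apply: E; rewrite sr.
have Et : Z t = y t - a t + L t by apply: E; rewrite st lexx.
have e2 : Z t - Z s = w + 2 * eta by rewrite /eta; lra.
move: fr e2; rewrite Er Et; lra.
Qed.

Section skorokhod_map.
Variable y : R -> R.
Hypothesis cy : cont0 y.

(** The regulator of the one-sided Skorokhod reflection of [y]; [refl] is the reflected path. *)
Definition push (t : R) := sup [set maxr (- y s) 0 | s in `[0, t]%classic].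
Definition refl (t : R) := y t + push t.

Let push_sup t : 0 <= t -> has_sup [set maxr (- y s) 0 | s in `[0, t]%classic].
Proof.
move=> t0; split; first by exists (maxr (- y 0) 0); exists 0 => //=; rewrite in_itv /= lexx.
have [K K0 HK] := cont0_bounded t cy.
exists K => z [s /=]; rewrite in_itv /= => st <-; rewrite ge_max K0 andbT.
by have := HK s st; rewrite ler_norml => /andP[]; lra.
Qed.

Let push_ub s t : 0 <= s <= t -> maxr (- y s) 0 <= push t.
Proof.
move=> /andP[s0 st]; apply: sup_upper_bound; first by apply: push_sup; exact: le_trans st.
by exists s => //=; rewrite in_itv /= s0.
Qed.

Let push_le t M : 0 <= t -> (forall s, 0 <= s <= t -> maxr (- y s) 0 <= M) -> push t <= M.
Proof.
move=> t0 H; apply: ge_sup; first by have [] := push_sup t0.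
by move=> z [s /=]; rewrite in_itv /= => st <-; exact: H.
Qed.

Lemma push_ge0 t : 0 <= t -> 0 <= push t.
Proof. by move=> t0; apply: le_trans (@push_ub 0 t _); rewrite ?lexx// le_max lexx orbT. Qed.

Lemma push_nd : nd0 push.
Proof.
move=> s t s0 st; apply: push_le => // r /andP[r0 rs]; apply: push_ub.
by rewrite r0 (le_trans rs).
Qed.

Lemma refl_ge0 t : 0 <= t -> 0 <= refl t.
Proof.
move=> t0; have : maxr (- y t) 0 <= push t by apply: push_ub; rewrite t0 lexx.
by rewrite /refl ge_max => /andP[]; lra.
Qed.

Lemma push0 : 0 <= y 0 -> push 0 = 0.
Proof.
move=> y0; apply/eqP; rewrite eq_le push_ge0// andbT; apply: push_le => // s.
by rewrite -eq_le => /eqP <-; rewrite ge_max lexx andbT oppr_le0.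
Qed.

Lemma push_cont : cont0 push.
Proof.
move=> t t0 e e0; have e30 : 0 < e / 3 by rewrite divr_gt0.
have [dl dl0 H] := cy t0 e30; exists dl => // r r0 rt.
have key a b : 0 <= a -> a <= b -> `|a - t| < dl -> `|b - t| < dl -> `|push b - push a| < e.
  move=> a0 ab at_ bt; rewrite ger0_norm ?subr_ge0 ?push_nd//.
  suff : push b <= push a + 2 * (e / 3) by move=> ?; lra.
  apply: push_le; first exact: le_trans ab.
  move=> s /andP[s0 sb]; have [sa|as_] := leP s a.
    have : maxr (- y s) 0 <= push a by apply: push_ub; rewrite s0.
    by move=> ?; lra.
  have st : `|s - t| < dl.
    by move: at_ bt; rewrite !ltr_norml => /andP[? ?] /andP[? ?]; apply/andP; split; lra.
  have := H s s0 st; have := H a a0 at_; rewrite !ltr_norml => /andP[? ?] /andP[? ?].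
  have : maxr (- y a) 0 <= push a by apply: push_ub; rewrite a0 lexx.
  rewrite !ge_max => /andP[? ?]; apply/andP; split; lra.
have tt : `|t - t| < dl by rewrite subrr normr0.
have [rt'|tr] := leP r t; first by rewrite distrC; apply: key.
by apply: key => //; exact: ltW.
Qed.

Lemma refl_cont : cont0 refl.
Proof. by apply: cont0D => //; exact: push_cont. Qed.

(** If [push] grew between [s] and [t], its value at [t] would be [- y c] for a minimum point [c] of
    [y] on [[s, t]], and there [refl c <= y c + push t <= 0]. *)
Lemma push_flat T : flat_off refl push T.
Proof.
move=> s t s0 st _ H; apply/eqP; rewrite eq_le push_nd//= leNgt; apply/negP => pst.
have cw : {within `[s, t], continuous y}.
  move/cont0P: cy; apply: continuous_subspaceW => r /=; rewrite !in_itv /= andbT => /andP[sr _].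
  exact: le_trans sr.
have [c ct Hc] := EVT_min st cw.
move: ct; rewrite in_itv /= => /andP[sc cst].
have pt : push t <= maxr (push s) (- y c).
  apply: push_le; first exact: le_trans st.
  move=> r /andP[r0 rt]; rewrite le_max; have [rs|sr] := leP r s.
    by rewrite push_ub ?r0.
  have := Hc r; rewrite in_itv /= (ltW sr) rt => /(_ isT) ycr.
  have ps := push_ge0 s0.
  have [yr0|yr0] := leP (- y r) 0; first by rewrite ps.
  by rewrite lerN2 ycr orbT.
have pc : push c <= push t by apply: push_nd => //; exact: le_trans sc.
have Zc := H c; move: Zc; rewrite sc cst => /(_ isT); rewrite /refl.
by move: pt; rewrite le_max leNgt pst /= => ?; lra.
Qed.

End skorokhod_map.

End reflection.

(** * Reflection with a power drift: stability and existence *)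

Section drift.
Context {R : realType}.
Implicit Types y Z L : R -> R.

Lemma normX_sub_le (a b K : R) n : 1 <= K -> 0 <= a <= K -> 0 <= b <= K ->
  `|a ^+ n - b ^+ n| <= n%:R * K ^+ n * `|a - b|.
Proof.
move=> K1 /andP[a0 aK] /andP[b0 bK]; have K0 : 0 <= K by exact: le_trans K1.
elim: n => [|n IH]; first by rewrite !expr0 subrr normr0 !mul0r.
have -> : a ^+ n.+1 - b ^+ n.+1 = a * (a ^+ n - b ^+ n) + (a - b) * b ^+ n.
  by rewrite !exprS; ring.
apply: (le_trans (ler_normD _ _)); rewrite !normrM (ger0_norm a0) normrX (ger0_norm b0).
have -> : n.+1%:R * K ^+ n.+1 * `|a - b| = K * (n%:R * K ^+ n * `|a - b|) + `|a - b| * K ^+ n.+1.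
  by rewrite -natr1 exprS; ring.
apply: lerD; first by rewrite ler_pM.
rewrite ler_wpM2l// exprS (le_trans (lerXn2r n _ _ bK))//.
by rewrite ler_peMl// exprn_ge0.
Qed.

Variables (beta : R) (k : nat).
Hypothesis beta0 : 0 <= beta.

Definition drift Z (t : R) := beta * int0 (fun s => Z s ^+ k) t.

(* Z need not be continuous, so that the scaled workload qualifies. *)
Definition rsol y Z L (T : R) := [/\ locint Z, (forall t, 0 <= t -> 0 <= Z t),
  (forall t, 0 <= t <= T -> Z t = y t - drift Z t + L t) &
  [/\ cont0 L, nd0 L, L 0 = 0 & flat_off Z L T]].

Lemma drift0 Z : drift Z 0 = 0.
Proof. by rewrite /drift int0_0 mulr0. Qed.

Lemma drift_cont Z : locint Z -> cont0 (drift Z).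
Proof. by move=> lZ; apply: cont0Z; apply: cont0_int0; exact: locintX. Qed.

Lemma drift_nd Z : locint Z -> (forall t, 0 <= t -> 0 <= Z t) -> nd0 (drift Z).
Proof.
move=> lZ Z0 s t s0 st; rewrite ler_wpM2l//; apply: int0_ge0 => //; first exact: locintX.
by move=> x /andP[sx _]; rewrite exprn_ge0// Z0// (le_trans s0)// ltW.
Qed.

Lemma drift_cmp Z1 Z2 (s t : R) : locint Z1 -> locint Z2 -> (forall t, 0 <= t -> 0 <= Z2 t) ->
  0 <= s -> s <= t -> (forall r, s < r <= t -> Z2 r <= Z1 r) ->
  drift Z2 t - drift Z2 s <= drift Z1 t - drift Z1 s.
Proof.
move=> l1 l2 Z0 s0 st H; rewrite -!mulrBr ler_wpM2l//; apply: int0_le => //; try exact: locintX.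
move=> x xt; have /andP[sx _] := xt; have x0 : 0 <= x by rewrite (le_trans s0)// ltW.
have HH := H x xt; apply: lerXn2r => //; rewrite nnegrE ?Z0//.
exact: le_trans (Z0 _ x0) HH.
Qed.

Lemma drift_dist Z1 Z2 (T K e : R) : 1 <= K -> locint Z1 -> locint Z2 ->
  (forall t, 0 <= t <= T -> 0 <= Z1 t <= K) -> (forall t, 0 <= t <= T -> 0 <= Z2 t <= K) ->
  (forall t, 0 <= t <= T -> `|Z1 t - Z2 t| <= e) ->
  forall t, 0 <= t <= T -> `|drift Z1 t - drift Z2 t| <= beta * (k%:R * K ^+ k * e * t).
Proof.
move=> K1 l1 l2 B1 B2 D t /andP[t0 tT]; rewrite /drift -mulrBr normrM (ger0_norm beta0) ler_wpM2l//.
apply: int0_dist => //; try exact: locintX.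
move=> x /andP[/ltW x0 xt]; have xT : 0 <= x <= T by rewrite x0 (le_trans xt).
apply: (le_trans (normX_sub_le k K1 (B1 _ xT) (B2 _ xT))); rewrite ler_wpM2l ?D//.
by rewrite mulr_ge0// exprn_ge0// (le_trans _ K1).
Qed.

Lemma rsol_stable1 y1 y2 Z1 Z2 L1 L2 (T e : R) : rsol y1 Z1 L1 T -> rsol y2 Z2 L2 T ->
  (forall t, 0 <= t <= T -> `|y1 t - y2 t| <= e) ->
  forall t, 0 <= t <= T -> Z1 t - Z2 t <= 2 * e.
Proof.
move=> [l1 p1 E1 [c1 n1 L10 f1]] [l2 p2 E2 [c2 n2 L20 f2]] ye.
apply: (@refl_stability _ Z1 Z2 y1 y2 (drift Z1) (drift Z2) L1 L2) => //.
- by move=> t /andP[t0 _]; exact: p2.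
- exact: drift_cont.
- exact: drift_nd.
- by rewrite !drift0.
- by move=> s t s0 st _ H; exact: drift_cmp.
- by rewrite L10 L20.
Qed.

Lemma rsol_stable y1 y2 Z1 Z2 L1 L2 (T e : R) : rsol y1 Z1 L1 T -> rsol y2 Z2 L2 T ->
  (forall t, 0 <= t <= T -> `|y1 t - y2 t| <= e) ->
  forall t, 0 <= t <= T -> `|Z1 t - Z2 t| <= 2 * e.
Proof.
move=> S1 S2 ye t tT; rewrite ler_norml lerNl opprB; apply/andP; split.
  by apply: (rsol_stable1 S2 S1) tT => s sT; rewrite distrC ye.
exact: (rsol_stable1 S1 S2) tT.
Qed.

Section existence.
Variable y : R -> R.
Hypotheses (cy : cont0 y) (y0 : 0 <= y 0).

Let Gam Z := refl (fun t => y t - drift Z t).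

Fixpoint picard (n : nat) : R -> R := if n is n'.+1 then Gam (picard n') else fun=> y 0.

Let GamP Z T : cont0 Z -> (forall t, 0 <= t -> 0 <= Z t) ->
  [/\ cont0 (Gam Z), (forall t, 0 <= t -> 0 <= Gam Z t) &
   let L := push (fun t => y t - drift Z t) in
   [/\ cont0 L, nd0 L, L 0 = 0 & flat_off (Gam Z) L T]].
Proof.
move=> cZ Z0; have cyd : cont0 (fun t => y t - drift Z t).
  by apply: cont0B => //; apply: drift_cont; exact: cont0_locint.
split; [exact: refl_cont|by move=> t t0; exact: refl_ge0|split].
- exact: push_cont.
- exact: push_nd.
- by rewrite push0// drift0 subr0.
- exact: push_flat.
Qed.

Let picardP n : cont0 (picard n) /\ forall t, 0 <= t -> 0 <= picard n t.
Proof.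
elim: n => [|n [cn pn]]; first by split => //; exact: cont0_cst.
by have [? ? _] := GamP 0 cn pn.
Qed.

(** The drift only pulls down, so [refl_upward] bounds every iterate by [y 0] plus the oscillation
    of [y], uniformly in [n]. On this range the power is Lipschitz, even where it is not so
    globally. *)
Let bnd T : exists2 K : R, 1 <= K & forall n t, 0 <= t <= T -> picard n t <= K.
Proof.
have [w w0 Hw] := cont0_bounded T cy.
exists (y 0 + 2 * w + 1).
  by rewrite lerDr addr_ge0// mulr_ge0.
move=> [|n] t tT /=; first by rewrite -addrA lerDl addr_ge0// mulr_ge0.
have [cn pn] := picardP n.
have [cG pG [cL nL L0 fL]] := GamP T cn pn.
have /andP[t0 tT'] := tT.
suff : Gam (picard n) t - Gam (picard n) 0 <= 2 * w.
  have -> : Gam (picard n) 0 = y 0.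
    by rewrite /Gam /refl L0 drift0 subr0 addr0.
  by lra.
apply: (@refl_upward _ _ y (drift (picard n)) (push (fun t => y t - drift (picard n) t))) => //.
- by move=> r /andP[r0 rt]; exact: pG.
- by apply: drift_nd => //; exact: cont0_locint.
- by move=> a b a0 ab bt; apply: fL => //; exact: le_trans tT'.
- move=> r /andP[r0 rt].
  have /Hw := tT; have : `|y r| <= w by apply: Hw; rewrite r0 (le_trans rt).
  by rewrite !ler_norml => /andP[? ?] /andP[? ?]; lra.
- by rewrite mulr_ge0.
Qed.

(** Both drifts are moved into the drivers, and reflection is 2-Lipschitz in those ([refl_stability]
    with zero [p1] and [p2]). The bound is kept in integral form so that iterating it produces
    factorials. *)
Let Gam_lip (T K : R) u v : 1 <= K -> cont0 u -> cont0 v ->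
  (forall t, 0 <= t -> 0 <= u t) -> (forall t, 0 <= t -> 0 <= v t) ->
  (forall t, 0 <= t <= T -> u t <= K) -> (forall t, 0 <= t <= T -> v t <= K) ->
  forall t, 0 <= t <= T -> `|Gam u t - Gam v t| <= 2 * beta * (k%:R * K ^+ k) * int0 (fun s => `|u s - v s|) t.
Proof.
move=> K1 cu cv u0 v0 uK vK t /andP[t0 tT].
have [cGu pGu [cLu nLu Lu0 fLu]] := GamP t cu u0.
have [cGv pGv [cLv nLv Lv0 fLv]] := GamP t cv v0.
have K0 : 0 <= K by exact: le_trans K1.
have C0 : 0 <= k%:R * K ^+ k by rewrite mulr_ge0// exprn_ge0.
have lu := cont0_locint cu; have lv := cont0_locint cv.
have luv : locint (fun s => `|u s - v s|).
  by apply: locint_norm; apply: cont0_locint; exact: cont0B.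
pose e := beta * (k%:R * K ^+ k) * int0 (fun s => `|u s - v s|) t.
have He r : 0 <= r <= t -> `|drift u r - drift v r| <= e.
  move=> /andP[r0 rt]; rewrite /drift -mulrBr normrM (ger0_norm beta0) /e -mulrA ler_wpM2l//.
  rewrite -int0Z//.
  have lux := locintX k lu; have lvx := locintX k lv.
  have lD : locint (fun s => u s ^+ k + -1 * v s ^+ k) by apply: locintD => //; exact: locintZ.
  have -> : int0 (fun s => u s ^+ k) r - int0 (fun s => v s ^+ k) r =
     int0 (fun s => u s ^+ k + -1 * v s ^+ k) r.
    by rewrite int0D//; [rewrite int0Z// mulN1r|exact: locintZ].
  have lC : locint (fun s => k%:R * K ^+ k * `|u s - v s|) by exact: locintZ.
  apply: (@le_trans _ _ (int0 (fun s => k%:R * K ^+ k * `|u s - v s|) r)); last first.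
    by apply: int0_ge0 => // x _; rewrite mulr_ge0.
  have pw x : 0 < x <= r -> `|u x ^+ k - v x ^+ k| <= k%:R * K ^+ k * `|u x - v x|.
    move=> /andP[/ltW x0 xr]; have xT : 0 <= x <= T by rewrite x0 (le_trans xr)// (le_trans rt).
    by apply: normX_sub_le; rewrite ?u0 ?v0 ?uK ?vK.
  rewrite ler_norml; apply/andP; split.
    have : int0 (fun x => -1 * (k%:R * K ^+ k * `|u x - v x|)) r - int0 (fun x => -1 * (k%:R * K ^+ k * `|u x - v x|)) 0
      <= int0 (fun s => u s ^+ k + -1 * v s ^+ k) r - int0 (fun s => u s ^+ k + -1 * v s ^+ k) 0.
      apply: int0_le => //; first exact: locintZ.
      by move=> x xr; have := pw x xr; rewrite !mulN1r ler_norml => /andP[].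
    by rewrite !int0_0 !subr0 (int0Z (-1) lC r0) mulN1r.
  have := int0_le lD lC (lexx 0) r0; rewrite !int0_0 !subr0; apply => x xr.
  by have := pw x xr; rewrite !mulN1r ler_norml => /andP[].
have E2 : 2 * beta * (k%:R * K ^+ k) * int0 (fun s => `|u s - v s|) t = 2 * e by rewrite /e; ring.
have stab a b : cont0 a -> cont0 b ->
   (forall t, 0 <= t -> 0 <= a t) -> (forall t, 0 <= t -> 0 <= b t) ->
   (forall r, 0 <= r <= t -> `|drift a r - drift b r| <= e) ->
   Gam a t - Gam b t <= 2 * e.
  move=> ca cb a0 b0 H.
  have [cGa pGa [cLa nLa La0 fLa]] := GamP t ca a0.
  have [cGb pGb [cLb nLb Lb0 fLb]] := GamP t cb b0.
  apply: (@refl_stability _ (Gam a) (Gam b) (fun t => y t - drift a t) (fun t => y t - drift b t)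
     (fun=> 0) (fun=> 0) (push (fun t => y t - drift a t)) (push (fun t => y t - drift b t)) t e) => //.
  - by move=> r _; rewrite subr0.
  - by move=> r _; rewrite subr0.
  - by move=> r /andP[r0 _]; exact: pGb.
  - exact: cont0_cst.
  - by rewrite La0 Lb0.
  - by move=> r rt; rewrite (_ : _ - _ = drift b r - drift a r) ?(distrC (drift b r)); [exact: H|ring].
  - by rewrite t0 lexx.
rewrite E2 ler_norml lerNl opprB; apply/andP; split; apply: stab => //.
by move=> r rt; rewrite distrC; exact: He.
Qed.

(** Two iterates differ by at most [2 K]; each further application of the integral bound adds one
    order of the exponential series in [C * t]. *)
Let picard_step (T K : R) n t : 1 <= K -> (forall n t, 0 <= t <= T -> picard n t <= K) ->
  0 <= t <= T ->
  `|picard n.+1 t - picard n t| <= 2 * K * exp_coeff (2 * beta * (k%:R * K ^+ k) * t) n.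
Proof.
move=> K1 HK; have K0 : 0 <= K by exact: le_trans K1.
set C := 2 * beta * (k%:R * K ^+ k).
have C0 : 0 <= C by rewrite !mulr_ge0// exprn_ge0.
elim: n t => [|n IH] t tT; have /andP[t0 tT'] := tT.
  have -> : exp_coeff (C * t) 0 = 1 by rewrite /exp_coeff /= expr0 fact0 divr1.
  rewrite mulr1 -[picard 1 t]/(Gam (picard 0) t).
  have [_ p1] := picardP 1; have [_ p0] := picardP 0.
  have := HK 1%N t tT; have := HK 0%N t tT; have := p1 t t0; have := p0 t t0 => ? ? ? ?.
  by rewrite ler_norml -[Gam (picard 0) t]/(picard 1 t); apply/andP; split; lra.
have [cn pn] := picardP n; have [cn1 pn1] := picardP n.+1.
apply: (le_trans (Gam_lip K1 cn1 cn pn1 pn (HK _) (HK _) tT)); rewrite -/C.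
have luv : locint (fun s => `|picard n.+1 s - picard n s|).
  by apply: locint_norm; apply: cont0_locint; exact: cont0B.
have lpow : locint (fun s : R => s ^+ n) by apply: locintX; apply: cont0_locint; exact: cont0_id.
have := @int0_le _ _ (fun s => (2 * K * (C ^+ n / n`!%:R)) * s ^+ n) 0 t luv (locintZ _ lpow) (lexx 0) t0.
rewrite !int0_0 !subr0 int0Z// int0_exprn// => H.
apply: (@le_trans _ _ (C * (2 * K * (C ^+ n / n`!%:R) * (t ^+ n.+1 / n.+1%:R)))).
  rewrite ler_wpM2l//; apply: H => x /andP[x0 xt].
  have := IH x; rewrite ltW// (le_trans xt)// => /(_ isT) /le_trans; apply.
  by rewrite /exp_coeff /= exprMn le_eqVlt; apply/orP; left; apply/eqP; ring.
clearbody C.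
have -> : exp_coeff (C * t) n.+1 = (C * t) ^+ n.+1 / (n.+1)`!%:R by [].
rewrite factS natrM exprMn invfM !exprS le_eqVlt; apply/orP; left; apply/eqP.
by set a1 := n.+1%:R^-1; set a2 := n`!%:R^-1; ring.
Qed.

Lemma picard_limit : exists Z, forall T e : R, 0 <= T -> 0 < e ->
  exists N, forall n t, (N <= n)%N -> 0 <= t <= T -> `|picard n t - Z t| <= e.
Proof.
have key T : 0 <= T -> exists E : nat -> R, [/\ cvgn E, nondecreasing_seq E &
   forall n m t, (n <= m)%N -> 0 <= t <= T -> `|picard m t - picard n t| <= E m - E n].
  move=> T0; have [K K1 HK] := bnd T; have K0 : 0 <= K by exact: le_trans K1.
  set C := 2 * beta * (k%:R * K ^+ k).
  have C0 : 0 <= C by rewrite !mulr_ge0// exprn_ge0.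
  have CT0 : 0 <= C * T by rewrite mulr_ge0.
  exists (fun n => 2 * K * series (exp_coeff (C * T)) n); split.
  - by apply: is_cvgMr; exact: is_cvg_series_exp_coeff.
  - apply/nondecreasing_seqP => n; rewrite ler_wpM2l ?mulr_ge0// seriesSr lerDl.
    exact: exp_coeff_ge0.
  - move=> n m t nm tT; have /andP[t0 tT'] := tT.
    rewrite -mulrBr -(subnKC nm); elim: (m - n)%N => [|j IH].
      by rewrite addn0 !subrr normr0 mulr0.
    have S := picard_step (n + j) K1 HK tT.
    rewrite addnS; move: IH S; set N := (n + j)%N; rewrite seriesSr; set p0 := picard n t; set p1 := picard (n + j) t.
    set p2 := picard N.+1 t => IH S.
    apply: (le_trans (ler_distD p1 _ _)).
    rewrite [leRHS](_ : _ = 2 * K * exp_coeff (C * T) N +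
      2 * K * (series (exp_coeff (C * T)) N - series (exp_coeff (C * T)) n)); last by ring.
    apply: lerD => //; apply: (le_trans S); rewrite ler_wpM2l ?mulr_ge0//.
    rewrite /exp_coeff /= ler_wpM2r ?invr_ge0//.
    apply: lerXn2r; rewrite ?nnegrE; [exact: mulr_ge0|exact: mulr_ge0|exact: ler_wpM2l].
exists (fun t => lim (picard n t @[n --> \oo])) => T e T0 e0.
have [E [cE nE HE]] := key T T0.
have : \forall n \near \oo, `|lim (E @ \oo) - E n| < e.
  by move/cvgrPdist_lt : cE; apply.
move=> [N _ HN]; exists N => n t Nn tT.
have En m : E m <= lim (E @ \oo) by exact: nondecreasing_cvgn_le.
have cz : cvg (picard n t @[n --> \oo]).
  apply/cauchy_cvgP; apply: cauchy_exP => e' e'0.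
  have : \forall n \near \oo, `|lim (E @ \oo) - E n| < e' by move/cvgrPdist_lt : cE; apply.
  move=> [N' _ HN']; exists (picard N' t); exists N' => // i Ni.
  rewrite /ball /= distrC; apply: (le_lt_trans (HE _ _ _ Ni tT)).
  by have := HN' N' (leqnn _); rewrite ger0_norm ?subr_ge0//; have := En i; lra.
rewrite distrC; apply: (@ler_cvg_to _ (\oo : set_system nat) _ _ (fun m => `|picard m t - picard n t|) (fun=> e)) (cvg_cst _) _ => //.
  by apply: cvg_norm; apply: cvgB => //; exact: cvg_cst.
exists n => // m nm; apply: (le_trans (HE _ _ _ nm tT)).
by have := HN n Nn; rewrite ger0_norm ?subr_ge0//; have := En m; lra.
Qed.

Lemma rsol_exists : exists Z L, cont0 Z /\ forall T, rsol y Z L T.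
Proof.
have [Z HZ] := picard_limit.
have pZ t : 0 <= t -> 0 <= Z t.
  move=> t0; rewrite leNgt; apply/negP => Zt.
  have e0 : 0 < - Z t / 2 by lra.
  have [N HN] := HZ t _ t0 e0; have := HN N t (leqnn _); rewrite t0 lexx => /(_ isT).
  by have := (picardP N).2 t t0; rewrite ler_norml => ? /andP[? ?]; lra.
have cZ : cont0 Z.
  move=> t t0 e e0; have e40 : 0 < e / 4 by rewrite divr_gt0.
  have t10 : 0 <= t + 1 by lra.
  have [N HN] := HZ (t + 1) _ t10 e40.
  have [dl dl0 Hd] := (picardP N).1 t t0 _ e40.
  exists (minr 1 dl); first by rewrite lt_min ltr01.
  move=> r r0; rewrite lt_min => /andP[r1 rd].
  have rt : 0 <= r <= t + 1 by rewrite r0; move: r1; rewrite ltr_norml => /andP[_ ?]; lra.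
  have tt : 0 <= t <= t + 1 by rewrite t0; lra.
  have := Hd r r0 rd; have := HN N r (leqnn _) rt; have := HN N t (leqnn _) tt.
  rewrite !ler_norml !ltr_norml => /andP[? ?] /andP[? ?] /andP[? ?]; apply/andP; split; lra.
(* The limit is a fixed point: [Z] and [Gam Z] are both close to [picard N.+1], which is
   [Gam (picard N)], with total error [e (1 + C t)], half of the assumed gap. *)
have fixZ t : 0 <= t -> Z t = Gam Z t.
  move=> t0; apply/eqP; rewrite -subr_eq0 -normr_le0 leNgt; apply/negP => D.
  have [K K1 HK] := bnd t; have K0 : 0 <= K by exact: le_trans K1.
  have [K' K'0 HK'] := cont0_bounded t cZ.
  pose M := maxr K K'.
  have M1 : 1 <= M by rewrite le_max K1.
  have MK n s : 0 <= s <= t -> picard n s <= M by move=> /HK H; rewrite le_max H.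
  have MZ s : 0 <= s <= t -> Z s <= M by move=> /HK' /ler_normlW H; rewrite le_max H orbT.
  set C := 2 * beta * (k%:R * M ^+ k).
  have C0 : 0 <= C by rewrite !mulr_ge0// exprn_ge0// (le_trans _ M1).
  have Ct0 : 0 < 1 + C * t by rewrite ltr_wpDr// mulr_ge0.
  pose e := `|Z t - Gam Z t| / (2 * (1 + C * t)).
  have e0 : 0 < e by rewrite divr_gt0// mulr_gt0.
  have [N HN] := HZ t _ t0 e0.
  have [cN pN] := picardP N.
  have tt : 0 <= t <= t by rewrite t0 lexx.
  have H1 := Gam_lip M1 cZ cN pZ pN MZ (MK N) tt; rewrite -/C in H1.
  have lD : locint (fun s => `|Z s - picard N s|).
    by apply: locint_norm; apply: cont0_locint; exact: cont0B.
  have H2 : int0 (fun s => `|Z s - picard N s|) t <= e * t.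
    have := int0_le lD (locint_cst e) (lexx 0) t0; rewrite !int0_0 !subr0 int0_cst//; apply.
    by move=> x /andP[/ltW x0 xt]; rewrite distrC; apply: HN => //; rewrite x0.
  have H3 := HN N.+1 t (leqnSn _) tt.
  have : `|Z t - Gam Z t| <= e + C * (e * t).
    apply: (le_trans (ler_distD (picard N.+1 t) _ _)); apply: lerD; first by rewrite distrC.
    by rewrite distrC; apply: (le_trans H1); rewrite ler_wpM2l.
  have -> : e + C * (e * t) = `|Z t - Gam Z t| / 2.
    by rewrite /e; field; rewrite lt0r_neq0.
  by rewrite leNgt ltr_pdivrMr// ltr_pMr// ltr1n.
exists Z, (push (fun t => y t - drift Z t)); split => // T.
have [cG pG [cL nL L0 fL]] := GamP T cZ pZ.
split => //; first exact: cont0_locint.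
- by move=> t /andP[t0 tT]; exact: fixZ.
- split => // s t s0 st tT H; apply: fL => // r /andP[sr rt].
  by rewrite -fixZ ?H ?sr// (le_trans s0).
Qed.

End existence.

End drift.

(** * J1-continuous functionals *)

Section lipschitz_envelope.
Context {R : realType} {n : nat}.
Implicit Types (x y : 'I_n -> R -> R).

Definition lip_path (Lam : R) y := forall i (s t : R), 0 <= s -> 0 <= t ->
  `|y i s - y i t| <= Lam * `|s - t|.

(* The horizon N - r shrinks as the tolerance r grows: this makes the functional
   below continuous although sup_[0,N] is not. *)
Definition close_upto (N r : R) x y := forall i (t : R), 0 <= t -> t <= N - r ->
  `|x i t - y i t| <= r.

Variables (S : set (('I_n -> R -> R) * R)) (N M Lam : R).
Hypothesis N0 : 0 <= N.
Hypothesis Lam0 : 0 <= Lam.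
Hypothesis Slip : forall y v, S (y, v) -> lip_path Lam y.
Hypothesis SM : forall y v, S (y, v) -> - M <= v.
Variables (y0 : 'I_n -> R -> R) (v0 : R).
Hypothesis S0 : S (y0, v0).

(** An infimal convolution: [S] is a set of Lipschitz paths with values attached, and replacing [x]
    by such a path within tolerance [r] costs [N * r]. *)
Definition env_set x : set R := [set q | exists y v r,
  [/\ S (y, v), 0 <= r, close_upto N r x y & q = v + N * r]].

Definition envelope x : R := inf (env_set x).

Let env_set_lb x : lbound (env_set x) (- M).
Proof. by move=> q [y [v [r [Syv r0 _ ->]]]]; rewrite (le_trans (SM Syv))// lerDl mulr_ge0. Qed.

Let env_set_top x : env_set x (v0 + N * (N + 1)).
Proof.
(* With tolerance [N + 1] the horizon [N - r] is negative and closeness is void, so the infimum is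
   never over the empty set. *)
have N0' := N0; exists y0, v0, (N + 1); split => //; first by lra.
by move=> i t t0 tN; exfalso; lra.
Qed.

Let env_has_inf x : has_inf (env_set x).
Proof. by split; [exists (v0 + N * (N + 1)); exact: env_set_top|exists (- M); exact: env_set_lb]. Qed.

Lemma envelope_le x y v r : S (y, v) -> 0 <= r -> close_upto N r x y ->
  envelope x <= v + N * r.
Proof. by move=> Syv r0 c; apply: ge_inf; [case: (env_has_inf x)|exists y, v, r]. Qed.

Lemma envelope_ge x q : (forall y v r, S (y, v) -> 0 <= r -> close_upto N r x y -> q <= v + N * r) ->
  q <= envelope x.
Proof.
move=> H; apply: lb_le_inf; first by case: (env_has_inf x).
by move=> z [y [v [r [Syv r0 c ->]]]]; exact: H Syv r0 c.
Qed.

Lemma envelope_near x e : 0 < e -> exists y v r,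
  [/\ S (y, v), 0 <= r, close_upto N r x y & v + N * r < envelope x + e].
Proof.
move=> e0; have [q [y [v [r [Syv r0 c ->]]]] H] := inf_adherent e0 (env_has_inf x).
by exists y, v, r.
Qed.

Lemma envelope_bounds x : - M <= envelope x <= v0 + N * (N + 1).
Proof.
apply/andP; split; first by apply: lb_le_inf => //; case: (env_has_inf x).
by apply: ge_inf; [case: (env_has_inf x)|].
Qed.

Lemma time_change_ge0 (l : R -> R) (t : R) : time_change l -> 0 <= t -> 0 <= l t.
Proof.
move=> [l0 [_ [lm _]]]; rewrite le_eqVlt => /predU1P[<-|t0]; first by rewrite l0.
by rewrite -l0 ltW// lm// in_itv /= ?lexx// ltW.
Qed.

(** A time change within [e] moves a path of the class by at most [Lam * e]. Raising the tolerance
    by [(2 + Lam) * e] pays for this, for the distance [e] in space, and for the time lost at the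
    end of the horizon, because a larger tolerance also shortens the horizon. *)
Let envelope_tc x x' (l : 'I_n -> R -> R) (e : R) : 0 <= e ->
  (forall i, time_change (l i)) -> (forall i t, 0 <= t -> `|l i t - t| <= e) ->
  (forall i t, 0 <= t <= N -> `|x' i (l i t) - x i t| <= e) ->
  `|envelope x' - envelope x| <= N * ((2 + Lam) * e).
Proof.
move=> e0 tc lt xl; have Lam0' := Lam0; have N0' := N0.
have Le0 : 0 <= Lam * e by rewrite mulr_ge0.
have Le (s t : R) : `|s - t| <= e -> Lam * `|s - t| <= Lam * e by move=> ?; rewrite ler_wpM2l.
have r'0 r : 0 <= r -> 0 <= r + (2 + Lam) * e by move=> ?; lra.
have H1 : envelope x' - N * ((2 + Lam) * e) <= envelope x.
  apply: envelope_ge => y v r Syv r0 c; rewrite lerBlDr -addrA -mulrDr.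
  apply: (envelope_le Syv (r'0 _ r0)) => i s s0 sN.
  have [_ [_ [_ /(_ s s0)[t t0 lts]]]] := tc i.
  have st := lt i t t0; rewrite lts in st.
  move: (st); rewrite ler_norml => /andP[st1 st2].
  have tN : t <= N - r by lra.
  have A1 : `|x' i s - x i t| <= e by rewrite -lts; apply: xl; rewrite t0; lra.
  have A2 := c i t t0 tN.
  have A3 := Slip Syv i t0 s0; rewrite distrC in st.
  have A4 := Le _ _ st.
  have := ler_distD (x i t) (x' i s) (y i s); have := ler_distD (y i t) (x i t) (y i s); lra.
have H2 : envelope x - N * ((2 + Lam) * e) <= envelope x'.
  apply: envelope_ge => y v r Syv r0 c; rewrite lerBlDr -addrA -mulrDr.
  apply: (envelope_le Syv (r'0 _ r0)) => i t t0 tN.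
  have lt0 := time_change_ge0 (tc i) t0.
  have st := lt i t t0; move: (st); rewrite ler_norml => /andP[st1 st2].
  have lN : l i t <= N - r by lra.
  have tN' : 0 <= t <= N by rewrite t0; lra.
  have A1 := xl i t tN'; rewrite distrC in A1.
  have A2 := c i _ lt0 lN.
  have A3 := Slip Syv i lt0 t0.
  have A4 := Le _ _ st.
  have := ler_distD (x' i (l i t)) (x i t) (y i t); have := ler_distD (y i (l i t)) (x' i (l i t)) (y i t); lra.
by rewrite ler_norml; apply/andP; split; lra.
Qed.

Lemma envelope_J1 : J1_continuous envelope.
Proof.
move=> xs x _ _ J.
have /choice[ls H] : forall i, exists ls : nat -> R -> R,
   (forall m, time_change (ls m)) /\
    (forall e : R, 0 < e -> \forall m \near \oo,
        forall t, 0 <= t -> `|ls m t - t| <= e) /\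
    (forall T e : R, 0 < e -> \forall m \near \oo,
        forall t, 0 <= t <= T -> `|xs m i (ls m t) - x i t| <= e) by exact: J.
apply/cvgrPdist_le => eps eps0.
pose e := eps / ((N + 1) * (2 + Lam)).
have Lam0' := Lam0; have N0' := N0.
have d0 : 0 < (N + 1) * (2 + Lam) by rewrite mulr_gt0//; lra.
have e0 : 0 < e by rewrite divr_gt0.
have F1 : \forall m \near \oo, forall i : 'I_n, forall t, 0 <= t -> `|ls i m t - t| <= e.
  by apply: filter_forall => i; have [_ [/(_ e e0)]] := H i.
have F2 : \forall m \near \oo, forall i : 'I_n, forall t, 0 <= t <= N -> `|xs m i (ls i m t) - x i t| <= e.
  by apply: filter_forall => i; have [_ [_ /(_ N e e0)]] := H i.
near=> m.
rewrite distrC; apply: (le_trans (@envelope_tc x (xs m) (fun i => ls i m) e (ltW e0) _ _ _)).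
- by move=> i; have [/(_ m)] := H i.
- by near: m.
- by near: m.
have -> : eps = (N + 1) * ((2 + Lam) * e) by rewrite /e mulrA mulrCA divff ?mulr1// lt0r_neq0.
by rewrite ler_wpM2r ?lerDl// mulr_ge0 ?ltW//; lra.
Unshelve. all: by end_near. Qed.

End lipschitz_envelope.

(** * A J1-continuous substitute for point evaluation *)

Section evaluation.
Context {R : realType}.
Implicit Types x y : R -> R.

Lemma minr_dist (M a b : R) : `|minr M a - minr M b| <= `|a - b|.
Proof.
have := ler_norm (a - b); have := ler_norm (b - a); rewrite (distrC b) ler_norml.
by case: (leP M a) => ?; case: (leP M b) => ? ? ?; apply/andP; split; lra.
Qed.

Definition clip (Lam a : R) : R := maxr (- Lam) (minr Lam a).

Lemma clip_lip Lam a b : `|clip Lam a - clip Lam b| <= `|a - b|.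
Proof.
apply: le_trans (minr_dist Lam a b); rewrite /clip; move: (minr Lam a) (minr Lam b) => x y.
have := ler_norm (x - y); have := ler_norm (y - x); rewrite (distrC y) ler_norml.
by case: (leP (- Lam) x) => ?; case: (leP (- Lam) y) => ? ? ?; apply/andP; split; lra.
Qed.

Lemma clip_bnd Lam a : 0 <= Lam -> - Lam <= clip Lam a <= Lam.
Proof.
rewrite /clip !maxEle !minEle => h; case: (leP Lam a) => h4; case: (leP (- Lam) Lam) => h6;
  case: (leP (- Lam) a) => h7; apply/andP; split; lra.
Qed.

Lemma clip_id Lam a : `|a| <= Lam -> clip Lam a = a.
Proof.
rewrite ler_norml /clip !maxEle !minEle => /andP[h1 h2]; case: (leP Lam a) => h4;
  case: (leP (- Lam) Lam) => h6; case: (leP (- Lam) a) => h7; lra.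
Qed.

(** An enumeration of the nonnegative rationals, with 0 for indices that encode no pair;
    countability makes [evq] measurable. *)
Definition grid (j : nat) : R :=
  if @unpickle (nat * nat)%type j is Some p then p.1%:R / p.2.+1%:R else 0.

Lemma grid_ge0 j : 0 <= grid j.
Proof. by rewrite /grid; case: unpickle => // p; rewrite divr_ge0. Qed.

Lemma grid_dense (a b : R) : 0 <= a -> a < b -> exists j, a < grid j < b.
Proof.
move=> a0 ab; have [q aq] := rat_in_itvoo ab.
have q0 : 0 < ratr q :> R by move: aq; rewrite in_itv /= => /andP[+ _]; exact: le_lt_trans.
move: q0; rewrite ltr0q => q0.
exists (pickle (`|numq q|%N, (`|denq q|.-1)%N)); rewrite /grid pickleK /=.
rewrite prednK ?absz_gt0 ?denq_neq0//.
have -> : `|numq q|%N%:R / `|denq q|%N%:R = ratr q :> R.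
  rewrite /ratr; congr (_ / _).
    by rewrite natr_absz ger0_norm// numq_ge0 ltW.
  by rewrite natr_absz ger0_norm.
by move: aq; rewrite in_itv.
Qed.

(* J1-continuous and measurable surrogate of evaluation at t, where it is discontinuous. *)
Definition evq (Lam t : R) x : R :=
  inf (range (fun j => clip Lam (x (grid j)) + Lam ^+ 2 * `|grid j - t|)).

Variable Lam : R.
Hypothesis Lam1 : 1 <= Lam.
Let Lam0 : 0 <= Lam. Proof. exact: le_trans Lam1. Qed.
Let LamS : Lam <= Lam ^+ 2. Proof. by rewrite expr2 ler_peMl. Qed.

Lemma evq_has_inf t x : has_inf (range (fun j => clip Lam (x (grid j)) + Lam ^+ 2 * `|grid j - t|)).
Proof.
split; first by eexists; exists 0%N.
exists (- Lam) => _ [j _ <-]; have /andP[H _] := clip_bnd (x (grid j)) Lam0.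
by rewrite (le_trans H)// lerDl mulr_ge0// sqr_ge0.
Qed.

Lemma evq_ge t x (q : R) : (forall j, q <= clip Lam (x (grid j)) + Lam ^+ 2 * `|grid j - t|) ->
  q <= evq Lam t x.
Proof.
move=> H; apply: lb_le_inf; first by case: (evq_has_inf t x).
by move=> _ [j _ <-].
Qed.

(** Right continuity at [s] lets grid points just after [s] replace it in the infimum. *)
Lemma evq_le t x s : 0 <= s -> x r @[r --> s^'+] --> x s ->
  evq Lam t x <= clip Lam (x s) + Lam ^+ 2 * `|s - t|.
Proof.
move=> s0 xs; apply/ler_addgt0Pr => e e0.
pose d := e / (2 * (1 + Lam ^+ 2)).
have L20 : 0 < 1 + Lam ^+ 2 by rewrite ltr_pwDl// sqr_ge0.
have d0 : 0 < d by rewrite divr_gt0// mulr_gt0.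
have e20 : 0 < e / 2 by rewrite divr_gt0.
have : \forall r \near s^'+, `|x s - x r| < e / 2 by move/cvgrPdist_lt : xs; apply.
rewrite near_withinE => /nbhs_ballP[dl /= dl0 H].
have sd : s < s + minr d dl by rewrite ltrDl lt_min d0.
have [j /andP[sj js]] := grid_dense s0 sd.
have gd : grid j - s < d.
  have : minr d dl <= d by rewrite ge_min lexx.
  by move=> ?; lra.
have gdl : grid j - s < dl.
  have : minr d dl <= dl by rewrite ge_min lexx orbT.
  by move=> ?; lra.
have xj : `|x s - x (grid j)| < e / 2.
  by apply: H => //; rewrite /ball /= distrC ger0_norm ?subr_ge0 ?(ltW sj).
have := clip_lip Lam (x (grid j)) (x s); rewrite (distrC (x (grid j))) => C.
move: (le_lt_trans C xj); rewrite ltr_norml => /andP[_ C2].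
have D : `|grid j - t| <= `|s - t| + d.
  have := ler_distD s (grid j) t; rewrite (ger0_norm (_ : 0 <= grid j - s)) ?subr_ge0 ?(ltW sj)//.
  by move=> ?; lra.
have D2 : Lam ^+ 2 * `|grid j - t| <= Lam ^+ 2 * `|s - t| + Lam ^+ 2 * d.
  by rewrite -mulrDr ler_wpM2l// sqr_ge0.
have D3 : Lam ^+ 2 * d <= e / 2.
  have -> : e / 2 = (1 + Lam ^+ 2) * d by rewrite /d; field; rewrite lt0r_neq0.
  by rewrite mulrDl mul1r lerDr ltW.
apply: (@le_trans _ _ (clip Lam (x (grid j)) + Lam ^+ 2 * `|grid j - t|)).
  by apply: ge_inf; [case: (evq_has_inf t x)|exists j].
lra.
Qed.

(** At distance 2 from [t] the penalty is at least [2 Lam^2 >= 2 Lam], as much as clipped values can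
    differ, so only times up to [t + 3] matter. There a time change within [e] alters the penalty by
    at most [Lam^2 * e] and the values by at most [e]. *)
Lemma evq_J1 (t : R) (xs : nat -> R -> R) x : 0 <= t -> (forall m, cadlag (xs m)) -> cadlag x ->
  J1_cvg xs x -> (fun m => evq Lam t (xs m)) @ \oo --> evq Lam t x.
Proof.
move=> t0 cxs [cx _] [ls [tc [H1 H2]]]; apply/cvgrPdist_le => eps eps0.
pose e := minr 1 (eps / (1 + Lam ^+ 2)).
have L20 : 0 < 1 + Lam ^+ 2 by rewrite ltr_pwDl// sqr_ge0.
have e0 : 0 < e by rewrite lt_min ltr01 divr_gt0.
have e1 : e <= 1 by rewrite ge_min lexx.
have ee : e + Lam ^+ 2 * e <= eps.
  have : e <= eps / (1 + Lam ^+ 2) by rewrite ge_min lexx orbT.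
  by rewrite ler_pdivlMr// => ?; lra.
have far (z : R -> R) (q : R) : t + 2 <= q -> (forall s, 0 <= s -> z r @[r --> s^'+] --> z s) ->
    forall w : R, evq Lam t z <= clip Lam w + Lam ^+ 2 * `|q - t|.
  move=> tq cz w; apply: (le_trans (evq_le t t0 (cz t t0))); rewrite subrr normr0 mulr0 addr0.
  have /andP[_ A] := clip_bnd (z t) Lam0; have /andP[B _] := clip_bnd w Lam0.
  have : 2 * Lam ^+ 2 <= Lam ^+ 2 * `|q - t|.
    by rewrite mulrC ler_wpM2l ?sqr_ge0// ger0_norm; lra.
  by have := LamS; lra.
near=> m.
have lt : forall s, 0 <= s -> `|ls m s - s| <= e by near: m; exact: H1.
have xl : forall s, 0 <= s <= t + 3 -> `|xs m (ls m s) - x s| <= e by near: m; exact: H2.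
have [cxm _] := cxs m.
have near (s : R) : 0 <= s -> `|Lam ^+ 2 * `|ls m s - t| - Lam ^+ 2 * `|s - t| | <= Lam ^+ 2 * e.
  move=> s0; rewrite -mulrBr normrM ger0_norm ?sqr_ge0// ler_wpM2l ?sqr_ge0//.
  apply: (le_trans (ler_dist_dist _ _)).
  by rewrite opprB addrA subrK lt.
suff [X1 X2] : evq Lam t (xs m) - eps <= evq Lam t x /\ evq Lam t x - eps <= evq Lam t (xs m).
  by rewrite ler_norml; apply/andP; split; lra.
split.
  apply: evq_ge => j.
  have g0 := grid_ge0 j; have [g3|g3] := leP (grid j) (t + 3); last first.
    apply: (le_trans _ (far (xs m) (grid j) _ cxm (x (grid j)))); last by lra.
    by rewrite lerBlDr lerDl ltW.
  have l0 := time_change_ge0 (tc m) g0.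
  have A := evq_le t l0 (cxm _ l0).
  have := near _ g0; rewrite ler_norml => /andP[_ B].
  have C := le_trans (clip_lip Lam (xs m (ls m (grid j))) (x (grid j))) (xl _ _).
  have {}C := C ltac:(by rewrite g0).
  move: C; rewrite ler_norml => /andP[_ C]; lra.
apply: evq_ge => j.
have g0 := grid_ge0 j; have [_ [_ [_ /(_ _ g0)[s s0 lsj]]]] := tc m.
have := lt s s0; rewrite lsj ler_norml => /andP[D1 D2].
have [g3|g3] := leP s (t + 3); last first.
  apply: (le_trans _ (far x (grid j) _ cx (xs m (grid j)))); last by lra.
  by rewrite lerBlDr lerDl ltW.
have A := evq_le t s0 (cx _ s0).
have := near _ s0; rewrite lsj ler_norml => /andP[B _].
have C := le_trans (clip_lip Lam (xs m (ls m s)) (x s)) (xl _ _).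
have {}C := C ltac:(by rewrite s0).
move: C; rewrite lsj ler_norml => /andP[C _]; lra.
Unshelve. all: by end_near. Qed.

End evaluation.

Lemma cont0_right {R : realType} (x : R -> R) (t : R) : cont0 x -> 0 <= t -> x r @[r --> t^'+] --> x t.
Proof.
move=> cx t0; apply/cvgrPdist_lt => e e0; have [dl dl0 H] := cx t t0 e e0.
rewrite near_withinE; apply/nbhs_ballP; exists dl => //= r tr /ltW t_r.
by rewrite distrC; apply: H; rewrite ?(le_trans t0)// distrC.
Qed.

Lemma cont0_cadlag {R : realType} (x : R -> R) : cont0 x -> cadlag x.
Proof.
move=> cx; split=> [t t0|t t0]; first exact: cont0_right.
apply/cvg_ex; exists (x t); apply/cvgrPdist_lt => e e0; have [dl dl0 H] := cx t (ltW t0) e e0.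
rewrite near_withinE; apply/nbhs_ballP; exists (minr dl t); first by rewrite /= lt_min dl0.
move=> r; rewrite /ball /= lt_min => /andP[tr1 tr2] rt.
rewrite distrC; apply: H; last by rewrite distrC.
by move: tr2; rewrite ltr_norml => /andP[_]; lra.
Qed.

(** Once [n.+1 * dl >= 2], the penalty excludes grid points farther than [dl] from [t], and nearer
    ones have values within [e] of [x t]. *)
Lemma evq_cvg {R : realType} (t : R) (x : R -> R) : 0 <= t -> cont0 x ->
  (fun n => evq n.+1%:R t x) @ \oo --> x t.
Proof.
move=> t0 cx; apply/cvgrPdist_le => e e0.
have [dl dl0 H] := cx t t0 e e0.
have : \forall n \near \oo, `|x t| + e <= n.+1%:R.
  near=> n; rewrite -natr1 ler_wpDr//; near: n; exact: nbhs_infty_ger.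
move=> [N1 _ HN1].
have : \forall n \near \oo, 2 <= n.+1%:R * dl.
  near=> n; rewrite -ler_pdivrMr// -[n.+1%:R]natr1 ler_wpDr//; near: n; exact: nbhs_infty_ger.
move=> [N2 _ HN2].
exists (maxn N1 N2) => // n; rewrite /= geq_max => /andP[n1 n2].
have L1 : 1 <= n.+1%:R :> R by rewrite ler1n.
have A := HN1 n n1; have B := HN2 n n2.
rewrite distrC ler_norml; apply/andP; split.
  rewrite lerBrDl; apply: evq_ge => // j; have g0 := @grid_ge0 R j.
  have L20 : 0 <= n.+1%:R ^+ 2 :> R by exact: sqr_ge0.
  have /andP[C1 C2] := clip_bnd (x (grid j)) (ler0n _ n.+1).
  have [gt|gt] := ltP `|grid j - t| dl.
    have := H _ g0 gt; rewrite ltr_norml => /andP[D1 D2].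
    have E : 0 <= n.+1%:R ^+ 2 * `|grid j - t| by rewrite mulr_ge0.
    have := ler_norm (x t); have := ler_norm (- x t); rewrite normrN => ? ?.
    suff : x t - e <= clip n.+1%:R (x (grid j)) by lra.
    by rewrite /clip le_max le_min; apply/orP; right; apply/andP; split; lra.
  have : n.+1%:R * 2 <= n.+1%:R ^+ 2 * `|grid j - t|.
    rewrite expr2 -mulrA ler_wpM2l//; apply: (le_trans B); rewrite ler_wpM2l//.
  have := ler_norm (x t); lra.
rewrite lerBlDl; have := evq_le L1 t t0 (cont0_right cx t0).
rewrite subrr normr0 mulr0 addr0 clip_id; [move=> ?; lra|lra].
Unshelve. all: by end_near. Qed.

(** * Independence *)

Section independence.
Context {d} {Om : measurableType d} {R : realType}.
Variable P : probability Om R.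

Lemma fineP (E : set Om) : measurable E -> P E = (fine (P E))%:E.
Proof. by move=> mE; rewrite fineK// fin_num_measure. Qed.

(** The events independent of [E2] form a Dynkin system. *)
Lemma indep_dynkin (G : set (set Om)) (E2 : set Om) : setI_closed G ->
  (forall E, G E -> measurable E) -> measurable E2 ->
  (forall E, G E -> P (E `&` E2) = P E * P E2)%E ->
  forall E, <<s G >> E -> (P (E `&` E2) = P E * P E2)%E.
Proof.
move=> GI Gm mE2 H E.
rewrite -(setI_closed_g_dynkin_g_sigma_algebra GI) => GE.
suff : measurable E /\ (P (E `&` E2) = P E * P E2)%E by case.
apply: (GE [set E | measurable E /\ (P (E `&` E2) = P E * P E2)%E]); split; last first.
  by move=> A GA; split; [exact: Gm|exact: H].
split => [|A [mA PA]|F tF mF].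
- by split=> //; rewrite setTI [X in (_ = X * _)%E](probability_setT P) mul1e.
- split; first exact: measurableC.
  have -> : ~` A `&` E2 = E2 `\` (A `&` E2).
    by apply/seteqP; split=> x /=; [case=> nA E2x; split => // -[]|case=> E2x nA; split => // Ax; apply: nA].
  have mAE := measurableI _ _ mA mE2.
  have -> : P (E2 `\` (A `&` E2)) = (P E2 - P (A `&` E2))%E.
    rewrite -[in RHS](setIid E2) [in RHS]setICA [in RHS]setIid.
    by apply: measureD => //; rewrite ltey_eq fin_num_measure.
  have -> : P (~` A) = (1 - P A)%E by exact: probability_setC.
  rewrite PA (fineP mA) (fineP mE2).
  by rewrite -EFinM -!EFinB -EFinM; congr EFin; ring.
- have mF' k : measurable (F k) by case: (mF k).
  split; first exact: bigcupT_measurable.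
  rewrite setI_bigcupl measure_bigcup//; last 2 first.
  - by move=> k _; exact: measurableI.
  - exact: trivIset_setIr.
  rewrite measure_bigcup// (eq_eseriesr (fun k _ => (mF k).2)).
  rewrite (fineP mE2) muleC -nneseriesZl//.
  by apply: eq_eseriesr => k _; rewrite muleC.
Qed.

Section family.
Variable X : nat -> Om -> R.
Hypothesis mX : forall i, measurable_fun setT (X i).

Definition prefix_indep := forall N (A : nat -> set R), (forall i, measurable (A i)) ->
  (P (\bigcap_(i in [set k | (k < N)%N]) (X i @^-1` A i)) = \prod_(i < N) P (X i @^-1` A i))%E.

Hypothesis iX : prefix_indep.

(** Cylinders on finitely many coordinates from [J]. Taking the full set at all other indices writes
    each of them as one intersection over all indices, so that two of them intersect coordinate by
    coordinate. *)
Definition rects (J : set nat) : set (set Om) := [set E | exists N (A : nat -> set R),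
  [/\ forall i, measurable (A i), forall i, ~ (J i /\ (i < N)%N) -> A i = setT &
   E = \bigcap_i (X i @^-1` A i)]].

Definition sub_sigma (J : set nat) : set (set Om) := <<s rects J >>.

Let mpre i A : measurable A -> measurable (X i @^-1` A).
Proof. by move=> mA; rewrite -[X in measurable X]setTI; exact: mX. Qed.

Lemma rects_setI J : setI_closed (rects J).
Proof.
move=> E1 E2 [N1 [A1 [m1 J1 ->]]] [N2 [A2 [m2 J2 ->]]].
exists (maxn N1 N2), (fun i => A1 i `&` A2 i); split.
- by move=> i; exact: measurableI.
- move=> i H; rewrite J1 ?J2 ?setTI// => -[Ji iN]; apply: H; split => //.
    by rewrite leq_max iN orbT.
  by rewrite leq_max iN.
- by rewrite -bigcapI; apply: eq_bigcapr => i _; rewrite preimage_setI.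
Qed.

Lemma rects_measurable J E : rects J E -> measurable E.
Proof.
by move=> [N [A [mA _ ->]]]; apply: bigcapT_measurable => i; exact: mpre.
Qed.

Lemma sub_sigma_measurable J E : sub_sigma J E -> measurable E.
Proof.
move=> H; apply: (H measurable); split; first exact: sigma_algebra_measurable.
exact: rects_measurable.
Qed.

Lemma sub_sigma_pre J i A : J i -> measurable A -> sub_sigma J (X i @^-1` A).
Proof.
move=> Ji mA; apply: sub_sigma_algebra.
exists i.+1, (fun k => if k == i then A else setT); split.
- by move=> k; case: ifP.
- by move=> k H; case: eqP => // ki; exfalso; apply: H; rewrite ki.
- apply/seteqP; split => w /= H.
    by move=> k _ /=; case: eqP => // ->.
  by have := H i I; rewrite /= eqxx.
Qed.

Lemma rects_prob N (A : nat -> set R) : (forall i, measurable (A i)) ->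
  (forall i, (N <= i)%N -> A i = setT) ->
  P (\bigcap_i (X i @^-1` A i)) = (\prod_(i < N) P (X i @^-1` A i))%E.
Proof.
move=> mA AT; rewrite -iX//; congr (P _); apply/seteqP; split => w H i.
  by move=> _; exact: H.
move=> _; have [iN|Ni] := ltnP i N; first exact: H.
by rewrite /= AT.
Qed.

Lemma sub_sigma_indep (J1 J2 : set nat) E1 E2 : J1 `&` J2 = set0 ->
  sub_sigma J1 E1 -> sub_sigma J2 E2 -> (P (E1 `&` E2) = P E1 * P E2)%E.
Proof.
move=> J12 H1 H2.
apply: (indep_dynkin (@rects_setI J1) (@rects_measurable J1)) H1; first exact: sub_sigma_measurable H2.
move=> {}E1 R1; rewrite setIC muleC.
apply: (indep_dynkin (@rects_setI J2) (@rects_measurable J2)) H2; first exact: rects_measurable R1.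
move=> {}E2 R2; move: R1 R2 => [N1 [A1 [m1 H1 ->]]] [N2 [A2 [m2 H2 ->]]].
rewrite -bigcapI; under eq_bigcapr do rewrite -preimage_setI.
pose N := maxn N1 N2.
rewrite (@rects_prob N (fun i => A2 i `&` A1 i)); last 2 first.
- by move=> i; exact: measurableI.
- move=> i; rewrite geq_max => /andP[n1 n2]; rewrite H1 ?H2 ?setTI// => -[_]; rewrite ltnNge => /negP; exact.
rewrite (@rects_prob N A2)//; last first.
  by move=> i; rewrite geq_max => /andP[n1 n2]; rewrite H2// => -[_]; rewrite ltnNge => /negP; exact.
rewrite (@rects_prob N A1)//; last first.
  by move=> i; rewrite geq_max => /andP[n1 n2]; rewrite H1// => -[_]; rewrite ltnNge => /negP; exact.
rewrite -big_split /=; apply: eq_bigr => i _.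
have [Ji|nJi] := pselect (J1 i).
  rewrite (H2 i) ?setTI ?preimage_setT ?[X in (_ = X * _)%E](probability_setT P) ?mul1e// => -[Ji2 _].
  by have : (J1 `&` J2) (i : nat) by []; rewrite J12.
rewrite (H1 i) ?setIT ?preimage_setT ?[X in (_ = _ * X)%E](probability_setT P) ?mule1//.
by move=> -[].
Qed.

End family.

Section expectation_product.

(** The sum counts the positive integers up to [x], so it is the integer part. At scale [1 / p.+1]
    this approximates a bounded function by indicators of its upper level sets. *)
Lemma layer_cake (x : R) K : 0 <= x <= K%:R ->
  `|x - \sum_(k < K) (nat_of_bool (k.+1%:R <= x))%:R| <= 1.
Proof.
elim: K => [|K IH] /andP[x0 xK].
  by rewrite big_ord0 subr0 (@le_anti _ _ x 0) ?normr0// x0 xK.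
rewrite big_ord_recr /=; have [xK'|xK'] := leP x K%:R.
  rewrite [K.+1%:R <= x]leNgt (le_lt_trans xK') ?ltr_nat//= addr0.
  by apply: IH; rewrite x0.
rewrite (eq_bigr (fun=> 1)); last first.
  by move=> k _; rewrite (le_trans _ (ltW xK'))// ler_nat.
rewrite sumr_const card_ord -[1 *+ K]/(K%:R).
have := xK; rewrite -natr1 => xK1; case: (leP _ x) => /= H; rewrite ler_norml; apply/andP; split; lra.
Qed.

Lemma prodr_dist (M e : R) n (a b : 'I_n -> R) : 1 <= M -> 0 <= e ->
  (forall i, `|a i| <= M) -> (forall i, `|b i| <= M) -> (forall i, `|a i - b i| <= e) ->
  `|\prod_i a i - \prod_i b i| <= n%:R * M ^+ n * e.
Proof.
move=> M1 e0; have M0 : 0 <= M by exact: le_trans M1.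
elim: n a b => [|n IH] a b aM bM ab; first by rewrite !big_ord0 subrr normr0 !mul0r.
rewrite !big_ord_recl.
set A := \prod_(i < n) _; set B := \prod_(i < n) b _.
have -> : a ord0 * A - b ord0 * B = a ord0 * (A - B) + (a ord0 - b ord0) * B by ring.
apply: (le_trans (ler_normD _ _)); rewrite !normrM.
have BM : `|B| <= M ^+ n.
  rewrite /B normr_prod -[X in M ^+ X](card_ord n) -prodr_const.
  by apply: ler_prod => i _; rewrite normr_ge0 bM.
have -> : n.+1%:R * M ^+ n.+1 * e = M * (n%:R * M ^+ n * e) + e * M ^+ n.+1.
  by rewrite -natr1 exprS; ring.
apply: lerD.
  by apply: ler_pM => //; apply: IH => i.
apply: ler_pM => //; apply: (le_trans BM); rewrite exprS ler_peMl// exprn_ge0//.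
Qed.

(** Independence is assumed for upper level sets only. By [layer_cake] their indicators suffice:
    both sides expand into the same finite sum over tuples of thresholds, up to an error that
    vanishes with the scale. *)
Lemma expect_prod (n : nat) (f : 'I_n -> Om -> R) (M : nat) :
  (forall m, measurable_fun setT (f m)) -> (forall m x, 0 <= f m x <= M%:R) ->
  (forall a : 'I_n -> R, P (\bigcap_(m in [set: 'I_n]) [set w | a m <= f m w]) =
     (\prod_(m < n) P [set w | (a m <= f m w)%R])%E) ->
  \int[P]_w (\prod_(m < n) f m w) = \prod_(m < n) \int[P]_w (f m w).
Proof.
move=> mf fM H.
pose M1 : R := M%:R + 1.
have M11 : 1 <= M1 by rewrite lerDr.
pose lc (p : nat) (m : 'I_n) (w : Om) : R :=
  p.+1%:R^-1 * \sum_(k < M * p.+1) \1_([set w | k.+1%:R / p.+1%:R <= f m w]) w.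
have p0 p : 0 < p.+1%:R :> R by [].
have lcf p m w : `|f m w - lc p m w| <= p.+1%:R^-1.
  have /andP[f0 fm] := fM m w.
  have := @layer_cake (p.+1%:R * f m w) (M * p.+1) _.
  rewrite mulr_ge0//= natrM mulrC ler_wpM2r// => /(_ isT) L.
  rewrite -[leRHS]mulr1 -[f m w](mulKf (lt0r_neq0 (p0 p))) -mulrBr normrM ger0_norm ?invr_ge0//.
  rewrite ler_wpM2l ?invr_ge0// mulrC.
  rewrite (eq_bigr (fun k : 'I_(M * p.+1) => (nat_of_bool (k.+1%:R <= f m w * p.+1%:R))%:R))//.
  move=> k _; rewrite indicE; congr (_%:R); congr nat_of_bool.
  rewrite -ler_pdivrMr//; apply/idP/idP; rewrite inE//.
have mset m (a : R) : measurable [set w | a <= f m w] by exact: measurable_set_le.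
have mlc p m : measurable_fun setT (lc p m).
  apply: measurable_funM => //; apply: measurable_sum => k; exact: measurable_indic.
have lcM p m w : `|lc p m w| <= M1.
  have /andP[f0 fm] := fM m w.
  rewrite -[lc p m w](subKr (f m w)) (le_trans (ler_normB _ _))// (ger0_norm f0) lerD//.
  by rewrite (le_trans (lcf _ _ _))// invf_le1// ler1n.
have fM1 m w : `|f m w| <= M1.
  by have /andP[f0 fm] := fM m w; rewrite ger0_norm// (le_trans fm)// lerDl.
have mprod (g : 'I_n -> Om -> R) : (forall m, measurable_fun setT (g m)) ->
    measurable_fun setT (fun w => \prod_(m < n) g m w).
  by move=> mg; apply: measurable_prod => m _; exact: mg.
have prodM (g : 'I_n -> Om -> R) w : (forall m, `|g m w| <= M1) -> `|\prod_(m < n) g m w| <= M1 ^+ n.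
  move=> gM; rewrite normr_prod -[X in M1 ^+ X](card_ord n) -prodr_const.
  by apply: ler_prod => i _; rewrite normr_ge0 gM.
have Elc p : \int[P]_w (\prod_(m < n) lc p m w) = \prod_(m < n) \int[P]_w (lc p m w).
  have El m : \int[P]_w (lc p m w) = \sum_(k < M * p.+1) p.+1%:R^-1 * fine (P [set w | k.+1%:R / p.+1%:R <= f m w]).
    rewrite /lc (@bounded_integralZ _ _ _ P _ (M * p.+1)%:R); last 2 first.
    - by apply: measurable_sum => k; exact: measurable_indic.
    - move=> x; rewrite (le_trans (ler_norm_sum _ _ _))//.
      have -> : (M * p.+1)%:R = \sum_(k < M * p.+1) (1 : R) by rewrite sumr_const card_ord.
      by apply: ler_sum => k _; exact: norm_indic_le1.
    rewrite (@bounded_integral_sum _ _ _ P _ _ _ (fun=> 1)); last 2 first.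
    - by move=> k; exact: measurable_indic.
    - by move=> k x; exact: norm_indic_le1.
    by rewrite mulr_sumr; apply: eq_bigr => k _; rewrite Rintegral_indic.
  under [RHS]eq_bigr do rewrite El.
  rewrite bigA_distr_bigA /=.
  have -> : (fun w => \prod_(m < n) lc p m w) = fun w => \sum_(g : {ffun 'I_n -> 'I_(M * p.+1)})
     (p.+1%:R^-1 ^+ n * \1_(\bigcap_(m in [set: 'I_n]) [set w | (g m).+1%:R / p.+1%:R <= f m w]) w).
    apply/funext => w; rewrite /lc big_split /= prodr_const card_ord bigA_distr_bigA /= mulr_sumr.
    apply: eq_bigr => g _; congr (_ * _).
    rewrite indicE; case: (boolP (_ \in _)) => [|].
      by rewrite inE => Hg; rewrite big1// => m _; rewrite indicE mem_set//; exact: Hg.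
    rewrite notin_setE => Hg; apply/eqP; rewrite prodf_seq_eq0; apply/hasP.
    have [m Hm] : exists m, ~ ((g m).+1%:R / p.+1%:R <= f m w).
      by apply/existsNP => Ha; apply: Hg => m _; exact: Ha.
    by exists m; rewrite ?mem_index_enum//= indicE memNset.
  have mcap (g : {ffun 'I_n -> 'I_(M * p.+1)}) :
     measurable (\bigcap_(m in [set: 'I_n]) [set w | (g m).+1%:R / p.+1%:R <= f m w]).
    by apply: fin_bigcap_measurable => // m _.
  rewrite (@bounded_integral_sum _ _ _ P _ _ _ (fun=> p.+1%:R^-1 ^+ n)); last 2 first.
  - by move=> g; apply: measurable_funM => //; exact: measurable_indic.
  - move=> g x; rewrite normrM ger0_norm ?exprn_ge0 ?invr_ge0// ler_piMr ?exprn_ge0 ?invr_ge0//.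
    exact: norm_indic_le1.
  apply: eq_bigr => g _.
  rewrite (@bounded_integralZ _ _ _ P _ 1); [|exact: measurable_indic|exact: norm_indic_le1].
  rewrite Rintegral_indic// (H (fun m => (g m).+1%:R / p.+1%:R)).
  rewrite (eq_bigr (fun m => (fine (P [set w | (g m).+1%:R / p.+1%:R <= f m w]))%:E)); last first.
    by move=> m _; rewrite -fineP.
  rewrite prodEFin /= big_split /= prodr_const card_ord//.
apply/eqP; rewrite -subr_eq0 -normr_le0; apply/ler_addgt0Pr => e e0; rewrite add0r.
set C := n%:R * M1 ^+ n.
have C0 : 0 <= C by rewrite mulr_ge0// exprn_ge0// (le_trans _ M11).
have [p Hp] : exists p, 2 * C * p.+1%:R^-1 <= e.
  have [p _ Hp] := near_infty_natSinv_lt (PosNum (divr_gt0 e0 (ltr_wpDl (mulr_ge0 (ler0n R 2) C0) ltr01))).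
  exists p; have := Hp p (leqnn _) => /=; rewrite ltr_pdivlMr; last by rewrite ltr_wpDl// mulr_ge0.
  rewrite mulrDr mulr1 => h; rewrite mulrC; apply: ltW; apply: le_lt_trans h.
  by rewrite lerDl invr_ge0.
have A : `|\int[P]_w (\prod_(m < n) f m w) - \int[P]_w (\prod_(m < n) lc p m w)| <= C * p.+1%:R^-1.
  apply: (@bounded_integral_dist _ _ _ P _ _ (M1 ^+ n)).
  - exact: mprod.
  - exact: mprod.
  - by move=> w; apply: prodM => m.
  - by move=> w; apply: prodM => m.
  - by move=> w; apply: prodr_dist => //; rewrite invr_ge0.
have B : `|\prod_(m < n) \int[P]_w (f m w) - \prod_(m < n) \int[P]_w (lc p m w)| <= C * p.+1%:R^-1.
  apply: prodr_dist => //; rewrite ?invr_ge0// => m.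
  - by apply: bounded_integral_le => // w.
  - by apply: bounded_integral_le => // w.
  - by apply: (@bounded_integral_dist _ _ _ P _ _ M1).
rewrite Elc in A; apply: le_trans Hp.
move: A B; set q := p.+1%:R^-1; set a1 := \int[P]_w _; set a2 := \prod_(m < n) _; set a3 := \prod_(m < n) _.
move=> A B; rewrite -[a1](subrK a2) -addrA (le_trans (ler_normD _ _))// -mulrA mulrDl mul1r lerD//.
by rewrite distrC.
Qed.

(** Adding [M] makes both factors nonnegative, as [expect_prod] requires; the extra terms cancel by
    linearity. *)
Lemma indep2_expect (f g : Om -> R) (M : nat) :
  measurable_fun setT f -> measurable_fun setT g ->
  (forall w, `|f w| <= M%:R) -> (forall w, `|g w| <= M%:R) ->
  (forall a b : R, P ([set w | (a <= f w)%R] `&` [set w | (b <= g w)%R]) =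
     (P [set w | (a <= f w)%R] * P [set w | (b <= g w)%R])%E) ->
  \int[P]_w (f w * g w) = (\int[P]_w f w) * (\int[P]_w g w).
Proof.
move=> mf mg fM gM H.
pose h (m : 'I_2) (w : Om) : R := if m == ord0 then f w + M%:R else g w + M%:R.
have hM (m : 'I_2) w : 0 <= h m w <= (2 * M)%:R.
  have := fM w; have := gM w; rewrite natrM !ler_norml /h => /andP[? ?] /andP[? ?].
  by case: ifP => _; apply/andP; split; lra.
have mh m : measurable_fun setT (h m) by rewrite /h; case: (m == ord0); exact: measurable_funD.
have := @expect_prod 2 h (2 * M) mh hM _.
under eq_Rintegral do rewrite big_ord_recl big_ord1 /h /=.
rewrite big_ord_recl big_ord1 /h /=.
pose MM1 : R := M%:R * M%:R.
have bM (x : Om) : `|M%:R : R| <= M%:R by rewrite ger0_norm.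
have mfg : measurable_fun setT (fun w => f w * g w) by exact: measurable_funM.
have fgM w : `|f w * g w| <= MM1 by rewrite normrM ler_pM.
have -> : (fun w => (f w + M%:R) * (g w + M%:R)) = (fun w => f w * g w + (M%:R * f w + (M%:R * g w + M%:R * M%:R))).
  by apply/funext => w; ring.
have MM (x : Om) : `|M%:R * M%:R : R| <= MM1 by rewrite ger0_norm// mulr_ge0.
have Mg w : `|M%:R * g w| <= MM1 by rewrite normrM ler_pM// ger0_norm.
have Mf w : `|M%:R * f w| <= MM1 by rewrite normrM ler_pM// ger0_norm.
have mMg : measurable_fun setT (fun w => M%:R * g w) by exact: measurable_funM.
have mMf : measurable_fun setT (fun w => M%:R * f w) by exact: measurable_funM.
have mc (c : R) : measurable_fun setT (fun _ : Om => c) by [].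
have b1 w : `|M%:R * g w + M%:R * M%:R| <= MM1 + MM1 by rewrite (le_trans (ler_normD _ _))// lerD// ?Mg ?(MM w).
have b2 w : `|M%:R * f w + (M%:R * g w + M%:R * M%:R)| <= MM1 + (MM1 + MM1) by rewrite (le_trans (ler_normD _ _))// lerD// ?Mf ?b1.
have m1 : measurable_fun setT (fun w => M%:R * g w + M%:R * M%:R) by exact: measurable_funD.
have m2 : measurable_fun setT (fun w => M%:R * f w + (M%:R * g w + M%:R * M%:R)) by exact: measurable_funD.
rewrite (bounded_integralD P mfg m2 fgM b2) (bounded_integralD P mMf m1 Mf b1).
rewrite (bounded_integralD P mMg (mc _) Mg MM).
rewrite !(@bounded_integralZ _ _ _ P _ M%:R)// prob_integral_cst.
rewrite (@bounded_integralD _ _ _ P f _ M%:R M%:R)// (@bounded_integralD _ _ _ P g _ M%:R M%:R)// !prob_integral_cst.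
move=> E; have {}E := E _.
suff : (forall a : 'I_2 -> R, P (\bigcap_(m in [set: 'I_2]) [set w | a m <= h m w]) =
     (\prod_(m < 2) P [set w | (a m <= h m w)%R])%E).
  move=> /E.
  move=> EE; apply: (addIr (M%:R * \int[P]_x f x + (M%:R * \int[P]_x g x + M%:R * M%:R))).
  by rewrite EE; ring.
move=> a; rewrite big_ord_recl big_ord1 /h /=.
have -> : \bigcap_(m in [set: 'I_2]) [set w | a m <= if m == ord0 then f w + M%:R else g w + M%:R] =
  [set w | a ord0 - M%:R <= f w] `&` [set w | a (lift ord0 ord0) - M%:R <= g w].
  apply/seteqP; split => w.
    by move=> Hw; split => /=; rewrite lerBlDr; [have := Hw ord0 I|have := Hw (lift ord0 ord0) I].
  move=> [/= H1 H2] m _ /=; case: ifPn => [/eqP ->|m0]; first by rewrite -lerBlDr.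
  have -> : m = lift ord0 ord0 by apply/val_inj => /=; case: m m0 => -[|[|]].
  by rewrite -lerBlDr.
rewrite H; congr (P _ * P _)%E; apply/funext => w /=; apply/propext; by rewrite lerBlDr.
Qed.

End expectation_product.

End independence.

(** * The queue along a path *)

Section counting.
Context {R : realType}.

Lemma nsum_fin (g : nat -> R) n : (forall i, (n <= i)%N -> g i = 0) ->
  nsum g = \sum_(i < n) g i.
Proof.
move=> g0; rewrite /nsum; apply/cvg_lim => //.
apply: cvg_near_cst; exists n => // m /= nm.
rewrite -(subnKC nm); elim: (m - n)%N => [|j IH]; first by rewrite addn0.
by rewrite addnS big_ord_recr /= IH g0 ?addr0// leq_addr.
Qed.

Variable s : nat -> R.
Hypothesis s_nd : forall i j, (i <= j)%N -> s i <= s j.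
Hypothesis s_unb : forall t, exists n, t < s n.

(** The first index beyond [t], hence the number of terms up to [t]; it turns the limit [nsum] into
    a finite sum. *)
Definition cnt t : nat := ex_minn (s_unb t).

Lemma cntE i t : (s i <= t) = (i < cnt t)%N.
Proof.
rewrite /cnt; case: ex_minnP => n tn min; apply/idP/idP => H.
  by rewrite ltnNge; apply/negP => /s_nd H2; move: (lt_le_trans tn (le_trans H2 H)); rewrite ltxx.
by rewrite leNgt; apply/negP => /min; rewrite leqNgt H.
Qed.

Lemma cnt_nd (t t' : R) : t <= t' -> (cnt t <= cnt t')%N.
Proof.
move=> tt'; rewrite leqNgt; apply/negP; rewrite -cntE => H.
by have := cntE (cnt t') t'; rewrite ltnn (le_trans H tt').
Qed.

Lemma nsum_cnt (c : nat -> R) t :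
  nsum (fun i => (nat_of_bool (s i <= t))%:R * c i) = \sum_(i < cnt t) c i.
Proof.
rewrite (@nsum_fin _ (cnt t)); last by move=> i; rewrite cntE leqNgt => /negbTE ->; rewrite mul0r.
by apply: eq_bigr => i _; rewrite cntE ltn_ord mul1r.
Qed.

Lemma cnt_right t : exists2 b, t < b & forall r, t <= r < b -> cnt r = cnt t.
Proof.
exists (s (cnt t)); first by rewrite ltNge cntE ltnn.
move=> r /andP[tr rb]; apply/eqP; rewrite eqn_leq (cnt_nd tr) andbT.
by rewrite leqNgt -cntE -ltNge.
Qed.

Lemma cnt_left t : exists n b, [/\ b < t, forall r, b <= r < t -> cnt r = n &
   forall i, (i < n)%N = (s i < t)].
Proof.
have ex : exists n, t <= s n by have [n /ltW] := s_unb t; exists n.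
pose n := ex_minn ex.
have nP i : (i < n)%N = (s i < t).
  rewrite /n; case: ex_minnP => m tm min; apply/idP/idP => H.
    by rewrite ltNge; apply/negP => /min; rewrite leqNgt H.
  by rewrite ltnNge; apply/negP => /s_nd H2; move: (lt_le_trans H (le_trans tm H2)); rewrite ltxx.
exists n, (if n is n'.+1 then s n' else t - 1); split => //.
  case E : n => [|n']; first by lra.
  by rewrite -nP E.
move=> r /andP[br rt]; apply/eqP; rewrite eqn_leq; apply/andP; split.
  rewrite leqNgt; apply/negP; rewrite -cntE => H.
  by have := nP n; rewrite ltnn (le_lt_trans H rt).
by case E : n br => [|n']//; rewrite cntE.
Qed.

Lemma cnt_cadlag (c : nat -> R) : cadlag (fun t => \sum_(i < cnt t) c i).
Proof.
split=> t _.
  have [b tb H] := cnt_right t.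
  apply: cvg_near_cst; rewrite near_withinE; apply/nbhs_ballP; exists (b - t); first by rewrite /= subr_gt0.
  move=> r; rewrite /ball /= => rt tr; rewrite H// (ltW tr) /=.
  by move: rt; rewrite distrC ger0_norm ?subr_ge0 ?(ltW tr)//; lra.
have [n [b [bt H _]]] := cnt_left t.
apply/cvg_ex; exists (\sum_(i < n) c i).
apply: cvg_near_cst; rewrite near_withinE; apply/nbhs_ballP; exists (t - b); first by rewrite /= subr_gt0.
move=> r; rewrite /ball /= => rt tr; rewrite H// tr andbT.
by move: rt; rewrite ger0_norm ?subr_ge0 ?(ltW tr)//; lra.
Qed.

Lemma cnt_left_lim (c : nat -> R) n t : (forall i, (i < n)%N = (s i < t)) ->
  (\sum_(i < cnt r) c i) @[r --> t^'-] --> \sum_(i < n) c i.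
Proof.
move=> nP; have [m [b [bt H mP]]] := cnt_left t.
have -> : n = m.
  apply/eqP; rewrite eqn_leq; apply/andP; split; rewrite leqNgt; apply/negP.
    by rewrite nP -mP ltnn.
  by rewrite mP -nP ltnn.
apply: cvg_near_cst; rewrite near_withinE; apply/nbhs_ballP; exists (t - b); first by rewrite /= subr_gt0.
move=> r; rewrite /ball /= => rt tr; rewrite H// tr andbT.
by move: rt; rewrite ger0_norm ?subr_ge0 ?(ltW tr)//; lra.
Qed.

End counting.

Lemma cadlagD {R : realType} (f g : R -> R) : cadlag f -> cadlag g -> cadlag (fun t => f t + g t).
Proof.
move=> [f1 f2] [g1 g2]; split=> t t0; first by apply: cvgD; [exact: f1|exact: g1].
by apply: is_cvgD; [exact: f2|exact: g2].
Qed.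

Lemma cadlag_scale {R : realType} (f : R -> R) (a b : R) : 0 < b -> cadlag f ->
  cadlag (fun t => a * f (b * t)).
Proof.
move=> b0 [f1 f2].
have R1 (t : R) : (fun s => b * s) @ t^'+ --> (b * t)^'+.
  move=> A H; have {H}/nbhs_ballP[e /= e0 H] : nbhs (b * t) [set r | b * t < r -> A r] by exact: H.
  suff : nbhs t [set s | t < s -> A (b * s)] by [].
  apply/nbhs_ballP; exists (e / b); first by rewrite /= divr_gt0.
  move=> s; rewrite /ball /= ltr_pdivlMr// => st ts; apply: H; last by rewrite ltr_pM2l.
  by rewrite /ball /= -mulrBr normrM gtr0_norm// mulrC.
have L1 (t : R) : (fun s => b * s) @ t^'- --> (b * t)^'-.
  move=> A H; have {H}/nbhs_ballP[e /= e0 H] : nbhs (b * t) [set r | r < b * t -> A r] by exact: H.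
  suff : nbhs t [set s | s < t -> A (b * s)] by [].
  apply/nbhs_ballP; exists (e / b); first by rewrite /= divr_gt0.
  move=> s; rewrite /ball /= ltr_pdivlMr// => st ts; apply: H; last by rewrite ltr_pM2l.
  by rewrite /ball /= -mulrBr normrM gtr0_norm// mulrC.
split=> t t0.
  apply: cvgMr; apply: (cvg_comp _ _ (R1 t)); apply: f1; by rewrite mulr_ge0// ltW.
have [l Hl] := (cvg_ex _).1 (f2 (b * t) (mulr_gt0 b0 t0)).
by apply/cvg_ex; exists (a * l); apply: cvgMr; apply: (cvg_comp _ _ (L1 t)).
Qed.

(** * The workload process and Lindley's recursion *)

Section workload.
Context {R : realType}.
Variables (u V D : nat -> R) (z0 : R) (Z L : R -> R).
Hypothesis u_gt0 : forall i, 0 < u i.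
Hypothesis V_ge0 : forall i, 0 <= V i.
Hypothesis T_unb : forall t, exists n, t < Tarr u n.
Hypothesis U_unb : forall t, exists n, t < \sum_(j < n.+1) V j.
Hypothesis dyn : vwt_dyn u V D z0 Z L.

Let T_lt i j : (i < j)%N -> Tarr u i < Tarr u j.
Proof.
move=> /subnKC <-; rewrite addSnnS; elim: (j - i.+1)%N => [|k IH].
  by rewrite addn1 /Tarr [ltRHS]big_ord_recr /= ltrDl.
by apply: (lt_trans IH); rewrite (addnS i k.+1) /Tarr [ltRHS]big_ord_recr /= ltrDl.
Qed.

Lemma Tarr_nd i j : (i <= j)%N -> Tarr u i <= Tarr u j.
Proof. by rewrite leq_eqVlt => /predU1P[->//|/T_lt/ltW]. Qed.

Lemma Tarr_gt0 i : 0 < Tarr u i.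
Proof.
have T0 : 0 < Tarr u 0 by rewrite /Tarr big_ord1.
by apply: (lt_le_trans T0); exact: Tarr_nd.
Qed.

Lemma Usum_nd i j : (i <= j)%N -> \sum_(l < i.+1) V l <= \sum_(l < j.+1) V l.
Proof.
move=> /subnKC <-; elim: (j - i)%N => [|k IH]; first by rewrite addn0.
by apply: (le_trans IH); rewrite addnS [leRHS]big_ord_recr /= lerDl.
Qed.

Definition nA := cnt T_unb.
Definition nS := cnt U_unb.
Definition acc i : R := (nat_of_bool (Woff u Z i < D i))%:R.

Lemma nAE i t : (Tarr u i <= t) = (i < nA t)%N. Proof. exact: (cntE Tarr_nd). Qed.
Lemma nSE i t : (\sum_(j < i.+1) V j <= t) = (i < nS t)%N. Proof. exact: (cntE Usum_nd). Qed.

Lemma AcountE t : Acount u t = (nA t)%:R.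
Proof.
rewrite /Acount -[RHS]/((cnt T_unb t)%:R).
have := nsum_cnt Tarr_nd T_unb (fun=> 1) t; rewrite sumr_const card_ord => <-.
by congr nsum; apply/funext => i; rewrite mulr1.
Qed.

Lemma ScountE t : Scount V t = (nS t)%:R.
Proof.
rewrite /Scount -[RHS]/((cnt U_unb t)%:R).
have := nsum_cnt Usum_nd U_unb (fun=> 1) t; rewrite sumr_const card_ord => <-.
by congr nsum; apply/funext => i; rewrite mulr1.
Qed.

Lemma A0countE t : A0count u D Z t = \sum_(i < nA t) acc i.
Proof.
rewrite /A0count -(nsum_cnt Tarr_nd T_unb acc); congr nsum; apply/funext => i.
by rewrite /acc -natrM mulnb.
Qed.

Lemma YworkE t : Ywork u V D Z t = \sum_(i < nA t) (acc i * V i).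
Proof.
rewrite /Ywork -(nsum_cnt Tarr_nd T_unb (fun i => acc i * V i)); congr nsum; apply/funext => i.
by rewrite /acc mulrA -natrM mulnb.
Qed.

Lemma L_lip (s t : R) : 0 <= s -> s <= t -> 0 <= L t - L s <= t - s.
Proof.
move=> s0 st; have [_ [-> _]] := dyn (le_trans s0 st); have [_ [-> _]] := dyn s0.
exact: idle_time_lip.
Qed.

Lemma L_flat (s t : R) : 0 <= s -> s <= t -> (forall r, s < r <= t -> 0 < Z r) -> L t = L s.
Proof.
move=> s0 st H; have [_ [-> _]] := dyn (le_trans s0 st); have [_ [-> _]] := dyn s0.
by apply: (@idle_time_flat R (fun s => Z s == 0)) => // r /H; apply: contraTF => /eqP ->; rewrite ltxx.
Qed.

Lemma L_0 : L 0 = 0.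
Proof. by have [_ [-> _]] := dyn (lexx 0); rewrite set_itv1 Rintegral_set1. Qed.

Lemma L_cont : cont0 L.
Proof.
apply: (@lip_cont0 _ L 1) => s t s0 st; rewrite mul1r.
by have /andP[a b] := L_lip s0 st; rewrite ger0_norm.
Qed.

Let Ztot t : 0 <= t -> Z t = z0 + \sum_(i < nA t) (acc i * V i) - t + L t.
Proof. by move=> t0; have [_ [_ ->]] := dyn t0; rewrite YworkE. Qed.

Let Z_ge0 t : 0 <= t -> 0 <= Z t. Proof. by move=> /dyn[]. Qed.

Lemma Woff_lim i : Z r @[r --> (Tarr u i)^'-] --> z0 + \sum_(j < i) (acc j * V j) - Tarr u i + L (Tarr u i).
Proof.
have T0 := Tarr_gt0 i.
have cl := @cont0_cadlag _ L L_cont.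
have e1 : \forall r \near (Tarr u i)^'-, z0 + \sum_(i < nA r) (acc i * V i) - r + L r = Z r.
  rewrite near_withinE; apply/nbhs_ballP; exists (Tarr u i) => // r; rewrite /ball /= => rt tr.
  rewrite Ztot//; by move: rt; rewrite ger0_norm ?subr_ge0 ?(ltW tr)//; lra.
apply: cvg_trans (near_eq_cvg e1) _.
apply: cvgD; last first.
  have /cont0P := L_cont; rewrite subspace_continuousP => /(_ (Tarr u i)).
  rewrite /= in_itv /= (ltW T0) => /(_ isT) H.
  move=> A /H {}H; have {H}/nbhs_ballP[e /= e0 H] : nbhs (Tarr u i) [set r | r \in `[0, +oo[ -> A (L r)] by exact: H.
  suff : nbhs (Tarr u i) [set r | r < Tarr u i -> A (L r)] by [].
  apply/nbhs_ballP; exists (minr e (Tarr u i)); first by rewrite /= lt_min e0.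
  move=> r; rewrite /ball /= lt_min => /andP[re rT] tr; apply: H => //.
  by rewrite in_itv /= andbT; move: rT; rewrite ger0_norm ?subr_ge0 ?(ltW tr)//; lra.
apply: cvgB; last exact: cvg_at_left_filter cvg_id.
apply: cvgD; first exact: cvg_cst.
have Hi j : (j < i)%N = (Tarr u j < Tarr u i).
  apply/idP/idP; first exact: T_lt.
  by apply: contraTT; rewrite -leqNgt -leNgt => /Tarr_nd.
exact: (@cnt_left_lim _ _ Tarr_nd T_unb (fun j => acc j * V j) i (Tarr u i) Hi).
Qed.

Lemma WoffE i : Woff u Z i = z0 + \sum_(j < i) (acc j * V j) - Tarr u i + L (Tarr u i).
Proof. by apply/cvg_lim => //; exact: Woff_lim. Qed.

Lemma Z_arr i : Z (Tarr u i) = Woff u Z i + acc i * V i.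
Proof.
rewrite Ztot ?(ltW (Tarr_gt0 _))// WoffE.
have -> : nA (Tarr u i) = i.+1.
  apply/eqP; rewrite eqn_leq -nAE lexx andbT leqNgt -nAE -ltNge; exact: T_lt.
by rewrite big_ord_recr /=; ring.
Qed.

(** Between arrivals the workload decreases at unit rate until it is empty. At the end [b] either it
    is still positive, so that it was positive throughout and the idle time did not move, or it is
    0. *)
Let drain (a b Za : R) : 0 <= a -> a < b -> 0 <= Za ->
  (forall t, a <= t < b -> Z t = Za - (t - a) + (L t - L a)) ->
  Za - (b - a) + (L b - L a) = maxr (Za - (b - a)) 0.
Proof.
move=> a0 ab Za0 HZ.
pose g t := Za - (t - a) + (L t - L a).
have gnd s t : a <= s -> s <= t -> g t <= g s.
  by move=> as_ st; have := L_lip (le_trans a0 as_) st; rewrite /g => /andP[_ ?]; lra.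
have gz t : a <= t -> t < b -> 0 <= g t.
  by move=> at_ tb; rewrite /g -HZ ?at_//; apply: Z_ge0; exact: le_trans at_.
have cg : cont0 (fun t => L t - t).
  by apply: cont0B; [exact: L_cont|exact: cont0_id].
have b0 : 0 <= b by rewrite (le_trans a0)// ltW.
(* The equation for [Z] is only known before [b], where the next arrival occurs; the value at [b] is
   reached through continuity of [L]. *)
have near e : 0 < e -> exists2 t, a <= t < b & `|g t - g b| < e.
  move=> e0; have [dl dl0 H] := cg b b0 e e0.
  pose m := minr dl (b - a); have m0 : 0 < m by rewrite lt_min dl0 subr_gt0.
  have mdl : m <= dl by rewrite ge_min lexx.
  have mba : m <= b - a by rewrite ge_min lexx orbT.
  exists (b - m / 2); first by apply/andP; split; lra.
  have := H (b - m / 2) _ _; rewrite /g => {}H.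
  have -> : Za - (b - m / 2 - a) + (L (b - m / 2) - L a) - (Za - (b - a) + (L b - L a)) =
    L (b - m / 2) - (b - m / 2) - (L b - b) by ring.
  apply: H; first by lra.
  by rewrite addrAC subrr add0r normrN ger0_norm; lra.
have gb0 : 0 <= g b.
  rewrite leNgt; apply/negP => gb; have [t /andP[at_ tb] H] := near _ (ltac:(rewrite oppr_gt0; exact: gb) : 0 < - g b).
  by have := gz t at_ tb; move: H; rewrite ltr_norml => /andP[_ ?] ?; lra.
rewrite -/(g b); have [gb|gb] := leP (g b) 0.
  have g0 : g b = 0 by apply/eqP; rewrite eq_le gb.
  rewrite g0 max_r//; have := L_lip a0 (ltW ab); move: g0; rewrite /g => ? /andP[? _]; lra.
have Leq : L b = L a.
  have Lt t : a <= t -> t < b -> L t = L a.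
    move=> at_ tb; apply: L_flat => // r /andP[ar rt].
    have rb := le_lt_trans rt tb.
    by rewrite HZ ?(ltW ar)//; apply: (lt_le_trans gb); apply: gnd; exact: ltW.
  apply/eqP; rewrite -subr_eq0 -normr_le0 leNgt; apply/negP => Lb.
  have [dl dl0 H] := L_cont b0 Lb.
  pose m := minr dl (b - a); have m0 : 0 < m by rewrite lt_min dl0 subr_gt0.
  have mdl : m <= dl by rewrite ge_min lexx.
  have mba : m <= b - a by rewrite ge_min lexx orbT.
  have A1 : 0 <= b - m / 2 by lra.
  have A2 : `|b - m / 2 - b| < dl by rewrite addrAC subrr add0r normrN ger0_norm; lra.
  by have := H _ A1 A2; rewrite Lt ?(distrC (L a)) ?ltxx//; lra.
rewrite /g Leq subrr addr0 max_l//.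
by move: gb; rewrite /g Leq subrr addr0 => /ltW.
Qed.

Lemma z0_ge0 : 0 <= z0.
Proof.
have := Z_ge0 (lexx 0); rewrite Ztot// L_0 addr0 subr0.
have -> : nA 0 = 0%N by apply/eqP; rewrite -leqn0 leqNgt -nAE -ltNge Tarr_gt0.
by rewrite big_ord0 addr0.
Qed.

Lemma Z_0 : Z 0 = z0.
Proof.
rewrite Ztot// L_0 addr0 subr0.
have -> : nA 0 = 0%N by apply/eqP; rewrite -leqn0 leqNgt -nAE -ltNge Tarr_gt0.
by rewrite big_ord0 addr0.
Qed.

Lemma Woff_0 : Woff u Z 0 = maxr (z0 - u 0%N) 0.
Proof.
have T0 : Tarr u 0 = u 0%N by rewrite /Tarr big_ord1.
rewrite WoffE big_ord0 addr0 T0.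
have := @drain 0 (u 0%N) z0 (lexx 0) (u_gt0 0) z0_ge0.
rewrite L_0 !subr0; apply => t /andP[t0 tu]; rewrite Ztot//.
have -> : nA t = 0%N by apply/eqP; rewrite -leqn0 leqNgt -nAE -ltNge T0.
by rewrite big_ord0 addr0 !subr0.
Qed.

Lemma Woff_S i : Woff u Z i.+1 = maxr (Woff u Z i + acc i * V i - u i.+1) 0.
Proof.
have TS : Tarr u i.+1 = Tarr u i + u i.+1 by rewrite /Tarr big_ord_recr.
have T0 := Tarr_gt0 i.
have Tlt : Tarr u i < Tarr u i.+1 by exact: T_lt.
have Zt0 : 0 <= Z (Tarr u i) by apply: Z_ge0; exact: ltW.
have nT : nA (Tarr u i) = i.+1.
  by apply/eqP; rewrite eqn_leq -nAE lexx andbT leqNgt -nAE -ltNge; exact: T_lt.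
have DR t : Tarr u i <= t < Tarr u i.+1 -> Z t = Z (Tarr u i) - (t - Tarr u i) + (L t - L (Tarr u i)).
  move=> /andP[t1 t2]; have t0 : 0 <= t by rewrite (le_trans (ltW T0)).
  rewrite Ztot// [Z (Tarr u i)]Ztot ?(ltW T0)// nT.
  have -> : nA t = i.+1.
    by apply/eqP; rewrite eqn_leq -nAE t1 andbT leqNgt -nAE -ltNge.
  by ring.
have := @drain (Tarr u i) (Tarr u i.+1) (Z (Tarr u i)) (ltW T0) Tlt Zt0 DR.
have -> : Tarr u i.+1 - Tarr u i = u i.+1 by rewrite TS; ring.
rewrite -Z_arr => <-; rewrite WoffE Ztot ?(ltW T0)// nT TS; ring.
Qed.

(** Lindley's recursion. It expresses the wait offered to customer [i] through the start, the
    interarrival times and the service and patience times of earlier customers, which is the source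
    of its measurability and of its independence of [V i] and [D i]. *)
Fixpoint Wrec (u V D : nat -> R) (z0 : R) (i : nat) : R :=
  if i is i'.+1 then maxr (Wrec u V D z0 i' + (nat_of_bool (Wrec u V D z0 i' < D i'))%:R * V i' - u i) 0
  else maxr (z0 - u 0%N) 0.

Lemma Woff_rec i : Woff u Z i = Wrec u V D z0 i.
Proof. by elim: i => [|i IH]; [exact: Woff_0|rewrite Woff_S /acc IH]. Qed.

Lemma Woff_near i (s q e : R) : s < Tarr u i -> (forall r, s <= r < Tarr u i -> `|Z r - q| <= e) ->
  `|Woff u Z i - q| <= e.
Proof.
move=> sT H; have := @Woff_lim i; rewrite WoffE; set l := (X in _ --> X) => Hl.
rewrite leNgt; apply/negP => lq.
have d0 : 0 < `|l - q| - e by rewrite subr_gt0.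
have F1 : \forall r \near (Tarr u i)^'-, `|l - Z r| < `|l - q| - e by move/cvgrPdist_lt : Hl; apply.
have F2 : \forall r \near (Tarr u i)^'-, s <= r < Tarr u i.
  rewrite near_withinE; apply/nbhs_ballP; exists (Tarr u i - s); first by rewrite /= subr_gt0.
  move=> r; rewrite /ball /= => rt tr; rewrite tr andbT.
  by move: rt; rewrite ger0_norm ?subr_ge0 ?(ltW tr)//; lra.
have [r [G1 G2]] : exists r, `|l - Z r| < `|l - q| - e /\ s <= r < Tarr u i.
  by have [r []] := @filter_ex _ _ (at_left_proper_filter _) _ (filterI F1 F2); exists r.
by have := H r G2; have := ler_distD (Z r) l q; lra.
Qed.

Lemma Z_cadlag : cadlag Z.
Proof.
have cY := cnt_cadlag Tarr_nd T_unb (fun i => acc i * V i).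
have cL : cadlag (fun t => z0 - t + L t).
  apply: cont0_cadlag; apply: cont0D; last exact: L_cont.
  by apply: cont0B; [exact: cont0_cst|exact: cont0_id].
have [c1 c2] := cadlagD cY cL.
have eZ t : 0 <= t -> \sum_(i < nA t) (acc i * V i) + (z0 - t + L t) = Z t.
  by move=> t0; rewrite Ztot//; ring.
split=> t t0.
  rewrite -eZ//; apply: cvg_trans (c1 t t0); apply: near_eq_cvg.
  rewrite near_withinE; near=> r => tr; apply: eZ; exact: le_trans (ltW tr).
have /cvg_ex[l Hl] := c2 t t0; apply/cvg_ex; exists l.
apply: cvg_trans Hl; apply: near_eq_cvg.
rewrite near_withinE; apply/nbhs_ballP; exists t => // r; rewrite /ball /= => rt tr.
by apply: eZ; move: rt; rewrite ger0_norm ?subr_ge0 ?(ltW tr)//; lra.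
Unshelve. all: by end_near. Qed.

Lemma L_cadlag : cadlag L. Proof. apply: cont0_cadlag; exact: L_cont. Qed.

Lemma Y_cadlag : cadlag (Ywork u V D Z).
Proof.
have -> : Ywork u V D Z = fun t => \sum_(i < nA t) (acc i * V i) by apply/funext => t; exact: YworkE.
exact: (cnt_cadlag Tarr_nd T_unb (fun i => acc i * V i)).
Qed.

Lemma A0_cadlag : cadlag (A0count u D Z).
Proof.
have -> : A0count u D Z = fun t => \sum_(i < nA t) acc i by apply/funext => t; exact: A0countE.
exact: (cnt_cadlag Tarr_nd T_unb acc).
Qed.

Lemma Y_nd (s t : R) : s <= t -> \sum_(i < nA s) (acc i * V i) <= \sum_(i < nA t) (acc i * V i).
Proof.
move=> st; have := cnt_nd Tarr_nd T_unb st; rewrite -/(nA s) -/(nA t) => /subnKC <-.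
rewrite big_split_ord /= lerDl; apply: sumr_ge0 => i _; rewrite mulr_ge0//.
Qed.

Lemma Z_locint : locint Z.
Proof.
split.
  apply: (@eq_measurable_fun _ _ _ _ _ (fun t => \sum_(i < nA t) (acc i * V i) + (z0 - t + L t))).
    by move=> t; rewrite inE /= in_itv /= andbT => t0; rewrite Ztot//; ring.
  apply: measurable_funD.
    by apply: nondecreasing_measurable => // s t st; exact: Y_nd.
  apply: (cont0_locint _).1; apply: cont0D; last exact: L_cont.
  by apply: cont0B; [exact: cont0_cst|exact: cont0_id].
move=> T; exists (`|z0| + \sum_(i < nA T) (acc i * V i) + T) => t /andP[t0 tT].
rewrite ger0_norm ?Z_ge0// Ztot//.
have := L_lip (lexx 0) t0; rewrite L_0 !subr0 => /andP[_ ?].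
have := Y_nd tT; have := ler_norm z0; lra.
Qed.

End workload.

Lemma sum_nat_le (R : realType) (m n : nat) (f : nat -> R) (M : R) : (m <= n)%N ->
  (forall i, (m <= i < n)%N -> `|f i| <= M) ->
  `|\sum_(i < n) f i - \sum_(i < m) f i| <= (n%:R - m%:R) * M.
Proof.
move=> mn H; rewrite -!(big_mkord xpredT f) (big_cat_nat (leq0n m) mn) /= addrAC subrr add0r.
rewrite -natrB// mulr_natl -sumr_const_nat.
apply: (le_trans (ler_norm_sum _ _ _)); rewrite big_nat_cond [leRHS]big_nat_cond.
by apply: ler_sum => i /andP[/H].
Qed.

(** [s] is the first time at which the clock [p q + x2 q] reaches [a + y]. The crude bound [K] first
    places [s] within [kappa] of [t]; then the modulus of [x2] replaces [x2 s] by [x2 t] at cost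
    [r], and the other [r] covers the overshoot at [s], where the clock may jump. *)
Lemma inverse_clock {R : realType} (x2 : R -> R) (t s p a y r kappa K N : R) : 0 < p -> 0 <= t <= N -> 0 <= s ->
  0 < kappa -> kappa <= r -> r <= 1 -> `|a - p * t| <= p * (kappa / 2) -> 2 * K <= p * (kappa / 2) -> `|y| <= K ->
  (forall q : R, 0 <= q <= N + 1 -> `|x2 q| <= K) ->
  (forall q v : R, 0 <= q <= N + 1 -> 0 <= v <= N + 1 -> `|q - v| <= kappa -> `|x2 q - x2 v| <= r) ->
  `|x2 0| <= r -> 0 <= a + y -> a + y <= p * s + x2 s -> (forall q, 0 <= q -> q < s -> p * q + x2 q < a + y) ->
  `|p * s - a - (y - x2 t)| <= 2 * r.
Proof.
move=> p0 /andP[t0 tN] s0 k0 kr r1; rewrite ler_norml => /andP[E1 E1'] E2 yK bd osc x20 ay0 IA IB.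
move: yK; rewrite ler_norml => /andP[y1 y2].
have st1 : s <= t + kappa.
  rewrite leNgt; apply/negP => h.
  have tk0 : 0 <= t + kappa by lra.
  have h2 : 0 <= t + kappa <= N + 1 by lra.
  by move: (bd _ h2) (IB _ tk0 h); rewrite ler_norml => /andP[? ?]; rewrite mulrDr; lra.
have sN : 0 <= s <= N + 1 by lra.
have tN1 : 0 <= t <= N + 1 by lra.
have st2 : t - kappa <= s.
  rewrite leNgt; apply/negP => h.
  have h3 : p * s < p * (t - kappa) by rewrite ltr_pM2l.
  by move: (bd _ sN); rewrite ler_norml => /andP[? ?]; move: h3; rewrite mulrBr; lra.
have st : `|s - t| <= kappa by rewrite ler_norml; lra.
move: (osc _ _ sN tN1 st); rewrite ler_norml => /andP[p2 p2'].
rewrite ler_norml; apply/andP; split; first by lra.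
rewrite leNgt; apply/negP => g0.
(* At [s = 0] no earlier time witnesses that the level had not been reached; the smallness of [x2 0]
   and [0 <= a + y] take over. *)
have [s00|sn0] := eqVneq s 0.
  move: x20; rewrite ler_norml => /andP[? ?].
  by move: g0 p2 p2'; rewrite s00 mulr0; lra.
have sp : 0 < s by rewrite lt_neqAle eq_sym sn0.
set g := p * s - a - (y - x2 t) in g0.
(* Step back from [s] by an [m] so short that [p * m] uses up at most half of the assumed excess
   over [2 r]. *)
pose m := minr (minr s kappa) ((g - 2 * r) / (2 * p)).
have m1 : m <= s by rewrite /m !ge_min lexx.
have m2 : m <= kappa by rewrite /m !ge_min lexx !orbT.
have m3 : m <= (g - 2 * r) / (2 * p) by rewrite /m !ge_min lexx !orbT.
have m4 : 0 < m.
  by rewrite /m !lt_min sp k0 /= divr_gt0// ?subr_gt0// mulr_gt0.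
have sm0 : 0 <= s - m by rewrite subr_ge0.
have sms : s - m < s by rewrite ltrBlDr ltrDl.
have h := IB (s - m) sm0 sms.
have sm : 0 <= s - m <= N + 1 by lra.
have sk : `|s - m - s| <= kappa by rewrite addrAC subrr add0r normrN gtr0_norm.
move: (osc _ _ sm sN sk); rewrite ler_norml => /andP[? ?].
have m5 : p * m <= (g - 2 * r) / 2.
  by move: m3; rewrite ler_pdivlMr ?mulr_gt0// [m * _]mulrC; clearbody m g; lra.
move: h m5 g0; rewrite /g mulrBr; clearbody m; lra.
Qed.

Section windows.
Context {R : realType}.
(** Chaining over windows of length [kappa]: the linear part of the bound adds up to [c1 * t], the
    constant part is paid once per window. *)
Lemma window_bound (H : R -> R) (N kappa c1 c2 : R) : 0 < kappa -> 0 <= c2 -> H 0 = 0 ->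
  (forall s t : R, 0 <= s -> s <= t -> t <= N -> t - s <= kappa ->
     `|H t - H s| <= c1 * (t - s) + c2) ->
  forall t : R, 0 <= t <= N -> `|H t| <= c1 * t + c2 * (t / kappa + 1).
Proof.
move=> k0 c20 H0 HH t /andP[t0 tN].
have step (j : nat) (q : R) : 0 <= q -> q <= N -> q <= j%:R * kappa -> `|H q| <= c1 * q + c2 * j%:R.
  elim: j q => [|j IH] q q0 qN qj.
    by move: qj; rewrite mul0r => qj; have -> : q = 0 by [lra]; rewrite H0 normr0 !mulr0 addr0.
  have [qj'|qj'] := leP q (j%:R * kappa).
    apply: (le_trans (IH q q0 qN qj')); rewrite lerD2l ler_wpM2l// ler_nat; exact: leqnSn.
  have j0 : 0 <= j%:R * kappa by rewrite mulr_ge0// ltW.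
  have h1 := HH (j%:R * kappa) q j0 (ltW qj') qN.
  have h2 := IH (j%:R * kappa) j0 (ltac:(lra)) (lexx _).
  have h3 : q - j%:R * kappa <= kappa by move: qj; rewrite -natr1; lra.
  move: (h1 h3) h2; have := ler_distD (H (j%:R * kappa)) (H q) 0; rewrite !subr0 -natr1; lra.
have t1 : 0 <= t / kappa by rewrite divr_ge0// ltW.
have /andP[n1 n2] := truncn_itv t1.
apply: (le_trans (step (truncn (t / kappa)).+1 t t0 tN _)).
  by rewrite -ler_pdivrMr// ltW.
by rewrite lerD2l ler_wpM2l// -natr1 lerD2r.
Qed.
End windows.

(** * The scaled queue along one good path *)

Section scaled.
Context {R : realType}.
Variables (u V D : nat -> R) (z0 : R) (Z L : R -> R).
Hypothesis u_gt0 : forall i, 0 < u i.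
Hypothesis V_ge0 : forall i, 0 <= V i.
Hypothesis T_unb : forall t, exists n, t < Tarr u n.
Hypothesis U_unb : forall t : R, exists n, t < \sum_(j < n.+1) V j.
Hypothesis dyn : vwt_dyn u V D z0 Z L.
Variables (B lam mu K r kappa N M0 Cc beta : R) (k : nat) (Fa : R -> R).

(** [B] stands for alpha^(-h), so this is the diffusion scaling of the statement. Below, [r] is the
    tolerance, [kappa] the length of the windows over which the inputs move by at most [r], [N] the
    horizon, [K] a bound for the inputs and [M0] one for the rates. *)
Definition scl (x : R -> R) (q t : R) := B^-1 * (x (B ^+ 2 * t) - B ^+ 2 * q * t).
Let x1 := scl (Acount u) lam.
Let x2 := scl (Scount V) mu.
Let A t := nA T_unb (B ^+ 2 * t).
Let cB := B * (lam / mu - 1).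

Hypothesis num1 : [/\ 1 <= B, 0 < r <= 1, 0 < kappa <= r, 0 <= N & 1 <= K].
Hypothesis num2 : [/\ 0 < mu, mu^-1 <= M0, mu <= M0, 0 < lam & lam <= M0].
Hypothesis num3 : `|lam / mu - 1| * (N + 1) <= kappa / 2.
Hypothesis num4 : 2 * K * M0 <= B * (kappa / 2).
Hypothesis num5 : `|cB| <= Cc.
Hypothesis num6 : N / kappa + 1 <= B.
Hypothesis osc1 : forall s t : R, 0 <= s <= N + 1 -> 0 <= t <= N + 1 -> `|s - t| <= kappa -> `|x1 s - x1 t| <= r.
Hypothesis osc2 : forall s t : R, 0 <= s <= N + 1 -> 0 <= t <= N + 1 -> `|s - t| <= kappa -> `|x2 s - x2 t| <= r.
Hypothesis bd1 : forall t : R, 0 <= t <= N + 1 -> `|x1 t| <= K.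
Hypothesis bd2 : forall t : R, 0 <= t <= N + 1 -> `|x2 t| <= K.
Hypothesis x20 : `|x2 0| <= r.
Hypothesis zt_le : B^-1 * z0 <= K.

Let B0 : 0 < B. Proof. by have [h _ _ _ _] := num1; lra. Qed.
Let Bn0 : B != 0. Proof. by rewrite gt_eqF. Qed.
Let mun0 : mu != 0. Proof. by have [h _ _ _ _] := num2; rewrite gt_eqF. Qed.

Lemma A_x1 t : (A t)%:R = B ^+ 2 * lam * t + B * x1 t.
Proof. by rewrite /x1 /scl (AcountE u_gt0 T_unb) -/(A t) mulrA mulfV// mul1r; ring. Qed.

Lemma S_x2 t : (nS U_unb (B ^+ 2 * t))%:R = B ^+ 2 * mu * t + B * x2 t.
Proof. by rewrite /x2 /scl (ScountE V_ge0 U_unb) mulrA mulfV// mul1r; ring. Qed.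

(* The work brought by the first n arrivals is read off the inverse of the
   service counting process: S(U(n)) >= n, and S(q) < n for q < U(n). *)
Lemma work_clock t : 0 <= t <= N ->
  `|scl (fun q => \sum_(i < nA T_unb q) V i) (lam / mu) t - mu^-1 * (x1 t - x2 t)| <= 2 * M0 * r.
Proof.
move=> /andP[t0 tN].
have [hB /andP[r0 r1] /andP[k0 kr] N0 K1] := num1; have [m0 mi mM l0 lM] := num2.
rewrite /scl -/(A t); set Un := \sum_(i < A t) V i; pose s := Un / B ^+ 2.
have B20 : 0 < B ^+ 2 by rewrite exprn_gt0.
have Bs : B ^+ 2 * s = Un by rewrite /s mulrC divfK// gt_eqF.
have Un0 : 0 <= Un by apply: sumr_ge0.
have s0 : 0 <= s by rewrite divr_ge0// ltW.
have IA : B * lam * t + x1 t <= B * mu * s + x2 s.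
  rewrite -(ler_pM2l B0).
  have -> : B * (B * lam * t + x1 t) = (A t)%:R by rewrite A_x1; ring.
  have -> : B * (B * mu * s + x2 s) = (nS U_unb (B ^+ 2 * s))%:R by rewrite S_x2; ring.
  rewrite Bs ler_nat; rewrite /Un; case: (A t) => [//|n].
  by rewrite -(nSE V_ge0).
have IB q : 0 <= q -> q < s -> B * mu * q + x2 q < B * lam * t + x1 t.
  move=> q0 qs; rewrite -(ltr_pM2l B0).
  have -> : B * (B * lam * t + x1 t) = (A t)%:R by rewrite A_x1; ring.
  have -> : B * (B * mu * q + x2 q) = (nS U_unb (B ^+ 2 * q))%:R by rewrite S_x2; ring.
  have qU : B ^+ 2 * q < Un by rewrite -Bs ltr_pM2l.
  have Bq : 0 <= B ^+ 2 * q by rewrite mulr_ge0// ltW.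
  rewrite ltr_nat; move: qU; rewrite /Un; case: (A t) => [|n] qU.
    by move: (le_lt_trans Bq qU); rewrite big_ord0 ltxx.
  by rewrite ltnS leqNgt -(nSE V_ge0) -ltNge.
have Bm : 0 < B * mu by rewrite mulr_gt0.
have E1 : `|B * lam * t - B * mu * t| <= B * mu * (kappa / 2).
  have -> : B * lam * t - B * mu * t = B * mu * ((lam / mu - 1) * t) by field; rewrite mun0.
  rewrite normrM (gtr0_norm Bm) ler_wpM2l ?(ltW Bm)// normrM (ger0_norm t0).
  apply: (le_trans _ num3); rewrite ler_wpM2l//; lra.
have E2 : 2 * K <= B * mu * (kappa / 2).
  have h : 1 <= mu * M0 by rewrite -ler_pdivrMl// mulr1.
  apply: (@le_trans _ _ (mu * (2 * K * M0))); last first.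
    by rewrite (_ : B * mu * _ = mu * (B * (kappa / 2))); [rewrite ler_wpM2l ?num4// ltW|ring].
  rewrite (_ : mu * _ = 2 * K * (mu * M0)); last by ring.
  by rewrite ler_peMr//; lra.
have tN1 : 0 <= t <= N + 1 by rewrite t0 (le_trans tN)// lerDl.
have tN' : 0 <= t <= N by rewrite t0.
have ay0 : 0 <= B * lam * t + x1 t.
  rewrite -(pmulr_rge0 _ B0); have -> : B * (B * lam * t + x1 t) = (A t)%:R by rewrite A_x1; ring.
  exact: ler0n.
have -> : B^-1 * (Un - B ^+ 2 * (lam / mu) * t) - mu^-1 * (x1 t - x2 t) =
  mu^-1 * (B * mu * s - B * lam * t - (x1 t - x2 t)).
  by rewrite -Bs; field; rewrite Bn0 mun0.
rewrite normrM gtr0_norm ?invr_gt0//.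
rewrite (_ : 2 * M0 * r = M0 * (2 * r)); last by ring.
apply: ler_pM => //; first by rewrite invr_ge0 ltW.
exact: (inverse_clock Bm tN' s0 k0 kr r1 E1 E2 (bd1 tN1) bd2 osc2 x20 ay0 IA IB).
Qed.

Let Zt (t : R) := B^-1 * Z (B ^+ 2 * t).
Let Lt (t : R) := B^-1 * L (B ^+ 2 * t).
Let Xt (t : R) := B^-1 * z0 + mu^-1 * (x1 t - x2 t) + cB * t.
(** The driver of the workload if nobody abandoned; [ab] is the work lost to abandonment, so that
    [Zt = Ys - ab + Lt]. *)
Let Ys (t : R) := B^-1 * z0 + scl (fun q => \sum_(i < nA T_unb q) V i) (lam / mu) t + cB * t.
Let ab t := B^-1 * \sum_(i < A t) (1 - acc u D Z i) * V i.

Let B2 : 0 < B ^+ 2. Proof. by rewrite exprn_gt0. Qed.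
Let B2t t : 0 <= t -> 0 <= B ^+ 2 * t. Proof. by move=> t0; rewrite mulr_ge0// ltW. Qed.
Let B2le s t : (B ^+ 2 * s <= B ^+ 2 * t) = (s <= t). Proof. by rewrite ler_pM2l. Qed.

Let Zt_eq t : 0 <= t -> Zt t = Ys t - ab t + Lt t.
Proof.
move=> t0; rewrite /Zt /Ys /ab /Lt /scl; have [_ [_ ->]] := dyn (B2t t0).
rewrite (YworkE V D Z u_gt0 T_unb) -/(A t).
rewrite (_ : \sum_(i < A t) acc u D Z i * V i = \sum_(i < A t) V i - \sum_(i < A t) (1 - acc u D Z i) * V i).
  by rewrite /cB; field; rewrite Bn0 mun0.
by rewrite -sumrB; apply: eq_bigr => i _; ring.
Qed.

Let Zt_ge0 t : 0 <= t -> 0 <= Zt t.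
Proof. by move=> t0; rewrite mulr_ge0 ?invr_ge0 ?(ltW B0)//; have [] := dyn (B2t t0). Qed.

Let Lt_P T : [/\ cont0 Lt, nd0 Lt, Lt 0 = 0 & flat_off Zt Lt T].
Proof.
split.
- apply: (@lip_cont0 _ _ B) => s t s0 st; rewrite /Lt -mulrBr normrM gtr0_norm ?invr_gt0//.
  have /andP[a b] := L_lip dyn (B2t s0) (ltac:(by rewrite B2le) : B ^+ 2 * s <= B ^+ 2 * t).
  rewrite ger0_norm// ler_pdivrMl// (le_trans b)// le_eqVlt; apply/orP; left; apply/eqP; ring.
- move=> s t s0 st; rewrite /Lt ler_pM2l ?invr_gt0//.
  by have /andP[a b] := L_lip dyn (B2t s0) (ltac:(by rewrite B2le) : B ^+ 2 * s <= B ^+ 2 * t); rewrite -subr_ge0.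
- by rewrite /Lt mulr0 (L_0 dyn) mulr0.
- move=> s t s0 st _ H; rewrite /Lt; congr (_ * _); apply/esym.
  apply: (L_flat dyn (B2t s0)); first by rewrite B2le.
  move=> q /andP[sq qt].
  have := H (q / B ^+ 2); rewrite ler_pdivlMr// ler_pdivrMr// ![_ * B ^+ 2]mulrC (ltW sq) qt => /(_ isT).
  by rewrite /Zt mulrCA mulfV ?gt_eqF// mulr1 pmulr_rgt0 ?invr_gt0.
Qed.

Let A_nd s t : s <= t -> (A s <= A t)%N.
Proof. by move=> st; apply: (cnt_nd (Tarr_nd u_gt0)); rewrite B2le. Qed.

Let acc01 i : 0 <= 1 - acc u D Z i. Proof. by rewrite /acc; case: (_ < _) => /=; lra. Qed.

Let ab_nd : nd0 ab.
Proof.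
move=> s t s0 st; rewrite /ab ler_pM2l ?invr_gt0//.
have /subnKC <- := A_nd st; rewrite big_split_ord /= lerDl; apply: sumr_ge0 => i _.
by rewrite mulr_ge0.
Qed.

(** Bounds the scaled workload: [K] for the start, the rest for the largest rise of [Ys] on
    [[0, N]], abandonment only lowering the workload. *)
Definition K2 := K + 4 * M0 + 4 * K * M0 + Cc * N.
(** Modulus of [Ys] in units of [r]: [4 M0] from [work_clock] at the two ends, [2 M0] from the
    inputs, [Cc] from the linear drift. *)
Definition C1 := 6 * M0 + Cc.

Let M0p : 1 <= M0.
Proof.
have [m0 mi mM l0 lM] := num2; rewrite leNgt; apply/negP => M1.
have : mu * mu^-1 < 1 by apply: (le_lt_trans (ler_wpM2l (ltW m0) mi)); nra.
by rewrite mulfV// ltxx.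
Qed.

Let Cc0 : 0 <= Cc. Proof. exact: le_trans (normr_ge0 _) num5. Qed.

Let K21 : 1 <= K2.
Proof.
have [hB /andP[r0 r1] /andP[k0 kr] N0 K1] := num1; have m := M0p; have c := Cc0.
rewrite /K2; have : 0 <= K * M0 by nra. have : 0 <= Cc * N by nra. lra.
Qed.

Let Ys_Xt t : 0 <= t <= N -> `|Ys t - Xt t| <= 2 * M0 * r.
Proof.
move=> tN; rewrite /Ys /Xt; apply: le_trans (work_clock tN).
by rewrite le_eqVlt; apply/orP; left; apply/eqP; congr (`|_|); ring.
Qed.

Let mui_norm a b : `|a| <= b -> `|mu^-1 * a| <= M0 * b.
Proof.
have [m0 mi mM l0 lM] := num2 => h; rewrite normrM gtr0_norm ?invr_gt0//.
by apply: ler_pM => //; rewrite invr_ge0 ltW.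
Qed.

Let Ys_osc s t : 0 <= s <= N -> 0 <= t <= N -> `|s - t| <= kappa -> `|Ys s - Ys t| <= C1 * r.
Proof.
move=> sN tN st; have [hB /andP[r0 r1] /andP[k0 kr] N0 K1] := num1.
have h1 := Ys_Xt sN; have h2 := Ys_Xt tN.
have o1 : `|x1 s - x1 t| <= r by apply: osc1 => //; lra.
have o2 : `|x2 s - x2 t| <= r by apply: osc2 => //; lra.
have h3 : `|(x1 s - x1 t) - (x2 s - x2 t)| <= 2 * r by apply: (le_trans (ler_normB _ _)); lra.
have h4 := mui_norm h3.
have h5 : `|cB * (s - t)| <= Cc * r.
  rewrite normrM; apply: ler_pM => //; lra.
have -> : Ys s - Ys t = (Ys s - Xt s) - (Ys t - Xt t) + mu^-1 * ((x1 s - x1 t) - (x2 s - x2 t)) + cB * (s - t).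
  by rewrite /Xt; ring.
apply: (le_trans (ler_normD _ _)); apply: le_trans (lerD (ler_normD _ _) (lexx _)) _.
apply: le_trans (lerD (lerD (ler_normB _ _) (lexx _)) (lexx _)) _.
by rewrite /C1; lra.
Qed.

Let Ys_range s t : 0 <= s <= N -> 0 <= t <= N -> Ys t - Ys s <= 4 * M0 + 4 * K * M0 + Cc * N.
Proof.
move=> sN tN; have [hB /andP[r0 r1] /andP[k0 kr] N0 K1] := num1.
have h1 := Ys_Xt sN; have h2 := Ys_Xt tN.
have sN1 : 0 <= s <= N + 1 by lra.
have tN1 : 0 <= t <= N + 1 by lra.
have h3 : `|(x1 t - x2 t) - (x1 s - x2 s)| <= 4 * K.
  apply: (le_trans (ler_normB _ _)); apply: le_trans (lerD (ler_normB _ _) (ler_normB _ _)) _.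
  by have := bd1 sN1; have := bd2 sN1; have := bd1 tN1; have := bd2 tN1; lra.
have h4 := le_trans (ler_norm _) (mui_norm h3).
have h5 : cB * (t - s) <= Cc * N.
  apply: (le_trans (ler_norm _)); rewrite normrM; apply: ler_pM => //.
  by rewrite ler_norml; lra.
have h6 : M0 * r <= M0 by rewrite ler_piMr//; have := M0p; lra.
move: h1 h2; rewrite !ler_norml => /andP[h1 h1'] /andP[h2 h2'].
have e : Xt t - Xt s = mu^-1 * ((x1 t - x2 t) - (x1 s - x2 s)) + cB * (t - s) by rewrite /Xt; ring.
move: h4; lra.
Qed.

Let Zt_up s t w : 0 <= s -> s <= t -> 0 <= w ->
  (forall q, s <= q <= t -> Ys t - Ys q <= w) -> Zt t - Zt s <= w.
Proof.
move=> s0 st w0 H; have [c1 c2 _ c4] := Lt_P t.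
by apply: (refl_upward s0 st _ _ ab_nd c1 c2 c4 H w0) => q /andP[sq qt];
  [apply: Zt_eq|apply: Zt_ge0]; exact: le_trans sq.
Qed.

Lemma scaled_Z_bound t : 0 <= t <= N -> Zt t <= K2.
Proof.
move=> /andP[t0 tN]; have [hB /andP[r0 r1] /andP[k0 kr] N0 K1] := num1.
have w0 : 0 <= 4 * M0 + 4 * K * M0 + Cc * N.
  have c := mulr_ge0 Cc0 N0; have m : 0 <= M0 by have := M0p; lra.
  have h : 0 <= K * M0 by rewrite mulr_ge0//; lra.
  lra.
have := @Zt_up 0 t _ (lexx 0) t0 w0.
have -> : Zt 0 = B^-1 * z0 by rewrite /Zt mulr0 (Z_0 u_gt0 T_unb dyn).
have h : forall q, 0 <= q <= t -> Ys t - Ys q <= 4 * M0 + 4 * K * M0 + Cc * N.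
  by move=> q qt; apply: Ys_range; lra.
by move=> /(_ h) h'; have := zt_le; rewrite /K2; lra.
Qed.

(** Truncation bounds the waits before anything is known about the losses, as the deviation
    estimates [mart0] and [mart1] require. By [scaled_Z_bound], which does not rely on them, it is
    never active for arrivals up to [N]. *)
Let w i := minr (Wrec u V D z0 i) (B * K2).
Let ind i : R := (nat_of_bool (D i <= w i))%:R.
(** [B ^ 2 * nQ] bounds the number of arrivals up to scaled time [N]. *)
Definition nQ := M0 * N + K.

Hypothesis beta0 : 0 <= beta.
Hypothesis mart0 : forall n, n%:R <= B ^+ 2 * nQ -> `|\sum_(i < n) (ind i - Fa (w i))| <= B * r.
Hypothesis mart1 : forall n, n%:R <= B ^+ 2 * nQ -> `|\sum_(i < n) (V i * ind i - mu^-1 * Fa (w i))| <= B * r.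
Hypothesis FaP : forall z, 0 <= z <= K2 -> `|B * Fa (B * z) - beta * z ^+ k| <= r.

Let z i := B^-1 * w i.
(** The scaled expected number of losses, with [B * Fa (B * z)] replaced by [beta * z ^ k]: a
    Riemann sum along the arrivals for [lam * beta] times the integral of [Zt ^ k]. *)
Let bb t := beta * ((B ^+ 2)^-1 * \sum_(i < A t) z i ^+ k).

Let wE t i : 0 <= t <= N -> (i < A t)%N -> [/\ w i = Woff u Z i, 0 <= z i <= K2 & 1 - acc u D Z i = ind i].
Proof.
move=> /andP[t0 tN] iA; have WR : Woff u Z i = Wrec u V D z0 i by apply: Woff_rec; eassumption.
have W0 : 0 <= Wrec u V D z0 i by case: i {iA WR} => [|i] /=; rewrite le_max lexx orbT.
have T0 := Tarr_gt0 u_gt0 i.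
have hT : Tarr u i / B ^+ 2 <= t by rewrite ler_pdivrMr// mulrC (nAE u_gt0 T_unb).
have hT0 : 0 <= Tarr u i / B ^+ 2 by rewrite divr_ge0// ltW.
have hZ := scaled_Z_bound (ltac:(by rewrite hT0 (le_trans hT)) : 0 <= Tarr u i / B ^+ 2 <= N).
have wW : w i = Woff u Z i.
  rewrite /w WR; apply/min_idPl.
  move: hZ; rewrite /Zt mulrCA mulfV ?gt_eqF// mulr1 ler_pdivrMl// => hZ.
  rewrite -WR; apply: le_trans hZ.
  by rewrite (Z_arr u_gt0 T_unb dyn) lerDl mulr_ge0// /acc ler0n.
split => //; last first.
  by rewrite /ind wW /acc leNgt; case: (_ < _) => /=; rewrite ?subrr ?subr0.
apply/andP; split; first by rewrite /z mulr_ge0 ?invr_ge0 ?(ltW B0)// wW WR.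
by rewrite /z ler_pdivrMl// /w ge_min lexx orbT.
Qed.

Let A_le t : 0 <= t <= N -> (A t)%:R <= B ^+ 2 * nQ.
Proof.
move=> tN; have [hB /andP[r0 r1] /andP[k0 kr] N0 K1] := num1; have [m0 mi mM l0 lM] := num2.
have tN1 : 0 <= t <= N + 1 by lra.
have := bd1 tN1; rewrite ler_norml => /andP[_ b].
rewrite A_x1 /nQ mulrDr; apply: lerD; last first.
  have : B * x1 t <= B * K by rewrite ler_wpM2l// ltW.
  by move/le_trans; apply; rewrite expr2 -mulrA ler_peMl// mulr_ge0 ?(ltW B0)//; lra.
rewrite -mulrA ler_wpM2l ?(ltW B2)//; apply: ler_pM => //; lra.
Qed.

Let nQ0 : 0 <= nQ.
Proof. have [hB /andP[r0 r1] /andP[k0 kr] N0 K1] := num1; have := M0p; rewrite /nQ; nra. Qed.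

Let Fsum t : 0 <= t <= N -> `|B^-1 * \sum_(i < A t) Fa (w i) - bb t| <= nQ * r.
Proof.
move=> tN; have [hB /andP[r0 r1] _ _ _] := num1.
have -> : B^-1 * (\sum_(i < A t) Fa (w i)) - bb t = (B ^+ 2)^-1 * \sum_(i < A t) (B * Fa (B * z i) - beta * z i ^+ k).
  rewrite /bb sumrB -!mulr_sumr mulrBr; congr (_ - _); last by rewrite mulrCA.
  rewrite mulrA; congr (_ * _); first by field.
  by apply: eq_bigr => i _; rewrite /z mulrA mulfV// mul1r.
rewrite normrM gtr0_norm ?invr_gt0// ler_pdivrMl//.
apply: (le_trans (ler_norm_sum _ _ _)).
apply: (@le_trans _ _ (\sum_(i < A t) r)).
  by apply: ler_sum => i _; apply: FaP; have [] := wE tN (ltn_ord i).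
rewrite sumr_const card_ord -mulr_natl mulrA ler_wpM2r ?(ltW r0)//; exact: A_le.
Qed.

Let sum_ind t f : 0 <= t <= N -> \sum_(i < A t) (1 - acc u D Z i) * f i = \sum_(i < A t) ind i * f i.
Proof. by move=> tN; apply: eq_bigr => i _; have [_ _ ->] := wE tN (ltn_ord i). Qed.

Definition Ca := 1 + M0 * nQ.
Let ab_bb t : 0 <= t <= N -> `|ab t - mu^-1 * bb t| <= Ca * r.
Proof.
move=> tN; have [hB /andP[r0 r1] _ _ _] := num1.
have h1 := mart1 (A_le tN); have h2 := mui_norm (Fsum tN).
rewrite /ab sum_ind//.
have -> : B^-1 * (\sum_(i < A t) ind i * V i) - mu^-1 * bb t =
  B^-1 * (\sum_(i < A t) (V i * ind i - mu^-1 * Fa (w i))) + mu^-1 * (B^-1 * \sum_(i < A t) Fa (w i) - bb t).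
  rewrite sumrB -mulr_sumr (eq_bigr (fun i : 'I_(A t) => V i * ind i)); last by move=> *; rewrite mulrC.
  by ring.
apply: (le_trans (ler_normD _ _)); rewrite /Ca mulrDl mul1r; apply: lerD; last by rewrite -mulrA.
by rewrite normrM gtr0_norm ?invr_gt0// ler_pdivrMl.
Qed.

Let a0_bb t : 0 <= t <= N -> `|B^-1 * (\sum_(i < A t) (1 - acc u D Z i)) - bb t| <= (1 + nQ) * r.
Proof.
move=> tN; have [hB /andP[r0 r1] _ _ _] := num1.
have h1 := mart0 (A_le tN); have h2 := Fsum tN.
have := @sum_ind t (fun=> 1) tN.
rewrite (eq_bigr (fun i : 'I_(A t) => 1 - acc u D Z i)); last by move=> i _; rewrite mulr1.
rewrite [X in _ = X](eq_bigr (fun i : 'I_(A t) => ind i)); last by move=> i _; rewrite mulr1.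
move=> ->.
have -> : B^-1 * (\sum_(i < A t) ind i) - bb t =
  B^-1 * (\sum_(i < A t) (ind i - Fa (w i))) + (B^-1 * \sum_(i < A t) Fa (w i) - bb t).
  by rewrite sumrB; ring.
apply: (le_trans (ler_normD _ _)); rewrite mulrDl mul1r; apply: lerD => //.
by rewrite normrM gtr0_norm ?invr_gt0// ler_pdivrMl.
Qed.

Let A_incr s t : 0 <= s -> s <= t -> t <= N -> t - s <= kappa ->
  0 <= (B ^+ 2)^-1 * ((A t)%:R - (A s)%:R) <= M0 * (t - s) + B^-1 * r /\
  `|(B ^+ 2)^-1 * ((A t)%:R - (A s)%:R) - lam * (t - s)| <= B^-1 * r.
Proof.
move=> s0 st tN ts; have [hB /andP[r0 r1] /andP[k0 kr] N0 K1] := num1; have [m0 mi mM l0 lM] := num2.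
have o1 : `|x1 t - x1 s| <= r by apply: osc1; rewrite ?ler_norml; lra.
have e : (B ^+ 2)^-1 * ((A t)%:R - (A s)%:R) = lam * (t - s) + B^-1 * (x1 t - x1 s).
  by rewrite !A_x1; field.
have h : `|B^-1 * (x1 t - x1 s)| <= B^-1 * r by rewrite normrM gtr0_norm ?invr_gt0// ler_pM2l ?invr_gt0.
have h2 : lam * (t - s) <= M0 * (t - s) by rewrite ler_wpM2r// subr_ge0.
split; last by rewrite e addrAC subrr add0r.
apply/andP; split; last by rewrite e lerD// (le_trans (ler_norm _)).
by rewrite mulr_ge0 ?invr_ge0 ?(ltW B2)// subr_ge0 ler_nat A_nd.
Qed.

Let zk_norm t i : 0 <= t <= N -> (i < A t)%N -> `|z i ^+ k| <= K2 ^+ k.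
Proof.
move=> tN iA; have [_ /andP[h1 h2] _] := wE tN iA.
by rewrite ger0_norm ?exprn_ge0// lerXn2r// nnegrE (le_trans h1).
Qed.

Let bb_incr s t : 0 <= s -> s <= t -> t <= N -> t - s <= kappa ->
  `|bb t - bb s| <= beta * K2 ^+ k * (M0 + 1) * r.
Proof.
move=> s0 st tN ts; have [hB /andP[r0 r1] /andP[k0 kr] N0 K1] := num1.
have [/andP[a1 a2] _] := A_incr s0 st tN ts.
have tN' : 0 <= t <= N by lra.
have := @sum_nat_le R (A s) (A t) (fun i => z i ^+ k) (K2 ^+ k) (A_nd st).
have h : forall i, (A s <= i < A t)%N -> `|z i ^+ k| <= K2 ^+ k by move=> i /andP[_ /zk_norm]; exact.
move=> /(_ h) {}h.
rewrite /bb -mulrBr normrM ger0_norm// -!mulrA ler_wpM2l// -mulrBr normrM gtr0_norm ?invr_gt0//.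
apply: (@le_trans _ _ ((B ^+ 2)^-1 * (((A t)%:R - (A s)%:R) * K2 ^+ k))); first by rewrite ler_pM2l ?invr_gt0.
rewrite (_ : _ * (_ * K2 ^+ k) = K2 ^+ k * ((B ^+ 2)^-1 * ((A t)%:R - (A s)%:R))); last by ring.
apply: ler_wpM2l; first by rewrite exprn_ge0//; have := K21; lra.
apply: (le_trans a2); rewrite mulrDl; apply: lerD; last by rewrite ler_pM2r// invf_le1.
by apply: ler_wpM2l; [have := M0p; lra|lra].
Qed.

Definition C2 := C1 + 2 * Ca + M0 * (beta * K2 ^+ k * (M0 + 1)).

Let K2k0 : 0 <= K2 ^+ k. Proof. by rewrite exprn_ge0//; have := K21; lra. Qed.
Let C1p : 0 <= C1. Proof. by rewrite /C1; have := M0p; have := Cc0; lra. Qed.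
Let Cap : 0 <= Ca. Proof. by rewrite /Ca; have := mulr_ge0 (ltac:(have := M0p; lra) : 0 <= M0) nQ0; lra. Qed.
Let C2p : 0 <= C2.
Proof.
have m := M0p; rewrite /C2; have : 0 <= M0 * (beta * K2 ^+ k * (M0 + 1)) by rewrite !mulr_ge0//; lra.
have := C1p; have := Cap; lra.
Qed.

(** Upward moves are due to [Ys] alone, by [Zt_up]. Downward, the push only helps, and the lost work
    [ab] stays within [Ca * r] of [mu^-1 * bb], whose increment over a window is controlled by the
    number of arrivals in it. *)
Lemma scaled_Z_modulus s t : 0 <= s <= N -> 0 <= t <= N -> `|s - t| <= kappa -> `|Zt s - Zt t| <= C2 * r.
Proof.
wlog st : s t / s <= t.
  by move=> H sN tN st; have [h|/ltW h] := leP s t; [exact: H|rewrite distrC; apply: H; rewrite // distrC].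
move=> sN tN; rewrite ler_norml => /andP[k1 _]; have [hB /andP[r0 r1] /andP[k0 kr] N0 K1] := num1.
have s0 : 0 <= s by lra.
have tN' : t <= N by lra.
have ts : t - s <= kappa by lra.
have t0 : 0 <= t by lra.
have up : Zt t - Zt s <= C1 * r.
  apply: Zt_up => //; first by rewrite mulr_ge0 ?C1p// ltW.
  move=> q sqt; apply: (le_trans (ler_norm _)); apply: Ys_osc; rewrite ?ler_norml; lra.
have ho := Ys_osc sN tN (ltac:(rewrite ler_norml; lra)).
have hb := mui_norm (bb_incr s0 st tN' ts).
have ha1 := ab_bb sN; have ha2 := ab_bb tN.
have [_ c2 _ _] := Lt_P t; have hL := c2 s t s0 st.
have e := Zt_eq s0; have e' := Zt_eq t0.
have C2e : C2 * r = C1 * r + 2 * (Ca * r) + M0 * (beta * K2 ^+ k * (M0 + 1) * r) by rewrite /C2; ring.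
have p1 : 0 <= Ca * r by rewrite mulr_ge0 ?Cap// ltW.
have p2 : 0 <= M0 * (beta * K2 ^+ k * (M0 + 1) * r) by exact: le_trans hb.
move: ho hb ha1 ha2; rewrite !ler_norml => /andP[? ?] /andP[? ?] /andP[? ?] /andP[? ?].
by apply/andP; split; rewrite C2e; lra.
Qed.

Let Zt_locint : locint Zt.
Proof.
have [mZ bZ] := Z_locint u_gt0 V_ge0 T_unb dyn; split.
  rewrite /Zt; apply: measurable_funM; first exact: measurable_cst.
  apply: (@measurable_comp _ _ _ _ _ _ (`[0, +oo[%classic : set R) Z _ (fun t => B ^+ 2 * t)) => //.
  by move=> x /= [t]; rewrite !in_itv /= !andbT => t0 <-; exact: B2t.
  by apply: (@measurable_funM _ _ _ _ (fun=> B ^+ 2) id); [exact: measurable_cst|exact: measurable_id].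
move=> T; have [M HM] := bZ (B ^+ 2 * T); exists (B^-1 * M) => t /andP[t0 tT].
by rewrite /Zt normrM gtr0_norm ?invr_gt0// ler_pM2l ?invr_gt0// HM// B2t//= B2le.
Qed.

Let I t := int0 (fun q => Zt q ^+ k) t.
Definition P0 := k%:R * K2 ^+ k * C2.
Definition C3 := 2 * M0 * P0 * N + P0 + K2 ^+ k.

Let P0p : 0 <= P0. Proof. by rewrite /P0 !mulr_ge0// ler0n. Qed.
Let Zk_ge0 t : 0 <= t -> 0 <= Zt t ^+ k. Proof. by move=> ?; rewrite exprn_ge0// Zt_ge0. Qed.

(** On a window of length [kappa] the sum over arrivals and the integral both see [Zt ^ k] within
    [P0 * r] of its value at the left end, and the scaled number of arrivals is [lam] times the
    length up to [B^-1 * r]. [window_bound] adds the windows up. *)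
Let sum_int t : 0 <= t <= N ->
  `|(B ^+ 2)^-1 * (\sum_(i < A t) z i ^+ k) - lam * I t| <= C3 * r.
Proof.
move=> tN; have [hB /andP[r0 r1] /andP[k0 kr] N0 K1] := num1; have [m0 mi mM l0 lM] := num2.
pose H t := (B ^+ 2)^-1 * (\sum_(i < A t) z i ^+ k) - lam * I t.
have lk : locint (fun q => Zt q ^+ k) by exact: locintX Zt_locint.
have A00 : A 0 = 0%N by apply/eqP; rewrite -leqn0 leqNgt -(nAE u_gt0) mulr0 -ltNge Tarr_gt0.
have H0 : H 0 = 0 by rewrite /H /I int0_0 A00 big_ord0 !mulr0 subrr.
have win (s q : R) : 0 <= s -> s <= q -> q <= N -> q - s <= kappa ->
    `|H q - H s| <= 2 * M0 * (P0 * r) * (q - s) + B^-1 * ((P0 + K2 ^+ k) * r).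
  move=> s0 sq qN qs.
  have [/andP[a1 a2] a3] := A_incr s0 sq qN qs.
  have sN := le_trans sq qN; have q0 := le_trans s0 sq.
  have qN' : 0 <= q <= N by rewrite q0.
  have mod x : s <= x <= q -> `|Zt x - Zt s| <= C2 * r.
    move=> /andP[sx xq]; apply: scaled_Z_modulus; rewrite ?s0 ?(le_trans s0 sx) ?(le_trans xq qN)//.
    by rewrite ger0_norm ?subr_ge0// (le_trans _ qs)// lerD2r.
  have kn x y e : 0 <= x <= K2 -> 0 <= y <= K2 -> `|x - y| <= e -> `|x ^+ k - y ^+ k| <= k%:R * K2 ^+ k * e.
    move=> h1 h2 h3; apply: (le_trans (normX_sub_le k K21 h1 h2)).
    by rewrite ler_wpM2l// mulr_ge0// ler0n.
  have Zb x : s <= x <= q -> 0 <= Zt x <= K2.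
    move=> /andP[sx xq]; have x0 := le_trans s0 sx.
    by rewrite Zt_ge0//= scaled_Z_bound// x0 (le_trans xq qN).
  have P0e : P0 * r = k%:R * K2 ^+ k * (C2 * r) by rewrite /P0; ring.
  have Zs0 : 0 <= Zt s <= K2 by apply: Zb; rewrite lexx sq.
  have zi i : (A s <= i < A q)%N -> `|z i ^+ k - Zt s ^+ k| <= P0 * r.
    move=> /andP[i1 iq]; have [wW zb _] := wE qN' iq.
    rewrite P0e; apply: kn => //.
    have hT1 : B ^+ 2 * s < Tarr u i by rewrite ltNge (nAE u_gt0 T_unb) -leqNgt.
    have hT2 : Tarr u i <= B ^+ 2 * q by rewrite (nAE u_gt0 T_unb).
    (* The wait of customer [i] is a left limit of the workload; the modulus of [Zt] is carried over
       to it by [Woff_near]. *)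
    have hn : forall x, B ^+ 2 * s <= x < Tarr u i -> `|Z x - B * Zt s| <= B * (C2 * r).
      move=> x /andP[x1' x2'].
      have h := mod (x / B ^+ 2); rewrite ler_pdivlMr// ler_pdivrMr// ![_ * B ^+ 2]mulrC x1' in h.
      have {h} := h (le_trans (ltW x2') hT2).
      rewrite {1}/Zt mulrCA mulfV ?gt_eqF// mulr1 => h.
      rewrite -{1}(mulVKf Bn0 (Z x)) -mulrBr.
      by rewrite normrM (gtr0_norm B0) ler_pM2l.
    have := Woff_near u_gt0 T_unb dyn hT1 hn.
    rewrite -wW => h.
    have -> : z i - Zt s = B^-1 * (w i - B * Zt s) by rewrite /z mulrBr mulrA mulVf// mul1r.
    by rewrite normrM gtr0_norm ?invr_gt0// ler_pdivrMl.
  have s1 := @sum_nat_le R (A s) (A q) (fun i => z i ^+ k - Zt s ^+ k) (P0 * r) (A_nd sq) zi.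
  have s2 : `|I q - I s - Zt s ^+ k * (q - s)| <= P0 * r * (q - s).
    have lc := locint_cst (Zt s ^+ k).
    have ld : locint (fun x => Zt x ^+ k + - 1 * Zt s ^+ k) by apply: locintD => //; exact: locint_cst.
    have := @int0_lip _ (fun x => Zt x ^+ k + - 1 * Zt s ^+ k) s q (P0 * r) ld s0 sq.
    rewrite !int0D ?int0_cst//; [|exact: locint_cst|exact: locint_cst].
    rewrite -/(I q) -/(I s) => h.
    rewrite (_ : _ - _ = I q + -1 * Zt s ^+ k * q - (I s + -1 * Zt s ^+ k * s)); last by ring.
    apply: h => x /andP[/ltW sx xq]; have sx' : s <= x <= q by rewrite sx.
    by rewrite P0e mulN1r; exact: (kn _ _ _ (Zb _ sx') Zs0 (mod _ sx')).
  have Zs : 0 <= Zt s ^+ k <= K2 ^+ k.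
    have /andP[h1 h2] := Zs0.
    by rewrite exprn_ge0//= lerXn2r// nnegrE (le_trans h1).
  set m := (B ^+ 2)^-1 * ((A q)%:R - (A s)%:R) in a1 a2 a3.
  have e : H q - H s = (B ^+ 2)^-1 * (\sum_(i < A q) (z i ^+ k - Zt s ^+ k) - \sum_(i < A s) (z i ^+ k - Zt s ^+ k))
      + Zt s ^+ k * (m - lam * (q - s)) - lam * (I q - I s - Zt s ^+ k * (q - s)).
    by rewrite !sumrB !sumr_const !card_ord /H /m -[_ *+ A q]mulr_natr -[_ *+ A s]mulr_natr; ring.
  rewrite e; apply: (le_trans (ler_normB _ _)); apply: le_trans (lerD (ler_normD _ _) (lexx _)) _.
  have g1 : `|(B ^+ 2)^-1 * (\sum_(i < A q) (z i ^+ k - Zt s ^+ k) - \sum_(i < A s) (z i ^+ k - Zt s ^+ k))| <= (M0 * (q - s) + B^-1 * r) * (P0 * r).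
    rewrite normrM gtr0_norm ?invr_gt0//.
    apply: (@le_trans _ _ (m * (P0 * r))); last by rewrite ler_wpM2r// mulr_ge0// ltW.
    by rewrite /m -mulrA ler_pM2l ?invr_gt0.
  have g2 : `|Zt s ^+ k * (m - lam * (q - s))| <= K2 ^+ k * (B^-1 * r).
    by have /andP[z1 z2] := Zs; rewrite normrM (ger0_norm z1); exact: ler_pM.
  have g3 : `|lam * (I q - I s - Zt s ^+ k * (q - s))| <= M0 * (P0 * r * (q - s)).
    by rewrite normrM (gtr0_norm l0); apply: ler_pM => //; exact: ltW.
  have g4 : B^-1 * r * (P0 * r) <= B^-1 * (P0 * r).
    rewrite -mulrA ler_pM2l ?invr_gt0// ler_piMl// mulr_ge0//; exact: ltW.
  apply: (le_trans (lerD (lerD g1 g2) g3)).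
  rewrite [leLHS](_ : _ = 2 * M0 * (P0 * r) * (q - s) + (B^-1 * r * (P0 * r) + B^-1 * (K2 ^+ k * r))); last by ring.
  by rewrite lerD2l mulrDl mulrDr lerD2r.
have c20 : 0 <= B^-1 * ((P0 + K2 ^+ k) * r).
  by rewrite !mulr_ge0 ?invr_ge0 ?(ltW B0) ?(ltW r0)// addr_ge0.
apply: (le_trans (window_bound k0 c20 H0 win tN)).
have pp : 0 <= P0 * r by rewrite mulr_ge0// ltW.
have h1 : 2 * M0 * (P0 * r) * t <= 2 * M0 * (P0 * r) * N.
  apply: ler_wpM2l; last by case/andP: tN.
  by rewrite -mulrA mulr_ge0// mulr_ge0// (le_trans ler01 M0p).
(* There are at most [N / kappa + 1 <= B] windows, which the factor [B^-1] in the constant part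
   compensates. *)
have h2 : B^-1 * ((P0 + K2 ^+ k) * r) * (t / kappa + 1) <= (P0 + K2 ^+ k) * r.
  rewrite mulrAC -[leRHS]mul1r ler_wpM2r//; first by rewrite mulr_ge0 ?(ltW r0)// addr_ge0.
  rewrite ler_pdivrMl// mulr1; apply: le_trans num6; rewrite lerD2r ler_pM2r ?invr_gt0//; lra.
rewrite /C3; lra.
Qed.

Let I_bound t : 0 <= t <= N -> 0 <= I t <= K2 ^+ k * N.
Proof.
move=> tN; have lk : locint (fun q => Zt q ^+ k) by exact: locintX Zt_locint.
have t0 : 0 <= t by lra.
have h : 0 <= I t.
  rewrite -(int0_0 (fun q => Zt q ^+ k)); apply: int0_ge0 => // x /andP[x0 _]; apply: Zk_ge0; exact: ltW.
rewrite h /=.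
have := @int0_lip _ _ 0 t (K2 ^+ k) lk (lexx 0) t0; rewrite int0_0 !subr0 => H.
apply: (le_trans (ler_norm _)); apply: le_trans (H _) _; last by rewrite ler_wpM2l//; lra.
move=> x xt; have x0 : 0 <= x by lra.
have hb := scaled_Z_bound (ltac:(lra) : 0 <= x <= N).
by rewrite ger0_norm ?Zk_ge0// lerXn2r// nnegrE ?Zt_ge0//; have := K21; lra.
Qed.

Let rho1 : `|lam / mu - 1| <= r.
Proof.
have [hB /andP[r0 r1] /andP[k0 kr] N0 K1] := num1.
have h := num3; have := mulr_ge0 (normr_ge0 (lam / mu - 1)) N0; lra.
Qed.

Let bb_I t : 0 <= t <= N -> `|bb t - lam * (beta * I t)| <= beta * C3 * r.
Proof.
move=> tN; have h := sum_int tN.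
have -> : bb t - lam * (beta * I t) = beta * ((B ^+ 2)^-1 * (\sum_(i < A t) z i ^+ k) - lam * I t).
  by rewrite /bb; ring.
by rewrite normrM ger0_norm// -[leRHS]mulrA ler_wpM2l.
Qed.

Let lamI t : 0 <= t <= N -> `|lam / mu * (beta * I t) - beta * I t| <= beta * (K2 ^+ k * N) * r.
Proof.
move=> tN; have /andP[i0 iN] := I_bound tN.
have -> : lam / mu * (beta * I t) - beta * I t = (lam / mu - 1) * (beta * I t) by ring.
have bi : 0 <= beta * I t by rewrite mulr_ge0.
rewrite normrM (ger0_norm bi) mulrC; apply: ler_pM => //.
by rewrite ler_wpM2l.
Qed.

Definition C4 := 2 * M0 + Ca + nQ + 1 + (M0 + 1) * (beta * C3 + beta * (K2 ^+ k * N)).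

Let C3p : 0 <= C3.
Proof.
have [hB _ _ N0 _] := num1; have p := P0p; have m := M0p; rewrite /C3.
have : 0 <= 2 * M0 * P0 * N by rewrite !mulr_ge0//; lra.
have := K2k0; lra.
Qed.

Let ab_I t : 0 <= t <= N -> `|ab t - beta * I t| <= (C4 - 2 * M0) * r.
Proof.
move=> tN; have [hB /andP[r0 r1] /andP[k0 kr] N0 K1] := num1; have m := M0p.
have h1 := ab_bb tN; have h2 := mui_norm (bb_I tN); have h3 := lamI tN.
have -> : ab t - beta * I t = (ab t - mu^-1 * bb t) + mu^-1 * (bb t - lam * (beta * I t)) +
   (lam / mu * (beta * I t) - beta * I t) by ring.
apply: (le_trans (ler_normD _ _)); apply: le_trans (lerD (ler_normD _ _) (lexx _)) _.
have p1 : 0 <= nQ * r by rewrite mulr_ge0 ?(ltW r0).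
have p2 : 0 <= M0 * (beta * (K2 ^+ k * N) * r) by rewrite !mulr_ge0 ?(ltW r0)//; lra.
have p3 : 0 <= beta * C3 * r by rewrite !mulr_ge0 ?(ltW r0).
rewrite /C4; lra.
Qed.

(** The exact drift is added back to the driver: the reflected equation then holds exactly and the
    whole error sits in the driver, where stability can absorb it. *)
Lemma scaled_rsol : exists2 y, rsol beta k y Zt Lt N & forall t, 0 <= t <= N -> `|y t - Xt t| <= C4 * r.
Proof.
exists (fun t => Ys t - ab t + drift beta k Zt t).
  split; [exact: Zt_locint|exact: Zt_ge0| |exact: Lt_P].
  by move=> t /andP[t0 _]; rewrite Zt_eq//; ring.
move=> t tN; have h1 := Ys_Xt tN; have h2 := ab_I tN.
have -> : Ys t - ab t + drift beta k Zt t - Xt t = (Ys t - Xt t) - (ab t - beta * I t) by rewrite /drift -/(I t); ring.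
by apply: (le_trans (ler_normB _ _)); lra.
Qed.

Lemma scaled_Y t : 0 <= t <= N ->
  `|scl (Ywork u V D Z) (lam / mu) t - (mu^-1 * (x1 t - x2 t) - drift beta k Zt t)| <= C4 * r.
Proof.
move=> tN; have h1 := work_clock tN; have h2 := ab_I tN.
have -> : scl (Ywork u V D Z) (lam / mu) t = scl (fun q => \sum_(i < nA T_unb q) V i) (lam / mu) t - ab t.
  rewrite /scl (YworkE V D Z u_gt0 T_unb) -/(A t) /ab.
  rewrite (_ : \sum_(i < A t) acc u D Z i * V i = \sum_(i < A t) V i - \sum_(i < A t) (1 - acc u D Z i) * V i); first by ring.
  by rewrite -sumrB; apply: eq_bigr => i _; ring.
rewrite /drift -/(I t).
set w1 := scl _ _ t in h1 *.
rewrite (_ : _ - _ = (w1 - mu^-1 * (x1 t - x2 t)) - (ab t - beta * I t)); last by ring.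
by apply: (le_trans (ler_normB _ _)); lra.
Qed.

(** The scaled number of losses is close to [lam * beta * I], and [lam] is exchanged for [mu]
    because their ratio is within [r] of 1. *)
Lemma scaled_A0 t : 0 <= t <= N ->
  `|scl (A0count u D Z) lam t - (x1 t - mu * drift beta k Zt t)| <= C4 * r.
Proof.
move=> tN; have [hB /andP[r0 r1] /andP[k0 kr] N0 K1] := num1; have [m0 mi mM l0 lM] := num2.
have h1 := a0_bb tN; have h2 := bb_I tN; have h3 := lamI tN; have m := M0p.
have e : scl (A0count u D Z) lam t = x1 t - B^-1 * \sum_(i < A t) (1 - acc u D Z i).
  rewrite /x1 /scl (A0countE D Z u_gt0 T_unb) (AcountE u_gt0 T_unb) -/(A t) sumrB sumr_const card_ord.
  by rewrite -mulr_natl; ring.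
have h4 : `|mu * (lam / mu * (beta * I t) - beta * I t)| <= M0 * (beta * (K2 ^+ k * N) * r).
  by rewrite normrM gtr0_norm//; apply: ler_pM => //; exact: ltW.
rewrite e /drift -/(I t); set q := B^-1 * _ in h1 *.
rewrite (_ : _ - _ = - ((q - bb t) + (bb t - lam * (beta * I t)) + mu * (lam / mu * (beta * I t) - beta * I t))); last by field.
rewrite normrN; apply: (le_trans (ler_normD _ _)); apply: le_trans (lerD (ler_normD _ _) (lexx _)) _.
have p1 : 0 <= M0 * r by rewrite mulr_ge0 ?(ltW r0)//; lra.
have p2 : 0 <= beta * (K2 ^+ k * N) * r by rewrite !mulr_ge0 ?(ltW r0)//.
have p3 : 0 <= M0 * (beta * C3 * r) by rewrite !mulr_ge0 ?(ltW r0)//; lra.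
have p4 : 0 <= Ca * r by rewrite mulr_ge0 ?(ltW r0).
rewrite /C4; lra.
Qed.

End scaled.

(** * Acceptance decisions *)

Section probability_facts.
Context {d} {Om : measurableType d} {R : realType}.
Variable P : probability Om R.

Lemma prob_ge0 (A : set Om) : 0 <= fine (P A).
Proof. exact: fine_ge0. Qed.

Lemma prob_mono (A B : set Om) : measurable A -> measurable B -> A `<=` B -> fine (P A) <= fine (P B).
Proof. by move=> mA mB AB; rewrite -lee_fin -!fineP//; apply: le_measure; rewrite ?inE. Qed.

Lemma prob_setU (A B : set Om) : measurable A -> measurable B ->
  fine (P (A `|` B)) <= fine (P A) + fine (P B).
Proof.
move=> mA mB; rewrite -lee_fin EFinD -!fineP//; last exact: measurableU.
exact: measureU2.
Qed.

Lemma prob_exists (A : nat -> set Om) n (e : R) : (forall i, measurable (A i)) ->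
  (forall i, (i < n)%N -> fine (P (A i)) <= e) ->
  measurable [set w | exists2 i, (i < n)%N & A i w] /\
  fine (P [set w | exists2 i, (i < n)%N & A i w]) <= n%:R * e.
Proof.
move=> mA; elim: n => [|n IH] H.
  have -> : [set w | exists2 i, (i < 0)%N & A i w] = set0 by rewrite -subset0 => w [].
  by rewrite measure0 mul0r.
have -> : [set w | exists2 i, (i < n.+1)%N & A i w] = [set w | exists2 i, (i < n)%N & A i w] `|` A n.
  apply/seteqP; split=> w /=.
    by move=> [i]; rewrite ltnS leq_eqVlt => /predU1P[->|ilt] Aw; [right|left; exists i].
  by move=> [[i ilt Aw]|Aw]; [exists i => //; rewrite ltnW|exists n].
have [m1 m2] := IH (fun i ilt => H i (ltnW ilt)).
split; first exact: measurableU.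
apply: (le_trans (prob_setU m1 (mA n))).
by rewrite -natr1 mulrDl mul1r lerD// H.
Qed.

Lemma bounded_cvg (f_ : nat -> Om -> R) (f : Om -> R) (M : R) :
  (forall n, measurable_fun setT (f_ n)) -> (forall n x, `|f_ n x| <= M) ->
  (forall x, (fun n => f_ n x) @ \oo --> f x) ->
  (fun n => \int[P]_x f_ n x) @ \oo --> \int[P]_x f x.
Proof.
move=> mf fM ff.
have M0 : 0 <= M by apply: le_trans (fM 0%N point); exact: normr_ge0.
have fM' x : `|f x| <= M.
  by apply: (cvgr_to_le (cvg_norm (ff x))); exact: nearW.
apply: (@fine_cvg _ _ _ _ (fun n => \int[P]_x (f_ n x)%:E)%E).
rewrite fineK; last exact: bounded_integral_fin fM'.
apply: (@dominated_cvg _ _ _ _ _ _ _ _ (cst M%:E)) => //.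
- by move=> n; apply/measurable_EFinP; exact: mf.
- by move=> x _; apply: cvg_EFin; [exact: nearW|exact: ff].
- by apply: (@bounded_integrable _ _ _ P (cst M) M) => // x; rewrite ger0_norm.
- by move=> n x _; rewrite /= lee_fin.
Qed.

Lemma same_law_int (X Y : Om -> R) (phi : R -> R) (M : R) :
  measurable_fun setT X -> measurable_fun setT Y -> same_law P X Y ->
  measurable_fun setT phi -> (forall x, `|phi x| <= M) ->
  \int[P]_w phi (X w) = \int[P]_w phi (Y w).
Proof.
move=> mX mY XY mphi phiM; rewrite /Rintegral; congr fine.
have H (W : Om -> R) : measurable_fun setT W ->
   (\int[pushforward P W]_y (phi y)%:E = \int[P]_w (phi (W w))%:E)%E.
  move=> mW; rewrite integral_pushforward//.
  - exact/measurable_EFinP.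
  - rewrite preimage_setT; by apply: (@bounded_integrable _ _ _ P (phi \o W) M) => [|w]; [exact: measurableT_comp|exact: phiM].
rewrite -!H//; apply: eq_measure_integral => A mA _; exact: XY.
Qed.

Lemma markov_square (f : Om -> R) (M e v : R) : measurable_fun setT f -> (forall w, `|f w| <= M) ->
  0 < e -> \int[P]_w (f w ^+ 2) <= v ->
  measurable [set w | e < `|f w|] /\ fine (P [set w | e < `|f w|]) <= v / e ^+ 2.
Proof.
move=> mf fM e0 fv.
have mA : measurable [set w | e < `|f w|].
  by apply: (measurable_set_lt (f := cst e) (g := fun w => `|f w|)) => //; exact: measurableT_comp.
split=> //; rewrite -Rintegral_indic//.
have M0 : 0 <= M by apply: le_trans (fM point); exact: normr_ge0.
have fM2 w : `|f w ^+ 2| <= M ^+ 2 by rewrite normrX lerXn2r// nnegrE.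
rewrite ler_pdivlMr ?exprn_gt0// mulrC; apply: le_trans fv.
rewrite -(@bounded_integralZ _ _ _ P _ 1)//; last exact: norm_indic_le1.
apply: (@le_bounded_integral _ _ _ P _ _ (e ^+ 2 + M ^+ 2)).
- move=> w; rewrite normrM; apply: (@le_trans _ _ (e ^+ 2)); last by rewrite lerDl exprn_ge0.
  rewrite [`|e ^+ 2|]ger0_norm ?exprn_ge0 ?(ltW e0)//.
  by rewrite ler_piMr ?exprn_ge0 ?(ltW e0)// norm_indic_le1.
- by move=> w; apply: (le_trans (fM2 w)); rewrite lerDr exprn_ge0// ltW.
move=> w; rewrite indicE; case: (boolP (w \in _)) => [|_]; last by rewrite mulr0 sqr_ge0.
rewrite inE /= mulr1 => ew; rewrite -[f w ^+ 2]real_normK ?num_real//.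
by rewrite lerXn2r ?nnegrE// ltW.
Qed.

(** * Sums of independent copies of a nonnegative variable *)

Section iid.
Variable Y : nat -> Om -> R.
Hypothesis mY : forall i, measurable_fun setT (Y i).
Hypothesis lY : forall i, same_law P (Y i) (Y 0%N).
Hypothesis iY : forall n (A : 'I_n -> set R), (forall m, measurable (A m)) ->
  P (\bigcap_(m in [set: 'I_n]) (Y m @^-1` A m)) = (\prod_(m < n) P (Y m @^-1` A m))%E.

Lemma iid_prod (phi : R -> R) n : measurable_fun setT phi -> (forall y, 0 <= phi y <= 1) ->
  \int[P]_w (\prod_(m < n) phi (Y m w)) = (\int[P]_w phi (Y 0%N w)) ^+ n.
Proof.
move=> mphi phi01.
have mA (a : R) : measurable [set y | a <= phi y].
  by apply: (measurable_set_le (f := cst a)).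
rewrite (@expect_prod _ _ _ P n (fun m w => phi (Y m w)) 1).
- transitivity (\prod_(m < n) \int[P]_w phi (Y 0%N w)); last by rewrite prodr_const card_ord.
  apply: eq_bigr => m _; apply: (@same_law_int _ _ _ 1) => //.
  by move=> y; have /andP[h1 h2] := phi01 y; rewrite ger0_norm.
- by move=> m; exact: measurableT_comp.
- by move=> m x; exact: phi01.
- move=> a; exact: (@iY n (fun m => [set y | a m <= phi y])).
Qed.

Variable m : R.
Hypothesis m0 : 0 < m.
Hypothesis Y0 : P [set w | 0 <= Y 0%N w] = 1%E.
Hypothesis EY : (\int[P]_w (Y 0%N w)%:E = m%:E)%E.

Lemma iid_ge0 : {ae P, forall w i, 0 <= Y i w}.
Proof.
apply: ae_foralln => i.
have mA : measurable [set w | 0 <= Y i w] by apply: (measurable_set_le (f := cst 0)).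
have PA : P [set w | 0 <= Y i w] = 1%E.
  by rewrite -Y0; apply: (lY i (A := [set y : R | 0 <= y])); rewrite (_ : [set y : R | 0 <= y] = `[0, +oo[%classic)//; apply/seteqP; split=> y /=; rewrite in_itv /= andbT.
exists (~` [set w | 0 <= Y i w]); split => //; first exact: measurableC.
by apply: (eq_trans (probability_setC P mA)); rewrite PA subee.
Qed.

Let Yp i w := maxr (Y i w) 0.
Let mYp i : measurable_fun setT (Yp i).
Proof. by apply: measurable_maxr => //; exact: measurable_cst. Qed.

Lemma iid_pos_int : P.-integrable setT (EFin \o Yp 0%N) /\ \int[P]_w Yp 0%N w = m.
Proof.
have E : (\int[P]_w (Yp 0%N w)%:E = m%:E)%E.
  rewrite -EY; apply: ae_eq_integral => //.
  - by apply/measurable_EFinP; exact: mYp.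
  - by apply/measurable_EFinP.
  have := iid_ge0; apply: filterS => w H _ /=; congr (_%:E); exact/max_idPl.
split; last by rewrite /Rintegral E.
apply/integrableP; split; first by apply/measurable_EFinP; exact: mYp.
rewrite (eq_integral (EFin \o Yp 0%N)); first by rewrite /= E ltry.
by move=> w _; rewrite /= ger0_norm// le_max lexx orbT.
Qed.

(** With [q = E exp(-Y)], the event that all partial sums are at most [N] has probability at most
    [exp N * q ^ n.+1] for every [n], and [q < 1] because the mean is positive. *)
Lemma iid_sum_unbounded : {ae P, forall w (t : R), exists n, t < \sum_(j < n.+1) Y j w}.
Proof.
pose phi (y : R) := expR (- maxr y 0).
have mphi : measurable_fun setT phi.
  apply: measurableT_comp => //; apply: measurableT_comp => //.
  by apply: measurable_maxr.
have phi01 y : 0 <= phi y <= 1.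
  by rewrite expR_ge0 -[leRHS]expR0 ler_expR oppr_le0 le_max lexx orbT.
have phib y : `|phi y| <= 1 by have /andP[h1 h2] := phi01 y; rewrite ger0_norm.
pose q := \int[P]_w phi (Y 0%N w).
have q0 : 0 <= q by apply: Rintegral_ge0 => w _; have /andP[] := phi01 (Y 0%N w).
have q1 : q < 1.
  (* If [q] were 1, [Y] would vanish almost surely, against its positive mean. *)
  rewrite ltNge; apply/negP => q1.
  have mg : measurable_fun setT (fun w => 1 - phi (Y 0%N w)).
    by apply: measurable_funB => //; exact: measurableT_comp.
  have I0 : \int[P]_w (1 - phi (Y 0%N w)) = 0.
    have e : \int[P]_w (1 - phi (Y 0%N w)) = 1 - q.
      rewrite RintegralB//; first by rewrite prob_integral_cst.
        by apply: (@bounded_integrable _ _ _ P (cst 1) 1) => // x; rewrite normr1.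
      by apply: (@bounded_integrable _ _ _ P (phi \o Y 0%N) 1) => [|w]; [exact: measurableT_comp|exact: phib].
    have : 0 <= \int[P]_w (1 - phi (Y 0%N w)).
      by apply: Rintegral_ge0 => w _; have /andP[_ h] := phi01 (Y 0%N w); rewrite subr_ge0.
    by rewrite e; lra.
  have I1 : (\int[P]_w `|(1 - phi (Y 0%N w))%:E| = 0)%E.
    rewrite (eq_integral (fun w => (1 - phi (Y 0%N w))%:E)); last first.
      by move=> w _; rewrite /= ger0_norm// subr_ge0; have /andP[] := phi01 (Y 0%N w).
    rewrite -[LHS]fineK; first by congr (_%:E).
    apply: (@bounded_integral_fin _ _ _ P _ 1) => w.
    by have /andP[h1 h2] := phi01 (Y 0%N w); rewrite ger0_norm; lra.
  have mgE : measurable_fun setT (fun w => (1 - phi (Y 0%N w))%:E) by exact/measurable_EFinP.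
  have [/(_ I1) ae0 _] := ae_eq_integral_abs P measurableT mgE.
  have E0 : (\int[P]_w (Y 0%N w)%:E = \int[P]_w (cst 0 w))%E.
    apply: ae_eq_integral => //; first exact/measurable_EFinP.
    near=> w => _.
    have H0 : 0 <= Y 0%N w by near: w; have := iid_ge0; apply: filterS => w; exact.
    have /(_ I)[/eqP] : setT w -> (1 - phi (Y 0%N w))%:E = 0%E by near: w.
    rewrite subr_eq0 /phi (max_idPl H0) -expR0 => /eqP/expR_inj/eqP; rewrite eq_sym oppr_eq0 => /eqP ->.
    by [].
  by move: E0; rewrite EY integral0 => -[] h; move: m0; rewrite h ltxx.
pose Sn n w := \sum_(j < n.+1) Yp j w.
have mSn n : measurable_fun setT (Sn n) by apply: measurable_sum => j; exact: mYp.
pose E N := [set w | forall n, Sn n w <= N%:R :> R].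
have mE N : measurable (E N).
  have -> : E N = \bigcap_n [set w | Sn n w <= N%:R].
    by apply/seteqP; split=> w /= H n; [move=> _; exact: H|apply: (H n)].
  by apply: bigcapT_measurable => n; apply: measurable_set_le.
have PE N : P (E N) = 0%E.
  rewrite fineP//; congr (_%:E); apply/eqP; rewrite eq_le prob_ge0 andbT.
  have B n : fine (P (E N)) <= expR N%:R * q ^+ n.+1.
    rewrite -Rintegral_indic// -iid_prod//.
    have pb w : `|\prod_(j < n.+1) phi (Y j w)| <= 1.
      by rewrite normr_prod; apply: prodr_ile1 => j _; rewrite normr_ge0 phib.
    have mp : measurable_fun setT (fun w => \prod_(j < n.+1) phi (Y j w)).
      by apply: measurable_prod => j _; exact: measurableT_comp.
    rewrite -(@bounded_integralZ _ _ _ P _ 1)//.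
    apply: (@le_bounded_integral _ _ _ P _ _ (1 + expR N%:R)).
    - by move=> w; apply: (le_trans (@norm_indic_le1 _ _ R (E N) w)); rewrite lerDl expR_ge0.
    - move=> w; rewrite normrM ger0_norm ?expR_ge0// (@le_trans _ _ (expR N%:R))//.
        by rewrite ler_piMr// expR_ge0.
      by rewrite lerDr.
    move=> w; rewrite indicE; case: (boolP (w \in _)) => [|_]; last first.
      by rewrite mulr_ge0 ?expR_ge0// prodr_ge0// => j _; have /andP[] := phi01 (Y j w).
    rewrite inE => /(_ n) Ew; rewrite /phi -expR_sum sumrN -expRD -[1%:R]expR0 ler_expR subr_ge0.
    exact: Ew.
  have C : (fun n => expR N%:R * q ^+ n.+1) @ \oo --> expR N%:R * 0.
    apply: cvgMr; have qn : `|q| < 1 by rewrite ger0_norm.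
    by have := cvg_expr qn; rewrite -cvg_shiftS; exact.
  by rewrite -(mulr0 (expR N%:R)); apply: (cvgr_to_ge C); exact: nearW.
have : {ae P, forall w N, ~ E N w}.
  apply: ae_foralln => N; exists (E N); split => //; [exact: PE|move=> w /= /contrapT; exact].
have := iid_ge0; apply: filterS2 => w Yw Ew t.
have /existsNP[n /negP] := Ew (truncn `|t|).+1.
rewrite -ltNge => H; exists n.
have -> : \sum_(j < n.+1) Y j w = Sn n w by apply: eq_bigr => j _; rewrite /Yp (max_idPl (Yw j)).
apply: le_lt_trans H; apply: (le_trans (ler_norm t)); exact: ltW (truncnS_gt _).
Unshelve. all: by end_near. Qed.

(** Quadratic near 0 and linear at infinity, so [E phi(Y / b)] controls at the same time the second
    moment of [Y] truncated at [b] and the mean of [Y] beyond [b]. *)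
Definition phi (x : R) := x - 1 + expR (- x).

Lemma phi_ge0 x : 0 <= phi x.
Proof. by have := expR_ge1Dx (- x); rewrite /phi; lra. Qed.

Lemma phi_linear x : x - 1 <= phi x.
Proof. by rewrite /phi lerDl expR_ge0. Qed.

Lemma phi_square x : 0 <= x -> minr x 1 ^+ 2 / 4 <= phi x.
Proof.
move=> x0; have [x2|x2] := leP x 2.
  have h : (1 - x / 2) ^+ 2 <= expR (- x).
    have -> : - x = - (x / 2) + - (x / 2) by lra.
    rewrite expRD -expr2 lerXn2r ?nnegrE ?expR_ge0//; first by lra.
    by have := expR_ge1Dx (- (x / 2)); lra.
  have : x ^+ 2 / 4 <= phi x by move: h; rewrite /phi; nra.
  move/(le_trans _); apply; rewrite ler_pM2r// lerXn2r ?nnegrE ?le_min ?x0//.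
  by rewrite ler01.
  by rewrite ge_min lexx.
have h := phi_linear x; rewrite min_r; last by lra.
by rewrite expr1n; lra.
Qed.

(* Exponential Markov bound: a weak law for the sums forces
   b E[phi(Y/b)] to be small, which controls the tail of Y beyond b. *)
Lemma laplace_small (b : nat) (eta M0 : R) (Bd : set Om) : m <= M0 -> 2 * M0 <= b%:R -> 0 < eta ->
  measurable Bd -> fine (P Bd) <= expR (- M0) * eta ->
  (forall w, ~ Bd w -> b%:R * (m - eta) <= \sum_(j < b) Yp j w) ->
  b%:R * \int[P]_w phi (Yp 0%N w / b%:R) <= 2 * eta + 2 * M0 ^+ 2 / b%:R.
Proof.
move=> mM Mb e0 mBd PBd HBd.
have b0 : 0 < b%:R :> R by apply: lt_le_trans Mb; have := m0; lra.
have [iYp EYp] := iid_pos_int.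
pose psi (y : R) := expR (- (maxr y 0 / b%:R)).
have mpsi : measurable_fun setT psi.
  apply: measurableT_comp => //; apply: measurableT_comp => //.
  by apply: measurable_funM => //; apply: measurable_maxr.
have mx0 y : 0 <= maxr y 0 :> R by rewrite le_max lexx orbT.
have psi01 y : 0 <= psi y <= 1.
  by rewrite expR_ge0 -[leRHS]expR0 ler_expR oppr_le0 divr_ge0// ltW.
have psib y : `|psi y| <= 1 by have /andP[h1 h2] := psi01 y; rewrite ger0_norm.
pose p := \int[P]_w psi (Y 0%N w); pose x := 1 - p.
have ipsi : P.-integrable setT (EFin \o (psi \o Y 0%N)).
  by apply: (@bounded_integrable _ _ _ P _ 1) => [|w]; [exact: measurableT_comp|exact: psib].
have i1 : P.-integrable setT (EFin \o (fun w => Yp 0%N w / b%:R)).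
  rewrite (_ : EFin \o _ = fun w => ((b%:R^-1)%:E * (Yp 0%N w)%:E)%E); last by apply/funext => w /=; rewrite -EFinM mulrC.
  exact: integrableZl.
have ic (c : R) : P.-integrable setT (EFin \o (fun w => c)).
  by apply: (@bounded_integrable _ _ _ P (cst c) `|c|).
have Ephi : \int[P]_w phi (Yp 0%N w / b%:R) = m / b%:R - x.
  rewrite /phi RintegralD//; last first.
    rewrite (_ : EFin \o _ = fun w => ((Yp 0%N w / b%:R)%:E - 1%:E)%E); last by apply/funext => w /=; rewrite EFinB.
    exact: (integrableB measurableT i1 (ic 1)).
  rewrite RintegralB// prob_integral_cst RintegralZr// EYp /x -/(p); ring.
have x0 : 0 <= x.
  by rewrite subr_ge0; apply: le_trans (ler_norm _) (@bounded_integral_le _ _ _ P (psi \o Y 0%N) 1 (fun w => psib (Y 0%N w))).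
have xm : x <= m / b%:R.
  rewrite -subr_ge0 -Ephi; apply: Rintegral_ge0 => w _; exact: phi_ge0.
have mb : m / b%:R <= 1 / 2 by rewrite ler_pdivrMr//; lra.
have x1 : 0 < 1 - x by lra.
have pb : p ^+ b <= expR (- (m - eta)) + expR (- M0) * eta.
  rewrite -iid_prod//; apply: (@le_trans _ _ (\int[P]_w (expR (- (m - eta)) + \1_Bd w))); last first.
    rewrite (@bounded_integralD _ _ _ P _ _ (expR (- (m - eta))) 1)//.
    - by rewrite prob_integral_cst Rintegral_indic// lerD2l.
    - by move=> w; rewrite ger0_norm ?expR_ge0.
    - exact: norm_indic_le1.
  apply: (@le_bounded_integral _ _ _ P _ _ (1 + (expR (- (m - eta)) + 1))).
  - move=> w; rewrite normr_prod (@le_trans _ _ 1)//; last by rewrite lerDl addr_ge0// expR_ge0.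
    by apply: prodr_ile1 => j _; rewrite normr_ge0 psib.
  - move=> w; apply: (le_trans (ler_normD _ _)); rewrite ger0_norm ?expR_ge0//.
    apply: (@le_trans _ _ (expR (- (m - eta)) + 1)); first by rewrite lerD2l; exact: norm_indic_le1.
    by rewrite lerDr.
  move=> w; rewrite indicE; case: (boolP (w \in _)) => [_|].
    apply: (@le_trans _ _ 1); last by rewrite lerDr expR_ge0.
    by apply: prodr_ile1 => j _.
  rewrite notin_setE => /HBd H; rewrite addr0 /psi -expR_sum sumrN ler_expR lerN2 -mulr_suml.
  by rewrite ler_pdivlMr// mulrC.
(* From [1 + v <= exp v] at [v = x / (1 - x)]. Together with [pb] this bounds [b * x] from below,
   hence [b * E phi(Y / b) = m - b * x] from above. *)
have p1 : expR (- (x / (1 - x))) <= p.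
  rewrite expRN invf_ple ?posrE ?expR_gt0//; last by rewrite /x in x1; lra.
  apply: le_trans (expR_ge1Dx _).
  have -> : p = 1 - x by rewrite /x; ring.
  by rewrite le_eqVlt; apply/orP; left; apply/eqP; field; rewrite gt_eqF.
have p2 : expR (- (b%:R * (x / (1 - x)))) <= p ^+ b.
  by rewrite -mulrN mulrC expRM_natr lerXn2r ?nnegrE ?expR_ge0// (le_trans _ p1)// expR_ge0.
(* The bad event has probability at most [exp(-M0) * eta] precisely so that, as [m <= M0], it is
   absorbed by [1 + eta <= exp eta]. *)
have p3 : expR (- (m - eta)) + expR (- M0) * eta <= expR (- (m - 2 * eta)).
  have -> : - (m - 2 * eta) = - (m - eta) + eta by ring.
  rewrite expRD; apply: (@le_trans _ _ (expR (- (m - eta)) * (1 + eta))); last first.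
    by rewrite ler_wpM2l ?expR_ge0// expR_ge1Dx.
  rewrite mulrDr mulr1 lerD2l ler_wpM2r ?(ltW e0)// ler_expR; lra.
have := le_trans p2 (le_trans pb p3); rewrite ler_expR lerN2 mulrA ler_pdivlMr// => Hx.
rewrite Ephi mulrBr mulrCA mulfV ?gt_eqF// mulr1.
have bx : 0 <= b%:R * x by rewrite mulr_ge0// ltW.
have M0b : 0 <= 2 * M0 ^+ 2 / b%:R by apply: divr_ge0; [apply: mulr_ge0 => //; exact: sqr_ge0|exact: ltW].
have [h|h] := leP m (2 * eta).
  apply: (@le_trans _ _ (2 * eta)); last by rewrite lerDl.
  by apply: le_trans h; rewrite gerBl.
have : (m - 2 * eta) * x <= 2 * M0 ^+ 2 / b%:R.
  apply: (@le_trans _ _ (M0 * (M0 / b%:R))).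
    apply: ler_pM => //; [lra|by have := e0; lra|].
    by apply: (le_trans xm); rewrite ler_pM2r ?invr_gt0.
  rewrite mulrA -expr2 ler_pM2r ?invr_gt0//; have := sqr_ge0 M0; lra.
move: Hx; rewrite mulrBr mulr1; lra.
Qed.

End iid.

End probability_facts.

(** Interleaves the primitives, [PZ0] first and the others by residue modulo 3, so that the results
    on sequences and their sigma-algebras apply to all primitives at once. *)
Definition pcode (k : nat) : prim_idx :=
  if k is k'.+1 then
    let q := (k' %/ 3)%N in
    if (k' %% 3 == 0)%N then PU q else if (k' %% 3 == 1)%N then PV q else PD q
  else PZ0.

Definition code (i : prim_idx) : nat :=
  match i with PZ0 => 0 | PU n => (n * 3).+1 | PV n => (n * 3 + 1).+1 | PD n => (n * 3 + 2).+1 end.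

Lemma pcodeK : cancel pcode code.
Proof.
case=> [//|k]; rewrite /pcode.
have := divn_eq k 3; have : (k %% 3 < 3)%N by rewrite ltn_mod.
case: (k %% 3)%N => [|[|[|//]]] _ /= e; rewrite -/(code _) /=; congr _.+1; by rewrite [RHS]e ?addn0.
Qed.

Lemma codeK : cancel code pcode.
Proof.
case=> [n|n|n|]; rewrite /code /pcode //.
- by rewrite mulnK // modnMl.
- by rewrite divnMDl// modnMDl /= addn0.
- by rewrite divnMDl// modnMDl /= addn0.
Qed.

(** The grid point lies strictly above [w], within [1 / m.+1] of it: right continuity is all that a
    distribution function, or the indicator of [D <= w] as a function of [w], offers. *)
Lemma step_cvg (R : realType) (H : R -> R) (w : R) : 0 <= w -> H s @[s --> w^'+] --> H w ->
  (fun m => H ((truncn (m.+1%:R * w)).+1%:R / m.+1%:R)) @ \oo --> H w.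
Proof.
move=> w0 Hw; apply/cvgrPdist_lt => e e0.
have {Hw} : \forall s \near w^'+, `|H w - H s| < e by move/cvgrPdist_lt : Hw; exact.
rewrite near_withinE => /nbhs_ballP[dl /= dl0 Hdl].
near=> m.
have m0 : 0 < m.+1%:R :> R by rewrite ltr0n.
have mw : 0 <= m.+1%:R * w by rewrite mulr_ge0// ltW.
have /andP[t1 t2] := truncn_itv mw.
have ws : w < (truncn (m.+1%:R * w)).+1%:R / m.+1%:R by rewrite ltr_pdivlMr// mulrC.
apply: Hdl => //; rewrite /ball /= distrC gtr0_norm ?subr_gt0//.
rewrite ltrBlDl ltr_pdivrMr// mulrDl -natr1.
apply: (le_lt_trans (lerD t1 (lexx 1))); rewrite [m.+1%:R * w]mulrC ltrD2l mulrC.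
rewrite -ltr_pdivrMr// div1r.
by rewrite invf_plt ?posrE//; near: m; exact: (near_infty_natSinv_lt (PosNum dl0)).
Unshelve. all: by end_near. Qed.

(** Both sequences are monotone and [Q] grows by at most [e] between grid points, so a bound on a
    sparse grid extends to all [n]. A union bound over the grid can then do the work of a maximal
    inequality. *)
Lemma mono_grid (R : realType) (S Q : nat -> R) (st J : nat) (e : R) : (0 < st)%N ->
  (forall m n, (m <= n)%N -> S m <= S n) -> (forall m n, (m <= n)%N -> Q m <= Q n) ->
  (forall n, Q (n + st)%N <= Q n + e) ->
  (forall j, (j < J.+1)%N -> `|S (j * st)%N - Q (j * st)%N| <= e) ->
  forall n, (n <= J * st)%N -> `|S n - Q n| <= 2 * e.
Proof.
move=> st0 mS mQ Qst H n; rewrite leq_eqVlt => /predU1P[->|nJ].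
  have h := H J (ltnSn J); apply: (le_trans h).
  by have := le_trans (normr_ge0 _) h; lra.
have jJ : (n %/ st < J)%N by rewrite ltn_divLR.
have e1 := divn_eq n st; have e2 : (n %% st < st)%N by rewrite ltn_mod.
set j := (n %/ st)%N in jJ e1.
have l1 : (j * st <= n)%N by rewrite e1 leq_addr.
have l2 : (n <= j.+1 * st)%N by rewrite e1 mulSn addnC leq_add2r ltnW.
have h1 := H j (ltnW jJ); have h2 := H j.+1 jJ.
have q1 := Qst (j * st)%N; rewrite -[(j * st + st)%N]addnC -mulSn in q1.
have s1 := mS _ _ l1; have s2 := mS _ _ l2; have q2 := mQ _ _ l1; have q3 := mQ _ _ l2.
by move: h1 h2; rewrite !ler_norml => /andP[? ?] /andP[? ?]; apply/andP; split; lra.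
Qed.

Lemma Wrec_measurable {d} {T : measurableType d} {R : realType} (u V D : nat -> T -> R) (z0 : T -> R) i :
  (forall j, measurable_fun setT (u j)) -> (forall j, (j < i)%N -> measurable_fun setT (V j)) ->
  (forall j, (j < i)%N -> measurable_fun setT (D j)) -> measurable_fun setT z0 ->
  measurable_fun setT (fun w => Wrec (u ^~ w) (V ^~ w) (D ^~ w) (z0 w) i).
Proof.
move=> mu; elim: i => [|i IH] mV mD mz /=.
  by apply: measurable_maxr => //; apply: measurable_funB.
have mW := IH (fun j h => mV j (ltnW h)) (fun j h => mD j (ltnW h)) mz.
apply: measurable_maxr => //; apply: measurable_funB => //; apply: measurable_funD => //.
apply: measurable_funM; last exact: mV.
have -> : (fun w => (nat_of_bool (Wrec (u ^~ w) (V ^~ w) (D ^~ w) (z0 w) i < D i w))%:R : R) =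
  \1_[set w | Wrec (u ^~ w) (V ^~ w) (D ^~ w) (z0 w) i < D i w].
  by apply/funext => w; rewrite indicE mem_setE.
by apply: measurable_indic; apply: measurable_set_lt => //; exact: mD.
Qed.

(** * Primitives, the past of a customer, and conditional acceptance *)

Section primitives.
Context {d} {Om : measurableType d} {R : realType}.
Variable P : probability Om R.
Variables (u V D : nat -> Om -> R) (z0 : Om -> R).
Hypothesis mu' : forall i, measurable_fun setT (u i).
Hypothesis mV' : forall i, measurable_fun setT (V i).
Hypothesis mD' : forall i, measurable_fun setT (D i).
Hypothesis mz' : measurable_fun setT z0.
Hypothesis ind' : mutual_indep P (prim u V D z0).

Lemma eq_prob_integral (f g : Om -> R) : (forall w, f w = g w) -> \int[P]_w f w = \int[P]_w g w.
Proof. by move=> fg; apply: eq_Rintegral => w _. Qed.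

Definition pX (k : nat) := prim u V D z0 (pcode k).

Lemma pX_measurable k : measurable_fun setT (pX k).
Proof. by rewrite /pX; case: (pcode k). Qed.

Lemma pX_indep : prefix_indep P pX.
Proof.
move=> N A mA.
have -> : \bigcap_(i in [set k | (k < N)%N]) (pX i @^-1` A i) =
   \bigcap_(m in [set: 'I_N]) (prim u V D z0 (pcode m) @^-1` A m).
  apply/seteqP; split=> w /= H i; first by move=> _; exact: (H i (ltn_ord i)).
  by move=> iN; exact: (H (Ordinal iN)).
apply: (ind' (j := fun m : 'I_N => pcode m)) => //.
by move=> a b /(can_inj pcodeK) /val_inj.
Qed.

(** Measurability with respect to the primitives indexed by [J] is expressed by giving [Om] the
    measurable structure they generate. *)
Lemma gen_prim (J : set prim_idx) i : J i ->
  measurable_fun setT (prim u V D z0 i : g_sigma_algebraType (rects pX [set k | J (pcode k)]) -> R).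
Proof.
move=> Ji _ A mA; rewrite setTI.
have -> : prim u V D z0 i = pX (code i) by rewrite /pX codeK.
by apply: (@sub_sigma_pre _ _ _ pX [set k | J (pcode k)]) => //=; rewrite codeK.
Qed.

Lemma gen_measurable (J : set prim_idx) (f : Om -> R) :
  measurable_fun setT (f : g_sigma_algebraType (rects pX [set k | J (pcode k)]) -> R) -> measurable_fun setT f.
Proof.
move=> mf _ A mA; have := mf measurableT A mA; rewrite !setTI => H.
exact: (sub_sigma_measurable pX_measurable H).
Qed.

Lemma gen_indep (J1 J2 : set prim_idx) (f g : Om -> R) (M : R) : J1 `&` J2 = set0 ->
  measurable_fun setT (f : g_sigma_algebraType (rects pX [set k | J1 (pcode k)]) -> R) ->
  measurable_fun setT (g : g_sigma_algebraType (rects pX [set k | J2 (pcode k)]) -> R) ->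
  (forall w, `|f w| <= M) -> (forall w, `|g w| <= M) ->
  \int[P]_w (f w * g w) = (\int[P]_w f w) * (\int[P]_w g w).
Proof.
move=> J12 mf mg fM gM.
have Mn : M <= (truncn `|M|).+1%:R by apply: (le_trans (ler_norm M)); exact: ltW (truncnS_gt _).
apply: (@indep2_expect _ _ _ P f g (truncn `|M|).+1).
- exact: gen_measurable mf.
- exact: gen_measurable mg.
- by move=> w; apply: le_trans Mn.
- by move=> w; apply: le_trans Mn.
move=> a b; apply: (@sub_sigma_indep _ _ _ P pX pX_measurable pX_indep [set k | J1 (pcode k)] [set k | J2 (pcode k)]).
- by rewrite -subset0 => k /= [j1 j2]; rewrite -[False]/(set0 (pcode k)) -J12.
- by have := measurable_set_le (measurable_cst a) mf.
- by have := measurable_set_le (measurable_cst b) mg.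
Qed.

Lemma prim_prod (f : nat -> prim_idx) : injective f -> forall n (A : 'I_n -> set R),
  (forall m, measurable (A m)) ->
  P (\bigcap_(m in [set: 'I_n]) (prim u V D z0 (f m) @^-1` A m)) =
  (\prod_(m < n) P (prim u V D z0 (f m) @^-1` A m))%E.
Proof. by move=> fi n A mA; apply: (ind' (j := fun m : 'I_n => f m)) => // a b /fi /val_inj. Qed.

Section martingale.
Variable Fa : R -> R.
Hypothesis lV : forall i, same_law P (V i) (V 0%N).
Hypothesis lD : forall i, same_law P (D i) (D 0%N).
Hypothesis cD : forall x, P (D 0%N @^-1` `]-oo, x]) = (Fa x)%:E.
Hypothesis Fa_nd : forall x y, x <= y -> Fa x <= Fa y.
Hypothesis Fa_right : forall x, Fa s @[s --> x^'+] --> Fa x.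

Let Fa_fine i x : fine (P [set w | D i w <= x]) = Fa x.
Proof.
have h : P (D i @^-1` `]-oo, x]) = (Fa x)%:E by rewrite (lD i)// cD.
have e : D i @^-1` `]-oo, x] = [set w | D i w <= x] by apply/seteqP; split=> w /=; rewrite in_itv.
by move: h; rewrite e => ->.
Qed.

Lemma Fa01 x : 0 <= Fa x <= 1.
Proof.
have mA : measurable [set w | D 0%N w <= x] by apply: (measurable_set_le (g := cst x)).
rewrite -(Fa_fine 0) prob_ge0 /= -lee_fin -fineP//; exact: probability_le1.
Qed.

Let Fa_measurable : measurable_fun setT Fa.
Proof. by apply: nondecreasing_measurable. Qed.

Variable c : R.
Hypothesis c0 : 0 <= c.

(** All interarrival times and the start belong to the past, so that the wait of customer [j] is
    measurable for it while [V j] and [D j] remain independent of it. *)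
Definition past (j : nat) : set prim_idx :=
  [set i | match i with PU _ | PZ0 => True | PV l | PD l => (l < j)%N end].
Definition own (j : nat) : set prim_idx :=
  [set i | match i with PV l | PD l => l = j | _ => False end].

Let past_own j : past j `&` own j = set0.
Proof. by rewrite -subset0 => -[l|l|l|] [] //= + E; rewrite E ltnn. Qed.

Let gpast j := g_sigma_algebraType (rects pX [set k | past j (pcode k)]).
Let gown j := g_sigma_algebraType (rects pX [set k | own j (pcode k)]).

Definition offered (i : nat) (w : Om) : R :=
  minr (Wrec (u ^~ w) (V ^~ w) (D ^~ w) (z0 w) i) c.

Lemma offered_bounds i w : 0 <= offered i w <= c.
Proof.
rewrite /offered ge_min lexx orbT andbT le_min c0 andbT.
by case: i => [|i] /=; rewrite le_max lexx orbT.
Qed.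

Lemma offered_past i j : (i <= j)%N -> measurable_fun setT (offered i : gpast j -> R).
Proof.
move=> ij; apply: measurable_minr => //.
apply: (@Wrec_measurable _ (gpast j)) => [l|l li|l li|].
- exact: (gen_prim (J := past j) (i := PU l)).
- by apply: (gen_prim (J := past j) (i := PV l)) => /=; exact: leq_trans ij.
- by apply: (gen_prim (J := past j) (i := PD l)) => /=; exact: leq_trans ij.
- exact: (gen_prim (J := past j) (i := PZ0)).
Qed.

Let indD i (x : R) w : R := (nat_of_bool (D i w <= x))%:R.

Let indD_indic i x : indD i x = \1_[set w | D i w <= x].
Proof. by apply/funext => w; rewrite indicE mem_setE. Qed.

Lemma indD01 (b : bool) : `|(nat_of_bool b)%:R : R| <= 1.
Proof. by case: b; rewrite ?normr1 ?normr0. Qed.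

Let own_split (psi : R -> R) (M x : R) j : measurable_fun setT psi -> (forall y, `|psi y| <= M) ->
  \int[P]_w (psi (V j w) * indD j x w) = (\int[P]_w psi (V 0%N w)) * Fa x.
Proof.
move=> mpsi psiM.
rewrite (@gen_indep [set i | i = PV j] [set i | i = PD j] _ _ (M + 1)).
- congr (_ * _); first exact: same_law_int psiM.
  rewrite indD_indic Rintegral_indic ?Fa_fine//.
  by apply: (measurable_set_le (g := cst x)).
- by rewrite -subset0 => i [->].
- apply: measurableT_comp => //; exact: (gen_prim (J := [set i | i = PV j]) (i := PV j)).
- rewrite indD_indic; apply: measurable_indic.
  apply: (measurable_set_le (g := cst x)) => //; exact: (gen_prim (J := [set i | i = PD j]) (i := PD j)).
- by move=> w; apply: (le_trans (psiM _)); rewrite lerDl.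
- move=> w; apply: (le_trans (indD01 _)); rewrite lerDr.
  exact: le_trans (normr_ge0 _) (psiM 0).
Qed.

(* Conditioning on the past, by discretizing the past-measurable threshold h from above. *)
Lemma conditional_acceptance (g h : Om -> R) (psi : R -> R) (M : R) j :
  measurable_fun setT (g : gpast j -> R) -> (forall w, `|g w| <= M) ->
  measurable_fun setT (h : gpast j -> R) -> (forall w, 0 <= h w <= c) ->
  measurable_fun setT psi -> (forall y, `|psi y| <= M) ->
  \int[P]_w (g w * (psi (V j w) * indD j (h w) w)) = (\int[P]_w psi (V 0%N w)) * \int[P]_w (g w * Fa (h w)).
Proof.
move=> mg gM mh hc mpsi psiM.
have M0 : 0 <= M := le_trans (normr_ge0 _) (psiM 0).
pose q m w := (truncn (m.+1%:R * h w)).+1%:R / m.+1%:R : R.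
pose L m := (truncn (m.+1%:R * c)).+1.
pose cell m l w : R := (nat_of_bool (l%:R <= m.+1%:R * h w < l.+1%:R))%:R.
have m0 m : 0 < m.+1%:R :> R by rewrite ltr0n.
have hw m w : 0 <= m.+1%:R * h w by rewrite mulr_ge0 ?(ltW (m0 m))//; have /andP[] := hc w.
have cellE m w (H : R -> R) : H (q m w) = \sum_(l < L m) cell m l w * H (l.+1%:R / m.+1%:R).
  have tL : (truncn (m.+1%:R * h w) < L m)%N.
    by rewrite ltnS le_truncn// ler_pM2l//; have /andP[] := hc w.
  rewrite (bigD1 (Ordinal tL)) //= big1 ?addr0.
    by rewrite /cell truncn_itv// mul1r.
  move=> l /eqP lt; rewrite /cell; case E : (_ <= _ < _); last by rewrite mul0r.
  move/andP: E => [a b]; exfalso; apply: lt; apply: val_inj => /=.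
  by apply/esym/truncn_def; rewrite a.
have mcell m l : measurable_fun setT (cell m l : gpast j -> R).
  have -> : cell m l = \1_([set w | l%:R <= m.+1%:R * h w] `&` [set w | m.+1%:R * h w < l.+1%:R]).
    by apply/funext => w; rewrite indicE in_setI !mem_setE.
  have mm : measurable_fun setT ((fun w => m.+1%:R * h w) : gpast j -> R) by exact: measurable_funM.
  apply: measurable_indic; apply: measurableI.
    exact: (measurable_set_le (f := cst l%:R)).
  exact: (measurable_set_lt (g := cst l.+1%:R)).
have cell1 m l w : `|cell m l w| <= 1 by exact: indD01.
have mg' := gen_measurable mg; have mh' := gen_measurable mh.
have mcell' m l := gen_measurable (mcell m l).
have mindD x : measurable_fun setT (indD j x).
  by rewrite indD_indic; apply: measurable_indic; apply: (measurable_set_le (g := cst x)).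
(* On each cell the threshold is constant: [g] times the cell indicator belongs to the past, the
   other factor to the customer, and independence applies cell by cell. *)
have disc m : \int[P]_w (g w * (psi (V j w) * indD j (q m w) w)) =
   (\int[P]_w psi (V 0%N w)) * \int[P]_w (g w * Fa (q m w)).
  have e1 w : g w * (psi (V j w) * indD j (q m w) w) =
     \sum_(l < L m) (g w * cell m l w) * (psi (V j w) * indD j (l.+1%:R / m.+1%:R) w).
    rewrite (cellE m w (fun x => indD j x w)) mulr_sumr mulr_sumr; apply: eq_bigr => l _; ring.
  have e2 w : g w * Fa (q m w) = \sum_(l < L m) (Fa (l.+1%:R / m.+1%:R) * (g w * cell m l w)).
    rewrite (cellE m w Fa) mulr_sumr; apply: eq_bigr => l _; ring.
  have mgc l : measurable_fun setT ((fun w => g w * cell m l w) : gpast j -> R) by exact: measurable_funM.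
  have gc l w : `|g w * cell m l w| <= M.
    by rewrite normrM -[leRHS]mulr1; apply: ler_pM.
  rewrite (eq_prob_integral e1) (eq_prob_integral e2).
  have mo l : measurable_fun setT ((fun w => psi (V j w) * indD j (l.+1%:R / m.+1%:R) w) : gown j -> R).
    apply: measurable_funM.
      apply: measurableT_comp => //; exact: (gen_prim (J := own j) (i := PV j)).
    rewrite indD_indic; apply: measurable_indic.
    apply: (measurable_set_le (g := cst (l.+1%:R / m.+1%:R))) => //.
    exact: (gen_prim (J := own j) (i := PD j)).
  have ob l w : `|psi (V j w) * indD j (l.+1%:R / m.+1%:R) w| <= M.
    by rewrite normrM -[leRHS]mulr1; apply: ler_pM => //; exact: indD01.
  rewrite (@bounded_integral_sum _ _ _ P _ _ _ (fun=> M * M)); last 2 first.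
  - by move=> l; apply: measurable_funM; [exact: gen_measurable (mgc l)|exact: gen_measurable (mo l)].
  - by move=> l w; rewrite normrM; apply: ler_pM.
  rewrite (@bounded_integral_sum _ _ _ P _ _ _ (fun=> 1 * M)); last 2 first.
  - by move=> l; apply: measurable_funM; [exact: measurable_cst|exact: gen_measurable (mgc l)].
  - move=> l w; rewrite normrM; apply: ler_pM => //.
    by have /andP[h1 h2] := Fa01 (l.+1%:R / m.+1%:R); rewrite ger0_norm.
  rewrite mulr_sumr; apply: eq_bigr => l _.
  rewrite (@gen_indep (past j) (own j) _ _ M)// (own_split _ _ mpsi psiM).
  rewrite (@bounded_integralZ _ _ _ P _ M)//; last exact: gen_measurable (mgc l).
  ring.
have mq m : measurable_fun setT (q m).
  have -> : q m = (fun w => \sum_(l < L m) cell m l w * (l.+1%:R / m.+1%:R)).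
    by apply/funext => w; exact: (cellE m w id).
  by apply: measurable_sum => l; apply: measurable_funM.
have lim1 : (fun m => \int[P]_w (g w * (psi (V j w) * indD j (q m w) w))) @ \oo -->
    \int[P]_w (g w * (psi (V j w) * indD j (h w) w)).
  apply: (@bounded_cvg _ _ _ P _ _ (M * M)).
  - move=> m; apply: measurable_funM => //; apply: measurable_funM; first exact: measurableT_comp.
    have -> : (fun w => indD j (q m w) w) = \1_[set w | D j w <= q m w].
      by apply/funext => w; rewrite indicE mem_setE.
    by apply: measurable_indic; exact: measurable_set_le.
  - move=> m w; rewrite normrM; apply: ler_pM => //.
    by rewrite normrM -[leRHS]mulr1; apply: ler_pM => //; exact: indD01.
  - move=> w; apply: cvgMr; apply: cvgMr; rewrite /q.
    apply: (@step_cvg R (fun x => indD j x w)); first by have /andP[] := hc w.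
    apply: cvg_near_cst; rewrite near_withinE; have [Dh|Dh] := leP (D j w) (h w).
      near=> s => hs; rewrite /indD Dh; by rewrite (le_trans Dh (ltW hs)).
    apply/nbhs_ballP; exists (D j w - h w); first by rewrite /= subr_gt0.
    move=> s; rewrite /ball /= => bs hs; rewrite /indD leNgt (leNgt (D j w)) Dh.
    suff -> : s < D j w by [].
    by move: bs; rewrite distrC gtr0_norm ?subr_gt0//; lra.
have lim2 : (fun m => \int[P]_w (g w * Fa (q m w))) @ \oo --> \int[P]_w (g w * Fa (h w)).
  apply: (@bounded_cvg _ _ _ P _ _ (M * 1)).
  - by move=> m; apply: measurable_funM => //; exact: measurableT_comp.
  - move=> m w; rewrite normrM; apply: ler_pM => //.
    by have /andP[h1 h2] := Fa01 (q m w); rewrite ger0_norm.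
  - move=> w; apply: cvgMr; apply: step_cvg => //; by have /andP[] := hc w.
have lim3 : (fun m => \int[P]_w (g w * (psi (V j w) * indD j (q m w) w))) @ \oo -->
   (\int[P]_w psi (V 0%N w)) * \int[P]_w (g w * Fa (h w)).
  rewrite (_ : (fun m => _) = fun m => (\int[P]_w psi (V 0%N w)) * \int[P]_w (g w * Fa (q m w))).
    exact: cvgMr.
  by apply/funext => m; exact: disc.
exact: (cvg_unique (@Rhausdorff R) lim1 lim3).
Unshelve. all: by end_near. Qed.

Section second_moment.
Variables (psi : R -> R) (b : R).
Hypothesis mpsi : measurable_fun setT psi.
Hypothesis psib : forall y, 0 <= psi y <= b.
Let mp := \int[P]_w psi (V 0%N w).

(** A martingale difference: [mp * Fa (offered i)] is the conditional mean of the first term given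
    the past of customer [i]. *)
Definition xi (i : nat) w : R :=
  psi (V i w) * (nat_of_bool (D i w <= offered i w))%:R - mp * Fa (offered i w).

Let psi_norm y : `|psi y| <= b. Proof. by have /andP[h1 h2] := psib y; rewrite ger0_norm. Qed.
Let b0 : 0 <= b. Proof. by have /andP[h1 h2] := psib 0; exact: le_trans h2. Qed.
Let mp_b : `|mp| <= b. Proof. by apply: bounded_integral_le => w. Qed.

Let xi_bound i w : `|xi i w| <= b + b.
Proof.
apply: (le_trans (ler_normB _ _)); apply: lerD.
  by rewrite normrM -[leRHS]mulr1; apply: ler_pM => //; exact: indD01.
rewrite normrM -[leRHS]mulr1; apply: ler_pM => //.
by have /andP[h1 h2] := Fa01 (offered i w); rewrite ger0_norm.
Qed.

Let xi_past i j : (i < j)%N -> measurable_fun setT (xi i : gpast j -> R).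
Proof.
move=> ij; have mo := offered_past (ltnW ij).
apply: measurable_funB; apply: measurable_funM => //.
- apply: measurableT_comp => //; exact: (gen_prim (J := past j) (i := PV i)).
- have -> : (fun w => (nat_of_bool (D i w <= offered i w))%:R : R) = \1_[set w | D i w <= offered i w].
    by apply/funext => w; rewrite indicE mem_setE.
  apply: measurable_indic; apply: measurable_set_le => //.
  exact: (gen_prim (J := past j) (i := PD i)).
- exact: measurableT_comp.
Qed.

Lemma mart_measurable n : measurable_fun setT (fun w => \sum_(i < n) xi i w).
Proof. by apply: measurable_sum => i; exact: gen_measurable (xi_past (ltnSn i)). Qed.

Lemma mart_bound n w : `|\sum_(i < n) xi i w| <= n%:R * (b + b).
Proof.
apply: (le_trans (ler_norm_sum _ _ _)); apply: (@le_trans _ _ (\sum_(i < n) (b + b))).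
  by apply: ler_sum => i _; exact: xi_bound.
by rewrite sumr_const card_ord [leRHS]mulr_natl.
Qed.

(** The differences are orthogonal, by [conditional_acceptance] with the partial sum as weight, and
    each has second moment at most [E psi(V)^2 * Fa c]. In the application [Fa c] is of order 1/B,
    which keeps the sum over about B^2 customers of order [B] times [E psi(V)^2]. *)
Lemma mart_second_moment n :
  \int[P]_w ((\sum_(i < n) xi i w) ^+ 2) <= n%:R * (\int[P]_w (psi (V 0%N w) ^+ 2) * Fa c).
Proof.
elim: n => [|n IH].
  by rewrite mul0r (eq_prob_integral (g := cst 0)) ?prob_integral_cst// => w; rewrite big_ord0 expr0n.
pose Mn w := \sum_(i < n) xi i w; pose K := n%:R * (b + b) + (b + b) + 1.
have K0 : 0 <= K by rewrite /K !addr_ge0 ?mulr_ge0 ?addr_ge0.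
have bK : b <= K by have := b0; rewrite /K; have : 0 <= n%:R * (b + b) by [rewrite mulr_ge0// addr_ge0|]; lra.
have MnK w : `|Mn w| <= K.
  by apply: (le_trans (mart_bound n w)); rewrite /K -addrA lerDl !addr_ge0.
have xiK w : `|xi n w| <= K.
  apply: (le_trans (xi_bound n w)); have : 0 <= n%:R * (b + b) by rewrite mulr_ge0// addr_ge0.
  by rewrite /K; lra.
have mMn : measurable_fun setT (Mn : gpast n -> R).
  by apply: measurable_sum => i; exact: xi_past.
have mMn' := gen_measurable mMn; have mxi := gen_measurable (xi_past (ltnSn n)).
have mo := offered_past (leqnn n).
have mind : measurable_fun setT (fun w => indD n (offered n w) w).
  have -> : (fun w => indD n (offered n w) w) = \1_[set w | D n w <= offered n w].
    by apply/funext => w; rewrite indicE mem_setE.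
  by apply: measurable_indic; apply: measurable_set_le => //; exact: gen_measurable mo.
have mFo : measurable_fun setT (fun w => Fa (offered n w)) by apply: measurableT_comp => //; exact: gen_measurable mo.
have mpV : measurable_fun setT (fun w => psi (V n w)) by exact: measurableT_comp.
have mp2 : measurable_fun setT (fun y => psi y ^+ 2) by exact: measurable_funX.
have FoM w : `|Fa (offered n w)| <= 1 by have /andP[h1 h2] := Fa01 (offered n w); rewrite ger0_norm.
have nM (x y X Y : R) : `|x| <= X -> `|y| <= Y -> `|x * y| <= X * Y by move=> h1 h2; rewrite normrM; apply: ler_pM.
have nid w : `|indD n (offered n w) w| <= 1 by exact: indD01.
have mpN : `|- mp| <= b by rewrite normrN.
have hMF w := nM _ _ _ _ (MnK w) (FoM w).
have hpi w := nM _ _ _ _ (psi_norm (V n w)) (nid w).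
have p2 y : `|psi y ^+ 2| <= K * K by rewrite expr2; apply: nM; exact: le_trans bK.
have K1 : K * K <= K * K + K by rewrite lerDl.
have KK : K <= K * K + K by rewrite lerDr mulr_ge0.
(* Expand the square and apply the conditional identity to each term. *)
have cross : \int[P]_w (Mn w * xi n w) = 0.
  rewrite (eq_prob_integral (g := fun w => Mn w * (psi (V n w) * indD n (offered n w) w) + (- mp) * (Mn w * Fa (offered n w)))).
    rewrite (@bounded_integralD _ _ _ P _ _ (K * (b * 1)) (b * (K * 1))); first last.
    - by move=> w; exact: (nM _ _ _ _ mpN (hMF w)).
    - by move=> w; exact: (nM _ _ _ _ (MnK w) (hpi w)).
    - by apply: measurable_funM => //; exact: measurable_funM.
    - by apply: measurable_funM => //; exact: measurable_funM.
    rewrite (@bounded_integralZ _ _ _ P _ (K * 1)); first last.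
    - by move=> w; exact: hMF.
    - exact: measurable_funM.
    rewrite (@conditional_acceptance Mn (offered n) psi K n mMn)//.
    + by rewrite -/mp; ring.
    + by move=> w; exact: offered_bounds.
    + by move=> y; apply: le_trans bK.
  by move=> w; rewrite /xi -/(indD n (offered n w) w); ring.
(* The indicator equals its square, and the square of the conditional mean comes out with a minus
   sign and is dropped. *)
have sq : \int[P]_w (xi n w ^+ 2) <= \int[P]_w (psi (V 0%N w) ^+ 2) * Fa c.
  have e w : xi n w ^+ 2 = 1 * (psi (V n w) ^+ 2 * indD n (offered n w) w) +
      ((- 2 * mp) * (Fa (offered n w) * (psi (V n w) * indD n (offered n w) w)) + mp ^+ 2 * (Fa (offered n w) * Fa (offered n w))).
    have i2 : indD n (offered n w) w * indD n (offered n w) w = indD n (offered n w) w.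
      by rewrite /indD; case: (_ <= _); rewrite ?mulr1 ?mulr0.
    rewrite -{1}i2 /xi -/(indD n (offered n w) w); ring.
  have mFF : measurable_fun setT (fun w => Fa (offered n w) * Fa (offered n w)) by exact: measurable_funM.
  have mt1 : measurable_fun setT (fun w => psi (V n w) ^+ 2 * indD n (offered n w) w).
    by apply: measurable_funM => //; exact: measurable_funX.
  have mt2 : measurable_fun setT (fun w => Fa (offered n w) * (psi (V n w) * indD n (offered n w) w)).
    by apply: measurable_funM => //; exact: measurable_funM.
  have bt1 w : `|psi (V n w) ^+ 2 * indD n (offered n w) w| <= K * K * 1 by exact: (nM _ _ _ _ (p2 _) (nid w)).
  have bt2 w : `|Fa (offered n w) * (psi (V n w) * indD n (offered n w) w)| <= 1 * (b * 1).
    exact: (nM _ _ _ _ (FoM w) (hpi w)).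
  have bFF w : `|Fa (offered n w) * Fa (offered n w)| <= 1 * 1 by exact: (nM _ _ _ _ (FoM w) (FoM w)).
  rewrite (eq_prob_integral e).
  rewrite (@bounded_integralD _ _ _ P _ _ (1 * (K * K * 1)) (`|- 2 * mp| * (1 * (b * 1)) + `|mp ^+ 2| * (1 * 1))); first last.
  - by move=> w; apply: (le_trans (ler_normD _ _)); apply: lerD; [exact: (nM _ _ _ _ (lexx _) (bt2 w))|exact: (nM _ _ _ _ (lexx _) (bFF w))].
  - by move=> w; have := bt1 w; rewrite !mul1r.
  - by apply: measurable_funD; apply: measurable_funM.
  - by apply: measurable_funM.
  rewrite (@bounded_integralD _ _ _ P _ _ (`|- 2 * mp| * (1 * (b * 1))) (`|mp ^+ 2| * (1 * 1))); first last.
  - by move=> w; exact: (nM _ _ _ _ (lexx _) (bFF w)).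
  - by move=> w; exact: (nM _ _ _ _ (lexx _) (bt2 w)).
  - by apply: measurable_funM.
  - by apply: measurable_funM.
  rewrite (@bounded_integralZ _ _ _ P _ _ (- 2 * mp) mt2 bt2) (@bounded_integralZ _ _ _ P _ _ (mp ^+ 2) mFF bFF).
  have c1 := @conditional_acceptance (cst 1) (offered n) (fun y => psi y ^+ 2) (K * K + 1) n.
  have bc1 (w : Om) : `|cst 1 w : R| <= K * K + 1 by rewrite normr1 lerDr mulr_ge0.
  have bp1 y : `|psi y ^+ 2| <= K * K + 1 by apply: (le_trans (p2 y)); rewrite lerDl.
  have {c1} c1 := c1 (measurable_cst _) bc1 mo (offered_bounds n) mp2 bp1.
  have c2 := @conditional_acceptance (fun w => Fa (offered n w)) (offered n) psi (K + 1) n.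
  have bF2 w : `|Fa (offered n w)| <= K + 1 by apply: (le_trans (FoM w)); rewrite lerDr.
  have bp2 y : `|psi y| <= K + 1 by apply: (le_trans (psi_norm y)); apply: (le_trans bK); rewrite lerDl.
  have {c2} c2 := c2 (measurableT_comp Fa_measurable mo) bF2 mo (offered_bounds n) mpsi bp2.
  have c1' : \int[P]_w (1 * (psi (V n w) ^+ 2 * indD n (offered n w) w)) =
     (\int[P]_w (psi (V 0%N w) ^+ 2)) * \int[P]_w (cst 1 w * Fa (offered n w)) by exact: c1.
  rewrite c1' c2 -/mp.
  have F1 : \int[P]_w (cst 1 w * Fa (offered n w)) <= Fa c.
    rewrite -[leRHS](prob_integral_cst P); apply: (@le_bounded_integral _ _ _ P _ _ 1) => w.
    - by rewrite /= mul1r.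
    - by have /andP[h1 h2] := Fa01 c; rewrite ger0_norm.
    - by rewrite /= mul1r; apply: Fa_nd; have /andP[] := offered_bounds n w.
  have s20 : 0 <= \int[P]_w (psi (V 0%N w) ^+ 2) by apply: Rintegral_ge0 => w _; exact: sqr_ge0.
  have FF0 : 0 <= \int[P]_w (Fa (offered n w) * Fa (offered n w)).
    by apply: Rintegral_ge0 => w _; rewrite -expr2; exact: sqr_ge0.
  have h1 := ler_wpM2l s20 F1; have h2 := mulr_ge0 (sqr_ge0 mp) FF0.
  move: h1 h2; set I1 := \int[P]_w (cst 1 w * _); set I2 := \int[P]_w (Fa _ * _); set s2 := \int[P]_w (psi _ ^+ 2).
  move=> h1 h2; have -> : s2 * I1 + (- 2 * mp * (mp * I2) + mp ^+ 2 * I2) = s2 * I1 - mp ^+ 2 * I2 by ring.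
  by apply: le_trans h1; rewrite gerBl.
have e w : (\sum_(i < n.+1) xi i w) ^+ 2 = Mn w ^+ 2 + (2 * (Mn w * xi n w) + xi n w ^+ 2).
  by rewrite big_ord_recr /= -/(Mn w); ring.
have bM2 w : `|Mn w ^+ 2| <= K * K by rewrite expr2; exact: (nM _ _ _ _ (MnK w) (MnK w)).
have bx2 w : `|xi n w ^+ 2| <= K * K by rewrite expr2; exact: (nM _ _ _ _ (xiK w) (xiK w)).
have bMx w : `|Mn w * xi n w| <= K * K by exact: (nM _ _ _ _ (MnK w) (xiK w)).
have mM2 : measurable_fun setT (fun w => Mn w ^+ 2) by exact: measurable_funX.
have mx2 : measurable_fun setT (fun w => xi n w ^+ 2) by exact: measurable_funX.
have mMx : measurable_fun setT (fun w => Mn w * xi n w) by exact: measurable_funM.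
rewrite (eq_prob_integral e).
rewrite (@bounded_integralD _ _ _ P _ _ (K * K) (`|2| * (K * K) + K * K))//; first last.
- by move=> w; apply: (le_trans (ler_normD _ _)); apply: lerD; [exact: (nM _ _ _ _ (lexx _) (bMx w))|exact: bx2].
- by apply: measurable_funD => //; exact: measurable_funM.
rewrite (@bounded_integralD _ _ _ P _ _ (`|2| * (K * K)) (K * K))//; first last.
- by move=> w; exact: (nM _ _ _ _ (lexx _) (bMx w)).
- exact: measurable_funM.
rewrite (@bounded_integralZ _ _ _ P _ (K * K))// cross mulr0 add0r -natr1 mulrDl mul1r.
exact: lerD.
Qed.

End second_moment.

(** * Uniform deviations of the sums over abandoning customers *)

Section deviations.
Variable m : R.
Hypothesis m0 : 0 < m.
Hypothesis V0 : P [set w | 0 <= V 0%N w] = 1%E.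
Hypothesis EV : (\int[P]_w (V 0%N w)%:E = m%:E)%E.
Variables (b st J : nat) (zeta e : R).
Hypothesis b0 : (0 < b)%N.
Hypothesis st0 : (0 < st)%N.
Hypothesis e0 : 0 < e.

Let Vp w := maxr (V 0%N w) 0.
Let X w := Vp w / b%:R.
Hypothesis Hz : b%:R * \int[P]_w phi (X w) <= zeta.
Hypothesis H1 : st%:R * Fa c <= e.
Hypothesis H2 : m * (st%:R * Fa c) <= e.
Hypothesis H3 : zeta * ((J * st)%:R * Fa c) <= e.

Let bR : 0 < b%:R :> R. Proof. by rewrite ltr0n. Qed.
Let Vp0 w : 0 <= Vp w. Proof. by rewrite le_max lexx orbT. Qed.
Let X0 w : 0 <= X w. Proof. by rewrite divr_ge0// ltW. Qed.
Let mVp : measurable_fun setT Vp. Proof. by apply: measurable_maxr. Qed.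
Let mX : measurable_fun setT X. Proof. by apply: measurable_funM. Qed.
Let iVp := iid_pos_int mV' lV V0 EV.

Let iphi : P.-integrable setT (EFin \o (fun w => phi (X w))).
Proof.
have iX : P.-integrable setT (EFin \o X).
  rewrite (_ : EFin \o X = fun w => ((b%:R^-1)%:E * (Vp w)%:E)%E); last by apply/funext => w /=; rewrite -EFinM mulrC.
  by apply: integrableZl => //; exact: iVp.1.
apply: (le_integrable measurableT _ _ iX).
  apply/measurable_EFinP; apply: measurable_funD; first exact: measurable_funB.
  by apply: measurableT_comp => //; exact: measurableT_comp.
move=> w _ /=; rewrite lee_fin !ger0_norm ?phi_ge0// /phi.
have : expR (- X w) <= 1 by rewrite -[leRHS]expR0 ler_expR oppr_le0.
lra.
Qed.

Let bphi : P.-integrable setT (EFin \o (fun w => b%:R * phi (X w))).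
Proof.
rewrite (_ : EFin \o _ = fun w => ((b%:R)%:E * (phi (X w))%:E)%E)//.
exact: integrableZl.
Qed.

(** The weight to which the second-moment bound applies. The facts below price the truncation by
    [zeta]: second moment at most [4 b zeta], mean lost at most [zeta], probability of exceeding [b]
    at most [4 zeta / b]. *)
Let psi2 (y : R) : R := minr (maxr y 0) b%:R.
Let mpsi2 : measurable_fun setT psi2.
Proof. by apply: measurable_minr => //; apply: measurable_maxr. Qed.
Let psi2b y : 0 <= psi2 y <= b%:R.
Proof. by rewrite /psi2 ge_min lexx orbT andbT le_min ler0n le_max lexx orbT. Qed.

Let scaled_min w : psi2 (V 0%N w) = b%:R * minr (X w) 1.
Proof. by rewrite /psi2 -/(Vp w) minr_pMr ?ler0n// mulr1 /X mulrCA mulfV ?mulr1// gt_eqF. Qed.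

Let s2 : \int[P]_w (psi2 (V 0%N w) ^+ 2) <= 4 * b%:R * zeta.
Proof.
apply: (@le_trans _ _ (\int[P]_w (4 * b%:R * (b%:R * phi (X w))))); last first.
  by rewrite !RintegralZl// ler_wpM2l// mulr_ge0.
apply: le_Rintegral => //.
- apply: (@bounded_integrable _ _ _ P _ (b%:R ^+ 2)); first by apply: measurable_funX; exact: measurableT_comp.
  by move=> w; have /andP[h1 h2] := psi2b (V 0%N w); rewrite ger0_norm ?sqr_ge0// lerXn2r ?nnegrE.
- rewrite (_ : EFin \o _ = fun w => ((4 * b%:R)%:E * (b%:R * phi (X w))%:E)%E)//.
  exact: integrableZl.
move=> w _; rewrite scaled_min exprMn.
have h := phi_square (X0 w).
rewrite (_ : 4 * b%:R * _ = b%:R ^+ 2 * (4 * phi (X w))); last by ring.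
by rewrite ler_wpM2l ?sqr_ge0//; lra.
Qed.

Let mdiff : 0 <= m - \int[P]_w psi2 (V 0%N w) <= zeta.
Proof.
have i2 : P.-integrable setT (EFin \o (psi2 \o V 0%N)).
  apply: (@bounded_integrable _ _ _ P _ b%:R); first exact: measurableT_comp.
  by move=> w; have /andP[h1 h2] := psi2b (V 0%N w); rewrite ger0_norm.
have e1 : m - \int[P]_w psi2 (V 0%N w) = \int[P]_w (Vp w - psi2 (V 0%N w)).
  by rewrite RintegralB//; [rewrite iVp.2|exact: iVp.1].
rewrite e1; apply/andP; split.
  by apply: Rintegral_ge0 => w _; rewrite subr_ge0 /psi2 ge_min lexx.
apply: le_trans Hz; rewrite -RintegralZl//; apply: le_Rintegral => //.
  rewrite (_ : EFin \o _ = fun w => ((Vp w)%:E - (psi2 (V 0%N w))%:E)%E)//.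
  by apply: integrableB => //; exact: iVp.1.
move=> w _; have h := phi_linear (X w); have h0 := phi_ge0 (X w).
rewrite /psi2 -/(Vp w); have [h1|h1] := leP (Vp w) b%:R; first by rewrite subrr mulr_ge0// ltW.
have -> : Vp w - b%:R = b%:R * (X w - 1) by rewrite mulrBr mulr1 /X mulrCA mulfV ?mulr1// gt_eqF.
by rewrite ler_pM2l.
Qed.

Let big_prob : \int[P]_w (\1_[set y : R | b%:R < y] (V 0%N w)) <= 4 * zeta / b%:R.
Proof.
have mb : measurable [set y : R | b%:R < y] by apply: (measurable_set_lt (f := cst b%:R)).
apply: (@le_trans _ _ (\int[P]_w (4 * phi (X w)))); last first.
  by rewrite RintegralZl// ler_pdivlMr// -mulrA ler_pM2l// mulrC.
apply: le_Rintegral => //.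
- apply: (@bounded_integrable _ _ _ P _ 1); last by move=> w; exact: norm_indic_le1.
  by apply: measurableT_comp => //; exact: measurable_indic.
- rewrite (_ : EFin \o _ = fun w => (4%:E * (phi (X w))%:E)%E)//.
  exact: integrableZl.
move=> w _; rewrite indicE; case: (boolP (_ \in _)) => [|_]; last by rewrite mulr_ge0// phi_ge0.
rewrite inE /= => bV; have h := phi_square (X0 w).
have X1 : 1 <= X w by rewrite /X ler_pdivlMr// mul1r /Vp le_max ltW.
move: h; rewrite (min_idPr X1) expr1n; lra.
Qed.

Let ind i w : R := (nat_of_bool (D i w <= offered i w))%:R.
(** Chebyshev's inequality at the [J.+1] grid points and [mono_grid] in between: [S] sums the
    weights of the abandoning customers, [Q] their conditional means, and both are nondecreasing. *)
Let dev (psi : R -> R) (q s : R) (Mn := fun n w => \sum_(i < n) xi psi i w) :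
  measurable_fun setT psi -> (forall y, 0 <= psi y <= q) ->
  0 <= s -> \int[P]_w (psi (V 0%N w) ^+ 2) <= s -> \int[P]_w psi (V 0%N w) * (st%:R * Fa c) <= e ->
  let Bd := [set w | exists2 j, (j < J.+1)%N & e < `|Mn (j * st)%N w|] in
  [/\ measurable Bd, fine (P Bd) <= J.+1%:R * ((J * st)%:R * (s * Fa c) / e ^+ 2) &
   forall w, ~ Bd w -> forall n, (n <= J * st)%N -> `|Mn n w| <= 2 * e].
Proof.
move=> mpsi psib s0 hs he Bd.
have F0 : 0 <= Fa c by have /andP[] := Fa01 c.
have psi0 : 0 <= \int[P]_w psi (V 0%N w) by apply: Rintegral_ge0 => w _; have /andP[] := psib (V 0%N w).
have q0 : 0 <= q by have /andP[h1 h2] := psib 0; exact: le_trans h2.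
have [||mB pB] := @prob_exists _ _ _ P (fun j => [set w | e < `|Mn (j * st)%N w|]) J.+1 ((J * st)%:R * (s * Fa c) / e ^+ 2).
- by move=> j; have [] := markov_square (mart_measurable mpsi (j * st)%N) (mart_bound psib (j * st)%N) e0 (mart_second_moment mpsi psib (j * st)%N).
- move=> j jJ.
  have [_ h] := markov_square (mart_measurable mpsi (j * st)%N) (mart_bound psib (j * st)%N) e0 (mart_second_moment mpsi psib (j * st)%N).
  apply: (le_trans h); rewrite ler_pM2r ?invr_gt0 ?exprn_gt0//.
  apply: ler_pM => //; first by apply: mulr_ge0 => //; apply: Rintegral_ge0 => w _; exact: sqr_ge0.
    by rewrite ler_nat leq_mul2r -ltnS jJ orbT.
  by rewrite ler_wpM2r.
split=> //.
move=> w Bw n nJ.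
pose S n := \sum_(i < n) (psi (V i w) * ind i w).
pose Q n := \sum_(i < n) ((\int[P]_w psi (V 0%N w)) * Fa (offered i w)).
have SQ k : Mn k w = S k - Q k by rewrite /Mn /S /Q -sumrB.
have mono (f : nat -> R) : (forall i, 0 <= f i) -> forall k l, (k <= l)%N -> \sum_(i < k) f i <= \sum_(i < l) f i.
  move=> f0 k l /subnKC <-; rewrite big_split_ord /= lerDl; exact: sumr_ge0.
rewrite SQ; apply: (mono_grid st0) nJ.
- apply: (mono (fun i => psi (V i w) * ind i w)) => i.
  by rewrite mulr_ge0 ?ler0n//; have /andP[] := psib (V i w).
- apply: (mono (fun i => (\int[P]_w psi (V 0%N w)) * Fa (offered i w))) => i.
  rewrite mulr_ge0//; by have /andP[] := Fa01 (offered i w).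
- move=> k; rewrite /Q big_split_ord /= lerD2l; apply: le_trans he.
  apply: (@le_trans _ _ (\sum_(i < st) ((\int[P]_w psi (V 0%N w)) * Fa c))).
    apply: ler_sum => i _; rewrite ler_wpM2l//; apply: Fa_nd; by have /andP[] := offered_bounds (k + i) w.
  by rewrite sumr_const card_ord -mulrnAr [leRHS]mulrA [_ * st%:R]mulrC -mulrA [leRHS]mulr_natl -mulrnAr.
- move=> j jJ; rewrite -SQ leNgt; apply/negP => h; apply: Bw; by exists j.
Qed.

(** Three bad events: a deviation of the count ([psi = 1]), one of the truncated service times, and
    some customer with both [V > b] and [D <= c]. In the last one the product of two small
    probabilities is set against the large number of customers. In [3 * e] the additional [e] is the
    mean lost by truncation. *)
Lemma acceptance_deviations : exists Bd : set Om, [/\ measurable Bd,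
  fine (P Bd) <= J.+1%:R * ((J * st)%:R * Fa c / e ^+ 2)
     + J.+1%:R * ((J * st)%:R * (4 * b%:R * zeta * Fa c) / e ^+ 2)
     + (J * st)%:R * (4 * zeta / b%:R * Fa c) &
  forall w, ~ Bd w -> (forall i, 0 <= V i w) -> forall n, (n <= J * st)%N ->
    `|\sum_(i < n) (ind i w - Fa (offered i w))| <= 2 * e /\
    `|\sum_(i < n) (V i w * ind i w - m * Fa (offered i w))| <= 3 * e].
Proof.
have F0 : 0 <= Fa c by have /andP[] := Fa01 c.
have z0' : 0 <= zeta by have /andP[h1 h2] := mdiff; exact: le_trans h2.
have I1 : \int[P]_w (cst 1 (V 0%N w) : R) = 1 by rewrite prob_integral_cst.
have [|||||mB1 pB1 hB1] := @dev (cst 1) 1 1 => //.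
- by move=> y; rewrite ler01 lexx.
- by rewrite (eq_prob_integral (g := cst 1)) ?prob_integral_cst// => w; rewrite expr1n.
- by rewrite I1 mul1r.
have [|||||mB2 pB2 hB2] := @dev psi2 b%:R (4 * b%:R * zeta) => //.
- by rewrite !mulr_ge0// ltW.
- apply: le_trans H2; rewrite ler_wpM2r ?mulr_ge0//; have /andP[] := mdiff; lra.
have mA i : measurable ([set w | b%:R < V i w] `&` [set w | D i w <= c]).
  by apply: measurableI; [apply: (measurable_set_lt (f := cst b%:R))|apply: (measurable_set_le (g := cst c))].
have mb : measurable [set y : R | b%:R < y] by apply: (measurable_set_lt (f := cst b%:R)).
have pA i : fine (P ([set w | b%:R < V i w] `&` [set w | D i w <= c])) <= 4 * zeta / b%:R * Fa c.
  rewrite -Rintegral_indic//.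
  have e1 w : \1_([set w | b%:R < V i w] `&` [set w | D i w <= c]) w = \1_[set y : R | b%:R < y] (V i w) * indD i c w :> R.
    by rewrite !indicE in_setI -mulnb natrM /indD !mem_setE.
  rewrite (eq_prob_integral e1) (@own_split (\1_[set y : R | b%:R < y]) 1 c i (measurable_indic mb) (@norm_indic_le1 _ _ R _)).
  exact: ler_wpM2r.
have [//|mB3 pB3] := @prob_exists _ _ _ P _ (J * st) (4 * zeta / b%:R * Fa c) mA.
set B1 := [set w | _] in mB1 pB1 hB1; set B2 := [set w | _] in mB2 pB2 hB2; set B3 := [set w | _] in mB3 pB3.
exists (B1 `|` B2 `|` B3); split.
- by apply: measurableU => //; exact: measurableU.
- apply: (le_trans (prob_setU P (measurableU _ _ mB1 mB2) mB3)); apply: lerD => //.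
  apply: (le_trans (prob_setU P mB1 mB2)); apply: lerD => //.
  by move: pB1; rewrite mul1r.
move=> w Bw Vw n nJ.
have n1 : ~ B1 w by move=> h; apply: Bw; left; left.
have n2 : ~ B2 w by move=> h; apply: Bw; left; right.
have n3 : ~ B3 w by move=> h; apply: Bw; right.
have h1 := hB1 w n1 n nJ; have h2 := hB2 w n2 n nJ; split.
  apply: le_trans h1; rewrite le_eqVlt; apply/orP; left; apply/eqP; congr (`|_|).
  by apply: eq_bigr => i _; rewrite /xi I1 !mul1r.
have -> : \sum_(i < n) (V i w * ind i w - m * Fa (offered i w)) =
  \sum_(i < n) xi psi2 i w - (m - \int[P]_w psi2 (V 0%N w)) * \sum_(i < n) Fa (offered i w).
  rewrite mulr_sumr -sumrB; apply: eq_bigr => i _; rewrite /xi -/(ind i w).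
  have -> : psi2 (V i w) * ind i w = V i w * ind i w.
    rewrite /ind; case: (boolP (D i w <= offered i w)) => Di; last by rewrite !mulr0.
    congr (_ * _); rewrite /psi2 (max_idPl (Vw i)); apply/min_idPl.
    rewrite leNgt; apply/negP => bV; apply: n3; exists i; first exact: leq_trans (ltn_ord i) nJ.
    by split => //=; apply: (le_trans Di); have /andP[] := offered_bounds i w.
  ring.
have /andP[d1 d2] := mdiff.
have sF : 0 <= \sum_(i < n) Fa (offered i w) <= (J * st)%:R * Fa c.
  apply/andP; split; first by apply: sumr_ge0 => i _; have /andP[] := Fa01 (offered i w).
  apply: (@le_trans _ _ (\sum_(i < n) Fa c)).
    by apply: ler_sum => i _; apply: Fa_nd; have /andP[] := offered_bounds i w.
  by rewrite sumr_const card_ord -[leLHS]mulr_natl ler_wpM2r// ler_nat.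
have /andP[s0 s1] := sF.
apply: (le_trans (ler_normB _ _)); rewrite [`|_ * \sum_(_ < _) _|]ger0_norm ?mulr_ge0//.
have : (m - \int[P]_w psi2 (V 0%N w)) * \sum_(i < n) Fa (offered i w) <= e.
  by apply: le_trans H3; apply: ler_pM.
by move: h2; lra.
Qed.

End deviations.
End martingale.
End primitives.

(** * The limit processes *)

Section polygons.
Context {R : realType}.

Definition ramp (n i : nat) (t : R) : R := maxr 0 (minr 1 (n%:R * t - i%:R)).

Lemma ramp01 n i t : 0 <= ramp n i t <= 1.
Proof. by rewrite /ramp le_max lexx /= ge_max ler01 /= ge_min lexx. Qed.

Lemma ramp_lip n i (s t : R) : s <= t -> `|ramp n i t - ramp n i s| <= n%:R * (t - s).
Proof.
move=> st; have h : n%:R * s <= n%:R * t by rewrite ler_wpM2l.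
rewrite mulrBr /ramp; set a := n%:R * t; set b := n%:R * s; rewrite -/a -/b in h.
rewrite ler_norml; case: (leP 1 (a - i%:R)) => h1; case: (leP 1 (b - i%:R)) => h2;
  rewrite ?maxEle ?ler01; repeat case: ifP => ?; apply/andP; split; lra.
Qed.

(** The piecewise linear path with increment [dl i] over [[i / n, (i + 1) / n]]; as a sum of ramps
    it is linear in the increments. *)
Definition polygon (n m : nat) (dl : 'I_m -> R) (t : R) : R := \sum_(i < m) dl i * ramp n i t.

Lemma polygon_cont n m dl : cont0 (@polygon n m dl).
Proof.
apply: (@lip_cont0 _ _ (\sum_(i < m) `|dl i| * n%:R)) => s t s0 st.
rewrite /polygon -sumrB mulr_suml; apply: (le_trans (ler_norm_sum _ _ _)).
apply: ler_sum => i _; rewrite -mulrBr normrM -mulrA ler_wpM2l//; exact: ramp_lip.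
Qed.

Lemma polygon_dist n m (d1 d2 : 'I_m -> R) (q t : R) : (forall i, `|d1 i - d2 i| <= q) ->
  `|polygon n d1 t - polygon n d2 t| <= m%:R * q.
Proof.
move=> H; rewrite /polygon -sumrB; apply: (le_trans (ler_norm_sum _ _ _)).
apply: (@le_trans _ _ (\sum_(i < m) q)); last by rewrite sumr_const card_ord mulr_natl.
apply: ler_sum => i _; rewrite -mulrBl normrM -[leRHS]mulr1; apply: ler_pM => //.
by have /andP[h1 h2] := ramp01 n i t; rewrite ger0_norm.
Qed.

Lemma polygon_interp (x : R -> R) n m (t e : R) : (0 < n)%N -> x 0 = 0 -> 0 <= t -> n%:R * t < m%:R ->
  (forall s, 0 <= s -> `|s - t| <= n%:R^-1 -> `|x s - x t| <= e) ->
  `|polygon n (fun i : 'I_m => x (i.+1%:R / n%:R) - x (i%:R / n%:R)) t - x t| <= e.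
Proof.
move=> n0 x0 t0 ntm H.
have nR : 0 < n%:R :> R by rewrite ltr0n.
have nt : 0 <= n%:R * t by rewrite mulr_ge0// ltW.
have /andP[j1 j2] := truncn_itv nt; set j := truncn (n%:R * t) in j1 j2.
have jm : (j < m)%N by rewrite -(ltr_nat R); exact: le_lt_trans ntm.
pose g i := (x (i.+1%:R / n%:R) - x (i%:R / n%:R)) * ramp n i t.
have -> : polygon n (fun i : 'I_m => x (i.+1%:R / n%:R) - x (i%:R / n%:R)) t =
   x (j%:R / n%:R) + (x (j.+1%:R / n%:R) - x (j%:R / n%:R)) * (n%:R * t - j%:R).
  rewrite /polygon -(big_mkord xpredT g) (big_cat_nat (leq0n j) (ltnW jm)) /=.
  congr (_ + _).
    rewrite (eq_big_nat _ _ (F2 := fun i => x (i.+1%:R / n%:R) - x (i%:R / n%:R))); last first.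
      move=> i /andP[_ ij]; rewrite /g /ramp.
      have h : i.+1%:R <= j%:R :> R by rewrite ler_nat.
      rewrite (min_idPl _) ?(max_idPr _) ?mulr1//.
      by rewrite -natr1 in h; lra.
    by rewrite (telescope_sumr (fun i => x (i%:R / n%:R)))// mul0r x0 subr0.
  rewrite (big_ltn jm) (big_nat_cond _ _ j.+1) big1 ?addr0.
    rewrite /g /ramp; congr (_ * _); rewrite -natr1 in j2.
    by rewrite (min_idPr _) ?(max_idPr _)//; lra.
  move=> i /andP[/andP[ji _] _]; rewrite /g /ramp.
  have h : j.+1%:R <= i%:R :> R by rewrite ler_nat.
  by rewrite (max_idPl _) ?mulr0// ge_min; apply/orP; right; lra.
set th := n%:R * t - j%:R.
have th01 : 0 <= th <= 1 by rewrite -natr1 in j2; rewrite /th; lra.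
have tE : t = (j%:R + th) / n%:R by rewrite /th; field; rewrite gt_eqF.
have h1 : `|x (j%:R / n%:R) - x t| <= e.
  apply: H; first by rewrite divr_ge0// ltW.
  have -> : j%:R / n%:R - t = - (th / n%:R) by rewrite tE; field; rewrite gt_eqF.
  by rewrite normrN ger0_norm ?ler_pdivrMr ?mulVf ?gt_eqF//; [lra|rewrite divr_ge0 ?(ltW nR)//; lra].
have h2 : `|x (j.+1%:R / n%:R) - x t| <= e.
  apply: H; first by rewrite divr_ge0// ltW.
  have -> : j.+1%:R / n%:R - t = (1 - th) / n%:R by rewrite tE -natr1; field; rewrite gt_eqF.
  by rewrite ger0_norm ?ler_pdivrMr ?mulVf ?gt_eqF//; [lra|rewrite divr_ge0 ?(ltW nR)//; lra].
have -> : x (j%:R / n%:R) + (x (j.+1%:R / n%:R) - x (j%:R / n%:R)) * th - x t =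
  (1 - th) * (x (j%:R / n%:R) - x t) + th * (x (j.+1%:R / n%:R) - x t) by ring.
have n1 : `|1 - th| = 1 - th by rewrite ger0_norm; lra.
have n2 : `|th| = th by rewrite ger0_norm; lra.
apply: (le_trans (ler_normD _ _)); rewrite !normrM n1 n2.
have -> : e = (1 - th) * e + th * e by ring.
by apply: lerD; apply: ler_wpM2l => //; lra.
Qed.

End polygons.

Definition X3 {R : realType} (A S : R -> R) (z : R) : 'I_3 -> R -> R := pvec 3 [:: A; S; fun _ => z].

Lemma ord3_case (Q : 'I_3 -> Prop) : Q (inord 0) -> Q (inord 1) -> Q (inord 2) -> forall i, Q i.
Proof.
move=> q0 q1 q2 i; rewrite -(inord_val i); case: i => -[|[|[|//]]] ? /=; by [].
Qed.

(** Continuity for locally uniform convergence of continuous paths, a property that survives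
    composition with the solution map. *)
Definition lu_continuous {R : realType} (Th : ('I_3 -> R -> R) -> R) :=
  forall (ys : nat -> 'I_3 -> R -> R) y,
    (forall n i, cont0 (ys n i)) -> (forall i, cont0 (y i)) ->
    (forall i (T e : R), 0 < e -> \forall n \near \oo, forall t : R, 0 <= t <= T -> `|ys n i t - y i t| <= e) ->
    (fun n => Th (ys n)) @ \oo --> Th y.

Section countable_code.
Context {d} {Om : measurableType d} {R : realType} (P : probability Om R) {T : countType}.

Let approx (g : T -> R) (c : Om -> T) K w : R :=
  \sum_(n < K) (if pickle_inv n is Some a then g a * \1_[set w | c w = a] w else 0).

Let approx_eq g c K w : approx g c K w = if (pickle (c w) < K)%N then g (c w) else 0.
Proof.
have h n : (if pickle_inv n is Some a then g a * \1_[set w | c w = a] w else 0) =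
   if n == pickle (c w) then g (c w) else 0.
  case: eqP => [->|nc]; first by rewrite pickleK_inv indicE mem_set// mulr1.
  case E : (pickle_inv n) => [a|//]; rewrite indicE memNset ?mulr0//= => ca.
  by apply: nc; rewrite ca; have := @pickle_invK T n; rewrite /oapp E.
rewrite /approx (eq_bigr (fun n : 'I_K => if val n == pickle (c w) then g (c w) else 0)) => [|n _]; last exact: h.
case: ltnP => [lt|ge].
  rewrite (bigD1 (Ordinal lt)) //= eqxx big1 ?addr0// => i /eqP il; case: eqP => // e.
  by exfalso; apply: il; apply: val_inj.
by apply: big1 => i _; case: eqP => // e; move: ge; rewrite leqNgt -e ltn_ord.
Qed.

Let approx_cvg g c w : (fun K => approx g c K w) @ \oo --> g (c w).
Proof.
apply: cvg_near_cst; exists (pickle (c w)).+1 => // K /= cK.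
by rewrite approx_eq cK.
Qed.

Lemma code_measurable (g : T -> R) (c : Om -> T) : (forall a, measurable [set w | c w = a]) ->
  measurable_fun setT (fun w => g (c w)).
Proof.
move=> mc; apply: (@measurable_fun_cvg _ _ _ _ (fun K w => approx g c K w)) => [K|w _]; last exact: approx_cvg.
apply: measurable_sum => n; case: (pickle_inv (val n)) => [a|]; last exact: measurable_cst.
by apply: measurable_funM => //; exact: measurable_indic.
Qed.

Lemma code_same_int (g : T -> R) (c c' : Om -> T) (M : R) : (forall a, `|g a| <= M) ->
  (forall a, measurable [set w | c w = a]) -> (forall a, measurable [set w | c' w = a]) ->
  (forall a, fine (P [set w | c w = a]) = fine (P [set w | c' w = a])) ->
  \int[P]_w g (c w) = \int[P]_w g (c' w).
Proof.
move=> gM mc mc' cc'.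
have b0 : 0 <= `|M| by [].
have bd (f : Om -> T) K w : `|approx g f K w| <= `|M|.
  rewrite approx_eq; case: ifP => _; last by rewrite normr0.
  exact: le_trans (gM _) (ler_norm _).
have mt (f : Om -> T) n : (forall a, measurable [set w | f w = a]) ->
  measurable_fun setT (fun w => (if pickle_inv n is Some a then g a * \1_[set w | f w = a] w else 0) : R).
  move=> mf; case: (pickle_inv n) => [a|]; last exact: measurable_cst.
  by apply: measurable_funM => //; exact: measurable_indic.
have L (f : Om -> T) : (forall a, measurable [set w | f w = a]) ->
  (fun K => \int[P]_w approx g f K w) @ \oo --> \int[P]_w g (f w).
  move=> mf; apply: (@bounded_cvg _ _ _ P _ _ `|M|) => [K|K w|w].
  - by apply: measurable_sum => n; exact: mt.
  - exact: bd.
  - exact: approx_cvg.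
have E K : \int[P]_w approx g c K w = \int[P]_w approx g c' K w.
  have F (f : Om -> T) : (forall a, measurable [set w | f w = a]) ->
    \int[P]_w approx g f K w = \sum_(n < K) (if pickle_inv (val n) is Some a then g a * fine (P [set w | f w = a]) else 0).
    move=> mf; rewrite (@bounded_integral_sum _ _ _ P _ _ (fun n w => if pickle_inv (val n) is Some a then g a * \1_[set w | f w = a] w else 0) (fun=> `|M|)).
    - apply: eq_bigr => n _; case: (pickle_inv (val n)) => [a|]; last exact: prob_integral_cst.
      rewrite (@bounded_integralZ _ _ _ P _ 1) ?Rintegral_indic//.
      by move=> w; exact: norm_indic_le1.
    - by move=> n; exact: mt.
    - move=> n w; case: (pickle_inv (val n)) => [a|]; last by rewrite normr0.
      rewrite normrM -[leRHS]mulr1; apply: ler_pM => //; last exact: norm_indic_le1.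
      exact: le_trans (gM _) (ler_norm _).
  rewrite !F//; apply: eq_bigr => n _; case: (pickle_inv (val n)) => // a; by rewrite cc'.
have L1 := L c mc; have L2 := L c' mc'.
apply: (cvg_unique (@Rhausdorff R) L1).
by rewrite (_ : (fun K => \int[P]_w approx g c K w) = (fun K => \int[P]_w approx g c' K w))//; apply/funext.
Qed.

End countable_code.

(** * Countable codes of paths *)

Section path_code.
Context {R : realType}.

(** A path on [[0, p.+1]] has [p.+1 ^ 2] increments over cells of length [1 / p.+1]; rounding each
    within [p.+1 ^ -3] displaces the decoded path by at most [1 / p.+1]. *)
Definition mesh (p : nat) : R := (p.+1 ^ 3)%:R.
Definition quant (p : nat) (x : R) : int := Num.floor (mesh p * x).
Definition unquant (p : nat) (k : int) : R := k%:~R / mesh p.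
Definition cell (p : nat) (k : int) : set R := `[unquant p k, unquant p (k + 1)[%classic.

Lemma mesh_gt0 p : 0 < mesh p. Proof. by rewrite ltr0n expn_gt0. Qed.

Lemma quant_cell p x k : (quant p x = k) <-> cell p k x.
Proof.
rewrite /cell /= in_itv /= /unquant ler_pdivrMr ?mesh_gt0// ltr_pdivlMr ?mesh_gt0// ![_ * mesh p]mulrC.
split=> [<-|h]; first by rewrite floor_itv ?num_real.
exact: floor_def.
Qed.

Lemma unquant_dist p x : `|unquant p (quant p x) - x| <= (mesh p)^-1.
Proof.
have := (quant_cell p x (quant p x)).1 erefl; rewrite /cell /= in_itv /= => /andP[h1 h2].
rewrite distrC ger0_norm ?subr_ge0// lerBlDl.
by apply: (le_trans (ltW h2)); rewrite /unquant intrD mulrDl mul1r.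
Qed.

Definition incr (x : R -> R) (p i : nat) : R := x (i.+1%:R / p.+1%:R) - x (i%:R / p.+1%:R).

Definition path_code p (x : R -> R) : {ffun 'I_(p.+1 * p.+1) -> int} :=
  [ffun i : 'I__ => quant p (incr x p i)].
Definition path_decode p (c : {ffun 'I_(p.+1 * p.+1) -> int}) : R -> R :=
  polygon p.+1 (fun i => unquant p (c i)).

Lemma path_decode_cvg (x : R -> R) (T e : R) : cont0 x -> x 0 = 0 -> 0 < e ->
  \forall p \near \oo, forall t, 0 <= t <= T -> `|path_decode (path_code p x) t - x t| <= e.
Proof.
move=> cx x0 e0; pose T1 := `|T| + 1.
have T10 : 0 <= T1 by rewrite addr_ge0.
have T1p : 0 < T1 by rewrite ltr_wpDl.
have T1i : 0 < T1^-1 by rewrite invr_gt0.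
have e2 : 0 < e / 2 by rewrite divr_gt0.
have [dl dl0 Hdl] := cont0_unif cx T10 e2.
have m0 : 0 < minr (minr dl 1) (e / 2) by rewrite !lt_min dl0 ltr01 e2.
near=> p.
have p0 : 0 < p.+1%:R :> R by rewrite ltr0n.
have pm : p.+1%:R^-1 < minr (minr dl 1) (e / 2) by near: p; exact: (near_infty_natSinv_lt (PosNum m0)).
have Tp : T1 < p.+1%:R.
  by rewrite -ltf_pV2 ?posrE//; near: p; exact: (near_infty_natSinv_lt (PosNum T1i)).
move: pm; rewrite !lt_min => /andP[/andP[pd p1] pe] t /andP[t0 tT].
have tT1 : t <= T1 by rewrite /T1; have := ler_norm T; lra.
have h1 : `|polygon p.+1 (fun i : 'I_(p.+1 * p.+1) => incr x p i) t - x t| <= e / 2.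
  apply: polygon_interp => //.
    by rewrite natrM ltr_pM2l//; exact: le_lt_trans Tp.
  move=> s s0 st; apply/ltW/Hdl; [| |exact: le_lt_trans pd].
  - rewrite s0 /=; apply: (@le_trans _ _ (t + 1)); last by rewrite /T1 lerD2r (le_trans tT)// ler_norm.
    by rewrite -lerBlDl; exact: le_trans (ler_norm _) (le_trans st (ltW p1)).
  - by rewrite t0.
have h2 : `|path_decode (path_code p x) t - polygon p.+1 (fun i : 'I_(p.+1 * p.+1) => incr x p i) t| <= e / 2.
  apply: (le_trans (@polygon_dist _ _ _ _ _ (mesh p)^-1 _ _)).
    by move=> i; rewrite ffunE; exact: unquant_dist.
  apply: le_trans (ltW pe); rewrite /mesh natrX natrM ler_pdivrMr ?exprn_gt0//.
  by rewrite exprS mulrA mulVf ?gt_eqF// mul1r expr2.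
have := ler_distD (polygon p.+1 (fun i : 'I_(p.+1 * p.+1) => incr x p i) t) (path_decode (path_code p x) t) (x t).
lra.
Unshelve. all: by end_near. Qed.

End path_code.

Section path_functionals.
Context {d} {Om : measurableType d} {R : realType} (P : probability Om R).
Variables (A S : R -> Om -> R) (Z : Om -> R).
Hypothesis mA : forall t, measurable_fun setT (A t).
Hypothesis mS : forall t, measurable_fun setT (S t).
Hypothesis mZ : measurable_fun setT Z.
Hypothesis cA : forall w, cont0 (A ^~ w).
Hypothesis cS : forall w, cont0 (S ^~ w).
Hypothesis A0 : forall w, A 0 w = 0.
Hypothesis S0 : forall w, S 0 w = 0.

Let ctype p : countType := ({ffun 'I_(p.+1 * p.+1) -> int} * {ffun 'I_(p.+1 * p.+1) -> int} * int)%type.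
Definition code3 p w : ctype p := (path_code p (A ^~ w), path_code p (S ^~ w), quant p (Z w)).
Definition decode3 p (c : ctype p) : 'I_3 -> R -> R :=
  X3 (path_decode c.1.1) (path_decode c.1.2) (unquant p c.2).

(** The conditions on arrivals and start are grouped apart from those on services, the form in which
    independence is used. *)
Lemma code3_event p (c : ctype p) : [set w | code3 p w = c] =
  (\bigcap_(i in [set: 'I_(p.+1 * p.+1)]) [set w | cell p (c.1.1 i) (incr (A ^~ w) p i)] `&` [set w | cell p c.2 (Z w)])
  `&` \bigcap_(i in [set: 'I_(p.+1 * p.+1)]) [set w | cell p (c.1.2 i) (incr (S ^~ w) p i)].
Proof.
case: c => [[a s] z] /=; apply/seteqP; split=> w /=.
  case=> ea es ez; split; [split|].
  - by move=> i _ /=; apply/quant_cell; rewrite -ea ffunE.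
  - exact/quant_cell.
  - by move=> i _ /=; apply/quant_cell; rewrite -es ffunE.
move=> [[ha hz] hs]; congr (_, _, _).
- by apply/ffunP => i; rewrite ffunE; apply/quant_cell; exact: ha.
- by apply/ffunP => i; rewrite ffunE; apply/quant_cell; exact: hs.
- exact/quant_cell.
Qed.

Lemma incr_event_measurable (X : R -> Om -> R) (C : set R) p i : (forall t, measurable_fun setT (X t)) ->
  measurable C -> measurable [set w | C (incr (X ^~ w) p i)].
Proof.
move=> mX mC; have mI : measurable_fun setT (fun w => incr (X ^~ w) p i) by exact: measurable_funB.
by have := mI measurableT C mC; rewrite setTI.
Qed.

Lemma cell_measurable p k : measurable (@cell R p k). Proof. exact: measurable_itv. Qed.

Lemma code3_measurable p (c : ctype p) : measurable [set w | code3 p w = c].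
Proof.
rewrite code3_event; apply: measurableI; first apply: measurableI.
- by apply: fin_bigcap_measurable => // i _; apply: incr_event_measurable => //; exact: cell_measurable.
- by have := mZ measurableT (cell_measurable p c.2); rewrite setTI.
- by apply: fin_bigcap_measurable => // i _; apply: incr_event_measurable => //; exact: cell_measurable.
Qed.

Variable Th : ('I_3 -> R -> R) -> R.
Hypothesis cTh : lu_continuous Th.

Lemma decode3_cvg w : (fun p => Th (decode3 (code3 p w))) @ \oo --> Th (X3 (A ^~ w) (S ^~ w) (Z w)).
Proof.
apply: cTh.
- move=> p; apply: ord3_case; rewrite /decode3 /X3 /pvec !inordK//=; try exact: polygon_cont; exact: cont0_cst.
- by apply: ord3_case; rewrite /X3 /pvec !inordK//=; exact: cont0_cst.
apply: ord3_case => T e e0; rewrite /decode3 /X3 /pvec !inordK//=.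
- exact: path_decode_cvg.
- exact: path_decode_cvg.
near=> p => t _; apply: (le_trans (unquant_dist _ _)).
have h : p.+1%:R^-1 < e by near: p; exact: (near_infty_natSinv_lt (PosNum e0)).
apply: le_trans (ltW h); rewrite lef_pV2 ?posrE ?ltr0n ?mesh_gt0// /mesh ler_nat.
by rewrite expnS leq_pmulr// expn_gt0.
Unshelve. all: by end_near. Qed.

Lemma functional_measurable : measurable_fun setT (fun w => Th (X3 (A ^~ w) (S ^~ w) (Z w))).
Proof.
apply: (@measurable_fun_cvg _ _ _ _ (fun p w => Th (decode3 (code3 p w)))) => [p|w _]; last exact: decode3_cvg.
exact: (@code_measurable _ _ _ _ (fun c => Th (decode3 c)) (code3 p) (@code3_measurable p)).
Qed.

End path_functionals.

Section sign_symmetry.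
Context {d} {Om : measurableType d} {R : realType} (P : probability Om R).
Variables (A S : R -> Om -> R) (Z : Om -> R).
Hypothesis mA : forall t, measurable_fun setT (A t).
Hypothesis mS : forall t, measurable_fun setT (S t).
Hypothesis mZ : measurable_fun setT Z.
Hypothesis cA : forall w, cont0 (A ^~ w).
Hypothesis cS : forall w, cont0 (S ^~ w).
Hypothesis A0 : forall w, A 0 w = 0.
Hypothesis S0 : forall w, S 0 w = 0.
Let S' t w := - S t w.
Let pastE p (c : 'I_(p.+1 * p.+1) -> int) (z : int) : set Om :=
  \bigcap_(i in [set: 'I_(p.+1 * p.+1)]) [set w | cell p (c i) (incr (A ^~ w) p i)] `&` [set w | cell p z (Z w)].
Let incrE (X : R -> Om -> R) p (c : 'I_(p.+1 * p.+1) -> int) : set Om :=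
  \bigcap_(i in [set: 'I_(p.+1 * p.+1)]) [set w | cell p (c i) (incr (X ^~ w) p i)].
Hypothesis fact1 : forall p (c : 'I_(p.+1 * p.+1) -> int) z (s : 'I_(p.+1 * p.+1) -> int),
  fine (P (@pastE p c z `&` @incrE S p s)) = fine (P (@pastE p c z)) * fine (P (@incrE S p s)).
Hypothesis fact2 : forall p (c : 'I_(p.+1 * p.+1) -> int) z (s : 'I_(p.+1 * p.+1) -> int),
  fine (P (@pastE p c z `&` @incrE S' p s)) = fine (P (@pastE p c z)) * fine (P (@incrE S' p s)).
Hypothesis sym : forall p (s : 'I_(p.+1 * p.+1) -> int), fine (P (@incrE S p s)) = fine (P (@incrE S' p s)).

(** Codes take countably many values, and each value is an event that factors into a part for
    arrivals and start and a part for services. Only the latter changes with the sign of [S], and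
    its probability does not. Refining the mesh gives the equality for [Th]. *)
Lemma sign_symmetry (Th : ('I_3 -> R -> R) -> R) (M : R) : lu_continuous Th -> (forall y, `|Th y| <= M) ->
  \int[P]_w Th (X3 (A ^~ w) (S ^~ w) (Z w)) = \int[P]_w Th (X3 (A ^~ w) (S' ^~ w) (Z w)).
Proof.
move=> cTh ThM.
have mS' t : measurable_fun setT (S' t) by exact: measurableT_comp.
have cS' w : cont0 (S' ^~ w) by exact: cont0N.
have S'0 w : S' 0 w = 0 by rewrite /S' S0 oppr0.
have mc p c := @code3_measurable _ _ _ A S Z mA mS mZ p c.
have mc' p c := @code3_measurable _ _ _ A S' Z mA mS' mZ p c.
have L (W : R -> Om -> R) : (forall t, measurable_fun setT (W t)) -> (forall w, cont0 (W ^~ w)) -> (forall w, W 0 w = 0) ->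
  (fun p => \int[P]_w Th (decode3 (code3 A W Z p w))) @ \oo --> \int[P]_w Th (X3 (A ^~ w) (W ^~ w) (Z w)).
  move=> mW cW W0; apply: (@bounded_cvg _ _ _ P _ _ M) => [p|p w|w]; [|exact: ThM|exact: decode3_cvg].
  exact: (@code_measurable _ _ _ _ (fun c => Th (decode3 c)) (code3 A W Z p) (fun c => code3_measurable mA mW mZ c)).
have L1 := L S mS cS S0; have L2 := L S' mS' cS' S'0.
apply: (cvg_unique (@Rhausdorff R) L1).
rewrite (_ : (fun p => \int[P]_w Th (decode3 (code3 A S Z p w))) = (fun p => \int[P]_w Th (decode3 (code3 A S' Z p w))))//.
apply/funext => p.
apply: (@code_same_int _ _ _ P _ (fun c => Th (decode3 c)) (code3 A S Z p) (code3 A S' Z p) M) => //.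
by move=> [[a s] z]; rewrite !code3_event /= fact1 fact2 sym.
Qed.

End sign_symmetry.

Section normal_symmetry.
Context {R : realType}.
Local Notation leb := (@lebesgue_measure R).

(** Reflection exchanges the closed and the open end, which carry no mass. *)
Lemma normal_prob_opp (s a b : R) : s != 0 ->
  normal_prob 0 s `[a, b[%classic = normal_prob 0 s `]- b, - a]%classic.
Proof.
move=> s0; rewrite /normal_prob.
have mp : measurable_fun setT (fun x : R => (normal_pdf 0 s x)%:E).
  by apply/measurable_EFinP; exact: measurable_normal_pdf.
have [ab|ba] := leP b a.
  rewrite !set_itv_ge ?integral_set0// -?leNgt ?bnd_simp//=.
  by rewrite lerN2.
rewrite integral_itv_bndo_bndc; last exact: measurable_funTS.
rewrite integral_itv_obnd_cbnd; last exact: measurable_funTS.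
rewrite integration_by_substitution_oppr; [|exact: ltW|].
  apply: eq_integral => x _ /=; rewrite !normal_pdfE// /normal_fun !subr0 sqrrN//.
by apply: continuous_subspaceT => x; exact: continuous_normal_pdf.
Qed.

End normal_symmetry.

(** * Test functionals for weak convergence *)

Section weak_convergence.
Context {R : realType}.

Lemma weak_cvg_real {d : measure_display} (Om : R -> measurableType d) (P : forall a, probability (Om a) R) n
  (X : forall a, Om a -> 'I_n -> R -> R) (Fl : set_system R) {d0} (Om0 : measurableType d0) (P0 : probability Om0 R)
  (X0 : Om0 -> 'I_n -> R -> R) (f : ('I_n -> R -> R) -> R) : Filter Fl ->
  weak_cvg P X Fl P0 X0 -> bounded_functional f -> J1_continuous f ->
  (fun a => \int[P a]_w f (X a w)) @ Fl --> \int[P0]_w f (X0 w).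
Proof.
move=> FF H [M fM] cf; have := H f (ex_intro _ M fM) cf => {}H.
apply: (@fine_cvg _ _ _ _ (fun a => \int[P a]_w (f (X a w))%:E)%E).
by rewrite fineK//; apply: (@bounded_integral_fin _ _ _ P0 (fun w => f (X0 w)) M).
Qed.

Lemma cvg_prod_ord {T : Type} {Fl : set_system T} {FF : Filter Fl} m (f : nat -> T -> R) (l : nat -> R) :
  (forall i, (i < m)%N -> f i @ Fl --> l i) ->
  (fun n => \prod_(i < m) f i n) @ Fl --> \prod_(i < m) l i.
Proof.
elim: m => [|m IH] H.
  rewrite (_ : (fun n => \prod_(i < 0) f i n) = fun=> 1); last by apply/funext => n; rewrite big_ord0.
  by rewrite big_ord0; exact: cvg_cst.
rewrite big_ord_recr /=.
rewrite (_ : (fun n => \prod_(i < m.+1) f i n) = fun n => (\prod_(i < m) f i n) * f m n); last first.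
  by apply/funext => n; rewrite big_ord_recr.
exact: cvgM (IH (fun i im => H i (ltnW im))) (H m (ltnSn m)).
Qed.

Lemma cvg_comp_cont {T : Type} {Fl : set_system T} {FF : Filter Fl} (h : R -> R) (f : T -> R) (a : R) :
  continuous h -> f @ Fl --> a -> (fun x => h (f x)) @ Fl --> h a.
Proof. by move=> ch fa; exact: (continuous_cvg FF (ch a) fa). Qed.

Lemma cvg_real_unique {T : Type} {Fl : set_system T} (PF : ProperFilter Fl) (f : T -> R) (a b : R) :
  f @ Fl --> a -> f @ Fl --> b -> a = b.
Proof. by move=> h1 h2; exact: (cvg_unique (@Rhausdorff R) h1 h2). Qed.

Lemma prod_bound m (f : nat -> R) : (forall i, 0 <= f i <= 1) -> 0 <= \prod_(i < m) f i <= 1.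
Proof.
move=> H; apply/andP; split; first by apply: prodr_ge0 => i _; have /andP[] := H i.
by apply: prodr_ile1 => i _; exact: H.
Qed.

(** Weak convergence only tests continuous functionals, so indicators enter as pointwise limits of
    continuous functions with values in [0,1]. *)
Definition soft (D : set R) := exists h : nat -> R -> R,
  [/\ forall p, continuous (h p), forall p x, 0 <= h p x <= 1 & forall x, (fun p => h p x) @ \oo --> (\1_D x : R)].

Let clamp (y : R) : R := (`|y| - `|y - 1| + 1) / 2.
Let clamp0 y : y <= 0 -> clamp y = 0.
Proof. by move=> y0; rewrite /clamp ler0_norm// ler0_norm; lra. Qed.
Let clamp1 y : 1 <= y -> clamp y = 1.
Proof. by move=> y0; rewrite /clamp ger0_norm ?ger0_norm; lra. Qed.
Let clamp01 y : 0 <= clamp y <= 1.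
Proof.
have [/clamp0 ->|y0] := leP y 0; first by rewrite lexx ler01.
have [/clamp1 ->|y1] := leP 1 y; first by rewrite lexx ler01.
by rewrite /clamp gtr0_norm// ltr0_norm; lra.
Qed.
Let clamp_cont : continuous clamp.
Proof.
move=> x; apply: cvgM; last exact: cvg_cst.
apply: cvgD; last exact: cvg_cst.
apply: cvgB; first by apply: cvg_norm; exact: cvg_id.
by apply: cvg_norm; apply: cvgB; [exact: cvg_id|exact: cvg_cst].
Qed.

Lemma soft_itv (a b : R) : soft `[a, b[%classic.
Proof.
(* The shift by 1 makes the first factor equal to 1 from [a] on, and the second one vanishes from
   [b] on, so the limit has the right values at both ends. *)
exists (fun p x => clamp (p%:R * (x - a) + 1) * clamp (p%:R * (b - x))); split.
- move=> p x; apply: cvgM; apply: (cvg_comp_cont clamp_cont).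
    by apply: cvgD; [apply: cvgMr; apply: cvgB; [exact: cvg_id|exact: cvg_cst]|exact: cvg_cst].
  by apply: cvgMr; apply: cvgB; [exact: cvg_cst|exact: cvg_id].
- move=> p x; have /andP[h1 h2] := clamp01 (p%:R * (x - a) + 1).
  have /andP[h3 h4] := clamp01 (p%:R * (b - x)).
  by rewrite mulr_ge0//= mulr_ile1.
move=> x; have [ax|xa] := leP a x; have [bx|xb] := leP b x.
- rewrite indicE memNset; last by rewrite /= in_itv /= => /andP[_]; lra.
  apply: cvg_near_cst; apply: nearW => p.
  have h : p%:R * (b - x) <= 0 by apply: mulr_ge0_le0 => //; lra.
  by rewrite (clamp0 h) mulr0.
- rewrite indicE mem_set; last by rewrite /= in_itv /= ax.
  have bx0 : 0 < b - x by lra.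
  apply: cvg_near_cst; exists (truncn (b - x)^-1).+1 => // p /= hp.
  have p1 : (b - x)^-1 <= p%:R.
    by apply: (le_trans (ltW (truncnS_gt _))); rewrite ler_nat.
  have h1 : 1 <= p%:R * (b - x) by rewrite -ler_pdivrMr// div1r.
  have h2 : 1 <= p%:R * (x - a) + 1 by rewrite lerDr mulr_ge0//; lra.
  by rewrite !clamp1// mulr1.
- rewrite indicE memNset; last by rewrite /= in_itv /= => /andP[]; lra.
  apply: cvg_near_cst; apply: nearW => p.
  have h : p%:R * (b - x) <= 0 by apply: mulr_ge0_le0 => //; lra.
  by rewrite (clamp0 h) mulr0.
rewrite indicE memNset; last by rewrite /= in_itv /= => /andP[]; lra.
have ax0 : 0 < a - x by lra.
apply: cvg_near_cst; exists (truncn (a - x)^-1).+1 => // p /= hp.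
have p1 : (a - x)^-1 <= p%:R.
  by apply: (le_trans (ltW (truncnS_gt _))); rewrite ler_nat.
have h1 : 1 <= p%:R * (a - x) by rewrite -ler_pdivrMr// div1r.
have h2 : p%:R * (x - a) + 1 <= 0 by rewrite -opprB mulrN; lra.
by rewrite (clamp0 h2) mul0r.
Qed.

Lemma soft_opp (D : set R) : soft D -> soft [set x | D (- x)].
Proof.
move=> [h [h1 h2 h3]]; exists (fun p x => h p (- x)); split.
- by move=> p x; apply: (cvg_comp_cont (h1 p)); apply: cvgN; exact: cvg_id.
- by move=> p x; exact: h2.
- move=> x; have := h3 (- x); rewrite (_ : \1_[set x0 | D (- x0)] x = \1_D (- x) :> R)//.
Qed.

Section evaluations.
Variables (Lam : R) (m : nat) (t : nat -> R) (g : nat -> R -> R).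
Hypothesis Lam1 : 1 <= Lam.
Hypothesis t0 : forall i, 0 <= t i.
Hypothesis cg : forall i, continuous (g i).
Hypothesis g01 : forall i x, 0 <= g i x <= 1.

Definition incr_fun (x : R -> R) : R := \prod_(i < m) g i (evq Lam (t i.+1) x - evq Lam (t i) x).

Lemma incr_fun01 x : 0 <= incr_fun x <= 1.
Proof. by apply: (@prod_bound m (fun i => g i (evq Lam (t i.+1) x - evq Lam (t i) x))). Qed.

Lemma incr_fun_J1 (xs : nat -> R -> R) x : (forall n, cadlag (xs n)) -> cadlag x -> J1_cvg xs x ->
  (fun n => incr_fun (xs n)) @ \oo --> incr_fun x.
Proof.
move=> cxs cx xsx; apply: (@cvg_prod_ord _ _ _ m (fun i n => g i (evq Lam (t i.+1) (xs n) - evq Lam (t i) (xs n))) (fun i => g i (evq Lam (t i.+1) x - evq Lam (t i) x))) => i _.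
have h : (fun n => evq Lam (t i.+1) (xs n) - evq Lam (t i) (xs n)) @ \oo --> evq Lam (t i.+1) x - evq Lam (t i) x.
  by apply: cvgB; exact: evq_J1.
exact: (cvg_comp_cont (@cg i) h).
Qed.

Lemma evq_measurable {d} {T : measurableType d} (L s : R) (X : T -> R -> R) : 0 <= L ->
  (forall q, measurable_fun setT (fun w => X w q)) -> measurable_fun setT (fun w => evq L s (X w)).
Proof.
move=> L0 mX.
have -> : (fun w => evq L s (X w)) = (fun w => infs (fun j => clip L (X w (grid j)) + L ^+ 2 * `|grid j - s|) 0).
  apply/funext => w; rewrite /evq /infs; congr inf; apply/seteqP; split=> y /=.
    by move=> [j _ <-]; exists j.
  by move=> [j _ <-]; exists j.
apply: (@measurable_fun_infs _ _ _ _ (fun j w => clip L (X w (grid j)) + L ^+ 2 * `|grid j - s|)) => [w _|j].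
  exists (- L) => _ [j _ <-].
  have /andP[h _] := clip_bnd (X w (grid j)) L0.
  by rewrite (le_trans h)// lerDl mulr_ge0// sqr_ge0.
apply: measurable_funD => //; apply: measurable_maxr => //; exact: measurable_minr.
Qed.

Lemma incr_fun_measurable {d} {T : measurableType d} (X : T -> R -> R) :
  (forall q, measurable_fun setT (fun w => X w q)) -> measurable_fun setT (fun w => incr_fun (X w)).
Proof.
move=> mX; have L0 : 0 <= Lam := le_trans ler01 Lam1.
apply: measurable_prod => i _; apply: measurableT_comp; first exact: continuous_measurable_fun.
by apply: measurable_funB; exact: evq_measurable.
Qed.

End evaluations.

(** A nonnegative extended series, measurable on the whole space, and equal to [Acount] and [Scount]
    on regular paths; those are limits that need not exist elsewhere. *)
Definition count_series (Y : nat -> R) (t : R) : R :=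
  fine (\sum_(0 <= i <oo) ((nat_of_bool (Tarr Y i <= t))%:R)%:E)%E.

Lemma count_seriesE (Y : nat -> R) t : (forall i, 0 <= Y i) -> (forall t : R, exists n, t < Tarr Y n) ->
  Acount Y t = count_series Y t.
Proof.
move=> Y0 Yunb; have [n tn] := Yunb t.
have nd i j : (i <= j)%N -> Tarr Y i <= Tarr Y j by exact: Usum_nd.
have z i : (n <= i)%N -> (nat_of_bool (Tarr Y i <= t))%:R = 0 :> R.
  by move=> ni; rewrite leNgt (lt_le_trans tn (nd _ _ ni)).
rewrite /Acount (nsum_fin z) /count_series (@nneseries_split _ _ 0 n); last by move=> i _; rewrite lee_fin.
rewrite add0n [X in (_ + X)%E]eseries0 ?adde0; last by move=> i ni _; rewrite z.
by rewrite sumEFin /= big_mkord.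
Qed.

Lemma count_series_measurable {d} {T : measurableType d} (Y : nat -> T -> R) t :
  (forall i, measurable_fun setT (Y i)) -> measurable_fun setT (fun w => count_series (Y ^~ w) t).
Proof.
move=> mY; apply: (measurableT_comp (fine_measurable measurableT)).
apply: (@ge0_emeasurable_sum _ _ _ _ (fun i w => ((nat_of_bool (Tarr (Y ^~ w) i <= t))%:R)%:E) xpredT) => // i _.
apply/measurable_EFinP.
rewrite (_ : (fun w => _) = \1_[set w | Tarr (Y ^~ w) i <= t]); last by apply/funext => w; rewrite indicE mem_setE.
apply: measurable_indic; apply: (measurable_set_le (g := cst t)) => //.
by apply: measurable_sum.
Qed.

End weak_convergence.

Lemma eq_integral_off_null {d} {T : measurableType d} {R : realType} (P : probability T R) (f g : T -> R) (M : R) :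
  (forall x, `|f x| <= M) -> (forall x, `|g x| <= M) -> {ae P, forall x, f x = g x} ->
  \int[P]_x f x = \int[P]_x g x.
Proof.
move=> fM gM [N [mN N0 HN]].
have pN : fine (P N) = 0 by rewrite N0.
have H x : ~ N x -> f x = g x by move=> nN; apply: contrapT => fg; apply: nN; exact: HN.
apply/eqP; rewrite eq_le; apply/andP; split.
  have := @bounded_integral_close _ _ _ P g f M 0 N mN (lexx _) gM fM (fun x nx => ltac:(rewrite addr0 H//)).
  by rewrite pN !mulr0 !addr0.
have := @bounded_integral_close _ _ _ P f g M 0 N mN (lexx _) fM gM (fun x nx => ltac:(rewrite addr0 H//)).
by rewrite pN !mulr0 !addr0.
Qed.

(** * Independence and symmetry of the service limit *)

Section queue_family.
Context {R : realType}.
Variables (F : R -> R) (Aset : set R) (HA : forall a, Aset a -> 0 < a) (d : measure_display)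
  (Om : R -> measurableType d) (P : forall a, probability (Om a) R)
  (u V D : forall a, nat -> Om a -> R) (z0 : forall a, Om a -> R)
  (lam mu : R -> R) (Z L : forall a, Om a -> R -> R).
Arguments u : clear implicits.
Arguments V : clear implicits.
Arguments D : clear implicits.
Arguments z0 : clear implicits.
Arguments Z : clear implicits.
Arguments L : clear implicits.
Hypothesis Hsys : forall a, Aset a ->
  queue_system (P a) (fun x => F (a * x)) (u a) (V a) (D a) (z0 a) (lam a) (mu a) (Z a) (L a).

Definition regular a (w : Om a) := [/\ forall i, 0 < u a i w, forall i, 0 <= V a i w,
  forall t : R, exists n, t < Tarr (u a ^~ w) n,
  forall t : R, exists n, t < \sum_(j < n.+1) V a j w &
  vwt_dyn (u a ^~ w) (V a ^~ w) (D a ^~ w) (z0 a w) (Z a w) (L a w)].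

Lemma PU_inj : injective PU. Proof. by move=> a b []. Qed.
Lemma PV_inj : injective PV. Proof. by move=> a b []. Qed.

Lemma regular_ae a : Aset a -> {ae P a, forall w, regular w}.
Proof.
move=> /Hsys [mu' [mV [mD [mz [lu [lV [lD [ind [u0 [V0 [cD [lam0 [mu0 [Eu [EV dyn]]]]]]]]]]]]]]].
have il0 : 0 < (lam a)^-1 by rewrite invr_gt0.
have im0 : 0 < (mu a)^-1 by rewrite invr_gt0.
have iu := prim_prod ind PU_inj; have iV := prim_prod ind PV_inj.
have u0' : P a [set w | 0 <= u a 0%N w] = 1%E.
  apply/eqP; rewrite eq_le probability_le1 ?andTb.
    rewrite -u0; apply: le_measure; rewrite ?inE; last by move=> w /= /ltW.
      by apply: (measurable_set_lt (f := cst 0)).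
    by apply: (measurable_set_le (f := cst 0)).
  by apply: (measurable_set_le (f := cst 0)).
have a1 : {ae P a, forall w i, 0 < u a i w}.
  apply: ae_foralln => i.
  have mA : measurable [set w | 0 < u a i w] by apply: (measurable_set_lt (f := cst 0)).
  have PA : P a [set w | 0 < u a i w] = 1%E.
    by rewrite -u0; apply: (lu i [set y : R | 0 < y]); apply: (measurable_set_lt (f := cst 0)).
  exists (~` [set w | 0 < u a i w]); split => //; first exact: measurableC.
  by apply: (eq_trans (probability_setC _ mA)); rewrite PA subee.
have a2 := iid_ge0 mV lV V0.
have a3 := iid_sum_unbounded mu' lu iu il0 u0' Eu.
have a4 := iid_sum_unbounded mV lV iV im0 V0 EV.
near=> w; split; near: w; [exact: a1|exact: a2|exact: a3|exact: a4|exact: dyn].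
Unshelve. all: by end_near. Qed.

Variables (hh : R) (mu_lim ca cs : R) (d0 : measure_display) (Om0 : measurableType d0) (P0 : probability Om0 R)
  (Ba Bs : R -> Om0 -> R) (Zs0 : Om0 -> R).
Hypothesis mu_pos : 0 < mu_lim.
Hypothesis HBa : std_BM P0 Ba.
Hypothesis HBs : std_BM P0 Bs.
Hypothesis HZs0 : measurable_fun setT Zs0.
Let Fl := within Aset (nbhs (0 : R)).
Hypothesis PF : ProperFilter Fl.
Definition Xpre a (w : Om a) : 'I_3 -> R -> R := pvec 3 [:: diffscale a hh (Acount (fun i => u a i w)) (lam a);
   diffscale a hh (Scount (fun i => V a i w)) (mu a); (fun _ : R => powR a hh * z0 a w)].
Definition Xlim w : 'I_3 -> R -> R := pvec 3 [:: (fun t => ca * Ba (mu_lim * t) w); (fun t => cs * Bs (mu_lim * t) w); (fun _ : R => Zs0 w)].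
Hypothesis HFCLT : weak_cvg P (fun a w => @Xpre a w) Fl P0 Xlim.

Let AS t w := ca * Ba (mu_lim * t) w.
Let SS t w := cs * Bs (mu_lim * t) w.

Lemma BM_path_cont B : std_BM P0 B -> forall w (c : R), cont0 (fun t => c * B (mu_lim * t) w).
Proof.
move=> [_ [_ [cB _]]] w c t t0 e e0; have /cont0P cBw := cB w.
have t0' : 0 <= mu_lim * t by rewrite mulr_ge0// ltW.
have c1 : 0 < `|c| + 1 by rewrite ltr_wpDl.
have [dl dl0 H] := cBw (mu_lim * t) t0' (e / (`|c| + 1)) (divr_gt0 e0 c1).
exists (dl / mu_lim); first exact: divr_gt0.
move=> r r0; rewrite ltr_pdivlMr// => rt.
have := H (mu_lim * r) (mulr_ge0 (ltW mu_pos) r0); rewrite -mulrBr normrM gtr0_norm// mulrC => /(_ rt).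
rewrite -mulrBr normrM ltr_pdivlMr// => h.
by apply: le_lt_trans h; rewrite mulrC ler_wpM2l// lerDl.
Qed.

Let mAS t : measurable_fun setT (AS t).
Proof. by apply: measurable_funM => //; have [] := HBa. Qed.
Let mSS t : measurable_fun setT (SS t).
Proof. by apply: measurable_funM => //; have [] := HBs. Qed.
Let cAS w : cont0 (AS ^~ w). Proof. exact: BM_path_cont. Qed.
Let cSS w : cont0 (SS ^~ w). Proof. exact: BM_path_cont. Qed.

Let jcad n (i : 'I_n) (xs : nat -> 'I_n -> R -> R) x : (forall m i, cadlag (xs m i)) -> (forall i, cadlag (x i)) ->
  J1n_cvg xs x -> [/\ forall m, cadlag (xs m i), cadlag (x i) & J1_cvg (fun m => xs m i) (x i)].
Proof. by move=> h1 h2 h3; split. Qed.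

(** In every queue the two functionals depend on disjoint sets of primitives, so their expectations
    factor; weak convergence of each and of their product carries this to the limit. It makes the
    service limit independent of the arrival limit and the start taken jointly. *)
Let fact_cont (Lam : R) m (t : nat -> R) (g h : nat -> R -> R) (phi : R -> R) :
  1 <= Lam -> (forall i, 0 <= t i) -> (forall i, continuous (g i)) -> (forall i, continuous (h i)) -> continuous phi ->
  (forall i x, 0 <= g i x <= 1) -> (forall i x, 0 <= h i x <= 1) -> (forall x, 0 <= phi x <= 1) ->
  \int[P0]_w ((incr_fun Lam m t g (AS ^~ w) * phi (evq Lam 0 (fun=> Zs0 w))) * incr_fun Lam m t h (SS ^~ w)) =
  (\int[P0]_w (incr_fun Lam m t g (AS ^~ w) * phi (evq Lam 0 (fun=> Zs0 w)))) * \int[P0]_w (incr_fun Lam m t h (SS ^~ w)).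
Proof.
move=> L1 t0 cg ch cphi g01 h01 phi01.
pose f1 (x : 'I_3 -> R -> R) := incr_fun Lam m t g (x (inord 0)) * phi (evq Lam 0 (x (inord 2))).
pose f2 (x : 'I_3 -> R -> R) := incr_fun Lam m t h (x (inord 1)).
have b1 x : 0 <= f1 x <= 1.
  have /andP[? ?] := incr_fun01 Lam m t g01 (x (inord 0)); have /andP[? ?] := phi01 (evq Lam 0 (x (inord 2))).
  by rewrite mulr_ge0//= mulr_ile1.
have b2 x : 0 <= f2 x <= 1 by exact: incr_fun01.
have n1 x : `|f1 x| <= 1 by have /andP[? ?] := b1 x; rewrite ger0_norm.
have n2 x : `|f2 x| <= 1 by have /andP[? ?] := b2 x; rewrite ger0_norm.
have n12 x : `|f1 x * f2 x| <= 1 by rewrite normrM mulr_ile1.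
have j1 : J1_continuous f1.
  move=> xs x h1 h2 h3; apply: cvgM.
    by have [a b c] := jcad (inord 0) h1 h2 h3; exact: incr_fun_J1.
  by have [a b c] := jcad (inord 2) h1 h2 h3; apply: (cvg_comp_cont cphi); exact: evq_J1.
have j2 : J1_continuous f2.
  by move=> xs x h1 h2 h3; have [a b c] := jcad (inord 1) h1 h2 h3; exact: incr_fun_J1.
have j12 : J1_continuous (fun x => f1 x * f2 x) by move=> xs x h1 h2 h3; apply: cvgM; [exact: j1|exact: j2].
have FF : Filter Fl by case: PF.
have w1 := weak_cvg_real FF HFCLT (ex_intro _ 1 n1) j1.
have w2 := weak_cvg_real FF HFCLT (ex_intro _ 1 n2) j2.
have w12 := weak_cvg_real FF HFCLT (ex_intro _ 1 n12) j12.
have X0 w : Xlim w (inord 0) = AS ^~ w by rewrite /Xlim /pvec inordK.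
have X1 w : Xlim w (inord 1) = SS ^~ w by rewrite /Xlim /pvec inordK.
have X2 w : Xlim w (inord 2) = fun=> Zs0 w by rewrite /Xlim /pvec inordK.
have pre a : Aset a -> \int[P a]_w (f1 (Xpre w) * f2 (Xpre w)) = (\int[P a]_w f1 (Xpre w)) * \int[P a]_w f2 (Xpre w).
  move=> Aa; have [mu' [mV [mD [mz [lu [lV [lD [ind _]]]]]]]] := Hsys Aa.
  pose x1 w := diffscale a hh (count_series (u a ^~ w)) (lam a).
  pose x2 w := diffscale a hh (count_series (V a ^~ w)) (mu a).
  pose g1 w := incr_fun Lam m t g (x1 w) * phi (evq Lam 0 (fun=> powR a hh * z0 a w)).
  pose g2 w := incr_fun Lam m t h (x2 w).
  have Y0 w : Xpre w (inord 0) = diffscale a hh (Acount (u a ^~ w)) (lam a) by rewrite /Xpre /pvec inordK.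
  have Y1 w : Xpre w (inord 1) = diffscale a hh (Scount (V a ^~ w)) (mu a) by rewrite /Xpre /pvec inordK.
  have Y2 w : Xpre w (inord 2) = fun=> powR a hh * z0 a w by rewrite /Xpre /pvec inordK.
  have e12 : {ae P a, forall w, f1 (Xpre w) = g1 w /\ f2 (Xpre w) = g2 w}.
    have := regular_ae Aa; apply: filterS => w [r1 r2 r3 r4 _].
    rewrite /f1 /f2 Y0 Y1 Y2 /g1 /g2 /x1 /x2; split.
      by congr (incr_fun _ _ _ _ _ * _); apply/funext => q; rewrite /diffscale count_seriesE// => i; exact: ltW.
    by congr (incr_fun _ _ _ _ _); apply/funext => q; rewrite /diffscale -count_seriesE.
  have gb1 w : `|g1 w| <= 1.
    have /andP[? ?] := incr_fun01 Lam m t g01 (x1 w); have /andP[? ?] := phi01 (evq Lam 0 (fun=> powR a hh * z0 a w)).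
    by rewrite ger0_norm ?mulr_ge0// mulr_ile1.
  have gb2 w : `|g2 w| <= 1 by have /andP[? ?] := incr_fun01 Lam m t h01 (x2 w); rewrite ger0_norm.
  have gb12 w : `|g1 w * g2 w| <= 1 by rewrite normrM mulr_ile1.
  rewrite (eq_integral_off_null (f := fun w => f1 (Xpre w)) (g := g1) (M := 1))//; last by have := e12; apply: filterS => w [].
  rewrite [X in _ = _ * X](eq_integral_off_null (f := fun w => f2 (Xpre w)) (g := g2) (M := 1))//; last by have := e12; apply: filterS => w [].
  rewrite (eq_integral_off_null (f := fun w => f1 (Xpre w) * f2 (Xpre w)) (g := fun w => g1 w * g2 w) (M := 1))//; last by have := e12; apply: filterS => w [-> ->].
  pose J1 := [set i : prim_idx | match i with PU _ | PZ0 => True | _ => False end].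
  pose J2 := [set i : prim_idx | match i with PV _ => True | _ => False end].
  apply: (@gen_indep _ _ _ (P a) (u a) (V a) (D a) (z0 a) mu' mV mD mz ind J1 J2 g1 g2 1) => //.
  - by rewrite -subset0 => -[n|n|n|] [].
  - apply: measurable_funM.
      apply: incr_fun_measurable => // q; apply: measurable_funM => //; apply: measurable_funB => //.
      apply: count_series_measurable => i.
      exact: (gen_prim (u := u a) (V := V a) (D := D a) (z0 := z0 a) (J := J1) (i := PU i)).
    apply: measurableT_comp; first exact: continuous_measurable_fun.
    apply: evq_measurable => [|q]; first exact: le_trans L1.
    apply: measurable_funM => //.
    exact: (gen_prim (u := u a) (V := V a) (D := D a) (z0 := z0 a) (J := J1) (i := PZ0)).
  - apply: incr_fun_measurable => // q; apply: measurable_funM => //; apply: measurable_funB => //.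
    apply: count_series_measurable => i.
    exact: (gen_prim (u := u a) (V := V a) (D := D a) (z0 := z0 a) (J := J2) (i := PV i)).
have w3 : (fun a => \int[P a]_w (f1 (Xpre w) * f2 (Xpre w))) @ Fl --> (\int[P0]_w f1 (Xlim w)) * \int[P0]_w f2 (Xlim w).
  apply: cvg_trans (cvgM w1 w2); apply: near_eq_cvg.
  by rewrite /Fl near_withinE; apply: nearW => a Aa; rewrite pre.
have := cvg_real_unique PF w12 w3.
rewrite /f1 /f2; under eq_Rintegral do rewrite X0 X1 X2.
under [X in _ = X * _]eq_Rintegral do rewrite X0 X2.
by under [X in _ = _ * X]eq_Rintegral do rewrite X1.
Qed.

Let dA t i w := AS (t i.+1) w - AS (t i) w.
Let dS t i w := SS (t i.+1) w - SS (t i) w.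

Lemma prod_measurable {d1} {T : measurableType d1} m (f : nat -> T -> R) : (forall i, measurable_fun setT (f i)) ->
  measurable_fun setT (fun w => \prod_(i < m) f i w).
Proof. by move=> mf; apply: measurable_prod => i _. Qed.

Let fact_lim m (t : nat -> R) (g h : nat -> nat -> Om0 -> R) (phi : nat -> Om0 -> R) (g' h' : nat -> Om0 -> R) (phi' : Om0 -> R) :
  (forall p i, measurable_fun setT (g p i)) -> (forall p i, measurable_fun setT (h p i)) -> (forall p, measurable_fun setT (phi p)) ->
  (forall p i x, 0 <= g p i x <= 1) -> (forall p i x, 0 <= h p i x <= 1) -> (forall p x, 0 <= phi p x <= 1) ->
  (forall i w, (fun p => g p i w) @ \oo --> g' i w) -> (forall i w, (fun p => h p i w) @ \oo --> h' i w) ->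
  (forall w, (fun p => phi p w) @ \oo --> phi' w) ->
  (forall p, \int[P0]_w ((\prod_(i < m) g p i w * phi p w) * \prod_(i < m) h p i w) =
     (\int[P0]_w (\prod_(i < m) g p i w * phi p w)) * \int[P0]_w (\prod_(i < m) h p i w)) ->
  \int[P0]_w ((\prod_(i < m) g' i w * phi' w) * \prod_(i < m) h' i w) =
     (\int[P0]_w (\prod_(i < m) g' i w * phi' w)) * \int[P0]_w (\prod_(i < m) h' i w).
Proof.
move=> mg mh mphi g01 h01 phi01 cg ch cphi E.
have bg p w : 0 <= \prod_(i < m) g p i w <= 1 by apply: (@prod_bound _ m (fun i => g p i w)) => i; exact: g01.
have bh p w : 0 <= \prod_(i < m) h p i w <= 1 by apply: (@prod_bound _ m (fun i => h p i w)) => i; exact: h01.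
have bgp p w : 0 <= \prod_(i < m) g p i w * phi p w <= 1.
  by have /andP[? ?] := bg p w; have /andP[? ?] := phi01 p w; rewrite mulr_ge0//= mulr_ile1.
have c1 w : (fun p => \prod_(i < m) g p i w * phi p w) @ \oo --> \prod_(i < m) g' i w * phi' w.
  apply: cvgM => //; apply: (@cvg_prod_ord _ _ _ _ m (fun i p => g p i w) (fun i => g' i w)) => i _; exact: cg.
have c2 w : (fun p => \prod_(i < m) h p i w) @ \oo --> \prod_(i < m) h' i w.
  apply: (@cvg_prod_ord _ _ _ _ m (fun i p => h p i w) (fun i => h' i w)) => i _; exact: ch.
have m1 p : measurable_fun setT (fun w => \prod_(i < m) g p i w * phi p w).
  by apply: measurable_funM => //; exact: (@prod_measurable _ _ m (g p) (mg p)).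
have m2 p : measurable_fun setT (fun w => \prod_(i < m) h p i w) by exact: (@prod_measurable _ _ m (h p) (mh p)).
have L1 := @bounded_cvg _ _ _ P0 _ _ 1 m1 (fun p w => ltac:(have /andP[? ?] := bgp p w; rewrite ger0_norm//)) c1.
have L2 := @bounded_cvg _ _ _ P0 _ _ 1 m2 (fun p w => ltac:(have /andP[? ?] := bh p w; rewrite ger0_norm//)) c2.
have b12 p w : `|(\prod_(i < m) g p i w * phi p w) * \prod_(i < m) h p i w| <= 1.
  have /andP[x0 x1] := bgp p w; have /andP[y0 y1] := bh p w.
  by rewrite ger0_norm; [exact: mulr_ile1|exact: mulr_ge0].
have L12 : (fun p => \int[P0]_w ((\prod_(i < m) g p i w * phi p w) * \prod_(i < m) h p i w)) @ \oo -->
    \int[P0]_w ((\prod_(i < m) g' i w * phi' w) * \prod_(i < m) h' i w).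
  apply: (@bounded_cvg _ _ _ P0 _ _ 1) => [p|//|w]; first exact: measurable_funM.
  by apply: cvgM; [exact: c1|exact: c2].
apply: (cvg_real_unique _ L12).
rewrite (_ : (fun p => _) = fun p => (\int[P0]_w (\prod_(i < m) g p i w * phi p w)) * \int[P0]_w (\prod_(i < m) h p i w)).
  by apply: cvgM; [exact: L1|exact: L2].
by apply/funext => p; exact: E.
Qed.

(** Two successive limits in the factorization: continuous functions tend to the indicators, and the
    J1-continuous [evq] to the point evaluations. *)
Lemma increments_factor m (t : nat -> R) (C D' : nat -> set R) (E : set R) : (forall i, 0 <= t i) ->
  (forall i, soft (C i)) -> (forall i, soft (D' i)) -> soft E ->
  \int[P0]_w ((\prod_(i < m) \1_(C i) (dA t i w) * \1_E (Zs0 w)) * \prod_(i < m) \1_(D' i) (dS t i w)) =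
     (\int[P0]_w (\prod_(i < m) \1_(C i) (dA t i w) * \1_E (Zs0 w))) * \int[P0]_w (\prod_(i < m) \1_(D' i) (dS t i w)).
Proof.
move=> t0 sC sD [phi [cphi phi01 phil]].
have /choice[g Hg] : forall i, exists g : nat -> R -> R, [/\ forall p, continuous (g p), forall p x, 0 <= g p x <= 1 & forall x, (fun p => g p x) @ \oo --> (\1_(C i) x : R)] by [].
have /choice[h Hh] : forall i, exists g : nat -> R -> R, [/\ forall p, continuous (g p), forall p x, 0 <= g p x <= 1 & forall x, (fun p => g p x) @ \oo --> (\1_(D' i) x : R)] by [].
have mdA i : measurable_fun setT (dA t i) by exact: measurable_funB.
have mdS i : measurable_fun setT (dS t i) by exact: measurable_funB.
apply: (@fact_lim m t (fun p i w => g i p (dA t i w)) (fun p i w => h i p (dS t i w)) (fun p w => phi p (Zs0 w))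
  (fun i w => \1_(C i) (dA t i w)) (fun i w => \1_(D' i) (dS t i w)) (fun w => \1_E (Zs0 w))).
- by move=> p i; apply: measurableT_comp => //; apply: continuous_measurable_fun; have [] := Hg i.
- by move=> p i; apply: measurableT_comp => //; apply: continuous_measurable_fun; have [] := Hh i.
- by move=> p; apply: measurableT_comp => //; exact: continuous_measurable_fun.
- by move=> p i x; have [_ + _] := Hg i; exact.
- by move=> p i x; have [_ + _] := Hh i; exact.
- by move=> p x; exact: phi01.
- by move=> i w; have [_ _] := Hg i; exact.
- by move=> i w; have [_ _] := Hh i; exact.
- by move=> w; exact: phil.
move=> p.
have L1 (n : nat) : 1 <= n.+1%:R :> R by rewrite ler1n.
have L0 (n : nat) : 0 <= n.+1%:R :> R by [].
apply: (@fact_lim m t (fun n i w => g i p (evq n.+1%:R (t i.+1) (AS ^~ w) - evq n.+1%:R (t i) (AS ^~ w)))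
  (fun n i w => h i p (evq n.+1%:R (t i.+1) (SS ^~ w) - evq n.+1%:R (t i) (SS ^~ w)))
  (fun n w => phi p (evq n.+1%:R 0 (fun=> Zs0 w)))
  (fun i w => g i p (dA t i w)) (fun i w => h i p (dS t i w)) (fun w => phi p (Zs0 w))).
- move=> n i; apply: measurableT_comp; first by apply: continuous_measurable_fun; have [] := Hg i.
  by apply: measurable_funB; exact: evq_measurable.
- move=> n i; apply: measurableT_comp; first by apply: continuous_measurable_fun; have [] := Hh i.
  by apply: measurable_funB; exact: evq_measurable.
- move=> n; apply: measurableT_comp; first exact: continuous_measurable_fun.
  exact: evq_measurable.
- by move=> n i x; have [_ + _] := Hg i; exact.
- by move=> n i x; have [_ + _] := Hh i; exact.
- by move=> n x; exact: phi01.
- move=> i w; have [cg _ _] := Hg i; apply: (cvg_comp_cont (cg p)); apply: cvgB; exact: evq_cvg.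
- move=> i w; have [ch _ _] := Hh i; apply: (cvg_comp_cont (ch p)); apply: cvgB; exact: evq_cvg.
- move=> w; apply: (cvg_comp_cont (cphi p)); apply: (evq_cvg (x := fun=> Zs0 w)) => //; exact: cont0_cst.
move=> n; apply: (@fact_cont n.+1%:R m t (fun i => g i p) (fun i => h i p) (phi p)) => //.
- by move=> i; have [] := Hg i.
- by move=> i; have [] := Hh i.
- by move=> i x; have [_ + _] := Hg i; exact.
- by move=> i x; have [_ + _] := Hh i; exact.
Qed.

Let indic_bigcap m (E : 'I_m -> set Om0) w :
  \1_(\bigcap_(i in [set: 'I_m]) E i) w = \prod_(i < m) \1_(E i) w :> R.
Proof.
rewrite indicE; case: (boolP (w \in _)) => H.
  rewrite big1// => i _; rewrite indicE mem_set//; move: H; rewrite inE => /(_ i); exact.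
have [i /negP Hi] : exists i, ~ (w \in E i).
  apply: contrapT => /forallNP h; move/negP: H; apply; rewrite inE => i _.
  by have := h i => /contrapT; rewrite inE.
by rewrite (bigD1 i)//= indicE (negbTE Hi) mul0r.
Qed.

Let SN t w := - SS t w.

Lemma cells_factor (W : R -> Om0 -> R) p (c s : 'I_(p.+1 * p.+1) -> int) z : W = SS \/ W = SN ->
  let E1 := \bigcap_(i in [set: 'I_(p.+1 * p.+1)]) [set w | cell p (c i) (incr (AS ^~ w) p i)] `&` [set w | cell p z (Zs0 w)] in
  let E2 := \bigcap_(i in [set: 'I_(p.+1 * p.+1)]) [set w | cell p (s i) (incr (W ^~ w) p i)] in
  fine (P0 (E1 `&` E2)) = fine (P0 E1) * fine (P0 E2).
Proof.
move=> WS E1 E2; set m := (p.+1 * p.+1)%N in c s E1 E2 *.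
pose t i : R := i%:R / p.+1%:R.
have t0 i : 0 <= t i by rewrite divr_ge0.
have sc k : soft (cell (R := R) p k) by exact: soft_itv.
have mW q : measurable_fun setT (W q) by case: WS => ->; [exact: mSS|apply: measurableT_comp => //; exact: mSS].
pose C i : set R := cell p (oapp c 0 (insub i)).
have [D' sD D'E] : exists2 D' : nat -> set R, (forall i, soft (D' i)) &
   forall (i : 'I_m) w, \1_(D' i) (dS t i w) = \1_[set w | cell p (s i) (incr (W ^~ w) p i)] w :> R.
  case: WS => ->.
    exists (fun i => cell p (oapp s 0 (insub i))) => [i|i w]; first exact: sc.
    by rewrite valK /= !indicE; congr (nat_of_bool _)%:R; apply/idP/idP; rewrite !inE.
  exists (fun i => [set x | cell p (oapp s 0 (insub i)) (- x)]) => [i|i w]; first exact/soft_opp/sc.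
  have e : - dS t i w = incr (SN ^~ w) p i by rewrite /dS /SN /incr; ring.
  by rewrite valK /= !indicE; congr (nat_of_bool _)%:R; apply/idP/idP; rewrite !inE /= e.
have CE (i : 'I_m) w : \1_(C i) (dA t i w) = \1_[set w | cell p (c i) (incr (AS ^~ w) p i)] w :> R.
  by rewrite /C valK /= !indicE; congr (nat_of_bool _)%:R; apply/idP/idP; rewrite !inE.
have ZE w : \1_(cell p z) (Zs0 w) = \1_[set w | cell p z (Zs0 w)] w :> R.
  by rewrite !indicE; congr (nat_of_bool _)%:R; apply/idP/idP; rewrite !inE.
have mZ : measurable [set w | cell p z (Zs0 w)].
  by have := HZs0 measurableT (cell_measurable p z); rewrite setTI.
have mE1 : measurable E1.
  apply: measurableI => //; apply: fin_bigcap_measurable => // i _.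
  by apply: incr_event_measurable => //; exact: cell_measurable.
have mE2 : measurable E2.
  apply: fin_bigcap_measurable => // i _.
  by apply: incr_event_measurable => //; exact: cell_measurable.
have e1 w : \1_E1 w = \prod_(i < m) \1_(C i) (dA t i w) * \1_(cell p z) (Zs0 w) :> R.
  rewrite /E1 indicI /= indic_bigcap ZE; congr (_ * _); apply: eq_bigr => i _; by rewrite CE.
have e2 w : \1_E2 w = \prod_(i < m) \1_(D' i) (dS t i w) :> R.
  by rewrite /E2 indic_bigcap; apply: eq_bigr => i _; rewrite D'E.
have e12 w : \1_(E1 `&` E2) w = (\prod_(i < m) \1_(C i) (dA t i w) * \1_(cell p z) (Zs0 w)) * \prod_(i < m) \1_(D' i) (dS t i w) :> R.
  by rewrite -e1 -e2 indicI.
rewrite -!(Rintegral_indic P0)//; last exact: measurableI.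
rewrite (eq_prob_integral P0 e12) (eq_prob_integral P0 e1) (eq_prob_integral P0 e2).
by apply: (@increments_factor m t C D' (cell p z)) => // i; exact: sc.
Qed.

Lemma normal_scaled_opp (s k a b : R) : s != 0 ->
  normal_prob 0 s [set x | `[a, b[%classic (k * x)] = normal_prob 0 s [set x | `[a, b[%classic (- (k * x))].
Proof.
move=> s0.
have pos q : 0 < q -> normal_prob 0 s [set x | `[a, b[%classic (q * x)] = normal_prob 0 s [set x | `[a, b[%classic (- (q * x))].
  move=> q0.
  have -> : [set x | `[a, b[%classic (q * x)] = `[a / q, b / q[%classic.
    by apply/seteqP; split=> x /=; rewrite !in_itv /= ler_pdivrMr// ltr_pdivlMr// ![_ * q]mulrC.
  rewrite normal_prob_opp//; congr (normal_prob 0 s _).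
  have E x : (- (b / q) < x <= - (a / q)) = (a <= - (q * x) < b).
    rewrite (_ : - (b / q) = (- b) / q) ?mulNr// (_ : - (a / q) = (- a) / q) ?mulNr//.
    by rewrite -!mulNr ltr_pdivrMr// ler_pdivlMr// mulNr [x * q]mulrC ltrNl lerNr andbC.
  by apply/seteqP; split=> x /=; rewrite !in_itv /= E.
have [k0|k0|->] := ltgtP k 0; [|exact: pos|].
  have := pos (- k); rewrite oppr_gt0 => /(_ k0) h.
  have e1 : [set x | `[a, b[%classic (- k * x)] = [set x | `[a, b[%classic (- (k * x))] by apply/seteqP; split=> x /=; rewrite mulNr.
  have e2 : [set x | `[a, b[%classic (- (- k * x))] = [set x | `[a, b[%classic (k * x)] by apply/seteqP; split=> x /=; rewrite mulNr opprK.
  by move: h; rewrite e1 e2 => ->.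
by congr (normal_prob 0 s _); apply/seteqP; split=> x /=; rewrite mul0r oppr0.
Qed.

Lemma cells_symmetric p (s : 'I_(p.+1 * p.+1) -> int) :
  fine (P0 (\bigcap_(i in [set: 'I_(p.+1 * p.+1)]) [set w | cell p (s i) (incr (SS ^~ w) p i)])) =
  fine (P0 (\bigcap_(i in [set: 'I_(p.+1 * p.+1)]) [set w | cell p (s i) (incr (SN ^~ w) p i)])).
Proof.
congr fine; have [_ [_ [_ [Bn Bi]]]] := HBs.
pose t (i : nat) : R := mu_lim * (i%:R / p.+1%:R).
have t0 i : 0 <= t i by rewrite mulr_ge0 ?(ltW mu_pos)// divr_ge0.
have tlt i : t i < t i.+1 by rewrite ltr_pM2l// ltr_pM2r ?invr_gt0 ?ltr0n// ltr_nat.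
have mm (f : R -> R) (k : int) : measurable_fun setT f -> measurable [set x | cell (R := R) p k (f x)].
  by move=> mf; have := mf measurableT _ (cell_measurable p k); rewrite setTI.
have m1 k : measurable [set x | cell (R := R) p k (cs * x)] by apply: mm; exact: measurable_funM.
have m2 k : measurable [set x | cell (R := R) p k (- (cs * x))].
  by apply: (mm (fun x => - (cs * x))); apply: measurableT_comp => //; exact: measurable_funM.
have ind (A : 'I_(p.+1 * p.+1) -> set R) : (forall i, measurable (A i)) ->
   P0 (\bigcap_(i in [set: 'I_(p.+1 * p.+1)]) [set w | A i (Bs (t i.+1) w - Bs (t i) w)]) =
   (\prod_(i < p.+1 * p.+1) normal_prob 0 (Num.sqrt (t i.+1 - t i)) (A i))%E.
  move=> mA; have h := Bi (p.+1 * p.+1)%N t (t0 0%N) tlt _ id (fun a b e => e) A mA.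
  by rewrite [LHS]h; apply: eq_bigr => i _; apply: Bn.
have e1 : \bigcap_(i in [set: 'I_(p.+1 * p.+1)]) [set w | cell p (s i) (incr (SS ^~ w) p i)] =
  \bigcap_(i in [set: 'I_(p.+1 * p.+1)]) [set w | [set x | cell p (s i) (cs * x)] (Bs (t i.+1) w - Bs (t i) w)].
  by apply: eq_bigcapr => i _; apply/seteqP; split=> w /=; rewrite /incr /SS /t mulrBr.
have e2 : \bigcap_(i in [set: 'I_(p.+1 * p.+1)]) [set w | cell p (s i) (incr (SN ^~ w) p i)] =
  \bigcap_(i in [set: 'I_(p.+1 * p.+1)]) [set w | [set x | cell p (s i) (- (cs * x))] (Bs (t i.+1) w - Bs (t i) w)].
  by apply: eq_bigcapr => i _; apply/seteqP; split=> w /=; rewrite /incr /SN /SS /t mulrBr opprB opprK addrC.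
rewrite e1 e2 (ind (fun i => [set x | cell p (s i) (cs * x)]))// (ind (fun i => [set x | cell p (s i) (- (cs * x))]))//.
apply: eq_bigr => i _; apply: normal_scaled_opp.
by rewrite gt_eqF// sqrtr_gt0 subr_gt0.
Qed.

Lemma limit_sign_symmetry (Th : ('I_3 -> R -> R) -> R) (M : R) : lu_continuous Th -> (forall y, `|Th y| <= M) ->
  \int[P0]_w Th (Xlim w) = \int[P0]_w Th (X3 (AS ^~ w) (fun t => - SS t w) (Zs0 w)).
Proof.
move=> cTh ThM.
have A0 w : AS 0 w = 0 by have [_ [h _]] := HBa; rewrite /AS mulr0 h mulr0.
have S0 w : SS 0 w = 0 by have [_ [h _]] := HBs; rewrite /SS mulr0 h mulr0.
apply: (@sign_symmetry _ _ _ P0 AS SS Zs0 mAS mSS HZs0 cAS cSS A0 S0 _ _ _ Th M cTh ThM).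
- by move=> p c z s; apply: cells_factor; left.
- by move=> p c z s; apply: cells_factor; right.
- exact: cells_symmetric.
Qed.

Lemma limit_measurable (Th : ('I_3 -> R -> R) -> R) : lu_continuous Th -> measurable_fun setT (fun w => Th (Xlim w)).
Proof.
move=> cTh.
have A0 w : AS 0 w = 0 by have [_ [h _]] := HBa; rewrite /AS mulr0 h mulr0.
have S0 w : SS 0 w = 0 by have [_ [h _]] := HBs; rewrite /SS mulr0 h mulr0.
exact: (functional_measurable mAS mSS HZs0 cAS cSS A0 S0 cTh).
Qed.

(** Time changes fix 0, so evaluation at time 0 is J1-continuous. The truncated negative part of the
    start has integral 0 in every queue, hence in the limit. *)
Lemma limit_start_ge0 : fine (P0 [set w | Zs0 w < 0]) = 0.
Proof.
pose f (x : 'I_3 -> R -> R) : R := minr 1 (maxr 0 (- x (inord 2) 0)).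
have f01 x : 0 <= f x <= 1 by rewrite /f le_min ler01 le_max lexx /= ge_min lexx.
have fM x : `|f x| <= 1 by have /andP[? ?] := f01 x; rewrite ger0_norm.
have fl (a b : R) : `|minr 1 (maxr 0 (- a)) - minr 1 (maxr 0 (- b))| <= `|a - b|.
  rewrite ler_norml; have := ler_norm (a - b); have := ler_norm (b - a); rewrite (distrC b).
  by case: (leP 0 (- a)) => ?; case: (leP 0 (- b)) => ?; rewrite ?minEle; repeat case: ifP => ?; lra.
have fJ : J1_continuous f.
  move=> xs x h1 h2 h3; have [ls [h4 [_ h6]]] := h3 (inord 2).
  apply/cvgrPdist_le => e e0; have := h6 0 e e0; apply: filterS => m /(_ 0); rewrite lexx => /(_ isT).
  have [-> _] := h4 m; rewrite distrC => h; exact: le_trans (fl _ _) h.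
have FF : Filter Fl by case: PF.
have w1 := weak_cvg_real FF HFCLT (ex_intro _ 1 fM) fJ.
have Ef0 : \int[P0]_w f (Xlim w) = 0.
  apply: (cvg_unique (@Rhausdorff R) w1).
  apply: (@cvg_trans _ ((fun=> (0:R)) @ Fl)); last exact: cvg_cst.
  apply: near_eq_cvg; rewrite /Fl near_withinE; apply: nearW => a Aa.
  rewrite -(prob_integral_cst (P a) 0).
  apply: (eq_integral_off_null (f := cst 0) (M := 1)) => [x|x|]; [by rewrite normr0|exact: fM|].
  have := regular_ae Aa; apply: filterS => w [r1 r2 r3 r4 r5] /=.
  have zw := z0_ge0 r1 r3 r5.
  rewrite /f /Xpre /pvec inordK//= max_l ?min_r//.
  by rewrite oppr_le0 mulr_ge0// powR_ge0.
have mN : measurable [set w | Zs0 w < 0] by apply: (measurable_set_lt (g := cst 0)).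
pose g w := f (Xlim w).
have gE w : g w = minr 1 (maxr 0 (- Zs0 w)) by rewrite /g /f /Xlim /pvec inordK.
have mg : measurable_fun setT (fun w => (g w)%:E).
  apply/measurable_EFinP; rewrite (_ : g = fun w => minr 1 (maxr 0 (- Zs0 w))); last by apply/funext.
  by apply: measurable_minr => //; apply: measurable_maxr => //; exact: measurableT_comp.
have I1 : (\int[P0]_w `|(g w)%:E| = 0)%E.
  rewrite (eq_integral (fun w => (g w)%:E)); last by move=> w _; rewrite /= ger0_norm//; have /andP[] := f01 (Xlim w).
  rewrite -[LHS]fineK; first by congr (_%:E).
  by apply: (@bounded_integral_fin _ _ _ P0 g 1) => w; exact: fM.
have [/(_ I1) [N [mN0 N0 HN]] _] := ae_eq_integral_abs P0 measurableT mg.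
have N0' : fine (P0 N) = 0 by rewrite N0.
apply/eqP; rewrite eq_le prob_ge0 andbT -[leRHS]N0'.
apply: prob_mono => // w /= zw; apply: HN => /= /(_ I) [] h.
move: h; rewrite gE; have z1 : 0 < - Zs0 w by rewrite oppr_gt0.
rewrite (max_idPr (ltW z1)) minEle; case: ifP => _; lra.
Qed.

End queue_family.

(** * The solution map *)

Section taylor.
Context {R : realType}.

(** Descends from the [k]-th derivative one order at a time. The function [e * pw] plus or minus the
    error vanishes at 0 and has nonnegative derivative by the previous order, so the mean value
    theorem makes it nonnegative. At 0 only one-sided difference quotients are given, so continuity
    there is derived separately. *)
Lemma small_taylor (G : nat -> R -> R) (k : nat) : 
  (forall j, (j < k)%N -> forall x : R, 0 < x -> is_derive x (1 : R) (G j) (G j.+1 x)) ->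
  (forall j, (j < k)%N -> (fun h => h^-1 * (G j h - G j 0)) @ at_right 0 --> G j.+1 0) ->
  cont0 (G k) -> (forall j, (j < k)%N -> G j 0 = 0) ->
  forall j, (j <= k)%N -> forall e : R, 0 < e -> exists2 dl : R, 0 < dl & forall x : R, 0 <= x < dl ->
    `|G (k - j)%N x - G k 0 * (x ^+ j / j`!%:R)| <= e * (x ^+ j / j`!%:R).
Proof.
move=> dG qG cG zG; elim=> [|j IH] jk e e0.
  have [dl dl0 H] := cG 0 (lexx 0) e e0; exists dl => // x /andP[x0 xdl].
  by rewrite subn0 expr0 fact0 divr1 !mulr1 ltW// H// subr0 ger0_norm.
have [dl dl0 H] := IH (ltnW jk) e e0; exists dl => // x /andP[].
set i := (k - j.+1)%N; have ik : (i < k)%N by rewrite /i ltn_subrL /= (leq_trans _ jk).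
have iS : (k - j)%N = i.+1 by rewrite /i subnSK.
rewrite iS in H.
rewrite le_eqVlt => /predU1P[<- _|x0 xdl].
  by rewrite (zG i ik) expr0n /= mul0r !mulr0 subrr normr0.
have j0 : j`!%:R != 0 :> R by rewrite pnatr_eq0 -lt0n fact_gt0.
pose pw (t : R) := t ^+ j.+1 / j.+1`!%:R.
have dpw (t : R) : is_derive t 1 pw (t ^+ j / j`!%:R).
  have h : is_derive t 1 (fun s : R => (j.+1`!%:R)^-1 *: s ^+ j.+1) ((j.+1`!%:R)^-1 *: (j.+1%:R * t ^+ j)).
    apply: is_deriveZ; apply: DeriveDef; first exact: exprn_derivable.
    by rewrite exp_derive /GRing.scale /= mulr1.
  rewrite (_ : pw = fun s : R => (j.+1`!%:R)^-1 *: s ^+ j.+1); last by apply/funext => s; rewrite /pw mulrC.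
  apply: (is_derive_eq h); rewrite /GRing.scale /= factS natrM; field.
  by rewrite j0 /= addrC natr1.
have cGi : G i @ at_right 0 --> G i 0.
  have h1 : (fun h : R => h * (h^-1 * (G i h - G i 0)) + G i 0) @ at_right 0 --> 0 * G i.+1 0 + G i 0.
    apply: cvgD; last exact: cvg_cst.
    apply: cvgM; last exact: qG.
    apply: cvg_at_right_filter; exact: cvg_id.
  rewrite mul0r add0r in h1; apply: cvg_trans h1; apply: near_eq_cvg.
  near=> h; have h0 : h != 0 by rewrite gt_eqF.
  by rewrite mulrA (mulfV h0) mul1r subrK.
have wc (f : R -> R) (df : R -> R) : (forall t : R, 0 < t -> is_derive t (1 : R) f (df t)) -> f @ at_right 0 --> f 0 ->
    {within `[0, x], continuous f}.
  move=> df0 f0; apply/continuous_within_itvP => //; split => //.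
    move=> t; rewrite in_itv /= => /andP[t0 _].
    by apply: differentiable_continuous; apply/derivable1_diffP; have [] := df0 t t0.
  by apply: cvg_at_left_filter; apply: differentiable_continuous; apply/derivable1_diffP; have [] := df0 x x0.
have pw0 : pw @ at_right 0 --> pw 0.
  by apply: cvg_at_right_filter; apply: differentiable_continuous; apply/derivable1_diffP; have [] := dpw 0.
have key (s : R) : `|s| = 1 -> 0 <= e * pw x + s * (G i x - G k 0 * pw x).
  move=> s1; pose f (t : R) := e * pw t + s * (G i t - G k 0 * pw t).
  pose df (t : R) := e * (t ^+ j / j`!%:R) + s * (G i.+1 t - G k 0 * (t ^+ j / j`!%:R)).
  have df' (t : R) : 0 < t -> is_derive t (1 : R) f (df t).
    move=> t0; have h1 := dG i ik t t0; have h2 := dpw t.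
    have h : is_derive t (1 : R) (fun t : R => e *: pw t + s *: (G i t - G k 0 *: pw t)) (e *: (t ^+ j / j`!%:R) + s *: (G i.+1 t - G k 0 *: (t ^+ j / j`!%:R))).
      apply: is_deriveD; apply: is_deriveZ; apply: is_deriveB.
    exact: h.
  have f0 : f 0 = 0 by rewrite /f /pw expr0n /= mul0r (zG i ik) !mulr0 subrr mulr0 addr0.
  have cf : f @ at_right 0 --> f 0.
    apply: cvgD; first exact: cvgMr.
    by apply: cvgMr; apply: cvgB => //; exact: cvgMr.
  have [c] := @MVT _ f df 0 x x0 (fun t ht => df' t (ltac:(move: ht; rewrite in_itv /= => /andP[]//))) (wc f df df' cf).
  rewrite in_itv /= => /andP[c0 cx]; rewrite f0 !subr0 -/(f x) => ->.
  apply: mulr_ge0; last exact: ltW.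
  have := H c; rewrite (ltW c0) (lt_trans cx xdl) => /(_ isT) => h.
  have : `|s * (G i.+1 c - G k 0 * (c ^+ j / j`!%:R))| <= e * (c ^+ j / j`!%:R) by rewrite normrM s1 mul1r.
  by rewrite ler_norml /df => /andP[? _]; lra.
have := key 1 (normr1 _); have := key (-1) (normrN1 _).
rewrite -/(pw x) ler_norml; move=> ? ?; apply/andP; split; lra.
Unshelve. all: by end_near. Qed.

Lemma local_expansion (F : R -> R) k (G : nat -> R -> R) : local_cond F k G ->
  forall e : R, 0 < e -> exists2 dl : R, 0 < dl & forall x : R, 0 <= x < dl ->
    `|F x - G k 0 / k`!%:R * x ^+ k| <= e * x ^+ k.
Proof.
move=> [GF [dG [qG [/cont0P cG [zG _]]]]] e e0.
have k0 : 0 < k`!%:R :> R by rewrite ltr0n fact_gt0.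
have [dl dl0 H] := small_taylor dG qG cG zG (leqnn k) (mulr_gt0 e0 k0).
exists dl => // x xd; have /andP[x0 _] := xd; have := H x xd; rewrite subnn GF//.
have -> : G k 0 * (x ^+ k / k`!%:R) = G k 0 / k`!%:R * x ^+ k by rewrite mulrA mulrAC.
by have -> : e * k`!%:R * (x ^+ k / k`!%:R) = e * x ^+ k by field; rewrite gt_eqF.
Qed.

(** Near 0 the sign of [F] is that of its leading term, and [F] is nonnegative; the drift is thus
    directed downward. *)
Lemma local_slope_ge0 (F : R -> R) k (G : nat -> R -> R) : cdf0 F -> local_cond F k G -> 0 <= G k 0 / k`!%:R.
Proof.
move=> [Fnd [_ [F0 _]]] HG; rewrite leNgt; apply/negP => b0.
set b := G k 0 / k`!%:R in b0.
have e0 : 0 < - b / 2 by rewrite divr_gt0// oppr_gt0.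
have [dl dl0 H] := local_expansion HG e0.
have x0 : 0 < dl / 2 by rewrite divr_gt0.
have := H (dl / 2); rewrite (ltW x0) ltr_pdivrMr// ltr_pMr// ltr1n => /(_ isT); rewrite -/b.
have xk : 0 < (dl / 2) ^+ k by rewrite exprn_gt0.
have Fx : 0 <= F (dl / 2) by rewrite -(F0 0 (lexx 0)) Fnd// ltW.
have h : b * (dl / 2) ^+ k < 0 by rewrite pmulr_llt0.
rewrite ler_norml => /andP[_ h2].
by move: h2 h Fx; set p := _ ^+ k => h2 h Fx; have := pmulr_llt0 b xk; rewrite -/p; lra.
Qed.

End taylor.

Lemma distB_le {R : realType} (a b a' b' p q e : R) : `|a - a'| <= p -> `|b - b'| <= q -> p + q <= e ->
  `|(a - b) - (a' - b')| <= e.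
Proof. by rewrite !ler_norml => /andP[? ?] /andP[? ?] ?; apply/andP; split; lra. Qed.

(** * The reflected equation as a map of its inputs *)

Section solution_map.
Context {R : realType}.
Variables (beta c mul : R) (k : nat).
Hypothesis beta0 : 0 <= beta.
Hypothesis mul0 : 0 < mul.
Implicit Types y : 'I_3 -> R -> R.

(** Values at 0 are subtracted so that the driver starts from the initial workload whatever the
    input; the service input enters with a minus sign. *)
Definition free_path y (t : R) : R :=
  mul^-1 * ((y (inord 0) t - y (inord 1) t) - (y (inord 0) 0 - y (inord 1) 0)).

(** The start is truncated at 0 so that a solution exists for every continuous input. *)
Definition driver y (t : R) : R := maxr (y (inord 2) 0) 0 + free_path y t + c * t.

Definition solution y : (R -> R) * (R -> R) :=
  xget (fun=> 0, fun=> 0) [set p | cont0 p.1 /\ forall T, rsol beta k (driver y) p.1 p.2 T].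

Definition outputs y : 'I_4 -> R -> R :=
  pvec 4 [:: (solution y).1; (solution y).2;
    (fun t => free_path y t - drift beta k (solution y).1 t);
    (fun t => y (inord 0) t - y (inord 0) 0 - mul * drift beta k (solution y).1 t)].

Lemma free_path_cont y : (forall i, cont0 (y i)) -> cont0 (free_path y).
Proof. by move=> cy; apply: cont0Z; apply: cont0B; [exact: cont0B|exact: cont0_cst]. Qed.

Lemma driver_cont y : (forall i, cont0 (y i)) -> cont0 (driver y).
Proof.
move=> cy; apply: cont0D; last by apply: cont0Z; exact: cont0_id.
by apply: cont0D; [exact: cont0_cst|exact: free_path_cont].
Qed.

Lemma driver_start y : 0 <= driver y 0.
Proof. by rewrite /driver /free_path subrr !mulr0 !addr0 le_max lexx orbT. Qed.

Lemma solutionP y : (forall i, cont0 (y i)) ->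
  cont0 (solution y).1 /\ forall T, rsol beta k (driver y) (solution y).1 (solution y).2 T.
Proof.
move=> cy; have [Z [L ZL]] := rsol_exists k beta0 (driver_cont cy) (driver_start y).
apply: (@xgetPex _ (fun=> 0, fun=> 0) [set p | cont0 p.1 /\ forall T, rsol beta k (driver y) p.1 p.2 T]); by exists (Z, L).
Qed.

Lemma ord4_case (Q : 'I_4 -> Prop) : Q (inord 0) -> Q (inord 1) -> Q (inord 2) -> Q (inord 3) -> forall i, Q i.
Proof.
move=> q0 q1 q2 q3 i; rewrite -(inord_val i); case: i => -[|[|[|[|//]]]] ? /=; by [].
Qed.

Lemma outputs_cont y : (forall i, cont0 (y i)) -> forall i, cont0 (outputs y i).
Proof.
move=> cy; have [cZ /(_ 0)[lZ _ _ [cL _ _ _]]] := solutionP cy; have cd := drift_cont beta k lZ.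
apply: ord4_case; rewrite /outputs /pvec inordK//=.
  by apply: cont0B => //; exact: free_path_cont.
by apply: cont0B; [apply: cont0B => //; exact: cont0_cst|exact: cont0Z].
Qed.

Lemma rsol_compare (y1 y2 Z1 Z2 L1 L2 : R -> R) (T K e : R) : 1 <= K -> rsol beta k y1 Z1 L1 T -> rsol beta k y2 Z2 L2 T ->
  (forall t, 0 <= t <= T -> Z1 t <= K) -> (forall t, 0 <= t <= T -> Z2 t <= K) ->
  (forall t, 0 <= t <= T -> `|y1 t - y2 t| <= e) ->
  let D := beta * (k%:R * K ^+ k * (2 * e) * T) in
  forall t, 0 <= t <= T -> [/\ `|Z1 t - Z2 t| <= 2 * e, `|L1 t - L2 t| <= 3 * e + D &
    `|drift beta k Z1 t - drift beta k Z2 t| <= D].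
Proof.
move=> K1 S1 S2 B1 B2 ye D t tT.
have ZZ := rsol_stable beta0 S1 S2 ye.
have [l1 p1 E1 _] := S1; have [l2 p2 E2 _] := S2.
have e0 : 0 <= e := le_trans (normr_ge0 _) (ye t tT).
have dd : `|drift beta k Z1 t - drift beta k Z2 t| <= D.
  have b1 s : 0 <= s <= T -> 0 <= Z1 s <= K by move=> sT; rewrite B1// p1//; case/andP: sT.
  have b2 s : 0 <= s <= T -> 0 <= Z2 s <= K by move=> sT; rewrite B2// p2//; case/andP: sT.
  apply: (le_trans (drift_dist k beta0 K1 l1 l2 b1 b2 ZZ tT)).
  rewrite /D ler_wpM2l// ler_wpM2l//; last by case/andP: tT.
  by rewrite mulr_ge0// mulr_ge0// exprn_ge0// (le_trans ler01).
split => //; first exact: ZZ.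
have := ZZ t tT; have := ye t tT; have := E1 t tT; have := E2 t tT.
move: dd; set d1 := drift _ _ _ _; set d2 := drift _ _ _ _ => dd ez1 ez2.
rewrite !ler_norml in dd * => /andP[? ?] /andP[? ?]; move/andP: dd => [? ?]; apply/andP; split; lra.
Qed.

Lemma maxr0_dist (a b : R) : `|maxr a 0 - maxr b 0| <= `|a - b|.
Proof.
by have := ler_norm (a - b); have := ler_norm (b - a); rewrite (distrC b) ler_norml; case: (leP a 0) => ?; case: (leP b 0) => ? ? ?; apply/andP; split; lra.
Qed.

Lemma free_path_dist y1 y2 (t e : R) : 0 <= t -> (forall i s, 0 <= s <= t -> `|y1 i s - y2 i s| <= e) ->
  `|free_path y1 t - free_path y2 t| <= mul^-1 * (4 * e).
Proof.
move=> t0 H; have im : 0 <= mul^-1 by rewrite invr_ge0 ltW.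
rewrite -mulrBr normrM (ger0_norm im) ler_wpM2l//.
have tt : 0 <= t <= t by rewrite t0 lexx.
have t00 : 0 <= (0:R) <= t by rewrite lexx.
have := H (inord 0) t tt; have := H (inord 1) t tt; have := H (inord 0) 0 t00; have := H (inord 1) 0 t00.
rewrite !ler_norml => /andP[? ?] /andP[? ?] /andP[? ?] /andP[? ?]; apply/andP; split; lra.
Qed.

Lemma driver_dist y1 y2 (t e : R) : 0 <= t -> (forall i s, 0 <= s <= t -> `|y1 i s - y2 i s| <= e) ->
  `|driver y1 t - driver y2 t| <= (1 + 4 * mul^-1) * e.
Proof.
move=> t0 H; have h1 := free_path_dist t0 H.
have h2 : `|maxr (y1 (inord 2) 0) 0 - maxr (y2 (inord 2) 0) 0| <= e.
  by apply: (le_trans (maxr0_dist _ _)); apply: H; rewrite lexx.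
rewrite /driver; move: h1 h2; set m := mul^-1; set a := maxr _ 0; set b := maxr _ 0; rewrite !ler_norml.
move=> /andP[? ?] /andP[? ?]; apply/andP; split; lra.
Qed.

Lemma outputs_lu (ys : nat -> 'I_3 -> R -> R) y : (forall n i, cont0 (ys n i)) -> (forall i, cont0 (y i)) ->
  (forall i (T e : R), 0 < e -> \forall n \near \oo, forall t : R, 0 <= t <= T -> `|ys n i t - y i t| <= e) ->
  forall i (T e : R), 0 < e -> \forall n \near \oo, forall t : R, 0 <= t <= T -> `|outputs (ys n) i t - outputs y i t| <= e.
Proof.
move=> cys cy H i T e e0.
have [cZ ZP] := solutionP cy.
have [K0 K00 HK0] := cont0_bounded T cZ.
pose K := K0 + 3; have K1 : 1 <= K by rewrite /K; lra.
have im : 0 < mul^-1 by rewrite invr_gt0.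
have T0 : 0 <= `|T| by [].
have Cge0 : 0 <= beta * (k%:R * K ^+ k * `|T|) by rewrite mulr_ge0// mulr_ge0// mulr_ge0// exprn_ge0// (le_trans ler01).
(* The denominator dominates the error coefficients of all four outputs: at most 3 for the paths and
   pushes, the Lipschitz factor of the drift, and the factor [mul] of the last output. *)
pose q := e / ((3 + 2 * (beta * (k%:R * K ^+ k * `|T|))) * (1 + mul)).
have q1 : 0 < (3 + 2 * (beta * (k%:R * K ^+ k * `|T|))) * (1 + mul) by have m0 := mul0; rewrite mulr_gt0//; lra.
have q0 : 0 < q by rewrite divr_gt0.
pose e1 := minr 1 q / (2 * (1 + 4 * mul^-1)).
have m1 : 0 < minr 1 q by rewrite lt_min ltr01.
have d1 : 0 < 2 * (1 + 4 * mul^-1) by lra.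
have e10 : 0 < e1 by rewrite divr_gt0.
have F1 : \forall n \near \oo, forall j : 'I_3, forall t, 0 <= t <= T -> `|ys n j t - y j t| <= e1.
  by apply: filter_forall => j; exact: H.
near=> n.
have Fn : forall j : 'I_3, forall t, 0 <= t <= T -> `|ys n j t - y j t| <= e1 by near: n.
move=> t /andP[t0 tT].
have Fn' (r : R) : r <= T -> forall j s, 0 <= s <= r -> `|ys n j s - y j s| <= e1.
  by move=> rT j s /andP[s0 sr]; apply: Fn; rewrite s0 (le_trans sr).
have qe : minr 1 q = 2 * (1 + 4 * mul^-1) * e1 by rewrite /e1 mulrC divfK// gt_eqF.
have qm : minr 1 q <= q by rewrite ge_min lexx orbT.
have qm1 : minr 1 q <= 1 by rewrite ge_min lexx.
have dd r : 0 <= r <= T -> `|driver (ys n) r - driver y r| <= minr 1 q / 2.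
  move=> /andP[r0 rT]; apply: (le_trans (driver_dist r0 (Fn' r rT))).
  by rewrite qe; lra.
have [cZn ZnP] := solutionP (cys n).
have Zb r : 0 <= r <= T -> (solution y).1 r <= K.
  by move=> /HK0; rewrite ler_norml => /andP[_ h]; rewrite /K; lra.
have Znb r : 0 <= r <= T -> (solution (ys n)).1 r <= K.
  move=> rT; have := rsol_stable beta0 (ZnP T) (ZP T) dd rT; have := HK0 r rT.
  by rewrite !ler_norml /K => /andP[? ?] /andP[? ?]; lra.
have tT' : 0 <= t <= T by rewrite t0.
have [h1 h2 h3] := rsol_compare K1 (ZnP T) (ZP T) Znb Zb dd tT'.
have TT : `|T| = T by rewrite ger0_norm// (le_trans t0).
have qE : e = (3 + 2 * (beta * (k%:R * K ^+ k * `|T|))) * (1 + mul) * q by rewrite /q mulrC divfK// gt_eqF.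
have m0 := mul0.
have Dq : beta * (k%:R * K ^+ k * (2 * (minr 1 q / 2)) * T) <= beta * (k%:R * K ^+ k * `|T|) * q.
  rewrite TT (_ : beta * (k%:R * K ^+ k * (2 * (minr 1 q / 2)) * T) = beta * (k%:R * K ^+ k * T) * minr 1 q); last by field.
  by rewrite ler_wpM2l// -TT.
move: h2 h3 Dq Cge0 qE; set D := beta * (_ * (2 * _) * _); set C := beta * _ => h2 h3 Dq Cge0 qE.
have Cq : 0 <= C * q by rewrite mulr_ge0// ltW.
have qpos := ltW q0.
have Cqm : 0 <= C * q * mul by rewrite mulr_ge0// ltW.
have qmul : 0 <= q * mul by rewrite mulr_ge0// ltW.
have eE : e = 3 * q + 3 * (q * mul) + 2 * (C * q) + 2 * (C * q * mul) by rewrite qE; ring.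
have im' := im.
move: i; apply: ord4_case; rewrite /outputs /pvec !inordK//=.
- apply: (le_trans h1); clear - qm qpos Cq Cqm qmul eE; lra.
- apply: (le_trans h2); clear - qm qpos Cq Cqm qmul eE Dq; lra.
- have h4 := free_path_dist t0 (Fn' t tT).
  have h5 : mul^-1 * (4 * e1) <= minr 1 q by have me : 0 <= mul^-1 * e1 by [rewrite mulr_ge0// ltW]; rewrite qe; clear - e10 me; lra.
  apply: (distB_le h4 h3); clear - h5 qm qpos Cq Cqm qmul eE Dq; lra.
- have h4 := Fn (inord 0) t tT'; have h5 : `|ys n (inord 0) 0 - y (inord 0) 0| <= e1 by apply: Fn; rewrite lexx (le_trans t0).
  have e1q : 2 * e1 <= minr 1 q.
    rewrite qe [leRHS](_ : _ = 2 * e1 + 8 * (mul^-1 * e1)); last by ring.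
    by rewrite lerDl mulr_ge0// mulr_ge0// ltW.
  have h6 : `|mul * drift beta k (solution (ys n)).1 t - mul * drift beta k (solution y).1 t| <= mul * D.
    by rewrite -mulrBr normrM gtr0_norm// ler_wpM2l// ltW.
  have h7 : mul * D <= C * q * mul by rewrite mulrC ler_wpM2r// ltW.
  apply: (distB_le (distB_le h4 h5 (lexx _)) h6); clear - e1q h7 qm qpos Cq Cqm qmul eE; lra.
Unshelve. all: by end_near. Qed.

Lemma lu_J1 n (xs : nat -> 'I_n -> R -> R) x :
  (forall i (T e : R), 0 < e -> \forall m \near \oo, forall t : R, 0 <= t <= T -> `|xs m i t - x i t| <= e) ->
  J1n_cvg xs x.
Proof.
move=> H i; exists (fun _ => id); split.
  move=> _; split => //; split; last by split => // y y0; exists y.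
  by apply: continuous_subspaceT => z; exact: cvg_id.
split=> [e e0|T e e0]; last exact: H.
by apply: nearW => m t t0; rewrite subrr normr0 ltW.
Qed.

Lemma J1_lu (f : ('I_3 -> R -> R) -> R) : J1_continuous f -> lu_continuous f.
Proof. by move=> cf ys y cys cy H; apply: cf => [m i|i|]; [exact: cont0_cadlag|exact: cont0_cadlag|exact: lu_J1]. Qed.

Lemma outputs_J1_lu (f : ('I_4 -> R -> R) -> R) : J1_continuous f -> lu_continuous (f \o outputs).
Proof.
move=> cf ys y cys cy H; apply: cf => [m i|i|].
- by apply: cont0_cadlag; exact: outputs_cont.
- by apply: cont0_cadlag; exact: outputs_cont.
- by apply: lu_J1; exact: outputs_lu.
Qed.

End solution_map.

(** J1 convergence ignores negative times, so the constant sequence [x] converges to [x'], and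
    limits of real sequences are unique. *)
Lemma J1_agree {R : realType} n (f : ('I_n -> R -> R) -> R) x x' : J1_continuous f -> (forall i, cadlag (x i)) ->
  (forall i, cadlag (x' i)) -> (forall i t, 0 <= t -> x i t = x' i t) -> f x = f x'.
Proof.
move=> cf cx cx' H; have h : J1n_cvg (fun=> x) x'.
  apply: lu_J1 => i T e e0; apply: nearW => m t /andP[t0 _]; by rewrite H// subrr normr0 ltW.
have := cf (fun=> x) x' (fun=> cx) cx' h.
by move/(cvg_real_unique _ (cvg_cst (f x))) => ->.
Qed.

(** * The prelimit queues *)

Section good_paths.
Context {R : realType}.

Lemma minr_cont (M : R) : continuous (minr M).
Proof.
move=> q; apply/cvgrPdist_le => e e0; apply/nbhs_ballP; exists e => //= x qx.
by apply: (le_trans (minr_dist _ _ _)); exact: ltW.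
Qed.

Lemma polygon_lip n m (dl : 'I_m -> R) (s t : R) :
  `|polygon n dl t - polygon n dl s| <= (\sum_(i < m) `|dl i| * n%:R) * `|t - s|.
Proof.
rewrite /polygon -sumrB mulr_suml; apply: (le_trans (ler_norm_sum _ _ _)).
apply: ler_sum => i _; rewrite -mulrBr normrM -mulrA ler_wpM2l//.
have [st|/ltW ts] := leP s t; first by rewrite (ger0_norm (_ : 0 <= t - s)) ?subr_ge0//; exact: ramp_lip.
by rewrite distrC (distrC t) (ger0_norm (_ : 0 <= s - t)) ?subr_ge0//; exact: ramp_lip.
Qed.

Lemma polygon0 n m (dl : 'I_m -> R) : polygon n dl 0 = 0.
Proof.
rewrite /polygon big1// => i _; rewrite /ramp mulr0 sub0r.
rewrite (max_idPl _) ?mulr0// ge_min; apply/orP; right; by rewrite oppr_le0.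
Qed.

Definition lip_class (j : nat) : set ('I_3 -> R -> R) :=
  [set y | [/\ lip_path j%:R y, y (inord 0) 0 = 0, y (inord 1) 0 = 0 & `|y (inord 2) 0| <= j%:R]].

Lemma lip_class_cont j y : lip_class j y -> forall i, cont0 (y i).
Proof.
move=> [ly _ _ _] i; apply: (@lip_cont0 _ _ j%:R) => s t s0 st.
by have := ly i t s (le_trans s0 st) s0; rewrite [X in _ * X]ger0_norm ?subr_ge0.
Qed.

Lemma lip_class0 j : lip_class j (fun _ _ => 0).
Proof. by split => //; rewrite ?normr0// => i s t _ _; rewrite subrr normr0 mulr_ge0. Qed.

Lemma lip_class_bound j y i (t : R) : lip_class j y -> 0 <= t -> `|y i t| <= j%:R * (1 + t).
Proof.
move=> [ly y0 y1 y2] t0.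
have h : forall i, `|y i 0| <= j%:R by apply: ord3_case; rewrite ?y0 ?y1 ?normr0.
have := ly i t 0 t0 (lexx 0); rewrite subr0 (ger0_norm t0) => h2.
have := ler_distD 0 (y i t) 0; have := ler_distD (y i 0) (y i t) 0; rewrite !subr0.
by have := h i; rewrite mulrDr mulr1; lra.
Qed.

Definition class_graph (j : nat) : set (('I_3 -> R -> R) * R) := [set p | lip_class j p.1 /\ p.2 = 0].

Variable N : R.
Hypothesis N0 : 0 <= N.
Let Np : 0 <= N + 2. Proof. by have h := N0; lra. Qed.

(** The values in [class_graph] are all 0, so the envelope measures the distance to the class. The
    horizon [N + 2] leaves a unit of room for the tolerance by which [close_upto] shortens it. *)
Definition fit (j : nat) (x : 'I_3 -> R -> R) : R := 1 - minr 1 (envelope (class_graph j) (N + 2) x).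

Let cg_lip j y v : class_graph j (y, v) -> lip_path j%:R y.
Proof. by move=> [[] ]. Qed.
Let cg_ge j y v : class_graph j (y, v) -> - 0 <= v.
Proof. by move=> [_ /= ->]; rewrite oppr0. Qed.
Let cg0 j : class_graph j ((fun _ _ => 0), 0). Proof. by split => //; exact: lip_class0. Qed.

Let env_ge0 j x : 0 <= envelope (class_graph j) (N + 2) x.
Proof. by have /andP[h _] := envelope_bounds Np (@cg_ge j) (cg0 j) x; rewrite oppr0 in h. Qed.

Lemma fit01 j x : 0 <= fit j x <= 1.
Proof.
have h := env_ge0 j x; rewrite /fit; set q := envelope _ _ _ in h *.
by case: (leP 1 q) => h1; apply/andP; split; lra.
Qed.

Lemma fit_J1 j : J1_continuous (fit j).
Proof.
move=> xs x cxs cx xsx; apply: cvgB; first exact: cvg_cst.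
have jn : (0 : R) <= j%:R by [].
have := envelope_J1 Np jn (@cg_lip j) (@cg_ge j) (cg0 j) cxs cx xsx => h.
exact: (cvg_comp_cont (@minr_cont 1) h).
Qed.

(** A near-optimal tolerance [q] satisfies [2 q <= (N + 2) q < r], so that the horizon [N + 2 - q]
    still reaches [N + 1]. *)
Lemma fit_good j x r : 0 < r -> r <= 1 -> 1 - r / 2 <= fit j x ->
  exists2 y, lip_class j y & forall i (t : R), 0 <= t <= N + 1 -> `|x i t - y i t| <= r.
Proof.
move=> r0 r1 hf; have N0' := N0.
have e0 : 0 < r / 2 by rewrite divr_gt0.
have [y [v [q [[/= yj ->] q0 cl]]]] := envelope_near Np (@cg_ge j) (cg0 j) x e0.
rewrite add0r => hq.
have env_le : envelope (class_graph j) (N + 2) x <= r / 2.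
  by move: hf; rewrite /fit; case: (leP 1 (envelope _ _ _)) => ? ?; lra.
have q2 : 2 * q <= (N + 2) * q by rewrite ler_wpM2r//; lra.
exists y => // i t /andP[t0 tN].
have := cl i t t0 (ltac:(lra)) => h; apply: (le_trans h); lra.
Qed.

(** Decoded polygons are Lipschitz and approximate a continuous path uniformly on [[0, N + 2]]; one
    of them belongs to the class for all large [j]. *)
Lemma fit_cvg (A S : R -> R) (z : R) : cont0 A -> cont0 S -> A 0 = 0 -> S 0 = 0 ->
  (fun j => fit j (X3 A S z)) @ \oo --> (1 : R).
Proof.
move=> cA cS A0 S0; apply/cvgrPdist_le => e e0.
have N0' := N0.
have e1 : 0 < e / (N + 2) by rewrite divr_gt0//; lra.
have [p [pA pS]] : exists p, (forall t, 0 <= t <= N + 2 -> `|path_decode (path_code p A) t - A t| <= e / (N + 2)) /\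
   (forall t, 0 <= t <= N + 2 -> `|path_decode (path_code p S) t - S t| <= e / (N + 2)).
  have h1 := path_decode_cvg (N + 2) cA A0 e1; have h2 := path_decode_cvg (N + 2) cS S0 e1.
  have [q _ Hq] : \forall p \near \oo, (forall t, 0 <= t <= N + 2 -> `|path_decode (path_code p A) t - A t| <= e / (N + 2)) /\
    (forall t, 0 <= t <= N + 2 -> `|path_decode (path_code p S) t - S t| <= e / (N + 2)).
    by apply: filterS2 h1 h2.
  by exists q; apply: Hq => /=.
pose y := X3 (path_decode (path_code p A)) (path_decode (path_code p S)) z.
pose lA : R := \sum_(i < p.+1 * p.+1) `|unquant p (path_code p A i)| * p.+1%:R.
pose lS : R := \sum_(i < p.+1 * p.+1) `|unquant p (path_code p S i)| * p.+1%:R.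
have lA0 : 0 <= lA by apply: sumr_ge0 => i _; rewrite mulr_ge0.
have lS0 : 0 <= lS by apply: sumr_ge0 => i _; rewrite mulr_ge0.
have jbig : \forall j \near \oo, lA + lS + `|z| <= j%:R by exact: nbhs_infty_ger.
apply: filterS jbig => j jb; have z0 := normr_ge0 z.
have yj : lip_class j y.
  split; rewrite /y /X3 /pvec ?inordK//=; [|exact: polygon0|exact: polygon0|lra].
  apply: ord3_case => s t s0 t0; rewrite !inordK//=.
  - by apply: (le_trans (polygon_lip _ _ _ _)); rewrite ler_wpM2r// -/lA; lra.
  - by apply: (le_trans (polygon_lip _ _ _ _)); rewrite ler_wpM2r// -/lS; lra.
  - by rewrite subrr normr0 mulr_ge0.
have env_le : envelope (class_graph j) (N + 2) (X3 A S z) <= e.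
  have -> : e = 0 + (N + 2) * (e / (N + 2)) by rewrite add0r mulrC divfK// gt_eqF//; lra.
  apply: (@envelope_le _ _ _ _ 0 Np (@cg_ge j) _ _ (cg0 j) _ y) => //; first exact: ltW.
  have ee := ltW e1.
  apply: ord3_case => t t0 tN; rewrite /y /X3 /pvec !inordK//=.
  - by rewrite distrC; apply: pA; rewrite t0; lra.
  - by rewrite distrC; apply: pS; rewrite t0; lra.
  - by rewrite subrr normr0.
have h := env_ge0 j (X3 A S z).
rewrite /fit opprB addrCA subrr addr0 ger0_norm; last by rewrite le_min ler01.
by apply: le_trans env_le; rewrite ge_min lexx orbT.
Qed.

End good_paths.

(** The mean of [fit] under the limit law tends to 1 as [j] grows. For a fixed [j], weak convergence
    makes it nearly 1 along the queues, and [inner_event] turns this into a measurable event. *)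
Lemma good_event {R : realType} (Aset : set R) (d : measure_display)
  (Om : R -> measurableType d) (P : forall a, probability (Om a) R)
  (X : forall a, Om a -> 'I_3 -> R -> R) (mu_lim ca cs : R) (d0 : measure_display)
  (Om0 : measurableType d0) (P0 : probability Om0 R) (Ba Bs : R -> Om0 -> R) (Zs0 : Om0 -> R) (N r eta : R) :
  0 < mu_lim -> std_BM P0 Ba -> std_BM P0 Bs -> measurable_fun setT Zs0 ->
  weak_cvg P X (within Aset (nbhs (0 : R))) P0 (Xlim mu_lim ca cs Ba Bs Zs0) ->
  0 <= N -> 0 < r -> r <= 1 -> 0 < eta ->
  exists j : nat, \forall a \near within Aset (nbhs (0 : R)), exists E : set (Om a),
    [/\ measurable E, fine (P a E) <= eta & forall w, ~ E w ->
      exists2 y, lip_class j y & forall i (t : R), 0 <= t <= N + 1 -> `|X a w i t - y i t| <= r].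
Proof.
move=> mu0 HBa HBs mZ HW N0 r0 r1 eta0.
have FF : Filter (within Aset (nbhs (0 : R))) by exact: within_filter.
have L : (fun j => \int[P0]_w fit N j (Xlim mu_lim ca cs Ba Bs Zs0 w)) @ \oo --> (1 : R).
  rewrite -(prob_integral_cst P0 1); apply: (@bounded_cvg _ _ _ P0 _ _ 1) => [j|j w|w].
  - by apply: (limit_measurable (Th := fit N j) ca cs mu0 HBa HBs mZ); apply: J1_lu; exact: fit_J1.
  - by have /andP[? ?] := fit01 N0 j (Xlim mu_lim ca cs Ba Bs Zs0 w); rewrite ger0_norm.
  - apply: fit_cvg => //; [exact: (BM_path_cont mu0 HBa)|exact: (BM_path_cont mu0 HBs)| |].
    + by have [_ [h _]] := HBa; rewrite mulr0 h mulr0.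
    + by have [_ [h _]] := HBs; rewrite mulr0 h mulr0.
have er : 0 < eta * (r / 2) by rewrite mulr_gt0// divr_gt0.
have [j Hj] : exists j, 1 - eta * (r / 2) < \int[P0]_w fit N j (Xlim mu_lim ca cs Ba Bs Zs0 w).
  have /cvgrPdist_lt/(_ _ er)[j _ Hj] := L; exists j; have := Hj j (leqnn _).
  by rewrite /= ltr_norml => /andP[_]; lra.
exists j.
have bf : bounded_functional (fit N j).
  by exists 1 => y; have /andP[? ?] := fit01 N0 j y; rewrite ger0_norm.
have W := weak_cvg_real FF HW bf (@fit_J1 _ N N0 j).
have nearW : \forall a \near within Aset (nbhs (0 : R)), 1 - eta * (r / 2) < \int[P a]_w fit N j (X a w).
  have e' : 0 < \int[P0]_w fit N j (Xlim mu_lim ca cs Ba Bs Zs0 w) - (1 - eta * (r / 2)) by rewrite subr_gt0.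
  move/cvgrPdist_lt : W => /(_ _ e'); apply: filterS => a; rewrite ltr_norml => /andP[_]; lra.
apply: filterS nearW => a Ha.
have r2 : 0 < r / 2 by rewrite divr_gt0.
have [E mE [PE HE]] := inner_event (fun w => fit01 N0 j (X a w)) Ha r2.
exists (~` E); split; first exact: measurableC.
  by rewrite mulfK ?gt_eqF// in PE.
by move=> w /contrapT Ew; apply: (fit_good N0 r0 r1); exact: HE.
Qed.

Lemma truncS_bounds {R : realType} (B : R) : 1 <= B -> B <= (truncn B).+1%:R <= 2 * B.
Proof.
move=> B1; have B0 : 0 <= B by lra.
have /andP[h1 h2] := truncn_itv B0; rewrite (ltW h2) /= -natr1; lra.
Qed.

(** * The scaling exponent and the patience distribution *)

Section scaling.
Context {R : realType}.
Variables (k : nat) (Aset : set R).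
Hypothesis k0 : (0 < k)%N.
Hypothesis HA : forall a, Aset a -> 0 < a.
Let h : R := k%:R / (k%:R + 1).
Let Fl := within Aset (nbhs (0 : R)).
Let FF : Filter Fl. Proof. exact: within_filter. Qed.
Local Existing Instance FF.

Definition magnify (a : R) : R := powR a (- h).

Let kR : 0 < k%:R :> R. Proof. by rewrite ltr0n. Qed.
Let h0 : 0 < h. Proof. by rewrite divr_gt0// addr_gt0. Qed.

Lemma magnify_inv a : powR a h = (magnify a)^-1.
Proof. by rewrite /magnify powRN invrK. Qed.

Lemma magnify_gt0 a : 0 < a -> 0 < magnify a. Proof. exact: powR_gt0. Qed.

Lemma magnify_sqr a : 0 < a -> powR a (- (2 * h)) = magnify a ^+ 2.
Proof.
move=> a0; rewrite (_ : - (2 * h) = - h * 2%:R); last by rewrite mulrC mulNr.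
by rewrite powRrM powR_mulrn// powR_ge0.
Qed.

Lemma diffscale_scl a (x : R -> R) (q : R) : 0 < a -> diffscale a h x q = scl (magnify a) x q.
Proof. by move=> a0; apply/funext => t; rewrite /diffscale /scl magnify_inv magnify_sqr. Qed.

(** The exponent [h = k / (k + 1)] is the solution of [- h + (1 - h) * k = 0]; it is here that its
    value matters. *)
Lemma magnify_power a : 0 < a -> magnify a * (magnify a * a) ^+ k = 1.
Proof.
move=> a0; have a0' := ltW a0; have an0 : a != 0 by rewrite gt_eqF.
rewrite -[X in (_ * X) ^+ k](powRr1 a0') /magnify -powRD; last by rewrite an0 implybT.
rewrite -powR_mulrn ?powR_ge0// -powRrM -powRD; last by rewrite an0 implybT.
have -> : - h + (- h + 1) * k%:R = 0 by rewrite /h; field; rewrite gt_eqF// addr_gt0.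
by rewrite powRr0.
Qed.

Lemma magnify_large (M : R) : \forall a \near Fl, M <= magnify a.
Proof.
pose M1 := maxr M 1; have M10 : 0 < M1 by rewrite lt_max ltr01 orbT.
have iM : 0 < M1^-1 by rewrite invr_gt0.
have /cvgrPdist_lt/(_ _ iM) := powR_cvg0 h0.
rewrite near_withinE => /nbhs_ballP[dl /= dl0 H].
rewrite /Fl near_withinE; apply/nbhs_ballP; exists dl => //= a ad /HA a0.
have := H a ad a0; rewrite sub0r normrN ger0_norm ?powR_ge0// magnify_inv => h1.
apply: (@le_trans _ _ M1); first by rewrite le_max lexx.
by move: h1; rewrite ltf_pV2 ?posrE ?magnify_gt0// => /ltW.
Qed.

Lemma near_sys (Q : R -> Prop) : (forall a, Aset a -> Q a) -> \forall a \near Fl, Q a.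
Proof. by move=> H; rewrite /Fl near_withinE; apply: nearW. Qed.

Section patience.
Variables (F : R -> R) (beta : R).
Hypothesis Fnd : {homo F : x y / x <= y}.
Hypothesis Fexp : forall e : R, 0 < e -> exists2 dl : R, 0 < dl & forall x : R, 0 <= x < dl ->
    `|F x - beta * x ^+ k| <= e * x ^+ k.

(** With [s = magnify a * a], which is small, the argument of [F] is [s * z], and
    [magnify a * s ^ k = 1] turns the leading term into [beta * z ^ k]. *)
Lemma scaled_patience (K r : R) : 0 < K -> 0 < r -> \forall a \near Fl,
  forall z : R, 0 <= z <= K -> `|magnify a * F (a * (magnify a * z)) - beta * z ^+ k| <= r.
Proof.
move=> K0 r0; have Kk : 0 < K ^+ k by rewrite exprn_gt0.
have e0 : 0 < r / K ^+ k by rewrite divr_gt0.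
have [dl dl0 H] := Fexp e0.
have Hbig := magnify_large ((K / dl) ^+ k + 1); have HAs := near_sys HA.
near=> a.
have a0 : 0 < a by near: a.
have B0 := magnify_gt0 a0.
have aB : (K / dl) ^+ k + 1 <= magnify a by near: a.
have pw := magnify_power a0; set s := magnify a * a in pw *.
have s0 : 0 < s by rewrite mulr_gt0.
have sK : s * K < dl.
  rewrite ltNge; apply/negP => dls.
  have h1 : 1 <= (s * (K / dl)) ^+ k.
    apply: exprn_ege1; by rewrite mulrA ler_pdivlMr// mul1r.
  rewrite exprMn in h1.
  have sk0 : 0 < s ^+ k by rewrite exprn_gt0.
  have h2 : s ^+ k * ((K / dl) ^+ k + 1) <= 1 by rewrite -[leRHS]pw mulrC ler_wpM2r// ltW.
  by move: h1 h2; rewrite mulrDr mulr1; lra.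
move=> z /andP[z0 zK].
have -> : a * (magnify a * z) = s * z by rewrite /s; ring.
have sz : 0 <= s * z < dl by rewrite mulr_ge0 ?(ltW s0)//=; apply: le_lt_trans sK; rewrite ler_wpM2l// ltW.
have := H _ sz => h1.
have -> : beta * z ^+ k = magnify a * (beta * (s * z) ^+ k) by rewrite exprMn -[LHS]mulr1 -pw; ring.
rewrite -mulrBr normrM (gtr0_norm B0).
have h2 : magnify a * (r / K ^+ k * (s * z) ^+ k) <= r.
  have -> : magnify a * (r / K ^+ k * (s * z) ^+ k) = r / K ^+ k * (magnify a * s ^+ k * z ^+ k) by rewrite exprMn; ring.
  rewrite pw mul1r -mulrA ger_pMr// mulrC ler_pdivrMr// mul1r.
  by rewrite lerXn2r ?nnegrE// (ltW K0).
by apply: le_trans h2; rewrite ler_wpM2l// ltW.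
Unshelve. all: by end_near. Qed.

End patience.
End scaling.

Section service_clock.
Context {R : realType} {d : measure_display} {Om : measurableType d} (P : probability Om R).
Variables (V : nat -> Om -> R) (mu : R).
Hypothesis mV : forall i, measurable_fun setT (V i).
Hypothesis lV : forall i, same_law P (V i) (V 0%N).
Hypothesis iV : forall n (A : 'I_n -> set R), (forall m, measurable (A m)) ->
  P (\bigcap_(m in [set: 'I_n]) (V m @^-1` A m)) = (\prod_(m < n) P (V m @^-1` A m))%E.
Hypothesis mu0 : 0 < mu.
Hypothesis V0 : P [set w | 0 <= V 0%N w] = 1%E.
Hypothesis EV : (\int[P]_w (V 0%N w)%:E = (mu^-1)%:E)%E.

(* If U(b) < b (1/mu - eta) then S has gained b eta mu renewals over its mean
   within a vanishing scaled time, which the path bound excludes. *)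
Lemma service_laplace (B M0 eta j r : R) (b' : nat) (Bd : set Om) : B <= b'.+1%:R -> b'.+1%:R <= 2 * B ->
  1 <= B -> mu^-1 <= M0 -> mu <= M0 -> 0 < eta -> 0 <= j -> measurable Bd ->
  fine (P Bd) <= expR (- M0) * eta ->
  2 * M0 <= B -> 2 * M0 ^+ 2 <= eta * B -> 2 * j * M0 / B + r < eta / M0 ->
  (forall w, ~ Bd w -> [/\ forall i, 0 <= V i w, forall t : R, exists n, t < \sum_(j < n.+1) V j w &
     forall t : R, 0 <= t <= 1 -> `|scl B (Scount (V ^~ w)) mu t| <= j * t + r]) ->
  b'.+1%:R * \int[P]_w phi (maxr (V 0%N w) 0 / b'.+1%:R) <= 3 * eta.
Proof.
set b := b'.+1 => Bb bB B1 iM mM e0 j0 mBd PBd HB HB2 Hsm Hgood.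
have B0 : 0 < B by lra.
have M00 : 0 < M0 by apply: lt_le_trans mM.
have b0 : 0 < b%:R :> R by lra.
have im0 : 0 < mu^-1 by rewrite invr_gt0.
have h1 : 2 * M0 <= b%:R by lra.
apply: le_trans (laplace_small mV lV iV im0 V0 EV iM h1 e0 mBd PBd _) _; last first.
  have : 2 * M0 ^+ 2 / b%:R <= eta by rewrite ler_pdivrMr//; apply: (le_trans HB2); rewrite ler_wpM2l// ltW.
  lra.
move=> w /Hgood[Vge Vunb HS]; rewrite (eq_bigr (fun j : 'I_b => V j w)); last by move=> i _; rewrite max_l.
rewrite leNgt; apply/negP => Hlt.
set q := b%:R * (mu^-1 - eta) in Hlt.
have U0 : 0 <= \sum_(j < b) V j w by apply: sumr_ge0.
have q0 : 0 <= q by rewrite ltW// (le_lt_trans U0).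
have qM : q <= 2 * B * M0.
  rewrite /q; apply: ler_pM => //; last by lra.
  by move: q0; rewrite /q pmulr_rge0.
pose t := q / B ^+ 2.
have B20 : 0 < B ^+ 2 by rewrite exprn_gt0.
have tB : t <= 2 * M0 / B.
  rewrite /t ler_pdivrMr// (_ : 2 * M0 / B * B ^+ 2 = 2 * B * M0)//; field; by rewrite gt_eqF.
have t01 : 0 <= t <= 1.
  rewrite divr_ge0// ?(ltW B20)//=; apply: (le_trans tB); by rewrite ler_pdivrMr// mul1r.
have := HS t t01.
have qt : B ^+ 2 * t = q by rewrite /t mulrC divfK// gt_eqF.
have Sb : b%:R <= Scount (V ^~ w) (B ^+ 2 * t).
  rewrite qt (ScountE Vge Vunb) ler_nat.
  have := nSE Vge Vunb b' q; rewrite -/b (ltW Hlt) => /esym; exact.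
have E : scl B (Scount (V ^~ w)) mu t = B^-1 * (Scount (V ^~ w) (B ^+ 2 * t) - mu * q).
  by rewrite /scl; congr (_ * (_ - _)); rewrite -qt; ring.
have muq : mu * q = b%:R - b%:R * (mu * eta) by rewrite /q; field; rewrite gt_eqF.
have big : mu * eta <= scl B (Scount (V ^~ w)) mu t.
  rewrite E muq [leRHS]mulrC ler_pdivlMr//.
  have : mu * eta * B <= b%:R * (mu * eta) by rewrite mulrC ler_wpM2r// mulr_ge0 ?ltW.
  lra.
have iM0 : M0^-1 <= mu by rewrite -[mu]invrK lef_pV2 ?posrE.
have h3 : eta / M0 <= mu * eta by rewrite mulrC ler_wpM2r// ltW.
have h4 : j * t <= 2 * j * M0 / B.
  by rewrite (_ : 2 * j * M0 / B = j * (2 * M0 / B)); [rewrite ler_wpM2l|ring].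
rewrite ler_norml => /andP[_ h5]; lra.
Qed.

End service_clock.

(** * Choice of the grid and of the truncation level *)

Section acceptance.
Context {R : realType} {d : measure_display} {Om : measurableType d} (P : probability Om R).
Variables (Fa : R -> R) (u V D : nat -> Om -> R) (z0 : Om -> R) (lam mu : R) (Z L : Om -> R -> R).
Hypothesis sys : queue_system P Fa u V D z0 lam mu Z L.
Hypothesis Fa_nd : forall x y : R, x <= y -> Fa x <= Fa y.
Hypothesis Fa_right : forall x : R, Fa s @[s --> at_right x] --> Fa x.

(** For a fixed [J] the probability bound is of order [1 / B] plus order [zeta], so it is made small
    by taking [zeta] small and then [B] large. *)
Lemma acceptance_small (B c Q M1 Cp r zeta : R) (b J : nat) :
  1 <= B -> 0 <= c -> 0 <= Q -> 1 <= M1 -> mu^-1 <= M1 -> 0 < Cp -> B * Fa c <= Cp -> 0 < r -> r <= 1 ->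
  Q * (6 * Cp * M1 / r) <= J%:R -> 0 <= zeta -> zeta * J%:R <= 1 -> B <= b%:R -> b%:R <= 2 * B ->
  b%:R * \int[P]_w phi (maxr (V 0%N w) 0 / b%:R) <= zeta -> 6 * Cp * M1 / r <= B ^+ 2 ->
  exists Bd : set Om, [/\ measurable Bd,
    fine (P Bd) <= (9 * J.+1%:R * J%:R / r ^+ 2) / B + (72 * J.+1%:R * J%:R / r ^+ 2 + 4 * J%:R) * zeta &
    forall w, ~ Bd w -> (forall i, 0 <= V i w) -> forall n, n%:R <= B ^+ 2 * Q ->
      let wo i := minr (Wrec (u ^~ w) (V ^~ w) (D ^~ w) (z0 w) i) c in
      let ind i : R := (nat_of_bool (D i w <= wo i))%:R in
      `|\sum_(i < n) (ind i - Fa (wo i))| <= B * r /\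
      `|\sum_(i < n) (V i w * ind i - mu^-1 * Fa (wo i))| <= B * r].
Proof.
move=> B1 c0 Q0 M11 iM Cp0 BF r0 r1 HJ zeta0 zJ Bb bB Hphi HB2.
have [mu' [mV [mD [mz [lu [lV [lD [ind [u0 [V0 [cD [lam0 [mu0 [Eu [EV dyn]]]]]]]]]]]]]]] := sys.
have B0 : 0 < B by lra.
have B20 : 0 < B ^+ 2 by rewrite exprn_gt0.
have CM0 : 0 < 6 * Cp * M1 by rewrite mulr_gt0//; lra.
have CM3 : 0 < 3 * Cp * M1 by rewrite mulr_gt0//; lra.
(* The grid spacing: over [x] customers the expected loss is at most
   [x * Cp / B = B * r / (3 * M1)]. As [x >= 2], rounding down keeps at least half of [x], which
   accounts for the 6 in the hypothesis on [J]. *)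
pose x := B ^+ 2 * r / (3 * Cp * M1).
have x2 : 2 <= x.
  by rewrite /x ler_pdivlMr//; move: HB2; rewrite ler_pdivrMr//; lra.
pose st := truncn x; have x0 : 0 <= x by lra.
have /andP[stx xst] := truncn_itv x0; rewrite -/st -natr1 in stx xst.
have sth : x / 2 <= st%:R by lra.
have st0 : (0 < st)%N by rewrite -(ltr_nat R); lra.
have Fc0 : 0 <= Fa c.
  by rewrite -lee_fin -cD.
have FcB : Fa c <= Cp / B by rewrite ler_pdivlMr// mulrC.
have e0 : 0 < B * r / 3 by rewrite divr_gt0// mulr_gt0.
have stF : st%:R * Fa c <= B * r / (3 * M1).
  apply: (@le_trans _ _ (x * (Cp / B))); first exact: ler_pM.
  rewrite le_eqVlt; apply/orP; left; apply/eqP; rewrite /x; field.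
  by rewrite !gt_eqF//; lra.
have M10 : 0 < M1 by lra.
have le1 : B * r / (3 * M1) <= B * r / 3.
  rewrite invfM mulrA ler_pdivrMr// ler_peMr// ltW//.
have b0 : (0 < b)%N by rewrite -(ltr_nat R); lra.
have c1 : st%:R * Fa c <= B * r / 3 by exact: le_trans le1.
have stF0 : 0 <= st%:R * Fa c by rewrite mulr_ge0.
have c2 : mu^-1 * (st%:R * Fa c) <= B * r / 3.
  have im0 : 0 <= mu^-1 by rewrite invr_ge0 ltW.
  apply: (@le_trans _ _ (M1 * (B * r / (3 * M1)))); first exact: ler_pM.
  rewrite le_eqVlt; apply/orP; left; apply/eqP; field; by rewrite gt_eqF.
have JF : (J * st)%:R * Fa c <= J%:R * (B * r / 3) by rewrite natrM -mulrA ler_wpM2l.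
have JF0 : 0 <= (J * st)%:R * Fa c by rewrite mulr_ge0.
have c3 : zeta * ((J * st)%:R * Fa c) <= B * r / 3.
  apply: (@le_trans _ _ (zeta * (J%:R * (B * r / 3)))); first by rewrite ler_wpM2l.
  by rewrite mulrA ler_piMl// ltW.
have [Bd [mBd PBd HBd]] := @acceptance_deviations _ _ _ P u V D z0 mu' mV mD mz ind Fa lV lD cD Fa_nd Fa_right c c0
  mu^-1 V0 EV b st J zeta (B * r / 3) b0 st0 e0 Hphi c1 c2 c3.
exists Bd; split => //.
  apply: (le_trans PBd).
  have bR : 0 < b%:R :> R by rewrite ltr0n.
  have JF' : (J * st)%:R * Fa c <= J%:R * B.
    have r3 : r / 3 <= 1 by rewrite ler_pdivrMr// mul1r (le_trans r1)// ler1n.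
    by apply: (le_trans JF); rewrite ler_wpM2l// -mulrA ler_piMr// ltW.
  have r20 : 0 < r ^+ 2 by rewrite exprn_gt0.
  have JJ0 : 0 <= J%:R * B by rewrite mulr_ge0// ltW.
  have e2 : 0 < (B * r / 3) ^+ 2 by rewrite exprn_gt0.
  have t1 : J.+1%:R * ((J * st)%:R * Fa c / (B * r / 3) ^+ 2) <= (9 * J.+1%:R * J%:R / r ^+ 2) / B.
    rewrite (_ : 9 * J.+1%:R * J%:R / r ^+ 2 / B = J.+1%:R * (J%:R * B / (B * r / 3) ^+ 2)); last first.
      by field; rewrite !gt_eqF.
    by rewrite ler_wpM2l// ler_pM2r// invr_gt0.
  have t2 : J.+1%:R * ((J * st)%:R * (4 * b%:R * zeta * Fa c) / (B * r / 3) ^+ 2) <= (72 * J.+1%:R * J%:R / r ^+ 2) * zeta.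
    rewrite (_ : 72 * J.+1%:R * J%:R / r ^+ 2 * zeta = J.+1%:R * ((4 * (2 * B) * zeta) * (J%:R * B) / (B * r / 3) ^+ 2)); last first.
      by field; rewrite !gt_eqF.
    rewrite ler_wpM2l// ler_pM2r ?invr_gt0// (_ : (J * st)%:R * (4 * b%:R * zeta * Fa c) = (4 * b%:R * zeta) * ((J * st)%:R * Fa c)); last by ring.
    by apply: ler_pM => //; [rewrite !mulr_ge0|rewrite ler_wpM2r// ler_wpM2l].
  have t3 : (J * st)%:R * (4 * zeta / b%:R * Fa c) <= 4 * J%:R * zeta.
    rewrite (_ : (J * st)%:R * (4 * zeta / b%:R * Fa c) = (4 * zeta) * ((J * st)%:R * Fa c) / b%:R); last by ring.
    rewrite ler_pdivrMr// (_ : 4 * J%:R * zeta * b%:R = (4 * zeta) * (J%:R * b%:R)); last by ring.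
    rewrite ler_wpM2l ?mulr_ge0//; apply: (le_trans JF'); by rewrite ler_wpM2l.
  by apply: (le_trans (lerD (lerD t1 t2) t3)); rewrite [X in _ <= _ + X]mulrDl addrA.
move=> w nw Vw n nQ wo ind'.
have nJ : (n <= J * st)%N.
  rewrite -(ler_nat R); apply: (le_trans nQ); rewrite natrM.
  apply: (@le_trans _ _ (Q * (6 * Cp * M1 / r) * (x / 2))); last first.
    have q0 : 0 <= 6 * Cp * M1 / r by rewrite divr_ge0 ?ltW.
    by apply: ler_pM => //; [rewrite mulr_ge0|rewrite divr_ge0].
  rewrite le_eqVlt; apply/orP; left; apply/eqP; rewrite /x; field.
  by rewrite !gt_eqF.
have [h1 h2] := HBd w nw Vw n nJ; have Br0 : 0 <= B * r by rewrite mulr_ge0 ?ltW.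
split; last by rewrite mulrCA divff ?mulr1 in h2.
by apply: (le_trans h1); rewrite mulrCA ler_piMr// ler_pdivrMr// mul1r ler_nat.
Qed.

End acceptance.

Lemma out_const_ge {R : realType} (C5 C6 Q K M0 b m : R) : 0 <= C5 -> 0 <= C6 -> 0 <= Q -> 0 <= K -> 0 <= M0 ->
  0 <= b -> 0 <= m -> let S := 3 * C5 + C6 + (Q + 2 * K + 2 * M0 + 1) + b + m in
  [/\ 2 * C5 <= S, 3 * C5 + C6 <= S, Q + (2 * K + 2 * M0) + C6 <= S & Q + 1 + b + m <= S].
Proof. by move=> ? ? ? ? ? ? ? S; rewrite /S; split; lra. Qed.

Lemma C4_ge0 {R : realType} (K N M0 Cc beta : R) k : 0 <= K -> 0 <= N -> 0 <= M0 -> 0 <= Cc -> 0 <= beta ->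
  0 <= C4 K N M0 Cc beta k.
Proof.
move=> *; rewrite /C4 /C3 /P0 /C2 /C1 /Ca /K2 /nQ.
by repeat first [assumption|exact: ler01|exact: ler0n|apply: addr_ge0|apply: mulr_ge0|apply: exprn_ge0].
Qed.

(** * Comparison with the solution driven by a nearby path *)

Section compare.
Context {R : realType}.
Variables (k : nat) (beta c mul : R).
Hypothesis beta0 : 0 <= beta.
Hypothesis mul0 : 0 < mul.

(** Coefficient of [r] in the distance between the drivers: [Q] from the queue, [1] from the start,
    [2 K + 2 M0] from the service rate and the inputs, [N] from the linear drift. *)
Definition drive_const (K N M0 Q : R) : R := Q + 1 + 2 * K + 2 * M0 + N.
Definition drift_const (K N M0 Q Kz : R) : R :=
  beta * (k%:R * (Kz + 2 * drive_const K N M0 Q) ^+ k * (2 * drive_const K N M0 Q) * N).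
Definition out_const (K N M0 Q Kz : R) : R := 3 * drive_const K N M0 Q + drift_const K N M0 Q Kz
  + (Q + 2 * K + 2 * M0 + 1) + beta * (Kz ^+ k * N) + M0 * drift_const K N M0 Q Kz.

Lemma out_const_ge0 (K N M0 Q Kz : R) : 0 <= K -> 0 <= N -> 0 <= M0 -> 0 <= Q -> 0 <= Kz ->
  0 <= out_const K N M0 Q Kz.
Proof.
move=> *; rewrite /out_const /drift_const /drive_const.
by repeat first [assumption|exact: ler01|exact: ler0n|apply: addr_ge0|apply: mulr_ge0|apply: exprn_ge0].
Qed.

Variables (K N M0 Q Kz r : R).
Hypothesis K1 : 1 <= K.
Hypothesis N0 : 0 <= N.
Hypothesis M01 : 1 <= M0.
Hypothesis Q0 : 0 <= Q.
Hypothesis Kz1 : 1 <= Kz.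
Hypothesis r01 : 0 < r <= 1.
Variables (mu cB : R) (x y : 'I_3 -> R -> R) (Zt Lt Yt At yd : R -> R).
Hypothesis imul : mul^-1 <= M0.
Hypothesis mulM : mul <= M0.
Hypothesis dmu : `|mu^-1 - mul^-1| <= r.
Hypothesis dmu' : `|mu - mul| <= r.
Hypothesis dc : `|cB - c| <= r.
Hypothesis xy : forall i (t : R), 0 <= t <= N -> `|x i t - y i t| <= r.
Hypothesis xK : forall i (t : R), 0 <= t <= N -> `|x i t| <= K.
Hypothesis cy : forall i, cont0 (y i).
Hypothesis y0 : y (inord 0) 0 = 0.
Hypothesis y1 : y (inord 1) 0 = 0.
Hypothesis x2 : 0 <= x (inord 2) 0.
Hypothesis rs : rsol beta k yd Zt Lt N.
Hypothesis ydP : forall t, 0 <= t <= N ->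
  `|yd t - (x (inord 2) 0 + mu^-1 * (x (inord 0) t - x (inord 1) t) + cB * t)| <= Q * r.
Hypothesis ZK : forall t, 0 <= t <= N -> Zt t <= Kz.
Hypothesis YP : forall t, 0 <= t <= N ->
  `|Yt t - (mu^-1 * (x (inord 0) t - x (inord 1) t) - drift beta k Zt t)| <= Q * r.
Hypothesis AP : forall t, 0 <= t <= N -> `|At t - (x (inord 0) t - mu * drift beta k Zt t)| <= Q * r.

Let x01 t : 0 <= t <= N -> `|mu^-1 * (x (inord 0) t - x (inord 1) t) - free_path mul y t| <= (2 * K + 2 * M0) * r.
Proof.
move=> tN; have im0 : 0 < mul^-1 by rewrite invr_gt0.
have [r0 r1] := andP r01.
rewrite /free_path y0 y1 subrr subr0.
have -> : mu^-1 * (x (inord 0) t - x (inord 1) t) - mul^-1 * (y (inord 0) t - y (inord 1) t) =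
  (mu^-1 - mul^-1) * (x (inord 0) t - x (inord 1) t) + mul^-1 * ((x (inord 0) t - y (inord 0) t) - (x (inord 1) t - y (inord 1) t)) by ring.
have h1 : `|x (inord 0) t - x (inord 1) t| <= 2 * K.
  by apply: (le_trans (ler_normB _ _)); have := xK (inord 0) tN; have := xK (inord 1) tN; lra.
have h2 : `|(x (inord 0) t - y (inord 0) t) - (x (inord 1) t - y (inord 1) t)| <= 2 * r.
  by apply: (le_trans (ler_normB _ _)); have := xy (inord 0) tN; have := xy (inord 1) tN; lra.
apply: (le_trans (ler_normD _ _)); rewrite !normrM (ger0_norm (ltW im0)) mulrDl.
apply: lerD; first by rewrite mulrC; apply: ler_pM.
by rewrite -mulrA mulrCA; apply: ler_pM => //; exact: ltW.
Qed.

Lemma compare_outputs i t : 0 <= t <= N ->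
  `|pvec 4 [:: Zt; Lt; Yt; At] i t - outputs beta c mul k y i t| <= out_const K N M0 Q Kz * r.
Proof.
move=> tN; have [r0 r1] := andP r01; have r0' := ltW r0.
have /andP[t0 _] := tN.
have im0 : 0 < mul^-1 by rewrite invr_gt0.
set C5 := drive_const K N M0 Q; set C6 := drift_const K N M0 Q Kz.
have C50 : 0 <= C5 by have h1 := K1; have h2 := N0; have h3 := M01; have h4 := Q0; rewrite /C5 /drive_const; lra.
have dd s : 0 <= s <= N -> `|yd s - driver c mul y s| <= C5 * r.
  move=> sN; have /andP[s0 sN'] := sN; have h1 := ydP sN; have h2 := x01 sN.
  have h3 : `|cB * s - c * s| <= r * N.
    by rewrite -mulrBl normrM (ger0_norm s0); apply: ler_pM.
  have h4 : `|x (inord 2) 0 - maxr (y (inord 2) 0) 0| <= r.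
    rewrite -[X in `|X - _|](max_idPl x2); apply: (le_trans (maxr0_dist _ _)).
    by apply: xy; rewrite lexx.
  rewrite /driver (_ : yd s - _ = (yd s - (x (inord 2) 0 + mu^-1 * (x (inord 0) s - x (inord 1) s) + cB * s)) +
    (x (inord 2) 0 - maxr (y (inord 2) 0) 0) + (mu^-1 * (x (inord 0) s - x (inord 1) s) - free_path mul y s) + (cB * s - c * s)); last by ring.
  apply: (le_trans (ler_normD _ _)).
  apply: (le_trans (lerD (le_trans (ler_normD _ _) (lerD (le_trans (ler_normD _ _) (lerD h1 h4)) h2)) h3)).
  by rewrite le_eqVlt; apply/orP; left; apply/eqP; rewrite /C5 /drive_const; ring.
have [cZ ZP] := solutionP c mul k beta0 cy.
have K31 : 1 <= Kz + 2 * C5 by apply: (le_trans Kz1); rewrite lerDl mulr_ge0.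
have b1 s : 0 <= s <= N -> Zt s <= Kz + 2 * C5.
  by move=> sN; apply: (le_trans (ZK sN)); rewrite lerDl mulr_ge0.
have b2 s : 0 <= s <= N -> (solution beta c mul k y).1 s <= Kz + 2 * C5.
  move=> sN; have := rsol_stable beta0 rs (ZP N) dd sN; rewrite ler_norml => /andP[h1 _].
  have h2 := ZK sN; have h3 : C5 * r <= C5 by rewrite ler_piMr.
  lra.
have [h1 h2 h3] := rsol_compare beta0 K31 rs (ZP N) b1 b2 dd tN.
have C6E : beta * (k%:R * (Kz + 2 * C5) ^+ k * (2 * (C5 * r)) * N) = C6 * r.
  by rewrite /C6 /drift_const -/C5; ring.
rewrite C6E in h2 h3.
have Kz0 : 0 <= Kz by apply: le_trans Kz1.
have C60 : 0 <= C6 by rewrite /C6 /drift_const -/C5 !mulr_ge0// exprn_ge0// (le_trans ler01 K31).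
have M00 : 0 <= M0 by apply: le_trans M01.
have MC : 0 <= M0 * C6 by rewrite mulr_ge0.
have BZ : 0 <= beta * (Kz ^+ k * N) by rewrite !mulr_ge0// exprn_ge0.
have dZ : `|drift beta k Zt t| <= beta * (Kz ^+ k * N).
  have [lZ Zge _ _] := rs.
  rewrite /drift normrM (ger0_norm beta0) ler_wpM2l//.
  have := @int0_lip _ (fun s => Zt s ^+ k) 0 t (Kz ^+ k) (locintX k lZ) (lexx 0) t0.
  rewrite int0_0 !subr0 => h4; apply: (le_trans (h4 _)).
    move=> s /andP[s0 st]; have s0' := ltW s0; have sN : 0 <= s <= N by rewrite s0' (le_trans st)//; case/andP: tN.
    by rewrite normrX (ger0_norm (Zge _ s0')) lerXn2r ?nnegrE ?Zge// ZK.
  by rewrite ler_wpM2l ?exprn_ge0//; case/andP: tN.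
have [S1 S2 S3 S4] := out_const_ge C50 C60 Q0 (le_trans ler01 K1) M00 BZ MC.
have up a : a <= out_const K N M0 Q Kz -> forall z : R, `|z| <= a * r -> `|z| <= out_const K N M0 Q Kz * r.
  by move=> h4 z h5; apply: (le_trans h5); rewrite ler_wpM2r.
move: i; apply: ord4_case; rewrite /outputs /pvec !inordK//=.
- by apply: (up (2 * C5)); rewrite // -mulrA.
- by apply: (up (3 * C5 + C6)); rewrite // mulrDl -mulrA.
- apply: (up (Q + (2 * K + 2 * M0) + C6)) => //.
  have h4 := YP tN; have h5 := x01 tN.
  rewrite (_ : Yt t - _ = (Yt t - (mu^-1 * (x (inord 0) t - x (inord 1) t) - drift beta k Zt t)) +
    (mu^-1 * (x (inord 0) t - x (inord 1) t) - free_path mul y t) - (drift beta k Zt t - drift beta k (solution beta c mul k y).1 t)); last by ring.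
  rewrite (mulrDl (Q + _)) (mulrDl Q); apply: (le_trans (ler_normB _ _)); apply: lerD => //.
  by apply: (le_trans (ler_normD _ _)); exact: lerD.
- apply: (up (Q + 1 + beta * (Kz ^+ k * N) + M0 * C6)) => //.
  have h4 := AP tN; have h5 := xy (inord 0) tN.
  rewrite (_ : At t - _ = (At t - (x (inord 0) t - mu * drift beta k Zt t)) + (x (inord 0) t - y (inord 0) t) -
    (mu - mul) * drift beta k Zt t - mul * (drift beta k Zt t - drift beta k (solution beta c mul k y).1 t)); last by rewrite y0; ring.
  have h6 : `|(mu - mul) * drift beta k Zt t| <= beta * (Kz ^+ k * N) * r.
    by rewrite normrM mulrC; apply: ler_pM.
  have h7 : `|mul * (drift beta k Zt t - drift beta k (solution beta c mul k y).1 t)| <= M0 * C6 * r.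
    by rewrite normrM gtr0_norm// -mulrA; apply: ler_pM => //; exact: ltW.
  rewrite [leRHS](_ : _ = Q * r + r + beta * (Kz ^+ k * N) * r + M0 * C6 * r); last by ring.
  apply: (le_trans (ler_normB _ _)); apply: lerD => //.
  apply: (le_trans (ler_normB _ _)); apply: lerD => //.
  by apply: (le_trans (ler_normD _ _)); exact: lerD.
Qed.

End compare.

Lemma half_window {R : realType} (m x : R) : `|m - x| <= m / 2 -> m / 2 <= x <= m * (3 / 2).
Proof. by rewrite ler_norml => /andP[? ?]; apply/andP; split; lra. Qed.

(** * Estimates along the family of queues *)

Section prelimit.
Context {R : realType}.
Variables (k : nat) (F : R -> R) (beta : R) (Aset : set R).
Hypothesis k0 : (0 < k)%N.
Hypothesis beta0 : 0 <= beta.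
Hypothesis HF : cdf0 F.
Hypothesis Fexp : forall e : R, 0 < e -> exists2 dl : R, 0 < dl & forall x : R, 0 <= x < dl ->
    `|F x - beta * x ^+ k| <= e * x ^+ k.
Hypothesis HA : forall a, Aset a -> 0 < a.
Variables (d : measure_display)
  (Om : R -> measurableType d) (P : forall a, probability (Om a) R)
  (u V D : forall a, nat -> Om a -> R) (z0 : forall a, Om a -> R)
  (lam mu : R -> R) (Z L : forall a, Om a -> R -> R).
Arguments u : clear implicits.
Arguments V : clear implicits.
Arguments D : clear implicits.
Arguments z0 : clear implicits.
Arguments Z : clear implicits.
Arguments L : clear implicits.
Hypothesis Hsys : forall a, Aset a ->
  queue_system (P a) (fun x => F (a * x)) (u a) (V a) (D a) (z0 a) (lam a) (mu a) (Z a) (L a).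
Let h : R := k%:R / (k%:R + 1).
Let Fl := within Aset (nbhs (0 : R)).
Let FF : Filter Fl. Proof. exact: within_filter. Qed.
Local Existing Instance FF.
Variables (mul c : R).
Hypothesis mul0 : 0 < mul.
Hypothesis Hmu : mu a @[a --> Fl] --> mul.
Hypothesis Hc : powR a (- h) * (lam a / mu a - 1) @[a --> Fl] --> c.
Variables (ca cs : R) (d0 : measure_display) (Om0 : measurableType d0) (P0 : probability Om0 R)
  (Ba Bs : R -> Om0 -> R) (Zs0 : Om0 -> R).
Hypothesis HBa : std_BM P0 Ba.
Hypothesis HBs : std_BM P0 Bs.
Hypothesis HZs0 : measurable_fun setT Zs0.
Hypothesis HFCLT : weak_cvg P (fun a w => Xpre u V z0 lam mu h w) Fl P0 (Xlim mul ca cs Ba Bs Zs0).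

Let B (a : R) := magnify k a.
(** Eventually [mu a] is within half of [mul] from [mul] and [lam a <= 2 * mu a], so this bounds
    both rates and the mean service time; the summand 1 makes it at least 1. *)
Let M0 : R := 3 * mul + 2 / mul + 1.
Let near_A (Q : R -> Prop) : (forall a, Aset a -> Q a) -> \forall a \near Fl, Q a.
Proof. exact: near_sys. Qed.
Let near_B (M : R) : \forall a \near Fl, M <= B a. Proof. exact: magnify_large. Qed.

Let M0_ge1 : 1 <= M0.
Proof. by have h1 := mul0; have : 0 < 2 / mul by [rewrite divr_gt0]; rewrite /M0; lra. Qed.

Let M0_ge : [/\ 2 / mul <= M0, mul * (3 / 2) <= M0 & 2 * (mul * (3 / 2)) <= M0].
Proof. by have h1 := mul0; have h2 : 0 < 2 / mul by [rewrite divr_gt0]; rewrite /M0; split; lra. Qed.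

Lemma traffic (e : R) : 0 < e -> \forall a \near Fl, [/\ `|(mu a)^-1 - mul^-1| <= e, `|mu a - mul| <= e,
  `|B a * (lam a / mu a - 1) - c| <= e, `|lam a / mu a - 1| <= e &
  [/\ 0 < mu a, (mu a)^-1 <= M0, mu a <= M0, 0 < lam a & lam a <= M0]].
Proof.
move=> e0; have m2 : 0 < mul / 2 by rewrite divr_gt0.
have e1 : 0 < minr e 1 by rewrite lt_min e0 ltr01.
have h1 : \forall a \near Fl, `|mul - mu a| <= e by move/cvgrPdist_le : Hmu; apply.
have h2 : \forall a \near Fl, `|mul - mu a| <= mul / 2 by move/cvgrPdist_le : Hmu; apply.
have h3 : \forall a \near Fl, `|mul^-1 - (mu a)^-1| <= e.
  have mn : mul != 0 by rewrite gt_eqF.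
  have hV : (fun a => (mu a)^-1) @ Fl --> mul^-1 by exact: (cvgV mn Hmu).
  by move/cvgrPdist_le : hV; apply.
have h4 : \forall a \near Fl, `|c - B a * (lam a / mu a - 1)| <= e by move/cvgrPdist_le : Hc; apply.
have h4' : \forall a \near Fl, `|c - B a * (lam a / mu a - 1)| <= 1 by move/cvgrPdist_le : Hc; apply.
have h5 := near_B (((`|c| + 1) / minr e 1) + 1).
have h6 : \forall a \near Fl, 0 < mu a /\ 0 < lam a.
  by apply: near_A => a Aa; have [_ [_ [_ [_ [_ [_ [_ [_ [_ [_ [_ [l0 [m0 _]]]]]]]]]]]]] := Hsys Aa.
near=> a.
have g1 : `|mul - mu a| <= e by near: a.
have g2 : `|mul - mu a| <= mul / 2 by near: a.
have g3 : `|mul^-1 - (mu a)^-1| <= e by near: a.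
have g4 : `|c - B a * (lam a / mu a - 1)| <= e by near: a.
have g4' : `|c - B a * (lam a / mu a - 1)| <= 1 by near: a.
have g5 : ((`|c| + 1) / minr e 1) + 1 <= B a by near: a.
have [m0 l0] : 0 < mu a /\ 0 < lam a by near: a.
have cp : 0 <= (`|c| + 1) / minr e 1 by rewrite divr_ge0// ltW.
have Bp : 0 < B a by apply: lt_le_trans g5; rewrite ltr_wpDl.
have rho : `|lam a / mu a - 1| <= minr e 1.
  have h7 : `|B a * (lam a / mu a - 1)| <= `|c| + 1.
    rewrite -(subKr c (B a * _)); apply: (le_trans (ler_normB _ _)); by rewrite lerD2l.
  rewrite normrM gtr0_norm// in h7.
  have h8 : `|c| + 1 <= B a * minr e 1.
    by rewrite -ler_pdivrMr//; apply: le_trans g5; rewrite lerDl.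
  by rewrite -(ler_pM2l Bp); exact: le_trans h8.
have mul0' := mul0.
have mm : mul / 2 <= mu a <= mul * (3 / 2) by exact: half_window.
have /andP[mm1 mm2] := mm.
have im : 0 < 2 / mul by rewrite divr_gt0.
split; [by rewrite distrC|by rewrite distrC|by rewrite distrC| |].
  by apply: (le_trans rho); rewrite ge_min lexx.
have [M1 M2 M3] := M0_ge.
split => //.
- apply: le_trans M1; rewrite -[leRHS]invrK lef_pV2 ?posrE ?invr_gt0//.
  by rewrite invf_div.
- exact: le_trans mm2 M2.
- have rho1 : lam a / mu a <= 2.
    have e11 : minr e 1 <= 1 by rewrite ge_min lexx orbT.
    have := le_trans (ler_norm _) (le_trans rho e11); rewrite lerBlDr; exact: le_trans.
  rewrite ler_pdivrMr// in rho1; apply: (le_trans rho1); apply: le_trans M3.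
  by rewrite ler_pM2l.
Unshelve. all: by end_near. Qed.

Let null_event a : Aset a -> exists Nl : set (Om a),
  [/\ measurable Nl, fine (P a Nl) = 0 & forall w, ~ Nl w -> regular u V D z0 Z L w].
Proof.
move=> /(regular_ae Hsys)[Nl [mN N0 HN]]; exists Nl; split => //; first by rewrite N0.
by move=> w nw; apply: contrapT => h1; apply: nw; exact: HN.
Qed.

(** [service_laplace] inspects scaled times in [[0, 1]] only, hence the good event with [N = 0]; its
    exceptional probability [exp(-M0) * eta] is the one required there. *)
Lemma prelimit_laplace (zeta : R) : 0 < zeta -> \forall a \near Fl,
  (truncn (B a)).+1%:R * \int[P a]_w phi (maxr (V a 0%N w) 0 / (truncn (B a)).+1%:R) <= zeta.
Proof.
move=> zt0; pose eta := zeta / 3; have eta0 : 0 < eta by rewrite divr_gt0.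
have M01 := M0_ge1; have M00 : 0 < M0 by lra.
pose r := minr 1 (eta / (3 * M0)).
have er0 : 0 < eta / (3 * M0) by rewrite divr_gt0// mulr_gt0.
have r0 : 0 < r by rewrite lt_min ltr01.
have r1 : r <= 1 by rewrite ge_min lexx.
have r2 : r <= eta / (3 * M0) by rewrite ge_min lexx orbT.
have pe : 0 < expR (- M0) * eta by rewrite mulr_gt0// expR_gt0.
have [j Hj] := good_event mul0 HBa HBs HZs0 HFCLT (lexx 0) r0 r1 pe.
have h1 := near_B 1; have h2 := near_B (2 * M0); have h3 := near_B (2 * M0 ^+ 2 / eta).
have h4 := near_B (2 * j%:R * M0 / (eta / (3 * M0))).
have h5 := traffic ltr01; have h6 : \forall a \near Fl, Aset a by exact: near_A.
near=> a.
have Aa : Aset a by near: a.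
have a0 := HA Aa.
have g1 : 1 <= B a by near: a.
have g2 : 2 * M0 <= B a by near: a.
have g3 : 2 * M0 ^+ 2 / eta <= B a by near: a.
have g4 : 2 * j%:R * M0 / (eta / (3 * M0)) <= B a by near: a.
have [_ _ _ _ [m0 iM mM _ _]] : [/\ `|(mu a)^-1 - mul^-1| <= 1, `|mu a - mul| <= 1,
  `|B a * (lam a / mu a - 1) - c| <= 1, `|lam a / mu a - 1| <= 1 &
  [/\ 0 < mu a, (mu a)^-1 <= M0, mu a <= M0, 0 < lam a & lam a <= M0]] by near: a.
have [E [mE PE HE]] : exists E : set (Om a),
    [/\ measurable E, fine (P a E) <= expR (- M0) * eta & forall w, ~ E w ->
      exists2 y, lip_class j y & forall i (t : R), 0 <= t <= 0 + 1 -> `|Xpre u V z0 lam mu h w i t - y i t| <= r].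
  by near: a.
have [Nl [mN N0 HN]] := null_event Aa.
have [mu' [mV [mD [mz [lu [lV [lD [ind [u0 [V0 [cD [lam0 [_ [Eu [EV dyn]]]]]]]]]]]]]]] := Hsys Aa.
have Bp : 0 < B a := magnify_gt0 _ a0.
have /andP[Bb bB] := truncS_bounds g1.
have -> : zeta = 3 * eta by rewrite /eta mulrC divfK.
apply: (@service_laplace _ _ _ _ (V a) (mu a) mV lV (prim_prod ind PV_inj) m0 V0 EV (B a) M0 eta j%:R r _ (E `|` Nl)) => //.
- exact: measurableU.
- apply: (le_trans (prob_setU (P a) mE mN)); by rewrite N0 addr0.
- by rewrite [leRHS]mulrC -ler_pdivrMr.
- have h7 : 2 * j%:R * M0 / B a <= eta / (3 * M0).
    by rewrite ler_pdivrMr// [leRHS]mulrC -ler_pdivrMr.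
  have -> : eta / M0 = 3 * (eta / (3 * M0)) by field; rewrite gt_eqF.
  lra.
- move=> w nw; have nE : ~ E w by move=> h8; apply: nw; left.
  have nN : ~ Nl w by move=> h8; apply: nw; right.
  have [r1' r2' r3' r4' r5'] := HN w nN; split => // t t01.
  have [y yj Hy] := HE w nE.
  have [ly y00 y10 _] := yj.
  have /andP[t0 _] := t01.
  have := Hy (inord 1) t; rewrite add0r => /(_ t01).
  rewrite /Xpre /pvec inordK//= (diffscale_scl _ _ _ a0) -/(B a) => h8.
  have := ly (inord 1) t 0 t0 (lexx 0); rewrite y10 !subr0 (ger0_norm t0) => h9.
  rewrite -(subrK (y (inord 1) t) (scl _ _ _ _)); apply: (le_trans (ler_normD _ _)).
  by rewrite addrC; exact: lerD.
Unshelve. all: by end_near. Qed.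

Lemma prelimit_martingale (K Q r eta : R) : 0 < K -> 0 <= Q -> 0 < r -> r <= 1 -> 0 < eta ->
  \forall a \near Fl, exists Bd : set (Om a), [/\ measurable Bd, fine (P a Bd) <= eta &
    forall w, ~ Bd w -> (forall i, 0 <= V a i w) -> forall n, n%:R <= B a ^+ 2 * Q ->
      let wo i := minr (Wrec (u a ^~ w) (V a ^~ w) (D a ^~ w) (z0 a w) i) (B a * K) in
      let ind i : R := (nat_of_bool (D a i w <= wo i))%:R in
      `|\sum_(i < n) (ind i - F (a * wo i))| <= B a * r /\
      `|\sum_(i < n) (V a i w * ind i - (mu a)^-1 * F (a * wo i))| <= B a * r].
Proof.
move=> K0 Q0 r0 r1 eta0; have M01 := M0_ge1; have M00 : 0 < M0 by lra.
pose Cp := beta * K ^+ k + 1.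
have Cp0 : 0 < Cp by rewrite ltr_wpDl// mulr_ge0// exprn_ge0// ltW.
(* [J] is fixed by [K], [Q] and the tolerance, then [zeta] by [J] and [eta]; only afterwards is [a]
   taken small. *)
pose J := (truncn (Q * (6 * Cp * M0 / r))).+1.
have J0 : 0 < J%:R :> R by [].
have HJ : Q * (6 * Cp * M0 / r) <= J%:R by apply/ltW/truncnS_gt.
pose c1 : R := 9 * J.+1%:R * J%:R / r ^+ 2.
pose c2 : R := 72 * J.+1%:R * J%:R / r ^+ 2 + 4 * J%:R.
have r20 : 0 <= r ^+ 2 by rewrite exprn_ge0// ltW.
have c10 : 0 <= c1 by rewrite divr_ge0.
have c20 : 0 < c2 by rewrite ltr_wpDl ?mulr_gt0// divr_ge0.
pose zeta := minr (J%:R^-1) (eta / 2 / c2).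
have eta2 : 0 < eta / 2 by rewrite divr_gt0.
have zeta0 : 0 < zeta by rewrite lt_min invr_gt0 J0/= divr_gt0.
have zJ : zeta * J%:R <= 1 by rewrite -ler_pdivlMr// div1r ge_min lexx.
have zc : c2 * zeta <= eta / 2 by rewrite mulrC -ler_pdivlMr// ge_min lexx orbT.
have [Fnd [Fr [F0 _]]] := HF.
have h1 := near_B 1; have h2 := near_B (c1 / (eta / 2)); have h3 := near_B (6 * Cp * M0 / r).
have h4 := scaled_patience k0 HA Fexp K0 ltr01; have h5 := traffic ltr01.
have h6 := prelimit_laplace zeta0; have h7 : \forall a \near Fl, Aset a by exact: near_A.
near=> a.
have Aa : Aset a by near: a.
have a0 := HA Aa.
have g1 : 1 <= B a by near: a.
have g2 : c1 / (eta / 2) <= B a by near: a.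
have g3 : 6 * Cp * M0 / r <= B a by near: a.
have g4 : forall z : R, 0 <= z <= K -> `|B a * F (a * (B a * z)) - beta * z ^+ k| <= 1 by near: a.
have [_ _ _ _ [m0 iM mM _ _]] : [/\ `|(mu a)^-1 - mul^-1| <= 1, `|mu a - mul| <= 1,
  `|B a * (lam a / mu a - 1) - c| <= 1, `|lam a / mu a - 1| <= 1 &
  [/\ 0 < mu a, (mu a)^-1 <= M0, mu a <= M0, 0 < lam a & lam a <= M0]] by near: a.
have g6 : (truncn (B a)).+1%:R * \int[P a]_w phi (maxr (V a 0%N w) 0 / (truncn (B a)).+1%:R) <= zeta by near: a.
have Bp : 0 < B a := magnify_gt0 _ a0.
have Fa_nd (x y : R) : x <= y -> F (a * x) <= F (a * y) by move=> xy; apply: Fnd; rewrite ler_pM2l.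
have Fa_r (x : R) : F (a * s) @[s --> at_right x] --> F (a * x).
  apply/cvgrPdist_le => e e0; have /cvgrPdist_le/(_ e e0) := Fr (a * x).
  rewrite !near_withinE => /nbhs_ballP[dl /= dl0 H]; apply/nbhs_ballP; exists (dl / a); first by rewrite /= divr_gt0.
  move=> s; rewrite /ball /= ltr_pdivlMr// => xs sx; apply: H; last by rewrite ltr_pM2l.
  by rewrite /ball /= -mulrBr normrM gtr0_norm// mulrC.
have BF : B a * F (a * (B a * K)) <= Cp.
  have := g4 K; rewrite (ltW K0) lexx => /(_ isT); rewrite ler_norml => /andP[_].
  by rewrite lerBlDr addrC.
have BK : 0 <= B a * K by rewrite mulr_ge0 ?ltW.
have /andP[Bb bB] := truncS_bounds g1.
have B2 : 6 * Cp * M0 / r <= B a ^+ 2.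
  by apply: (le_trans g3); rewrite expr2 ler_peMl// ltW.
have [Bd [mBd PBd HBd]] := acceptance_small (Hsys Aa) Fa_nd Fa_r g1 BK Q0 M01 iM Cp0 BF r0 r1 HJ (ltW zeta0) zJ Bb bB g6 B2.
exists Bd; split => //; apply: (le_trans PBd); rewrite -/c1 -/c2.
have h8 : c1 / B a <= eta / 2 by rewrite ler_pdivrMr// [leRHS]mulrC -ler_pdivrMr.
by apply: (le_trans (lerD h8 zc)); rewrite -splitr.
Unshelve. all: by end_near. Qed.


Definition queue_outputs a (w : Om a) : 'I_4 -> R -> R := pvec 4 [:: diffscale a h (Z a w) 0; diffscale a h (L a w) 0;
  diffscale a h (Ywork (fun i => u a i w) (fun i => V a i w) (fun i => D a i w) (Z a w)) (lam a / mu a);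
  diffscale a h (A0count (fun i => u a i w) (fun i => D a i w) (Z a w)) (lam a)].

Let scl_cadlag (b q : R) (f : R -> R) : 0 < b -> cadlag f -> cadlag (scl b f q).
Proof.
move=> b0 cf; rewrite (_ : scl b f q = fun t => (b^-1 * f (b ^+ 2 * t)) + - (b^-1 * (b ^+ 2 * q)) * t); last first.
  by apply/funext => t; rewrite /scl; ring.
apply: cadlagD; first by apply: cadlag_scale => //; rewrite exprn_gt0.
by apply: cont0_cadlag; apply: cont0Z; exact: cont0_id.
Qed.

Lemma queue_outputs_cadlag a (w : Om a) : 0 < a -> regular u V D z0 Z L w -> forall i, cadlag (queue_outputs w i).
Proof.
move=> a0 [r1 r2 r3 r4 r5]; have Bp : 0 < B a := magnify_gt0 _ a0.
apply: ord4_case; rewrite /queue_outputs /pvec inordK//= (diffscale_scl _ _ _ a0); apply: scl_cadlag => //.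
- exact: (Z_cadlag r1 r3 r5).
- exact: (L_cadlag r5).
- exact: (Y_cadlag _ _ _ r1 r3).
- exact: (A0_cadlag _ _ r1 r3).
Qed.

(** The constant [C] must not depend on [r]. It is built from the bound [K] provided by a first good
    event at tolerance 1; a second good event, at tolerance [r / 4], provides the modulus, and its
    class [j] may depend on [r]. *)
Lemma prelimit_outputs (N eta : R) : 0 <= N -> 0 < eta -> exists2 C : R, 0 <= C & forall r : R, 0 < r -> r <= 1 ->
  exists j : nat, \forall a \near Fl, exists Bd : set (Om a), [/\ measurable Bd, fine (P a Bd) <= eta &
    forall w, ~ Bd w -> (forall i, cadlag (queue_outputs w i)) /\
    exists2 y, lip_class j y & (forall i (t : R), 0 <= t <= N + 1 -> `|Xpre u V z0 lam mu h w i t - y i t| <= r) /\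
      forall i (t : R), 0 <= t <= N -> `|queue_outputs w i t - outputs beta c mul k y i t| <= C * r].
Proof.
move=> N0 eta0; have M01 := M0_ge1; have M00 : 0 <= M0 := le_trans ler01 M01.
have eta4 : 0 < eta / 4 by rewrite divr_gt0.
have [j1 Hj1] := good_event mul0 HBa HBs HZs0 HFCLT N0 ltr01 (lexx 1) eta4.
pose K : R := j1%:R * (1 + (N + 1)) + 2.
have jN : 0 <= j1%:R * (1 + (N + 1)) by rewrite mulr_ge0// !addr_ge0.
have K1 : 1 <= K by rewrite /K; lra.
pose Cc : R := `|c| + 1; have Cc0 : 0 <= Cc by rewrite addr_ge0.
pose Kz := K2 K N M0 Cc; pose Q := nQ K N M0; pose C4v := C4 K N M0 Cc beta k.
have K0 : 0 <= K := le_trans ler01 K1.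
have MK : 0 <= K * M0 by rewrite mulr_ge0.
have CN : 0 <= Cc * N by rewrite mulr_ge0.
have Kz1 : 1 <= Kz by rewrite /Kz /K2; move: K1 MK CN M00; rewrite -mulrA; lra.
have Kz0 : 0 < Kz by apply: lt_le_trans Kz1.
have Q0 : 0 <= Q by rewrite /Q /nQ addr_ge0// mulr_ge0.
have C40 : 0 <= C4v by exact: C4_ge0.
have C0 : 0 <= out_const k beta K N M0 C4v Kz by apply: out_const_ge0 => //; exact: ltW.
exists (out_const k beta K N M0 C4v Kz) => // r r0 r1.
have r4 : 0 < r / 4 by rewrite divr_gt0.
have r41 : r / 4 <= 1 by rewrite ler_pdivrMr// mul1r; apply: (le_trans r1); rewrite ler1n.
have [j Hj] := good_event mul0 HBa HBs HZs0 HFCLT N0 r4 r41 eta4.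
exists j.
(* A path of class [j] moves by at most [r / 2] over [kappa]; two approximation errors [r / 4]
   complete the oscillation bound [r]. *)
pose kappa := minr r (r / (2 * (j%:R + 1))).
have j1p : 0 < 2 * (j%:R + 1) :> R by rewrite mulr_gt0// ltr_wpDl.
have kap0 : 0 < kappa by rewrite lt_min r0 divr_gt0.
have kapr : kappa <= r by rewrite ge_min lexx.
have kapj : j%:R * kappa <= r / 2.
  apply: (@le_trans _ _ (j%:R * (r / (2 * (j%:R + 1))))); first by rewrite ler_wpM2l// ge_min lexx orbT.
  rewrite mulrA ler_pdivrMr// (_ : r / 2 * (2 * (j%:R + 1)) = (j%:R + 1) * r); last by field.
  by rewrite ler_wpM2r ?(ltW r0)// lerDl.
have kN0 : 0 < minr r (kappa / (2 * (N + 1))).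
  by rewrite lt_min r0 divr_gt0// mulr_gt0// ltr_wpDl.
have h1 := near_B 1; have h2 := near_B (2 * K * M0 / (kappa / 2)); have h3 := near_B (N / kappa + 1).
have h4 := scaled_patience k0 HA Fexp Kz0 r0; have h5 := traffic kN0; have h5' := traffic ltr01.
have h6 := prelimit_martingale Kz0 Q0 r0 r1 eta4; have h7 : \forall a \near Fl, Aset a by exact: near_A.
near=> a.
have Aa : Aset a by near: a.
have a0 := HA Aa; have Bp : 0 < B a := magnify_gt0 _ a0.
have g1 : 1 <= B a by near: a.
have g2 : 2 * K * M0 / (kappa / 2) <= B a by near: a.
have g3 : N / kappa + 1 <= B a by near: a.
have g4 : forall z : R, 0 <= z <= Kz -> `|B a * F (a * (B a * z)) - beta * z ^+ k| <= r by near: a.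
have [t1 t2 t3 t4 [m0 iM mM l0 lM]] : [/\ `|(mu a)^-1 - mul^-1| <= minr r (kappa / (2 * (N + 1))), `|mu a - mul| <= minr r (kappa / (2 * (N + 1))),
  `|B a * (lam a / mu a - 1) - c| <= minr r (kappa / (2 * (N + 1))), `|lam a / mu a - 1| <= minr r (kappa / (2 * (N + 1))) &
  [/\ 0 < mu a, (mu a)^-1 <= M0, mu a <= M0, 0 < lam a & lam a <= M0]] by near: a.
have [_ _ t3' _ _] : [/\ `|(mu a)^-1 - mul^-1| <= 1, `|mu a - mul| <= 1,
  `|B a * (lam a / mu a - 1) - c| <= 1, `|lam a / mu a - 1| <= 1 &
  [/\ 0 < mu a, (mu a)^-1 <= M0, mu a <= M0, 0 < lam a & lam a <= M0]] by near: a.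
have [E1 [mE1 PE1 HE1]] : exists E : set (Om a),
    [/\ measurable E, fine (P a E) <= eta / 4 & forall w, ~ E w ->
      exists2 y, lip_class j1 y & forall i (t : R), 0 <= t <= N + 1 -> `|Xpre u V z0 lam mu h w i t - y i t| <= 1].
  by near: a.
have [E2 [mE2 PE2 HE2]] : exists E : set (Om a),
    [/\ measurable E, fine (P a E) <= eta / 4 & forall w, ~ E w ->
      exists2 y, lip_class j y & forall i (t : R), 0 <= t <= N + 1 -> `|Xpre u V z0 lam mu h w i t - y i t| <= r / 4].
  by near: a.
have [E3 [mE3 PE3 HE3]] : exists Bd : set (Om a), [/\ measurable Bd, fine (P a Bd) <= eta / 4 &
    forall w, ~ Bd w -> (forall i, 0 <= V a i w) -> forall n, n%:R <= B a ^+ 2 * Q ->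
      let wo i := minr (Wrec (u a ^~ w) (V a ^~ w) (D a ^~ w) (z0 a w) i) (B a * Kz) in
      let ind i : R := (nat_of_bool (D a i w <= wo i))%:R in
      `|\sum_(i < n) (ind i - F (a * wo i))| <= B a * r /\
      `|\sum_(i < n) (V a i w * ind i - (mu a)^-1 * F (a * wo i))| <= B a * r].
  by near: a.
have [Nl [mN PN HN]] := null_event Aa.
exists (((E1 `|` E2) `|` E3) `|` Nl); split.
- by do 3! (apply: measurableU => //).
- have mU : measurable (E1 `|` E2) by exact: measurableU.
  have mU3 : measurable ((E1 `|` E2) `|` E3) by exact: measurableU.
  apply: (le_trans (prob_setU (P a) mU3 mN)); rewrite PN addr0.
  apply: (le_trans (prob_setU (P a) mU mE3)).
  apply: (le_trans (lerD (le_trans (prob_setU (P a) mE1 mE2) (lerD PE1 PE2)) PE3)).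
  rewrite (_ : eta / 4 + eta / 4 + eta / 4 = eta * (3 / 4)); last by field.
  by rewrite ler_piMr ?(ltW eta0)// ler_pdivrMr// mul1r ler_nat.
move=> w nw.
have n1 : ~ E1 w by move=> hw; apply: nw; left; left; left.
have n2 : ~ E2 w by move=> hw; apply: nw; left; left; right.
have n3 : ~ E3 w by move=> hw; apply: nw; left; right.
have nN : ~ Nl w by move=> hw; apply: nw; right.
have reg := HN w nN; have [r1' r2' r3' r4' r5'] := reg.
split; first exact: queue_outputs_cadlag.
have [yK yKj HyK] := HE1 w n1; have [y yj Hy] := HE2 w n2.
have {}HE3 := HE3 w n3 r2'.
set x := Xpre u V z0 lam mu h w in HyK Hy *.
have r4r : r / 4 <= r by rewrite ler_piMr ?(ltW r0)// invf_le1// ler1n.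
exists y => //; split; first by move=> i t tN; apply: (le_trans (Hy i t tN)).
have x0E : x (inord 0) = scl (B a) (Acount (u a ^~ w)) (lam a).
  by rewrite /x /Xpre /pvec inordK//= (diffscale_scl _ _ _ a0).
have x1E : x (inord 1) = scl (B a) (Scount (V a ^~ w)) (mu a).
  by rewrite /x /Xpre /pvec inordK//= (diffscale_scl _ _ _ a0).
have x2E t : x (inord 2) t = (B a)^-1 * z0 a w.
  by rewrite /x /Xpre /pvec inordK//= (magnify_inv k).
have xK i t : 0 <= t <= N + 1 -> `|x i t| <= K.
  move=> tN; have /andP[t0 tN'] := tN; have hy := lip_class_bound i yKj t0; have hx := HyK i t tN.
  have hm : j1%:R * (1 + t) <= j1%:R * (1 + (N + 1)) by rewrite ler_wpM2l// lerD2l.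
  rewrite -(subrK (yK i t) (x i t)); apply: (le_trans (ler_normD _ _)).
  by apply: (le_trans (lerD hx (le_trans hy hm))); rewrite /K addrC lerD2l ler1n.
have [ly y00 y10 y20] := yj.
have osc i s t : 0 <= s <= N + 1 -> 0 <= t <= N + 1 -> `|s - t| <= kappa -> `|x i s - x i t| <= r.
  move=> sN tN st; have /andP[s0 _] := sN; have /andP[t0 _] := tN.
  have hs := Hy i s sN; have ht := Hy i t tN.
  have hl : `|y i s - y i t| <= r / 2.
    by apply: (le_trans (ly i s t s0 t0)); apply: le_trans kapj; rewrite ler_wpM2l.
  rewrite (_ : x i s - x i t = (x i s - y i s) + (y i s - y i t) - (x i t - y i t)); last by ring.
  apply: (le_trans (ler_normB _ _)).
  apply: (le_trans (lerD (le_trans (ler_normD _ _) (lerD hs hl)) ht)).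
  by rewrite le_eqVlt; apply/orP; left; apply/eqP; field.
have N1 : 0 <= N + 1 by rewrite addr_ge0.
have x10 : `|x (inord 1) 0| <= r.
  have := Hy (inord 1) 0; rewrite lexx N1 => /(_ isT); rewrite y10 subr0 => hh; exact: le_trans r4r.
have zK : (B a)^-1 * z0 a w <= K.
  by rewrite -(x2E 0); apply: (le_trans (ler_norm _)); apply: xK; rewrite lexx.
have num1 : [/\ 1 <= B a, 0 < r <= 1, 0 < kappa <= r, 0 <= N & 1 <= K] by rewrite r0 kap0.
have num2 : [/\ 0 < mu a, (mu a)^-1 <= M0, mu a <= M0, 0 < lam a & lam a <= M0] by [].
have num3 : `|lam a / mu a - 1| * (N + 1) <= kappa / 2.
  have N1p : 0 < N + 1 by rewrite ltr_wpDl.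
  rewrite -ler_pdivlMr//; apply: (le_trans t4); rewrite (_ : kappa / 2 / (N + 1) = kappa / (2 * (N + 1))) ?ge_min ?lexx ?orbT//.
  by rewrite invfM mulrA.
have num4 : 2 * K * M0 <= B a * (kappa / 2) by rewrite -ler_pdivrMr// divr_gt0.
have num5 : `|B a * (lam a / mu a - 1)| <= Cc.
  rewrite -(subrK c (B a * _)) /Cc addrC; apply: (le_trans (ler_normD _ _)); exact: lerD.
have mle (q : R) : q <= minr r (kappa / (2 * (N + 1))) -> q <= r by move=> hq; apply: (le_trans hq); rewrite ge_min lexx.
have [mulM imul] : mul <= M0 /\ mul^-1 <= M0.
  have [q1 q2 _] := M0_ge; split.
    by apply: le_trans q2; rewrite ler_peMr ?(ltW mul0)// ler_pdivlMr// mul1r ler_nat.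
  by apply: le_trans q1; rewrite ler_peMl ?invr_ge0 ?(ltW mul0)// ler1n.
have osc0 (s t : R) : 0 <= s <= N + 1 -> 0 <= t <= N + 1 -> `|s - t| <= kappa ->
   `|scl (B a) (Acount (u a ^~ w)) (lam a) s - scl (B a) (Acount (u a ^~ w)) (lam a) t| <= r.
  by rewrite -x0E; exact: osc.
have osc1 (s t : R) : 0 <= s <= N + 1 -> 0 <= t <= N + 1 -> `|s - t| <= kappa ->
   `|scl (B a) (Scount (V a ^~ w)) (mu a) s - scl (B a) (Scount (V a ^~ w)) (mu a) t| <= r.
  by rewrite -x1E; exact: osc.
have bd0 (t : R) : 0 <= t <= N + 1 -> `|scl (B a) (Acount (u a ^~ w)) (lam a) t| <= K by rewrite -x0E; exact: xK.
have bd1 (t : R) : 0 <= t <= N + 1 -> `|scl (B a) (Scount (V a ^~ w)) (mu a) t| <= K by rewrite -x1E; exact: xK.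
have x10' : `|scl (B a) (Scount (V a ^~ w)) (mu a) 0| <= r by rewrite -x1E.
pose Fa (x : R) := F (a * x).
have mart0 n : n%:R <= B a ^+ 2 * nQ K N M0 -> `|\sum_(i < n) ((nat_of_bool (D a i w <= minr (Wrec (u a ^~ w) (V a ^~ w) (D a ^~ w) (z0 a w) i) (B a * K2 K N M0 Cc)))%:R -
   Fa (minr (Wrec (u a ^~ w) (V a ^~ w) (D a ^~ w) (z0 a w) i) (B a * K2 K N M0 Cc)))| <= B a * r.
  by move=> hn; have [] := HE3 n hn.
have mart1 n : n%:R <= B a ^+ 2 * nQ K N M0 -> `|\sum_(i < n) (V a i w * (nat_of_bool (D a i w <= minr (Wrec (u a ^~ w) (V a ^~ w) (D a ^~ w) (z0 a w) i) (B a * K2 K N M0 Cc)))%:R -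
   (mu a)^-1 * Fa (minr (Wrec (u a ^~ w) (V a ^~ w) (D a ^~ w) (z0 a w) i) (B a * K2 K N M0 Cc)))| <= B a * r.
  by move=> hn; have [] := HE3 n hn.
have [yd rsd ydP] := scaled_rsol r1' r2' r3' r4' r5' num1 num2 num3 num4 num5 g3 osc0 osc1 bd0 bd1 x10' zK beta0 mart1 g4.
have ZK := @scaled_Z_bound _ _ _ _ _ _ _ r1' r2' r3' r4' r5' _ _ _ _ _ _ _ _ _ num1 num2 num3 num4 num5 osc1 bd0 bd1 x10' zK.
have YP := @scaled_Y _ _ _ _ _ _ _ r1' r2' r3' r4' r5' _ _ _ _ _ _ _ _ _ _ _ _ num1 num2 num3 num4 num5 g3 osc0 osc1 bd0 bd1 x10' zK beta0 mart1 g4.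
have AP := @scaled_A0 _ _ _ _ _ _ _ r1' r2' r3' r4' r5' _ _ _ _ _ _ _ _ _ _ _ _ num1 num2 num3 num4 num5 g3 osc0 osc1 bd0 bd1 x10' zK beta0 mart0 mart1 g4.
have NN t : 0 <= t <= N -> 0 <= t <= N + 1 by move=> /andP[t0 tN]; rewrite t0 (le_trans tN)// lerDl.
have qE : queue_outputs w = pvec 4 [:: (fun t => (B a)^-1 * Z a w (B a ^+ 2 * t)); (fun t => (B a)^-1 * L a w (B a ^+ 2 * t));
   scl (B a) (Ywork (u a ^~ w) (V a ^~ w) (D a ^~ w) (Z a w)) (lam a / mu a);
   scl (B a) (A0count (u a ^~ w) (D a ^~ w) (Z a w)) (lam a)].
  have s0 (f : R -> R) : diffscale a h f 0 = fun t => (B a)^-1 * f (B a ^+ 2 * t).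
    by rewrite (diffscale_scl _ _ _ a0); apply/funext => t; rewrite /scl mulr0 mul0r subr0.
  by rewrite /queue_outputs !s0 !(diffscale_scl _ _ _ a0).
move=> i t tN; rewrite qE.
apply: (@compare_outputs _ k beta c mul beta0 mul0 K N M0 C4v Kz r K1 N0 M01 C40 Kz1 _ (mu a) (B a * (lam a / mu a - 1)) x y _ _ _ _ yd) => //.
- by rewrite r0.
- exact: mle.
- exact: mle.
- exact: mle.
- by move=> i' t' tN'; apply: (le_trans (Hy i' t' (NN _ tN'))).
- by move=> i' t' tN'; apply: xK; exact: NN.
- exact: lip_class_cont yj.
- by rewrite x2E mulr_ge0 ?invr_ge0 ?(ltW Bp)//; exact: (z0_ge0 r1' r3' r5').
- by move=> t' tN'; rewrite x2E x0E x1E; exact: ydP.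
- by move=> t' tN'; rewrite x0E x1E; exact: YP.
- by move=> t' tN'; rewrite x0E; exact: AP.
Unshelve. all: by end_near. Qed.

End prelimit.

(** * The limit theorem *)

Section transfer.
Context {R : realType}.
Variables (k : nat) (beta c mul : R).
Hypothesis beta0 : 0 <= beta.
Hypothesis mul0 : 0 < mul.
Variables (f : ('I_4 -> R -> R) -> R) (M : R).
Hypothesis fM : forall y, `|f y| <= M.
Hypothesis fJ : J1_continuous f.
Let Phi := outputs beta c mul k.
Let M0 : 0 <= M. Proof. exact: le_trans (normr_ge0 _) (fM (fun _ _ => 0)). Qed.

(* The value f y' + N r' makes the envelope a lower bound for f at every
   output path near Phi of a Lipschitz path near the input. *)
Definition image_graph (N : R) (j : nat) : set (('I_3 -> R -> R) * R) :=
  [set p | lip_class j p.1 /\ exists y' r', [/\ forall i, cadlag (y' i), 0 <= r',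
    forall i (t : R), 0 <= t <= N -> `|y' i t - Phi p.1 i t| <= r' & p.2 = f y' + N * r']].

(** The cap [M] makes the functional bounded and keeps it a lower bound in the limit sense, since
    [f <= M]. *)
Definition lower_functional (n j : nat) (x : 'I_3 -> R -> R) : R :=
  minr M (envelope (image_graph n.+1%:R j) n.+1%:R x).

Let ig_lip n j y v : image_graph n.+1%:R j (y, v) -> lip_path j%:R y.
Proof. by move=> [[] ]. Qed.
Let ig_ge n j y v : image_graph n.+1%:R j (y, v) -> - M <= v.
Proof.
move=> [_ [y' [r' [_ r0 _ /= ->]]]]; have := fM y'; rewrite ler_norml => /andP[h _].
by apply: (le_trans h); rewrite lerDl mulr_ge0.
Qed.
Let ig0 n j : image_graph n.+1%:R j ((fun _ _ => 0), f (Phi (fun _ _ => 0)) + n.+1%:R * 0).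
Proof.
split; first exact: lip_class0.
exists (Phi (fun _ _ => 0)), 0; split => //.
  move=> i; apply: cont0_cadlag; apply: outputs_cont => // i'; exact: cont0_cst.
by move=> i t _; rewrite subrr normr0.
Qed.
Let n0 (n : nat) : 0 <= n.+1%:R :> R. Proof. by []. Qed.

Lemma lower_functional_bound n j x : `|lower_functional n j x| <= M.
Proof.
have /andP[h _] := envelope_bounds (n0 n) (@ig_ge n j) (ig0 n j) x.
rewrite /lower_functional ler_norml ge_min lexx andbT le_min h andbT.
by rewrite lerNl (le_trans _ M0)// oppr_le0.
Qed.

Lemma lower_functional_J1 n j : J1_continuous (lower_functional n j).
Proof.
move=> xs x cxs cx xsx; have jn : (0 : R) <= j%:R by [].
have := envelope_J1 (n0 n) jn (@ig_lip n j) (@ig_ge n j) (ig0 n j) cxs cx xsx => h.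
exact: (cvg_comp_cont (@minr_cont _ M) h).
Qed.

Lemma lower_functional_le n j x y y' (r C : R) : lip_class j y -> (forall i, cadlag (y' i)) -> 0 <= r -> 0 <= C ->
  (forall i (t : R), 0 <= t <= n.+1%:R + 1 -> `|x i t - y i t| <= r) ->
  (forall i (t : R), 0 <= t <= n.+1%:R -> `|y' i t - Phi y i t| <= C * r) ->
  lower_functional n j x <= f y' + n.+1%:R * (C + 1) * r.
Proof.
move=> yj cy' r0 C0 xy yy'; apply: (@le_trans _ _ (envelope (image_graph n.+1%:R j) n.+1%:R x)).
  by rewrite /lower_functional ge_min lexx orbT.
have h : image_graph n.+1%:R j (y, f y' + n.+1%:R * (C * r)).
  by split => //; exists y', (C * r); split => //; rewrite mulr_ge0.
have cl : close_upto n.+1%:R r x y.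
  move=> i t t0 tn; apply: xy; rewrite t0 (le_trans tn)// -subr_ge0.
  by rewrite (_ : n.+1%:R + 1 - (n.+1%:R - r) = 1 + r); [rewrite addr_ge0|ring].
apply: (le_trans (envelope_le (n0 n) (@ig_ge n j) (ig0 n j) h r0 cl)).
by rewrite le_eqVlt; apply/orP; left; apply/eqP; ring.
Qed.

(** A near-minimiser has value below [M + 1] while [f >= - M], so both of its tolerances are at most
    [(2 M + 1) / n.+1]. The near-minimising inputs thus converge to [x] and the paths attached to
    them to [Phi x], where J1-continuity of [f] applies. *)
Lemma lower_functional_liminf (js : nat -> nat) x (e : R) : (forall i, cont0 (x i)) -> 0 < e ->
  \forall n \near \oo, f (Phi x) - e <= lower_functional n (js n) x.
Proof.
move=> cx e0; pose e1 := minr (e / 2) 1.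
have e2 : 0 < e / 2 by rewrite divr_gt0.
have e10 : 0 < e1 by rewrite lt_min e2 ltr01.
have cPx : forall i, cadlag (Phi x i) by move=> i; apply: cont0_cadlag; exact: outputs_cont.
have /choice[p Hp] : forall n, exists p : ('I_3 -> R -> R) * ('I_4 -> R -> R), [/\ forall i, cont0 (p.1 i), forall i, cadlag (p.2 i),
   forall i (t : R), 0 <= t <= n.+1%:R - (2 * M + 1) / n.+1%:R -> `|x i t - p.1 i t| <= (2 * M + 1) / n.+1%:R,
   forall i (t : R), 0 <= t <= n.+1%:R -> `|p.2 i t - Phi p.1 i t| <= (2 * M + 1) / n.+1%:R &
   f p.2 <= lower_functional n (js n) x + e / 2].
  move=> n; have nR : 0 < n.+1%:R :> R by [].
  have q0 : 0 <= (2 * M + 1) / n.+1%:R by rewrite divr_ge0// addr_ge0// mulr_ge0.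
  (* If the envelope is at least [M], the capped value is [M >= f (Phi x)] and [x] itself serves as
     the approximating input. *)
  have [HM|HM] := leP M (envelope (image_graph n.+1%:R (js n)) n.+1%:R x).
    exists (x, Phi x); split => //=.
    - by move=> i t _; rewrite subrr normr0.
    - by move=> i t _; rewrite subrr normr0.
    - rewrite /lower_functional (min_idPl HM); apply: (le_trans (ler_norm _)); apply: (le_trans (fM _)).
      by rewrite lerDl ltW.
  have [y [v [r [[/= yj [y' [r' [cy' r'0 yy' ->]]]] r0 cl H]]]] := envelope_near (n0 n) (@ig_ge n (js n)) (ig0 n (js n)) x e10.
  have e11 : e1 <= 1 by rewrite ge_min lexx orbT.
  have e12 : e1 <= e / 2 by rewrite ge_min lexx.
  have nr : 0 <= n.+1%:R * r by rewrite mulr_ge0.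
  have nr' : 0 <= n.+1%:R * r' by rewrite mulr_ge0.
  have := fM y'; rewrite ler_norml => /andP[fy _].
  have rle : r <= (2 * M + 1) / n.+1%:R by rewrite ler_pdivlMr// mulrC; lra.
  have r'le : r' <= (2 * M + 1) / n.+1%:R by rewrite ler_pdivlMr// mulrC; lra.
  exists (y, y'); split => //=.
  - exact: lip_class_cont yj.
  - move=> i t /andP[t0 tn]; apply: (le_trans _ rle); apply: cl => //; apply: (le_trans tn); exact: lerB.
  - by move=> i t tn; apply: le_trans r'le; exact: yy'.
  - by rewrite /lower_functional min_r ?(ltW HM)//; lra.
have small (q : R) : 0 < q -> \forall n \near \oo, (2 * M + 1) / n.+1%:R <= q.
  move=> qp; have h : 0 < q / (2 * M + 1) by rewrite divr_gt0// ltr_wpDl// mulr_ge0.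
  have Mp : 0 < 2 * M + 1 by rewrite ltr_wpDl// mulr_ge0.
  near=> n; have : n.+1%:R^-1 < q / (2 * M + 1) by near: n; exact: (near_infty_natSinv_lt (PosNum h)).
  by rewrite ltr_pdivlMr// mulrC => /ltW.
have lu1 i (T q : R) : 0 < q -> \forall n \near \oo, forall t : R, 0 <= t <= T -> `|(p n).1 i t - x i t| <= q.
  move=> qp; have s1 := small q qp; have s2 := small 1 ltr01.
  have s3 : \forall n \near \oo, T + 1 <= n%:R by exact: nbhs_infty_ger.
  apply: filterS3 s1 s2 s3 => n s1 s2 s3 t /andP[t0 tT].
  have [_ _ h _ _] := Hp n; rewrite distrC; apply: le_trans s1; apply: h.
  by rewrite t0 /= lerBrDr; apply: (le_trans (lerD tT s2)); apply: (le_trans s3); rewrite ler_nat.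
have cp n i : cont0 ((p n).1 i) by have [h _ _ _ _] := Hp n; exact: h.
have lu2 := @outputs_lu _ beta c mul k beta0 mul0 (fun n => (p n).1) x cp cx lu1.
have lu3 i (T q : R) : 0 < q -> \forall n \near \oo, forall t : R, 0 <= t <= T -> `|(p n).2 i t - Phi x i t| <= q.
  move=> qp; have q2 : 0 < q / 2 by rewrite divr_gt0.
  have s1 := small _ q2; have s2 := lu2 i T (q / 2) q2.
  have s3 : \forall n \near \oo, T <= n%:R by exact: nbhs_infty_ger.
  apply: filterS3 s1 s2 s3 => n s1 s2 s3 t tT; have /andP[t0 tT'] := tT.
  have [_ _ _ h _] := Hp n.
  have tn : 0 <= t <= n.+1%:R by rewrite t0 /= -natr1; lra.
  have := ler_distD (Phi (p n).1 i t) ((p n).2 i t) (Phi x i t).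
  have := h i t tn; have := s2 t tT; rewrite -/Phi => a1 a2 a3.
  by apply: (le_trans a3); rewrite [leRHS]splitr; exact: (lerD (le_trans a2 s1) a1).
have fc : (fun n => f (p n).2) @ \oo --> f (Phi x).
  by apply: fJ => [n i| |]; [have [_ h _ _ _] := Hp n; exact: h|exact: cPx|exact: lu_J1].
have : \forall n \near \oo, `|f (Phi x) - f (p n).2| <= e / 2 by move/cvgrPdist_le : fc; apply.
apply: filterS => n; rewrite ler_norml => /andP[_ h].
by have [_ _ _ _ h2] := Hp n; lra.
Unshelve. all: by end_near. Qed.

Variables (Aset : set R) (d : measure_display)
  (Om : R -> measurableType d) (P : forall a, probability (Om a) R)
  (X : forall a, Om a -> 'I_3 -> R -> R) (Y : forall a, Om a -> 'I_4 -> R -> R) (ca cs : R) (d0 : measure_display)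
  (Om0 : measurableType d0) (P0 : probability Om0 R) (Ba Bs : R -> Om0 -> R) (Zs0 : Om0 -> R).
Hypothesis HBa : std_BM P0 Ba.
Hypothesis HBs : std_BM P0 Bs.
Hypothesis HZs0 : measurable_fun setT Zs0.
Let Fl := within Aset (nbhs (0 : R)).
Let FF : Filter Fl. Proof. exact: within_filter. Qed.
Local Existing Instance FF.
Let Xl := Xlim mul ca cs Ba Bs Zs0.
Hypothesis HW : weak_cvg P X Fl P0 Xl.
Hypothesis Happ : forall (N eta : R), 0 <= N -> 0 < eta -> exists2 C : R, 0 <= C & forall r : R, 0 < r -> r <= 1 ->
  exists j : nat, \forall a \near Fl, exists Bd : set (Om a), [/\ measurable Bd, fine (P a Bd) <= eta &
    forall w, ~ Bd w -> (forall i, cadlag (Y w i)) /\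
    exists2 y, lip_class j y & (forall i (t : R), 0 <= t <= N + 1 -> `|X w i t - y i t| <= r) /\
      forall i (t : R), 0 <= t <= N -> `|Y w i t - Phi y i t| <= C * r].

Let Xl_cont w i : cont0 (Xl w i).
Proof.
move: i; apply: ord3_case; rewrite /Xl /Xlim /pvec inordK//=.
- exact: (BM_path_cont mul0 HBa).
- exact: (BM_path_cont mul0 HBs).
- exact: cont0_cst.
Qed.

Let fPhi_lu : lu_continuous (f \o Phi). Proof. exact: outputs_J1_lu. Qed.

Lemma transfer_lower (e : R) : 0 < e -> \forall a \near Fl, \int[P0]_w f (Phi (Xl w)) - e <= \int[P a]_w f (Y w).
Proof.
(* The losses are [q] for the limit in [n], [q] for weak convergence, and [2 q + 4 M q] for the
   comparison off the bad event. *)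
move=> e0; pose q := e / (5 + 4 * M).
have Mp : 0 < 5 + 4 * M by rewrite ltr_wpDr// mulr_ge0.
have q0 : 0 < q by rewrite divr_gt0.
have /choice[js Hjs] : forall n, exists j, \forall a \near Fl, exists Bd : set (Om a),
    [/\ measurable Bd, fine (P a Bd) <= q & forall w, ~ Bd w -> lower_functional n j (X w) <= f (Y w) + q].
  move=> n; have [C C0 HC] := Happ (n0 n) q0.
  have C1 : 0 < n.+1%:R * (C + 1) :> R by rewrite mulr_gt0// ltr_wpDl.
  pose r := minr 1 (q / (n.+1%:R * (C + 1))).
  have r0 : 0 < r by rewrite lt_min ltr01 divr_gt0.
  have r1 : r <= 1 by rewrite ge_min lexx.
  have rq : n.+1%:R * (C + 1) * r <= q by rewrite mulrC -ler_pdivlMr// ge_min lexx orbT.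
  have [j Hj] := HC r r0 r1; exists j; apply: filterS Hj => a [Bd [mBd PBd HBd]].
  exists Bd; split => // w /HBd[cY [y yj [xy yy]]].
  by apply: (le_trans (lower_functional_le yj cY (ltW r0) C0 xy yy)); rewrite lerD2l.
(* Capping by the limit value turns the one-sided asymptotic bound into pointwise convergence, to
   which bounded convergence applies. *)
pose lf n w := minr (f (Phi (Xl w))) (lower_functional n (js n) (Xl w)).
have mlow n : measurable_fun setT (fun w => lower_functional n (js n) (Xl w)).
  by apply: (limit_measurable (Th := lower_functional n (js n)) ca cs mul0 HBa HBs HZs0); apply: J1_lu; exact: lower_functional_J1.
have mPhi : measurable_fun setT (fun w => f (Phi (Xl w))).
  exact: (limit_measurable (Th := f \o Phi) ca cs mul0 HBa HBs HZs0).
have lfM n w : `|lf n w| <= M.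
  by rewrite /lf; case: (leP (f _) _) => _; [exact: fM|exact: lower_functional_bound].
have lfc w : (fun n => lf n w) @ \oo --> f (Phi (Xl w)).
  apply/cvgrPdist_le => e' e'0; have := @lower_functional_liminf js (Xl w) e' (Xl_cont w) e'0.
  apply: filterS => n hn; rewrite /lf; case: (leP (f _) _) => h1; first by rewrite subrr normr0 ltW.
  by rewrite ger0_norm ?subr_ge0 ?(ltW h1)// lerBlDr -lerBlDl.
have L := @bounded_cvg _ _ _ P0 lf (fun w => f (Phi (Xl w))) M (fun n => measurable_minr mPhi (mlow n)) lfM lfc.
have [n Hn] : exists n, \int[P0]_w f (Phi (Xl w)) - q <= \int[P0]_w lf n w.
  move/cvgrPdist_le : L => /(_ _ q0)[n _ Hn]; exists n.
  by have := Hn n (leqnn _); rewrite /= ler_norml => /andP[_]; rewrite lerBlDr -lerBlDl.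
have Hn2 : \int[P0]_w f (Phi (Xl w)) - q <= \int[P0]_w lower_functional n (js n) (Xl w).
  apply: (le_trans Hn); apply: (@le_bounded_integral _ _ _ P0 _ _ M) => // w.
    exact: lower_functional_bound.
  by rewrite /lf ge_min lexx orbT.
have bl : bounded_functional (lower_functional n (js n)).
  by exists M => y; exact: lower_functional_bound.
have W := weak_cvg_real FF HW bl (@lower_functional_J1 n (js n)).
have W2 : \forall a \near Fl, \int[P0]_w lower_functional n (js n) (Xl w) - q <= \int[P a]_w lower_functional n (js n) (X w).
  move/cvgrPdist_le : W => /(_ _ q0); apply: filterS => a; rewrite ler_norml => /andP[_].
  by rewrite lerBlDr -lerBlDl.
apply: filterS2 W2 (Hjs n) => a W2 [Bd [mBd PBd HBd]].
have := @bounded_integral_close _ _ _ (P a) (fun w => f (Y w)) (fun w => lower_functional n (js n) (X w)) M q Bd mBd (ltW q0)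
  (fun w => fM _) (fun w => lower_functional_bound _ _ _) HBd => h.
have h2 : 4 * M * fine (P a Bd) <= 4 * M * q by rewrite ler_wpM2l// mulr_ge0.
have eE : e = 5 * q + 4 * M * q by rewrite -mulrDl /q mulrC divfK// gt_eqF.
move: Hn2 W2 h h2; set I1 := Rintegral _ _ _; set I2 := Rintegral _ _ _; set I3 := Rintegral _ _ _; set I4 := Rintegral _ _ _.
by move: (4 * M * q) (4 * M * fine _) eE q0 => x1 x2; lra.
Qed.

End transfer.

(** [bounded_integralN] holds without measurability, so the lower bound for [- f] is an upper bound
    for [f]. *)
Lemma transfer_cvg {R : realType} (k : nat) (beta c mul : R) (beta0 : 0 <= beta) (mul0 : 0 < mul)
  (f : ('I_4 -> R -> R) -> R) (M : R) (fM : forall y, `|f y| <= M) (fJ : J1_continuous f)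
  (Aset : set R) (d : measure_display) (Om : R -> measurableType d) (P : forall a, probability (Om a) R)
  (X : forall a, Om a -> 'I_3 -> R -> R) (Y : forall a, Om a -> 'I_4 -> R -> R) (ca cs : R) (d0 : measure_display)
  (Om0 : measurableType d0) (P0 : probability Om0 R) (Ba Bs : R -> Om0 -> R) (Zs0 : Om0 -> R) :
  std_BM P0 Ba -> std_BM P0 Bs -> measurable_fun setT Zs0 ->
  weak_cvg P X (within Aset (nbhs (0 : R))) P0 (Xlim mul ca cs Ba Bs Zs0) ->
  (forall (N eta : R), 0 <= N -> 0 < eta -> exists2 C : R, 0 <= C & forall r : R, 0 < r -> r <= 1 ->
    exists j : nat, \forall a \near within Aset (nbhs (0 : R)), exists Bd : set (Om a), [/\ measurable Bd, fine (P a Bd) <= eta &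
    forall w, ~ Bd w -> (forall i, cadlag (Y a w i)) /\
    exists2 y, lip_class j y & (forall i (t : R), 0 <= t <= N + 1 -> `|X a w i t - y i t| <= r) /\
      forall i (t : R), 0 <= t <= N -> `|Y a w i t - outputs beta c mul k y i t| <= C * r]) ->
  (fun a => \int[P a]_w f (Y a w)) @ within Aset (nbhs (0 : R)) -->
    \int[P0]_w f (outputs beta c mul k (Xlim mul ca cs Ba Bs Zs0 w)).
Proof.
move=> HBa HBs HZ HW Happ.
have FF : Filter (within Aset (nbhs (0 : R))) by exact: within_filter.
have lo := @transfer_lower R k beta c mul beta0 mul0 f M fM fJ Aset d Om P X Y ca cs d0 Om0 P0 Ba Bs Zs0 HBa HBs HZ HW Happ.
have gM y : `|- f y| <= M by rewrite normrN.
have gJ : J1_continuous (fun y => - f y).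
  by move=> xs x h1 h2 h3; apply: cvgN; exact: fJ.
have up := @transfer_lower R k beta c mul beta0 mul0 (fun y => - f y) M gM gJ Aset d Om P X Y ca cs d0 Om0 P0 Ba Bs Zs0 HBa HBs HZ HW Happ.
apply/cvgrPdist_le => e e0; apply: filterS2 (lo e e0) (up e e0) => a h1 h2.
rewrite (@bounded_integralN _ _ _ P0 (fun w => f (outputs beta c mul k (Xlim mul ca cs Ba Bs Zs0 w))) M) in h2; last by move=> w; exact: fM.
rewrite (@bounded_integralN _ _ _ (P a) (fun w => f (Y a w)) M) in h2; last by move=> w; exact: fM.
move: h1 h2; set I1 := Rintegral _ _ _; set I2 := Rintegral _ _ _ => h1 h2.
by rewrite ler_norml; apply/andP; split; lra.
Qed.

(** * Solutions in the sense of the statement, and their uniqueness *)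

Section reflected_solutions.
Context {R : realType}.
Variables (z0 beta c : R) (X : R -> R) (k : nat).

Let y (t : R) : R := z0 + X t + c * t.

Lemma refl_sol_rsol Z L : refl_sol z0 X beta c k Z L ->
  [/\ cont0 Z, cont0 L & forall T, rsol beta k y Z L T].
Proof.
move=> [/cont0P cZ [/cont0P cL [E [Z0 [Lnd [L0 Lflat]]]]]]; split => // T; split.
- exact: cont0_locint.
- exact: Z0.
- by move=> t /andP[t0 _]; rewrite E// /drift /int0 /y; ring.
- split => //.
    by move=> s t s0 st; apply: Lnd => //; rewrite in_itv /= andbT// (le_trans s0).
  by move=> s t s0 st _ H; exact: Lflat.
Qed.

Lemma rsol_refl_sol Z L : cont0 Z -> (forall T, rsol beta k y Z L T) -> refl_sol z0 X beta c k Z L.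
Proof.
move=> cZ H; have [_ Z0 _ [cL Lnd L0 _]] := H 0.
split; first exact/cont0P. split; first exact/cont0P.
split.
  move=> t t0; have [_ _ E _] := H t; rewrite E ?t0 ?lexx// /drift /int0 /y; ring.
split=> //; split; last split => //.
  by move=> s t; rewrite !in_itv /= !andbT => s0 _ st; exact: Lnd.
by move=> s t s0 st h; have [_ _ _ [_ _ _ fl]] := H t; exact: fl.
Qed.

Hypothesis beta0 : 0 <= beta.

Lemma rsol_unique y1 y2 Z1 L1 Z2 L2 : (forall t : R, 0 <= t -> y1 t = y2 t) ->
  (forall T, rsol beta k y1 Z1 L1 T) -> (forall T, rsol beta k y2 Z2 L2 T) ->
  forall t : R, 0 <= t -> Z1 t = Z2 t /\ L1 t = L2 t.
Proof.
move=> yy H1 H2 t t0; have tt : 0 <= t <= t by rewrite t0 lexx.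
have ZE (s : R) : 0 <= s -> Z1 s = Z2 s.
  move=> s0; have ss : 0 <= s <= s by rewrite s0 lexx.
  have ye r : 0 <= r <= s -> `|y1 r - y2 r| <= 0 by move=> /andP[r0 _]; rewrite yy// subrr normr0.
  have := rsol_stable beta0 (H1 s) (H2 s) ye ss.
  by rewrite mulr0 normr_le0 subr_eq0 => /eqP.
split; first exact: ZE.
have [l1 _ E1 _] := H1 t; have [l2 _ E2 _] := H2 t.
have := E1 t tt; have := E2 t tt; rewrite -(ZE t t0) (yy t t0).
have -> : drift beta k Z1 t = drift beta k Z2 t.
  rewrite /drift /int0; congr (_ * _); apply: eq_Rintegral => s.
  by rewrite inE /= in_itv /= => /andP[s0 _]; rewrite ZE.
by lra.
Qed.

End reflected_solutions.

Theorem theorem3 (R : realType)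
  (* patience CDF F, index k, derivatives G j = F^(j) on [0,oo) *)
  (k : nat) (hk : (0 < k)%N)
  (F : R -> R) (G : nat -> R -> R)
  (HF : cdf0 F) (Hmean : finite_mean F) (Hloc : local_cond F k G)
  (* the family of systems, indexed by alpha in Aset (a set of alpha > 0),
     alpha -> 0 *)
  (Aset : set R) (HA : forall a, Aset a -> 0 < a)
  (d : measure_display) (Om : R -> measurableType d)
  (P : forall a, probability (Om a) R)
  (u V D : forall a, nat -> Om a -> R) (z0 : forall a, Om a -> R)
  (lam mu : R -> R) (Z L : forall a, Om a -> R -> R)
  (Hsys : forall a, Aset a ->
     queue_system (P a) (fun x => F (a * x)) (u a) (V a) (D a) (z0 a)
       (lam a) (mu a) (Z a) (L a))
  (mu_lim c : R) (Hmu_pos : 0 < mu_lim)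
  (Hmu : mu a @[a --> within Aset (nbhs (0 : R))] --> mu_lim)
  (Hc : powR a (- (k%:R / (k%:R + 1))) * (lam a / mu a - 1)
          @[a --> within Aset (nbhs (0 : R))] --> c)
  (* the limit objects: independent standard BMs B_a, B_s, and Zstar(0) *)
  (ca cs : R)
  (d0 : measure_display) (Om0 : measurableType d0) (P0 : probability Om0 R)
  (Ba Bs : R -> Om0 -> R) (Zs0 : Om0 -> R)
  (HBa : std_BM P0 Ba) (HBs : std_BM P0 Bs)
  (HBind : indep_processes P0 (fun b : bool => if b then Ba else Bs))
  (HZs0 : measurable_fun setT Zs0)
  (* functional CLT for (A~, S~, Z~(0)) *)
  (HFCLT : weak_cvg P
     (fun a w => pvec 3
        [:: diffscale a (k%:R / (k%:R + 1)) (Acount (fun i => u a i w)) (lam a);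
            diffscale a (k%:R / (k%:R + 1)) (Scount (fun i => V a i w)) (mu a);
            (fun _ => powR a (k%:R / (k%:R + 1)) * z0 a w)])
     (within Aset (nbhs (0 : R))) P0
     (fun w => pvec 3
        [:: (fun t => ca * Ba (mu_lim * t) w);
            (fun t => cs * Bs (mu_lim * t) w);
            (fun _ => Zs0 w)])) :
  let h : R := k%:R / (k%:R + 1) in
  let beta : R := G k 0 / (factorial k)%:R in
  let X := fun w t => mu_lim^-1 * (ca * Ba (mu_lim * t) w)
                      + mu_lim^-1 * (cs * Bs (mu_lim * t) w) in
  (* existence and uniqueness of (Zstar, Lstar) *)
  (forall w, 0 <= Zs0 w -> exists Zs Ls : R -> R,
       refl_sol (Zs0 w) (X w) beta c k Zs Ls) /\
  (forall w Z1 L1 Z2 L2, refl_sol (Zs0 w) (X w) beta c k Z1 L1 ->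
       refl_sol (Zs0 w) (X w) beta c k Z2 L2 ->
       forall t, 0 <= t -> Z1 t = Z2 t /\ L1 t = L2 t) /\
  (* weak convergence of (Z~, L~, Y~, A0~) to (Zstar, Lstar, Ystar, A0star) *)
  (forall Zs Ls : Om0 -> R -> R,
     (forall w, 0 <= Zs0 w -> refl_sol (Zs0 w) (X w) beta c k (Zs w) (Ls w)) ->
     let A0s := fun w t => ca * Ba (mu_lim * t) w
            - mu_lim * beta * (\int[@lebesgue_measure R]_(s in `[0, t]) (Zs w s ^+ k)) in
     let Ys := fun w t => mu_lim^-1 * A0s w t + mu_lim^-1 * (cs * Bs (mu_lim * t) w) in
     weak_cvg P
       (fun a w => pvec 4
          [:: diffscale a h (Z a w) 0;
              diffscale a h (L a w) 0;
              diffscale a h (Ywork (fun i => u a i w) (fun i => V a i w)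
                            (fun i => D a i w) (Z a w)) (lam a / mu a);
              diffscale a h (A0count (fun i => u a i w) (fun i => D a i w) (Z a w))
                     (lam a)])
       (within Aset (nbhs (0 : R))) P0
       (fun w => pvec 4 [:: Zs w; Ls w; Ys w; A0s w])).
Proof.
move=> h beta X.
have beta0 : 0 <= beta := local_slope_ge0 HF Hloc.
have cBa w : cont0 (fun t => ca * Ba (mu_lim * t) w) by exact: (BM_path_cont Hmu_pos HBa).
have cBs w : cont0 (fun t => cs * Bs (mu_lim * t) w) by exact: (BM_path_cont Hmu_pos HBs).
have Ba0 w : ca * Ba (mu_lim * 0) w = 0 by have [_ [e _]] := HBa; rewrite mulr0 e mulr0.
have Bs0 w : cs * Bs (mu_lim * 0) w = 0 by have [_ [e _]] := HBs; rewrite mulr0 e mulr0.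
split; [|split].
- move=> w Zw; have cy : cont0 (fun t : R => Zs0 w + X w t + c * t).
    apply: cont0D; last by apply: cont0Z; exact: cont0_id.
    by apply: cont0D; [exact: cont0_cst|apply: cont0D; apply: cont0Z].
  have y0 : 0 <= Zs0 w + X w 0 + c * 0 by rewrite /X Ba0 Bs0 !mulr0 !addr0.
  have [Z1 [L1 [cZ1 H]]] := rsol_exists k beta0 cy y0.
  by exists Z1, L1; apply: rsol_refl_sol.
- move=> w Z1 L1 Z2 L2 /refl_sol_rsol[_ _ H1] /refl_sol_rsol[_ _ H2] t t0.
  exact: (rsol_unique beta0 _ H1 H2).
move=> Zs Ls HZL A0s Ys f [M fM] fJ.
have FF : Filter (within Aset (nbhs (0 : R))) by exact: within_filter.
(* If 0 is not adherent to [Aset], the filter is not proper and every convergence along it holds. *)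
have [PF|nPF] := pselect (ProperFilter (within Aset (nbhs (0 : R)))); last first.
  have F0 : within Aset (nbhs (0 : R)) set0.
    by apply: contrapT => h0; apply: nPF; exact: Build_ProperFilter.
  by move=> A _; apply: filterS F0 => a [].
have HW : weak_cvg P (fun a w => Xpre u V z0 lam mu h w) (within Aset (nbhs (0 : R))) P0 (Xlim mu_lim ca cs Ba Bs Zs0).
  exact: HFCLT.
have main := transfer_cvg beta0 Hmu_pos fM fJ HBa HBs HZs0 HW
  (fun N eta => @prelimit_outputs R k F beta Aset hk beta0 HF (local_expansion Hloc) HA d Om P u V D z0 lam mu Z L Hsys
     mu_lim c Hmu_pos Hmu Hc ca cs d0 Om0 P0 Ba Bs Zs0 HBa HBs HZs0 HW N eta).
have sym := @limit_sign_symmetry R F Aset d Om P u V D z0 lam mu Z L Hsys h mu_lim ca cs d0 Om0 P0 Ba Bs Zs0 Hmu_pos HBa HBs HZs0 PF HW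
  (f \o outputs beta c mu_lim k) M (outputs_J1_lu beta0 Hmu_pos fJ) (fun y => fM _).
(* With the opposite of the service limit as input, the solution map gives the processes of the
   statement path by path, off the null event of a negative start. *)
have E : \int[P0]_w f (outputs beta c mu_lim k (X3 (fun t => ca * Ba (mu_lim * t) w) (fun t => - (cs * Bs (mu_lim * t) w)) (Zs0 w))) =
    \int[P0]_w f (pvec 4 [:: Zs w; Ls w; Ys w; A0s w]).
  apply: (@eq_integral_off_null _ _ _ P0 _ _ M) => [w|w|]; [exact: fM|exact: fM|].
  have mN : measurable [set w | Zs0 w < 0] by apply: (measurable_set_lt (g := cst 0)).
  exists [set w | Zs0 w < 0]; split; first exact: mN.
    have := @limit_start_ge0 R F Aset d Om P u V D z0 lam mu Z L Hsys h mu_lim ca cs d0 Om0 P0 Ba Bs Zs0 HZs0 PF HW.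
    by move=> h0; rewrite (fineP P0 mN) h0.
  move=> w /= hw; rewrite ltNge; apply/negP => Zw; apply: hw.
  have [cZ cL H] := refl_sol_rsol (HZL w Zw).
  set y := X3 _ _ _.
  have y0E : y (inord 0) = fun t => ca * Ba (mu_lim * t) w by rewrite /y /X3 /pvec inordK.
  have y1E : y (inord 1) = fun t => - (cs * Bs (mu_lim * t) w) by rewrite /y /X3 /pvec inordK.
  have y2E : y (inord 2) = fun=> Zs0 w by rewrite /y /X3 /pvec inordK.
  have cy : forall i, cont0 (y i).
    apply: ord3_case.
    - by rewrite y0E; exact: cBa.
    - by rewrite y1E; apply: cont0N; exact: cBs.
    - by rewrite y2E; exact: cont0_cst.
  have [cS HS] := solutionP c mu_lim k beta0 cy.
  have fpE t : free_path mu_lim y t = X w t.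
    by rewrite /free_path y0E y1E Ba0 Bs0 oppr0 !subr0 /X opprK mulrDr.
  have yE t : 0 <= t -> driver c mu_lim y t = Zs0 w + X w t + c * t.
    by move=> _; rewrite /driver fpE y2E (max_idPl Zw).
  have U t := rsol_unique beta0 yE HS H (t := t).
  have dE t : 0 <= t -> drift beta k (solution beta c mu_lim k y).1 t = beta * \int[@lebesgue_measure R]_(s in `[0, t]) (Zs w s ^+ k).
    move=> t0; rewrite /drift /int0; congr (_ * _); apply: eq_Rintegral => s.
    by rewrite inE /= in_itv /= => /andP[s0 _]; have [-> _] := U s s0.
  have agree : forall i t, 0 <= t -> outputs beta c mu_lim k y i t = pvec 4 [:: Zs w; Ls w; Ys w; A0s w] i t.
    apply: ord4_case => t t0; rewrite /outputs /pvec.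
    - by rewrite (inordK (isT : (0 < 4)%N)); have [] := U t t0.
    - by rewrite (inordK (isT : (1 < 4)%N)); have [] := U t t0.
    - rewrite (inordK (isT : (2 < 4)%N)) /= (dE t t0) fpE /Ys /A0s /X.
      move: (Rintegral _ _ _) (Ba _ _) (Bs _ _) => I b1 b2; field; by rewrite gt_eqF.
    - by rewrite (inordK (isT : (3 < 4)%N)) /= (dE t t0) y0E Ba0 subr0 /A0s -mulrA.
  apply: (J1_agree fJ _ _ agree) => i.
    by apply: cont0_cadlag; exact: outputs_cont.
  have cO := outputs_cont c mu_lim k beta0 cy i.
  apply: cont0_cadlag; apply: (eq_cont0 _ cO) => t t0; exact: agree.
have lim : (fun a => \int[P a]_w f (queue_outputs k u V D lam mu Z L w)) @ within Aset (nbhs (0 : R)) -->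
    \int[P0]_w f (pvec 4 [:: Zs w; Ls w; Ys w; A0s w]).
  by rewrite -E -[X in _ --> X]sym.
have fin_a a : (\int[P a]_w (f (queue_outputs k u V D lam mu Z L w))%:E)%E = (\int[P a]_w f (queue_outputs k u V D lam mu Z L w))%:E.
  apply: esym; apply: fineK; apply: (@bounded_integral_fin _ _ _ (P a) _ M) => w; exact: fM.
have fin_0 : (\int[P0]_w (f (pvec 4 [:: Zs w; Ls w; Ys w; A0s w]))%:E)%E = (\int[P0]_w f (pvec 4 [:: Zs w; Ls w; Ys w; A0s w]))%:E.
  apply: esym; apply: fineK; apply: (@bounded_integral_fin _ _ _ P0 _ M) => w; exact: fM.
rewrite fin_0 (_ : (fun a => _) = fun a => (\int[P a]_w f (queue_outputs k u V D lam mu Z L w))%:E); last first.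
  by apply/funext => a; rewrite -fin_a.
by apply/fine_cvgP; split; [exact: nearW|exact: lim].
Qed.
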